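(* Let $\Lambda$ be a basic Artin algebra with Jacobson radical $J$ such that $\mathcal{P}^{<\infty}(\Lambda\text{-mod})$ is contravariantly finite in $\Lambda\text{-mod}$. Let $e_1,\dots,e_n\in\Lambda$ be a complete set of orthogonal primitive idempotents, $S_i=\Lambda e_i/Je_i$ the corresponding simple left modules, and $\mathcal{A}_i$ the minimal $\mathcal{P}^{<\infty}(\Lambda\text{-mod})$-approximation of the indecomposable injective left module $E(S_i)$ with socle $S_i$, for $1\le i\le n$. Let $m\le n$ be chosen such that $\operatorname{pdim}_\Lambda S_j<\infty$ for $j>m$. Set $e=e_1+\cdots+e_m$ and assume that $\operatorname{pdim}_{e\Lambda e}e\Lambda(1-e)<\infty$. Then: (1) The number of distinct (i.e., pairwise non-isomorphic) indecomposable direct summands of $\bigoplus_{1\le i\le m}\mathcal{A}_i$ is $m$. Denote them by $T_1,\dots,T_m$ and set $T'=\bigoplus_{1\le i\le m}T_i$. For $j\ge m+1$, the approximation $\mathcal{A}_j$ of $E(S_j)$ decomposes in the form $\mathcal{A}_j=T_j\oplus U_j$, where $T_j$ is indecomposable with the property that $S_j$ is the only simple module of finite projective dimension in $\operatorname{soc}T_j$, and all indecomposable direct summands of $U_j$ occur as direct summands of $T'$. (2) $\Lambda\text{-mod}$ allows for unlimited iteration of strong tilting if and only if the same is true for $e\Lambda e\text{-mod}$.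
   Context: For an Artin algebra $A$, $A\text{-mod}$ (resp. $\text{mod-}A$) is the category of finitely generated left (resp. right) $A$-modules, and $\mathcal{P}^{<\infty}(A\text{-mod})$ (resp. $\mathcal{P}^{<\infty}(\text{mod-}A)$) its full subcategory of modules of finite projective dimension; $\operatorname{pdim}$ denotes projective dimension and $\operatorname{soc}$ the socle. $A$ is basic if $A/J(A)$ is a product of division rings, where $J(A)$ is the Jacobson radical; a module is basic if it has no indecomposable direct summand of multiplicity $>1$. For a module $M$, $\operatorname{add}(M)$ is the full subcategory of direct summands of finite direct sums of copies of $M$. A (right) $\mathcal{P}^{<\infty}(A\text{-mod})$-approximation of $M\in A\text{-mod}$ is a map $\phi:X\to M$ with $X\in\mathcal{P}^{<\infty}(A\text{-mod})$ through which every homomorphism from an object of $\mathcal{P}^{<\infty}(A\text{-mod})$ to $M$ factors. It is minimal if every endomorphism $u$ of $X$ with $\phi\circ u=\phi$ is an automorphism; if $M$ has an approximation, the minimal one exists and is unique up to isomorphism (its domain $X$ is also called the minimal approximation). $\mathcal{P}^{<\infty}(A\text{-mod})$ is contravariantly finite in $A\text{-mod}$ if every $M\in A\text{-mod}$ has such an approximation. Similarly for right modules. A module $T\in A\text{-mod}$ is a tilting module if (1) $T\in\mathcal{P}^{<\infty}(A\text{-mod})$, (2) $\operatorname{Ext}^i_A(T,T)=0$ for $i\ge1$, (3) there is an exact sequence $0\to A\to X_0\to\cdots\to X_s\to0$ with all $X_j\in\operatorname{add}(T)$. It is strong if, in addition, $\operatorname{Ext}^i_A(M,T)=0$ for all $M\in\mathcal{P}^{<\infty}(A\text{-mod})$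 and $i\ge1$. Similarly for right modules. A strong tilting module exists in $A\text{-mod}$ if and only if $\mathcal{P}^{<\infty}(A\text{-mod})$ is contravariantly finite in $A\text{-mod}$, and the basic one is then unique up to isomorphism. For basic Artin algebras $A,B$: $\text{mod-}B$ results from $A\text{-mod}$ via strong tilting if $B\cong\operatorname{End}_A(T)^{\mathrm{op}}$, where $T$ is the basic strong tilting module in $A\text{-mod}$; $B\text{-mod}$ results from $\text{mod-}A$ via strong tilting if $B\cong\operatorname{End}_A(T)$, where $T$ is the basic strong tilting module in $\text{mod-}A$. The category $A\text{-mod}$ allows for unlimited iteration of strong tilting if there is an infinite sequence of basic algebras $(A_i)_{i\ge0}$ with $A_0=A$ such that $\text{mod-}A_{i+1}$ results from $A_i\text{-mod}$ via strong tilting for $i$ even, and $A_{i+1}\text{-mod}$ results from $\text{mod-}A_i$ via strong tilting for $i$ odd. *)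

(* Defs.v *)
(* boolp supplies the eqType/choiceType structures on endomorphism rings and
   finite direct sums.

   Rings are pzRingType, so that the zero algebra is allowed.  Left A-modules
   are lmodType A; right A-modules are left modules over the opposite ring,
   i.e. lmodType A^c. *)
From HB Require Import structures.
From mathcomp Require Import all_boot all_algebra.
From mathcomp Require Import boolp.

Set Implicit Arguments.
Unset Strict Implicit.
Unset Printing Implicit Defensive.

Import GRing.Theory.
Local Open Scope ring_scope.

Definition surjective (X Y : Type) (f : X -> Y) : Prop :=
  forall y, exists x, f x = y.

Section Modules.
Variable A : pzRingType.
Implicit Types M N X Y T : lmodType A.

Definition is_zero M : Prop := forall x : M, x = 0.

Definition module_iso M N : Prop := exists f : {linear M -> N}, bijective f.

Definition finitely_generated M : Prop :=
  exists (k : nat) (g : 'I_k -> M), forall x : M,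
    exists c : 'I_k -> A, x = \sum_i c i *: g i.

Definition submodule M (N : M -> Prop) : Prop :=
  [/\ N 0, forall x y, N x -> N y -> N (x + y)
    & forall (a : A) x, N x -> N (a *: x)].

Definition simple_module M : Prop :=
  ~ is_zero M /\
  forall N : M -> Prop, submodule N ->
    (forall x, N x -> x = 0) \/ (forall x, N x).

Definition simple_submodule M (N : M -> Prop) : Prop :=
  [/\ submodule N, exists2 x, N x & x != 0
    & forall N' : M -> Prop, submodule N' -> (forall x, N' x -> N x) ->
        (forall x, N' x -> x = 0) \/ (forall x, N x -> N' x)].

Definition socle M (x : M) : Prop :=
  exists (k : nat) (y : 'I_k -> M),
    (forall i, exists2 N : M -> Prop, simple_submodule N & N (y i)) /\
    x = \sum_i y i.

Definition in_socle S M : Prop :=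
  exists2 f : {linear S -> M}, injective f & forall s, socle (f s).

Definition socle_iso M S : Prop :=
  exists2 f : {linear S -> M}, injective f &
    forall x, socle x <-> exists s, f s = x.

Definition projective_module X : Prop :=
  forall M N (p : {linear M -> N}) (f : {linear X -> N}), surjective p ->
    exists g : {linear X -> M}, forall x, p (g x) = f x.

Definition injective_module X : Prop :=
  forall M N (i : {linear M -> N}) (f : {linear M -> X}), injective i ->
    exists g : {linear N -> X}, forall x, g (i x) = f x.

Definition direct_summand X M : Prop :=
  exists Y, module_iso M (X * Y)%type.

Definition indecomposable M : Prop :=
  ~ is_zero M /\
  forall X Y, module_iso M (X * Y)%type -> is_zero X \/ is_zero Y.

(* By Krull-Schmidt, multiplicity > 1 of X in M means that X (+) X is a
   direct summand of M. *)
Definition basic_module M : Prop :=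
  forall X, indecomposable X -> ~ direct_summand (X * X)%type M.

Record proj_resolution M := ProjResolution {
  pr_obj : nat -> lmodType A;
  pr_diff : forall i, {linear pr_obj i.+1 -> pr_obj i};
  pr_aug : {linear pr_obj 0 -> M};
  pr_proj : forall i, projective_module (pr_obj i);
  pr_aug_surj : surjective pr_aug;
  pr_exact0 : forall x, pr_aug x = 0 <-> exists y, pr_diff 0 y = x;
  pr_exact : forall i x, pr_diff i x = 0 <-> exists y, pr_diff i.+1 y = x
}.

Definition finite_pdim M : Prop :=
  exists (d : nat) (P : proj_resolution M),
    forall i, (d < i)%N -> is_zero (pr_obj P i).

(* Ext^(i+1)(M, N) = 0: the complex Hom(P, N) is exact in degree i+1, for
   P a projective resolution of M. *)
Definition Ext_succ_vanishes (i : nat) M N : Prop :=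
  forall (P : proj_resolution M) (f : {linear pr_obj P i.+1 -> N}),
    (forall x, f (pr_diff P i.+1 x) = 0) ->
    exists g : {linear pr_obj P i -> N}, forall x, g (pr_diff P i x) = f x.

(* The objects of P^{<oo}(A-mod). *)
Definition Pfin M : Prop := finitely_generated M /\ finite_pdim M.

Definition Pfin_approximation M X (phi : {linear X -> M}) : Prop :=
  Pfin X /\
  forall Y (f : {linear Y -> M}), Pfin Y ->
    exists g : {linear Y -> X}, forall y, phi (g y) = f y.

Definition minimal_Pfin_approximation M X : Prop :=
  exists2 phi : {linear X -> M}, Pfin_approximation phi &
    forall u : {linear X -> X}, (forall x, phi (u x) = phi x) -> bijective u.

Definition Pfin_contravariantly_finite : Prop :=
  forall M, finitely_generated M ->
    exists X (phi : {linear X -> M}), Pfin_approximation phi.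

End Modules.

Section DirectSum.
Variables (A : pzRingType) (k : nat) (M : 'I_k -> lmodType A).

(* A finite direct sum, realized as a product. *)
Definition dsum := forall i, M i.

HB.instance Definition _ := gen_eqMixin dsum.
HB.instance Definition _ := gen_choiceMixin dsum.

Definition dsum_add (x y : dsum) : dsum := fun i => x i + y i.
Definition dsum_opp (x : dsum) : dsum := fun i => - x i.
Definition dsum_zero : dsum := fun i => 0.
Definition dsum_scale (a : A) (x : dsum) : dsum := fun i => a *: x i.

Lemma dsum_addA : associative dsum_add.
Proof. by move=> x y z; apply: functional_extensionality_dep => i; apply: addrA. Qed.
Lemma dsum_addC : commutative dsum_add.
Proof. by move=> x y; apply: functional_extensionality_dep => i; apply: addrC. Qed.
Lemma dsum_add0 : left_id dsum_zero dsum_add.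
Proof. by move=> x; apply: functional_extensionality_dep => i; apply: add0r. Qed.
Lemma dsum_addN : left_inverse dsum_zero dsum_opp dsum_add.
Proof. by move=> x; apply: functional_extensionality_dep => i; apply: addNr. Qed.

HB.instance Definition _ :=
  GRing.isZmodule.Build dsum dsum_addA dsum_addC dsum_add0 dsum_addN.

Lemma dsum_scaleA a b (x : dsum) :
  dsum_scale a (dsum_scale b x) = dsum_scale (a * b) x.
Proof. by apply: functional_extensionality_dep => i; apply: scalerA. Qed.
Lemma dsum_scale1 : left_id 1 dsum_scale.
Proof. by move=> x; apply: functional_extensionality_dep => i; apply: scale1r. Qed.
Lemma dsum_scaleDr : right_distributive dsum_scale +%R.
Proof. by move=> a x y; apply: functional_extensionality_dep => i; apply: scalerDr. Qed.
Lemma dsum_scaleDl (x : dsum) : {morph dsum_scale^~ x : a b / a + b}.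
Proof. by move=> a b; apply: functional_extensionality_dep => i; apply: scalerDl. Qed.

HB.instance Definition _ := GRing.Zmodule_isLmodule.Build A dsum
  dsum_scaleA dsum_scale1 dsum_scaleDr dsum_scaleDl.

End DirectSum.

Section Endomorphisms.
Variables (A : pzRingType) (T : lmodType A).

(* End_A(T), with composition (u * v) x = u (v x) as multiplication. *)
Definition endo := {linear T -> T}.

HB.instance Definition _ := gen_eqMixin endo.
HB.instance Definition _ := gen_choiceMixin endo.

Lemma endoP (u v : endo) : (forall x, u x = v x) -> u = v.
Proof.
case: u v => [u [[hu1] [hu2]]] [v [[hv1] [hv2]]] /= uv.
have {}uv : u = v by apply: functional_extensionality_dep.
move: hu1 hu2; rewrite uv => hu1 hu2.
by rewrite (Prop_irrelevance hu1 hv1) (Prop_irrelevance hu2 hv2).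
Qed.

Definition endo_zero : endo := [the {linear T -> T} of \0].
Definition endo_add (u v : endo) : endo := [the {linear T -> T} of u \+ v].
Definition endo_opp (u : endo) : endo := [the {linear T -> T} of \- u].
Definition endo_one : endo := [the {linear T -> T} of idfun].
Definition endo_mul (u v : endo) : endo := [the {linear T -> T} of u \o v].

Lemma endo_addA : associative endo_add.
Proof. by move=> u v w; apply: endoP => x /=; rewrite addrA. Qed.
Lemma endo_addC : commutative endo_add.
Proof. by move=> u v; apply: endoP => x /=; rewrite addrC. Qed.
Lemma endo_add0 : left_id endo_zero endo_add.
Proof. by move=> u; apply: endoP => x /=; rewrite add0r. Qed.
Lemma endo_addN : left_inverse endo_zero endo_opp endo_add.
Proof. by move=> u; apply: endoP => x /=; rewrite addNr. Qed.

HB.instance Definition _ :=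
  GRing.isZmodule.Build endo endo_addA endo_addC endo_add0 endo_addN.

Lemma endo_mulA : associative endo_mul.
Proof. by move=> u v w; apply: endoP. Qed.
Lemma endo_mul1l : left_id endo_one endo_mul.
Proof. by move=> u; apply: endoP. Qed.
Lemma endo_mul1r : right_id endo_one endo_mul.
Proof. by move=> u; apply: endoP. Qed.
Lemma endo_mulDl : left_distributive endo_mul +%R.
Proof. by move=> u v w; apply: endoP. Qed.
Lemma endo_mulDr : right_distributive endo_mul +%R.
Proof. by move=> u v w; apply: endoP => x /=; rewrite raddfD. Qed.

HB.instance Definition _ := GRing.Zmodule_isPzRing.Build endo
  endo_mulA endo_mul1l endo_mul1r endo_mulDl endo_mulDr.

End Endomorphisms.

Section Algebras.
Variable A : pzRingType.

Definition artinian_ring (K : comPzRingType) : Prop :=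
  forall I : nat -> K^o -> Prop, (forall k, submodule (I k)) ->
    (forall k x, I k.+1 x -> I k x) ->
    exists N, forall k, (N <= k)%N -> forall x, I N x -> I k x.

Definition artin_algebra : Prop :=
  exists (K : comPzRingType) (eta : {rmorphism K -> A}),
    [/\ artinian_ring K,
        forall c a, eta c * a = a * eta c
      & exists (k : nat) (g : 'I_k -> A), forall a,
          exists c : 'I_k -> K, a = \sum_i eta (c i) * g i].

Definition maximal_left_ideal (I : A^o -> Prop) : Prop :=
  [/\ submodule I, ~ I 1
    & forall I' : A^o -> Prop, submodule I' -> (forall x, I x -> I' x) ->
        (forall x, I' x -> I x) \/ (forall x, I' x)].

Definition jacobson (x : A) : Prop :=
  forall I : A^o -> Prop, maximal_left_ideal I -> I x.

Definition division_ring (D : nzRingType) : Prop :=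
  forall x : D, x != 0 -> exists y, x * y = 1 /\ y * x = 1.

(* A / J(A) is a product of division rings: a surjective ring morphism from A
   onto a finite product of the D i, given by its components, with kernel
   J(A). *)
Definition basic_algebra : Prop :=
  exists (k : nat) (D : 'I_k -> nzRingType)
         (p : forall i, {rmorphism A -> D i}),
    [/\ forall i, division_ring (D i),
        forall y : (forall i, D i), exists x, forall i, p i x = y i
      & forall x, (forall i, p i x = 0) <-> jacobson x].

Definition ring_iso (B C : pzRingType) : Prop :=
  exists f : {rmorphism B -> C}, bijective f.

Definition idempotent_elt (e : A) : Prop := e * e = e.

Definition primitive_idempotent (e : A) : Prop :=
  [/\ idempotent_elt e, e != 0
    & forall f g : A, idempotent_elt f -> idempotent_elt g ->
        f * g = 0 -> g * f = 0 -> e = f + g -> f = 0 \/ g = 0].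

Definition complete_primitive_idempotents (n : nat) (e : 'I_n -> A) : Prop :=
  [/\ forall i, primitive_idempotent (e i),
      forall i j, i != j -> e i * e j = 0
    & \sum_i e i = 1].

Definition partial_sum (n m : nat) (e : 'I_n -> A) : A :=
  \sum_(i < n | (i < m)%N) e i.

Lemma idempotent_partial_sum (n : nat) (e : 'I_n -> A) (m : nat) :
  complete_primitive_idempotents e -> idempotent_elt (partial_sum m e).
Proof.
case=> pe oe _; rewrite /idempotent_elt /partial_sum mulr_suml.
apply: eq_bigr => i im; rewrite mulr_sumr (bigD1 i) //= big1 ?addr0.
  by case: (pe i).
by move=> j /andP[_ ji]; rewrite oe // eq_sym.
Qed.

End Algebras.

Section LeftIdeal.
Variables (A : pzRingType) (e : A).

(* For e idempotent, {x | x e = x} is the left ideal A e. *)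
Definition left_ideal_pred : {pred A^o} := fun x : A => x * e == x.

Lemma left_ideal_subproof : submod_closed left_ideal_pred.
Proof.
split; first by rewrite unfold_in /left_ideal_pred mul0r.
move=> a x y /eqP hx /eqP hy; apply/eqP.
by rewrite mulrDl -[a *: x]/(a * (x : A)) -mulrA hx hy.
Qed.

HB.instance Definition _ :=
  GRing.isSubmodClosed.Build A A^o left_ideal_pred left_ideal_subproof.

Definition left_ideal := {x : A^o | x \in left_ideal_pred}.

HB.instance Definition _ := [isSub of left_ideal for @sval _ _].
HB.instance Definition _ := [Choice of left_ideal by <:].
HB.instance Definition _ := [SubChoice_isSubLmodule of left_ideal by <:].

(* S is A e / J e, as the target of a surjection from A e with kernel J e. *)
Definition is_top_of (S : lmodType A) : Prop :=
  exists2 p : {linear left_ideal -> S}, surjective p &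
    forall x, p x = 0 <-> exists2 y : A, jacobson y & val x = y * e.

End LeftIdeal.

Section Peirce.
Variables (A : pzRingType) (e f : A).

(* For e and f idempotent, {x | e x = x and x f = x} is e A f. *)
Definition peirce_pred : {pred A} := fun x => (e * x == x) && (x * f == x).

Lemma peirce_subproof : zmod_closed peirce_pred.
Proof.
split; first by rewrite unfold_in /peirce_pred mulr0 mul0r eqxx.
move=> x y /andP[/eqP ex /eqP xf] /andP[/eqP ey /eqP yf].
by apply/andP; rewrite mulrBr mulrBl ex xf ey yf.
Qed.

HB.instance Definition _ :=
  GRing.isZmodClosed.Build A peirce_pred peirce_subproof.

Definition peirce := {x : A | x \in peirce_pred}.

HB.instance Definition _ := [isSub of peirce for @sval _ _].
HB.instance Definition _ := [Choice of peirce by <:].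
HB.instance Definition _ := [SubChoice_isSubZmodule of peirce by <:].

Lemma peirceP (x : peirce) : (e * val x = val x) * (val x * f = val x).
Proof. by case: x => x /= /andP[/eqP ? /eqP ?]. Qed.

End Peirce.

(* The ring e A e, with unit e, and e A f as a left module over it. *)
Definition corner (A : pzRingType) (e : A) of idempotent_elt e := peirce e e.
Definition corner_module (A : pzRingType) (e : A) of idempotent_elt e :=
  fun f : A => peirce e f.

Section Corner.
Variables (A : pzRingType) (e : A) (he : idempotent_elt e).
Local Notation corner := (corner he).

HB.instance Definition _ := GRing.Zmodule.on corner.

Lemma corner_one_subproof : e \in peirce_pred e e.
Proof. by apply/andP; rewrite he. Qed.

Definition corner_one : corner := exist _ e corner_one_subproof.

Lemma peirce_mul_subproof (f : A) (x : peirce e e) (y : peirce e f) :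
  val x * val y \in peirce_pred e f.
Proof. by apply/andP; rewrite mulrA peirceP -mulrA peirceP. Qed.

Definition peirce_mul (f : A) (x : peirce e e) (y : peirce e f) : peirce e f :=
  exist _ (val x * val y) (peirce_mul_subproof x y).

Definition corner_mul (x y : corner) : corner := peirce_mul x y.

Lemma corner_mulA : associative corner_mul.
Proof. by move=> x y z; apply: val_inj; rewrite /= mulrA. Qed.
Lemma corner_mul1l : left_id corner_one corner_mul.
Proof. by move=> x; apply: val_inj; rewrite /= peirceP. Qed.
Lemma corner_mul1r : right_id corner_one corner_mul.
Proof. by move=> x; apply: val_inj; rewrite /= peirceP. Qed.
Lemma corner_mulDl : left_distributive corner_mul +%R.
Proof. by move=> x y z; apply: val_inj; rewrite /= mulrDl. Qed.
Lemma corner_mulDr : right_distributive corner_mul +%R.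
Proof. by move=> x y z; apply: val_inj; rewrite /= mulrDr. Qed.

HB.instance Definition _ := GRing.Zmodule_isPzRing.Build corner
  corner_mulA corner_mul1l corner_mul1r corner_mulDl corner_mulDr.

Variable f : A.

Local Notation corner_module := (corner_module he f).

HB.instance Definition _ := GRing.Zmodule.on corner_module.

Definition corner_scale (a : corner) (x : corner_module) : corner_module :=
  peirce_mul a x.

Lemma corner_scaleA a b (x : corner_module) :
  corner_scale a (corner_scale b x) = corner_scale (a * b) x.
Proof. by apply: val_inj; rewrite /= mulrA. Qed.
Lemma corner_scale1 : left_id 1 corner_scale.
Proof. by move=> x; apply: val_inj; rewrite /= peirceP. Qed.
Lemma corner_scaleDr : right_distributive corner_scale +%R.
Proof. by move=> a x y; apply: val_inj; rewrite /= mulrDr. Qed.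
Lemma corner_scaleDl (x : corner_module) :
  {morph corner_scale^~ x : a b / a + b}.
Proof. by move=> a b; apply: val_inj; rewrite /= mulrDl. Qed.

HB.instance Definition _ := GRing.Zmodule_isLmodule.Build corner corner_module
  corner_scaleA corner_scale1 corner_scaleDr corner_scaleDl.

End Corner.

Section Tilting.
Variable A : pzRingType.
Implicit Types M X T : lmodType A.

Definition in_add T X : Prop :=
  exists k : nat, direct_summand X (dsum (fun _ : 'I_k => T)).

(* An exact sequence 0 -> A -> X_0 -> ... -> X_s -> 0 with all X_j in add(T),
   prolonged by zero modules. *)
Definition add_coresolution T : Prop :=
  exists (s : nat) (X : nat -> lmodType A)
         (d : forall i, {linear X i -> X i.+1}) (i0 : {linear A^o -> X 0%N}),
    [/\ forall i, (i <= s)%N -> in_add T (X i),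
        forall i, (s < i)%N -> is_zero (X i),
        injective i0,
        forall x, d 0%N x = 0 <-> exists y, i0 y = x
      & forall i x, d i.+1 x = 0 <-> exists y, d i y = x].

Definition tilting T : Prop :=
  [/\ Pfin T, forall i, Ext_succ_vanishes i T T & add_coresolution T].

Definition strong_tilting T : Prop :=
  tilting T /\ forall M, Pfin M -> forall i, Ext_succ_vanishes i M T.

(* T_0, ..., T_(k-1) lists, without repetition, the isomorphism classes of
   indecomposable direct summands of M. *)
Definition distinct_indecomposable_summands (k : nat) (T : 'I_k -> lmodType A)
    M : Prop :=
  [/\ forall i, indecomposable (T i) /\ direct_summand (T i) M,
      forall i j, module_iso (T i) (T j) -> i = j
    & forall X, indecomposable X -> direct_summand X M ->
        exists i, module_iso X (T i)].

Definition indecomposable_injective_with_socle (S M : lmodType A) : Prop :=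
  [/\ finitely_generated M, injective_module M, indecomposable M
    & socle_iso M S].

(* Up to isomorphism, S is the only simple module of finite projective
   dimension in the socle of M. *)
Definition only_Pfin_simple_in_socle (S M : lmodType A) : Prop :=
  [/\ simple_module S, finite_pdim S, in_socle S M
    & forall S' : lmodType A, simple_module S' -> finite_pdim S' ->
        in_socle S' M -> module_iso S' S].

End Tilting.

(* mod-B results from A-mod via strong tilting. *)
Definition strong_tilt_left (A B : pzRingType) : Prop :=
  exists T : lmodType A,
    [/\ strong_tilting T, basic_module T & ring_iso B (endo T)^c].

(* B-mod results from mod-A via strong tilting. *)
Definition strong_tilt_right (A B : pzRingType) : Prop :=
  exists T : lmodType A^c,
    [/\ strong_tilting T, basic_module T & ring_iso B (endo T)].

Definition unlimited_strong_tilting (A : pzRingType) : Prop :=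
  exists As : nat -> pzRingType,
    [/\ As 0%N = A,
        forall i, artin_algebra (As i) /\ basic_algebra (As i)
      & forall i, if odd i then strong_tilt_right (As i) (As i.+1)
                  else strong_tilt_left (As i) (As i.+1)].

(* Main.v *)
(* (1) The minimal approximations of the indecomposable injectives add up to a strong tilting
   module, which has [n] indecomposable summands up to isomorphism, by an Euler characteristic
   count.  The kernel of a minimal approximation contains no nonzero submodule of finite
   projective dimension, so a simple module of finite projective dimension embeds in the
   approximation of E(S_j) only if it is S_j, and then in a unique way; this isolates T_j.  The
   socle of the complement U_j only involves S_i with [i < m], hence U_j embeds in a sum of
   copies of the approximations of these E(S_i), and the embedding splits.

   (2) Let T be a strong tilting module.  Unlimited iteration amounts to contravariant
   finiteness over End(T): the tilting module T2 obtained from it has a double centralizer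
   property which makes the process periodic.  Contravariant finiteness is equivalent over D
   and over a corner f D f when f D and the simple D-modules killed by f have finite projective
   dimension; coinduction Hom_(f D f)(f D, -) transports approximations.  If W is strong tilting
   over e L e and W' is coinduced from W, then T + W' is strong tilting over L, and End(T) and
   End(W) = End(W') are corners of End(T + W') to which this equivalence applies. *)
Require Import Defs.
From Stdlib Require List.
From HB Require Import structures.
From mathcomp Require Import all_boot all_algebra.
From mathcomp Require Import boolp.

Set Implicit Arguments.
Unset Strict Implicit.
Unset Printing Implicit Defensive.

Import GRing.Theory.
Local Open Scope ring_scope.

(** Ext appears only as [E1], the extension of maps along short exact sequences with a given end
    term. Modules of finite projective dimension are closed under syzygies, so degree one against
    all of them controls every degree, and vanishing in degree [s.+1] is expressed on [s]-th
    syzygies. The pivot is [SC], a form of strong tilting without coresolutions: [T] is in [Pf], is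
    Ext-orthogonal to [Pf] and separates the points of its modules, and the finitistic dimension is
    finite. Approximations of injective modules produce such a [T]; conversely, from such a [T] all
    approximations are recovered by alternating left and right ones. Injective modules are obtained
    without Matlis duality, as maximal essential extensions; their length over the central artinian
    ring is bounded, once that ring is known to have finite length. Periodicity in (2) requires each
    simple End(T)-module to embed in the second tilting module. It does, because simple modules over
    End(T) embed in T itself. The double centralizer property and the description of [Pf] over the
    endomorphism ring both rest on one fact: a module of [Pf] is recovered from its Hom into T by
    evaluation. *)

Section Submodule.
Variables (A : pzRingType) (M : lmodType A) (P : M -> Prop) (hP : submodule P).

Definition spred of submodule P : {pred M} := fun x => `[< P x >].

Lemma spred_closed : submod_closed (spred hP).
Proof.
case: hP => P0 PD PZ; split; first exact/asboolP.
by move=> a x y /asboolP hx /asboolP hy; apply/asboolP/PD => //; apply: PZ.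
Qed.

HB.instance Definition _ :=
  GRing.isSubmodClosed.Build A M (spred hP) spred_closed.

Definition subm := {x : M | x \in spred hP}.

HB.instance Definition _ := [isSub of subm for @sval _ _].
HB.instance Definition _ := [Choice of subm by <:].
HB.instance Definition _ := [SubChoice_isSubLmodule of subm by <:].

Lemma submN x : P x -> P (- x).
Proof. by case: hP => _ _ PZ /(PZ (- 1)); rewrite scaleN1r. Qed.

Lemma submB x y : P x -> P y -> P (x - y).
Proof. by case: hP => _ PD _ hx hy; apply: PD => //; apply: submN. Qed.

Lemma subm_sum (I : Type) (r : seq I) (F : I -> M) :
  (forall i, P (F i)) -> P (\sum_(i <- r) F i).
Proof. by case: hP => P0 PD _ hF; apply: big_ind. Qed.

(** [choose] returns the same element for extensionally equal predicates, whatever witness it starts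
    from. So each coset gets a canonical representative, and the quotient module is carried by the
    fixed points of [qrep]. *)
Definition qrep (x : M) : M := choose (fun y => `[< P (x - y) >]) x.

Lemma qrepP x : P (x - qrep x).
Proof.
apply/asboolP; rewrite /qrep; apply: (@chooseP _ (fun y => `[< P (x - y) >])).
by apply/asboolP; rewrite subrr; case: hP.
Qed.

Lemma qrep_eq x y : P (x - y) -> qrep x = qrep y.
Proof.
case: (hP) => P0 PD _ xy; rewrite /qrep.
have e : (fun z => `[< P (x - z) >]) =1 (fun z => `[< P (y - z) >]).
  move=> z; apply/asboolP/asboolP => h.
    rewrite (_ : y - z = (x - z) - (x - y)); first exact: submB.
    by rewrite opprB [RHS]addrC addrA subrK.
  rewrite (_ : x - z = (x - y) + (y - z)); first exact: PD.
  by rewrite addrA subrK.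
rewrite (eq_choose e); apply: choose_id; apply/asboolP; last by rewrite subrr.
by rewrite -opprB; apply: submN.
Qed.

Definition quot of submodule P := {x : M | qrep x = x}.
Local Notation Q := (quot hP).

HB.instance Definition _ := gen_eqMixin Q.
HB.instance Definition _ := gen_choiceMixin Q.

Lemma qrepK x : qrep (qrep x) = qrep x.
Proof. by apply: qrep_eq; rewrite -opprB; apply: submN; apply: qrepP. Qed.

Definition qpi (x : M) : Q := exist _ (qrep x) (qrepK x).

Lemma qpi_eq x y : qpi x = qpi y <-> P (x - y).
Proof.
split => [[e]|h]; last by apply: eq_exist; apply: qrep_eq.
rewrite (_ : x - y = (x - qrep x) - (y - qrep y)).
  by apply: submB; apply: qrepP.
by rewrite e opprB addrA subrK.
Qed.

Lemma qpi_val (q : Q) : qpi (sval q) = q.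
Proof. by case: q => x hx; apply: eq_exist. Qed.

Definition quot_add (p q : Q) := qpi (sval p + sval q).
Definition quot_opp (p : Q) := qpi (- sval p).
Definition quot_scale (a : A) (p : Q) := qpi (a *: sval p).

Lemma qpiD x y : quot_add (qpi x) (qpi y) = qpi (x + y).
Proof.
have [_ PD _] := hP; apply/qpi_eq => /=; rewrite opprD addrACA.
by apply: PD; rewrite -opprB; apply: submN; apply: qrepP.
Qed.

Lemma qpiN x : quot_opp (qpi x) = qpi (- x).
Proof. by apply/qpi_eq => /=; rewrite opprK addrC; apply: qrepP. Qed.

Lemma qpiZ a x : quot_scale a (qpi x) = qpi (a *: x).
Proof.
have [_ _ PZ] := hP; apply/qpi_eq => /=; rewrite -scalerBr.
by apply: PZ; rewrite -opprB; apply: submN; apply: qrepP.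
Qed.

Lemma quot_addA : associative quot_add.
Proof.
move=> p q r; rewrite -(qpi_val p) -(qpi_val q) -(qpi_val r).
by rewrite !qpiD addrA.
Qed.
Lemma quot_addC : commutative quot_add.
Proof. by move=> p q; rewrite /quot_add addrC. Qed.
Lemma quot_add0 : left_id (qpi 0) quot_add.
Proof. by move=> p; rewrite -(qpi_val p) qpiD add0r. Qed.
Lemma quot_addN : left_inverse (qpi 0) quot_opp quot_add.
Proof. by move=> p; rewrite -(qpi_val p) qpiN qpiD addNr. Qed.

HB.instance Definition _ :=
  GRing.isZmodule.Build Q quot_addA quot_addC quot_add0 quot_addN.

Lemma qpi_add x y : qpi x + qpi y = qpi (x + y).
Proof. exact: qpiD. Qed.

Lemma quot_scaleA a b (x : Q) :
  quot_scale a (quot_scale b x) = quot_scale (a * b) x.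
Proof. by rewrite -(qpi_val x) !qpiZ scalerA. Qed.
Lemma quot_scale1 : left_id 1 quot_scale.
Proof. by move=> x; rewrite -(qpi_val x) !qpiZ scale1r. Qed.
Lemma quot_scaleDr : right_distributive quot_scale +%R.
Proof.
move=> a x y; rewrite -(qpi_val x) -(qpi_val y).
by rewrite !(qpi_add, qpiZ) scalerDr.
Qed.
Lemma quot_scaleDl (x : Q) : {morph quot_scale^~ x : a b / a + b}.
Proof.
by move=> a b; rewrite -(qpi_val x) !qpiZ qpi_add scalerDl.
Qed.

HB.instance Definition _ := GRing.Zmodule_isLmodule.Build A Q
  quot_scaleA quot_scale1 quot_scaleDr quot_scaleDl.

End Submodule.

(** * Linear maps: kernels, images, quotients, pullbacks and pushouts *)

Section LinearMaps.
Variable A : pzRingType.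
Implicit Types M N X Y Z W Q K I P U V : lmodType A.

(** Most maps below come from existence statements giving a bundled map together with its values, so
    that a proof need not declare a structure for each map. *)
Lemma linear_ex M N (f : M -> N) : linear f ->
  exists g : {linear M -> N}, forall x, g x = f x.
Proof.
move=> hf; pose g := GRing.isLinear.Build A M N *:%R f hf.
by exists (HB.pack f g : {linear M -> N}).
Qed.

Lemma sub_ex M (P : M -> Prop) : submodule P ->
  exists N (i : {linear N -> M}), injective i /\
    forall x, P x <-> exists y, i y = x.
Proof.
move=> hP; have [i hi] : exists i : {linear subm hP -> M}, forall x, i x = val x.
  by apply: linear_ex.
exists (subm hP : lmodType A), i; split.
  by move=> x y; rewrite !hi; apply: val_inj.
move=> x; split => [/asboolP hx|[y <-]]; last first.
  by rewrite hi; apply/asboolP; exact: (valP y).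
by exists (exist _ x hx); rewrite hi.
Qed.

Lemma quot_ex M (P : M -> Prop) : submodule P ->
  exists Q (p : {linear M -> Q}), surjective p /\ forall x, p x = 0 <-> P x.
Proof.
move=> hP; have hl : linear (qpi hP).
  by move=> a x y; rewrite -qpiD -qpiZ.
have [p hp] := linear_ex hl; exists (quot hP : lmodType A), p; split.
  by move=> q; exists (sval q); rewrite hp qpi_val.
by move=> x; rewrite hp -[0]/(qpi hP 0) qpi_eq subr0.
Qed.

Lemma lin_inj X Y (f : {linear X -> Y}) :
  (forall x, f x = 0 -> x = 0) -> injective f.
Proof.
move=> h x y e; apply/eqP; rewrite -subr_eq0; apply/eqP/h.
by rewrite linearB e subrr.
Qed.

Lemma inj0 X Y (f : {linear X -> Y}) x : injective f -> f x = 0 -> x = 0.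
Proof. by move=> hf h; apply: hf; rewrite h linear0. Qed.

Lemma lin_lift X Y Z (f : {linear X -> Y}) (i : {linear Z -> Y}) :
  injective i -> (forall x, exists z, i z = f x) ->
  exists g : {linear X -> Z}, forall x, i (g x) = f x.
Proof.
move=> ii h; pose g x := sval (cid (h x)).
have hg x : i (g x) = f x by rewrite /g; case: cid.
have [|k hk] := @linear_ex X Z g.
  by move=> a x y; apply: ii; rewrite linearP !hg linearP.
by exists k => x; rewrite hk hg.
Qed.

Lemma lin_fact X Y Z (p : {linear X -> Z}) (f : {linear X -> Y}) :
  surjective p -> (forall x, p x = 0 -> f x = 0) ->
  exists g : {linear Z -> Y}, forall x, g (p x) = f x.
Proof.
move=> sp h; pose s z := sval (cid (sp z)).
have hs z : p (s z) = z by rewrite /s; case: cid.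
have hf x y : p x = p y -> f x = f y.
  move=> e; apply/eqP; rewrite -subr_eq0 -linearB; apply/eqP/h.
  by rewrite linearB e subrr.
have [|k hk] := @linear_ex Z Y (f \o s).
  by move=> a x y /=; rewrite -linearP; apply: hf; rewrite linearP !hs.
by exists k => x; rewrite hk /=; apply: hf; rewrite hs.
Qed.

Lemma bij_inv X Y (f : {linear X -> Y}) : injective f -> surjective f ->
  exists g : {linear Y -> X}, cancel f g /\ cancel g f.
Proof.
move=> fi fs; have [g hg] : exists g : {linear Y -> X}, forall y, f (g y) = y.
  by have [|g hg] := @lin_lift Y Y X idfun f fi; [move=> y; apply: fs|exists g].
by exists g; split => // x; apply: fi; rewrite hg.
Qed.

Lemma bijP X Y (f : {linear X -> Y}) :
  bijective f <-> injective f /\ surjective f.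
Proof.
split=> [[g fK gK]|[fi fs]].
  by split; [exact: can_inj fK | move=> y; exists (g y)].
by have [g [? ?]] := bij_inv fi fs; exists g.
Qed.

Lemma isoP X Y : module_iso X Y <->
  exists (f : {linear X -> Y}) (g : {linear Y -> X}), cancel f g /\ cancel g f.
Proof.
split=> [[f /bijP [fi fs]]|[f [g [fK gK]]]]; last by exists f, g.
by have [g ?] := bij_inv fi fs; exists f, g.
Qed.

Lemma iso_refl X : module_iso X X.
Proof. by apply/isoP; exists idfun, idfun. Qed.

Lemma iso_sym X Y : module_iso X Y -> module_iso Y X.
Proof. by case/isoP=> f [g [fK gK]]; apply/isoP; exists g, f. Qed.

Lemma iso_trans X Y Z : module_iso X Y -> module_iso Y Z -> module_iso X Z.
Proof.
case=> f bf [g bg]; exists (g \o f : {linear X -> Z}); exact: bij_comp.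
Qed.

Lemma pair_ex X Y Z (f : {linear X -> Y}) (g : {linear X -> Z}) :
  exists h : {linear X -> (Y * Z)%type}, forall x, h x = (f x, g x).
Proof. by apply: linear_ex => a x y; rewrite !linearP. Qed.

Lemma copair_ex X Y Z (f : {linear Y -> X}) (g : {linear Z -> X}) :
  exists h : {linear (Y * Z)%type -> X}, forall x, h x = f x.1 + g x.2.
Proof.
apply: linear_ex => a x y /=; rewrite !linearP /= scalerDr.
by rewrite addrACA.
Qed.

Lemma inl_ex X Y :
  exists h : {linear X -> (X * Y)%type}, forall x, h x = (x, 0).
Proof. by have [h hh] := @pair_ex X X Y idfun \0; exists h. Qed.

Lemma inr_ex X Y :
  exists h : {linear Y -> (X * Y)%type}, forall x, h x = (0, x).
Proof. by have [h hh] := @pair_ex Y X Y \0 idfun; exists h. Qed.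

Definition ses X Y Z (i : {linear X -> Y}) (p : {linear Y -> Z}) : Prop :=
  [/\ injective i, surjective p & forall y, p y = 0 <-> exists x, i x = y].

Lemma ses0 X Y Z (i : {linear X -> Y}) (p : {linear Y -> Z}) x :
  ses i p -> p (i x) = 0.
Proof. by case=> _ _ h; apply/h; exists x. Qed.

Lemma ker_submodule X Y (f : {linear X -> Y}) : submodule (fun x => f x = 0).
Proof.
split=> [|x y hx hy|a x hx]; first exact: linear0.
  by rewrite linearD hx hy addr0.
by rewrite linearZ_LR hx scaler0.
Qed.

Lemma im_submodule X Y (f : {linear X -> Y}) :
  submodule (fun y => exists x, f x = y).
Proof.
split=> [|_ _ [x <-] [y <-]|a _ [x <-]]; first by exists 0; rewrite linear0.
  by exists (x + y); rewrite linearD.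
by exists (a *: x); rewrite linearZ_LR.
Qed.

Lemma ker_ses X Y (p : {linear X -> Y}) : surjective p ->
  exists K (i : {linear K -> X}), ses i p.
Proof.
by move=> sp; have [K [i [? ?]]] := sub_ex (ker_submodule p); exists K, i.
Qed.

Lemma ker_ex X Y (p : {linear X -> Y}) :
  exists K (i : {linear K -> X}), injective i /\
    forall x, p x = 0 <-> exists k, i k = x.
Proof.
by have [K [i [? ?]]] := sub_ex (ker_submodule p); exists K, i.
Qed.

Lemma coker_ses X Y (i : {linear X -> Y}) : injective i ->
  exists Q (p : {linear Y -> Q}), ses i p.
Proof.
by move=> ii; have [Q [p [? ?]]] := quot_ex (im_submodule i); exists Q, p.
Qed.

Lemma im_ex X Y (f : {linear X -> Y}) :
  exists I (p : {linear X -> I}) (i : {linear I -> Y}),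
    [/\ surjective p, injective i & forall x, i (p x) = f x].
Proof.
have [I [i [ii hi]]] := sub_ex (im_submodule f).
have [|p hp] := @lin_lift X Y I f i ii; first by move=> x; apply/hi; exists x.
exists I, p, i; split=> // z; have /hi [x e] : exists z', i z' = i z by exists z.
by exists x; apply: ii; rewrite hp.
Qed.

Lemma pullback_ex X Y Z (f : {linear X -> Z}) (g : {linear Y -> Z}) :
  exists P (a : {linear P -> X}) (b : {linear P -> Y}),
    [/\ forall q, f (a q) = g (b q),
        forall q, a q = 0 -> b q = 0 -> q = 0
      & forall x y, f x = g y -> exists q, a q = x /\ b q = y].
Proof.
have [d hd] := @copair_ex Z X Y f (\- g).
have [P [i [ii hi]]] := ker_ex d.
exists P, (fst \o i : {linear P -> X}), (snd \o i : {linear P -> Y}).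
split=> /= [q|q e1 e2|x y e].
- have /hi : exists k, i k = i q by exists q.
  by rewrite hd /= => /eqP; rewrite subr_eq0 => /eqP.
- by apply: (inj0 ii); case: (i q) e1 e2 => u v /= -> ->.
- have /hi [q hq] : d (x, y) = 0 by rewrite hd /= e subrr.
  by exists q; rewrite hq.
Qed.

Lemma pushout_ex X Y Z (f : {linear Z -> X}) (g : {linear Z -> Y}) :
  exists Q (a : {linear X -> Q}) (b : {linear Y -> Q}),
    [/\ forall z, a (f z) = b (g z),
        forall q, exists x y, q = a x + b y
      & forall x y, a x + b y = 0 <-> exists z, x = f z /\ y = - g z].
Proof.
have [d hd] := @pair_ex Z X Y f (\- g).
have [Q [p [sp hp]]] := quot_ex (im_submodule d).
have [ix hx] := inl_ex X Y; have [iy hy] := inr_ex X Y.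
have e x y : p (ix x) + p (iy y) = p (x, y).
  by rewrite -linearD hx hy /= -[(x, 0) + _]/(x + 0, 0 + y) addr0 add0r.
exists Q, (p \o ix : {linear X -> Q}), (p \o iy : {linear Y -> Q}).
split=> /= [z|q|x y].
- apply/eqP; rewrite -subr_eq0 -linearN -[- iy _]linearN e; apply/eqP/hp.
  by exists z; rewrite hd.
- by have [[x y] <-] := sp q; exists x, y; rewrite e.
- rewrite e hp; split=> [[z]|[z [-> ->]]]; last by exists z; rewrite hd.
  by rewrite hd => -[<- <-]; exists z.
Qed.

End LinearMaps.

(** * Finite direct sums and finite generation *)

Section DirectSums.
Variable A : pzRingType.
Implicit Types X Y Z : lmodType A.

Lemma tuple_ex k (M : 'I_k -> lmodType A) X (f : forall i, {linear X -> M i}) :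
  exists h : {linear X -> dsum M}, forall x i, h x i = f i x.
Proof.
have [|h hh] := @linear_ex A X (dsum M) (fun x i => f i x).
  move=> a x y; apply: functional_extensionality_dep => i.
  by rewrite linearP.
by exists h => x i; rewrite hh.
Qed.

Lemma cotuple_ex k (M : 'I_k -> lmodType A) X (g : forall i, {linear M i -> X}) :
  exists h : {linear dsum M -> X}, forall x, h x = \sum_i g i (x i).
Proof.
apply: linear_ex => a x y; rewrite scaler_sumr -big_split.
by apply: eq_bigr => i _ /=; rewrite -linearP.
Qed.

Lemma proj_ex k (M : 'I_k -> lmodType A) i :
  exists h : {linear dsum M -> M i}, forall x, h x = x i.
Proof. exact: linear_ex. Qed.

Lemma inj_ex k (M : 'I_k -> lmodType A) i :
  exists h : {linear M i -> dsum M},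
    (forall x, h x i = x) /\ (forall x j, j != i -> h x j = 0).
Proof.
pose d (x : M i) : dsum M := dfwith (fun k => 0 : M k) x.
have [|h hh] := @linear_ex A (M i) (dsum M) d.
  move=> a x y; apply: functional_extensionality_dep => j.
  rewrite -[RHS]/(a *: d x j + d y j) /d.
  have [<-|ij] := eqVneq i j; first by rewrite !dfwith_in.
  by rewrite !dfwith_out // scaler0 addr0.
exists h; split=> [x|x j ji]; rewrite hh /d ?dfwith_in // dfwith_out //.
by rewrite eq_sym.
Qed.

Lemma dsumP k (M : 'I_k -> lmodType A) (x y : dsum M) :
  (forall i, x i = y i) -> x = y.
Proof. exact: functional_extensionality_dep. Qed.

Definition powm (T : lmodType A) k : lmodType A := dsum (fun _ : 'I_k => T).

Lemma smul_ex X (x : X) :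
  exists h : {linear A^o -> X}, forall a : A, h a = a *: x.
Proof. by apply: linear_ex => a b c; rewrite scalerDl scalerA. Qed.

Lemma fgP X : finitely_generated X <->
  exists k (p : {linear powm A^o k -> X}), surjective p.
Proof.
split=> [[k [g hg]]|[k [p sp]]].
  pose s i := sval (cid (smul_ex (g i))).
  have hs i (a : A) : s i a = a *: g i by rewrite /s; case: cid.
  have [p hp] := cotuple_ex s; exists k, p => x; have [c ->] := hg x.
  by exists c; rewrite hp; apply: eq_bigr => i _; rewrite hs.
pose e i : powm A^o k := fun j => (i == j)%:R.
exists k, (fun i => p (e i)) => x; have [c <-] := sp x; exists c.
have ec : c = \sum_i (c i : A) *: e i.
  apply: dsumP => j; have [pj hpj] := proj_ex (fun _ : 'I_k => A^o : lmodType A) j.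
  rewrite -[RHS]hpj linear_sum /= (bigD1 j) //= linearZ_LR /= hpj big1 => [|i ij].
    by rewrite addr0 /e eqxx -[_ *: _]/(_ * _) mulr1.
  by rewrite linearZ_LR hpj /e (negPf ij) scaler0.
by rewrite [in LHS]ec linear_sum; apply: eq_bigr => i _; rewrite linearZ_LR.
Qed.

Lemma fg_surj X Y (p : {linear X -> Y}) : surjective p ->
  finitely_generated X -> finitely_generated Y.
Proof.
move=> sp [k [g hg]]; exists k, (p \o g) => y; have [x <-] := sp y.
have [c ->] := hg x; exists c; rewrite linear_sum.
by apply: eq_bigr => i _; rewrite linearZ_LR.
Qed.

Lemma fg_ext X Y Z (i : {linear X -> Y}) (p : {linear Y -> Z}) : ses i p ->
  finitely_generated X -> finitely_generated Z -> finitely_generated Y.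
Proof.
case=> _ sp hip [k [g hg]] [l [h hh]].
pose s z := sval (cid (sp z)).
have hs z : p (s z) = z by rewrite /s; case: cid.
exists (k + l)%N, (fun j => match split j with inl u => i (g u) | inr v => s (h v) end).
move=> y; have [d hd] := hh (p y).
have /hip [x hx] : p (y - \sum_v d v *: s (h v)) = 0.
  rewrite linearB linear_sum hd; apply/eqP; rewrite subr_eq0; apply/eqP.
  by apply: eq_bigr => v _; rewrite linearZ_LR hs.
have [c hc] := hg x.
exists (fun j => match split j with inl u => c u | inr v => d v end).
rewrite big_split_ord /=.
under eq_bigr => u _ do rewrite (unsplitK (inl u : 'I_k + 'I_l)).
under [X in _ + X]eq_bigr => v _ do rewrite (unsplitK (inr v : 'I_k + 'I_l)).
rewrite -[y](subrK (\sum_v d v *: s (h v))) -hx hc linear_sum; congr (_ + _).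
by apply: eq_bigr => u _; rewrite linearZ_LR.
Qed.

Lemma ses_prod X Y (ix : {linear X -> (X * Y)%type}) :
  (forall x, ix x = (x, 0)) -> ses ix (snd : {linear (X * Y)%type -> Y}).
Proof.
move=> hi; split=> [x x'|y|[x y]] /=; first by rewrite !hi => -[].
  by exists (0, y).
by split=> [->|[x']]; [exists x; rewrite hi | rewrite hi => -[_ <-]].
Qed.

Lemma fg_prod X Y :
  finitely_generated X -> finitely_generated Y ->
  finitely_generated (X * Y)%type.
Proof.
by have [ix /ses_prod hi] := inl_ex X Y; apply: fg_ext hi.
Qed.

Lemma fg_zero X : is_zero X -> finitely_generated X.
Proof.
move=> h; exists 0%N, (fun=> 0) => x; exists (fun=> 0).
by rewrite big_ord0; apply: h.
Qed.

Lemma dsum0_zero (M : 'I_0 -> lmodType A) : is_zero (dsum M).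
Proof. by move=> x; apply: dsumP => -[]. Qed.

(** Splits off the first summand, so that statements about [dsum] follow by induction from closure
    under extensions. *)
Lemma dsumS_ses k (M : 'I_k.+1 -> lmodType A) :
  exists (i : {linear dsum (fun j => M (lift ord0 j)) -> dsum M})
         (p : {linear dsum M -> M ord0}), ses i p.
Proof.
have [p hp] := proj_ex M ord0.
pose u j := cid (inj_ex M (lift ord0 j)).
have [i hi] := cotuple_ex (fun j => sval (u j)).
have i0 x : i x ord0 = 0.
  rewrite -hp hi linear_sum big1 // => j _; rewrite hp.
  by apply: (svalP (u j)).2; rewrite neq_lift.
have iS x j : i x (lift ord0 j) = x j.
  have [q hq] := proj_ex M (lift ord0 j).
  rewrite -hq hi linear_sum (bigD1 j) //= hq big1 ?addr0 => [|l lj].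
    exact: (svalP (u j)).1.
  rewrite hq; apply: (svalP (u l)).2.
  by rewrite (inj_eq lift_inj) eq_sym.
exists i, p; split=> [x y e|z|x].
- by apply: dsumP => j; rewrite -!iS e.
- by have [h [h1 h2]] := inj_ex M ord0; exists (h z); rewrite hp h1.
- rewrite hp; split=> [x0|[y <-]]; last by rewrite i0.
  exists (fun j => x (lift ord0 j)); apply: dsumP => j.
  by case: (unliftP ord0 j) => [j'|] ->; rewrite ?iS ?i0.
Qed.

Lemma fg_dsum k (M : 'I_k -> lmodType A) :
  (forall i, finitely_generated (M i)) -> finitely_generated (dsum M).
Proof.
elim: k M => [|k IHk] M hM; first by apply/fg_zero/dsum0_zero.
have [i [p s]] := dsumS_ses M.
by apply: fg_ext s _ _ => //; apply: IHk => j; apply: hM.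
Qed.

Lemma fg_free : finitely_generated A^o.
Proof.
exists 1%N, (fun=> 1) => x; exists (fun=> x); rewrite big_ord1.
by rewrite -[_ *: _]/(_ * _) mulr1.
Qed.

Lemma fg_iso X Y : module_iso X Y ->
  finitely_generated X -> finitely_generated Y.
Proof. by case=> f /bijP [_ sf]; apply: fg_surj sf. Qed.

End DirectSums.

(** * Length of modules *)

Section Length.
Variable A : pzRingType.
Implicit Types M X Y Z : lmodType A.

(** A strict chain of submodules with [n] steps and top [P]. Length is the largest such [n]; its
    additivity is proved on chains, without composition series. *)
Inductive chain M : (M -> Prop) -> nat -> Prop :=
| chain0 P : submodule P -> chain P 0
| chainS P Q n : chain Q n -> submodule P -> (forall x, Q x -> P x) ->
    (exists2 x, P x & ~ Q x) -> chain P n.+1.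

Definition finlen M := exists b, forall (P : M -> Prop) n, chain P n -> (n <= b)%N.

Lemma chain_sub M (P : M -> Prop) n : chain P n -> submodule P.
Proof. by case. Qed.

Lemma chain_mono M (P Q : M -> Prop) n : chain P n -> submodule Q ->
  (forall x, P x -> Q x) -> chain Q n.
Proof.
case=> {P n} [P _ hQ _|P R n cR hP RP [x Px nRx] hQ PQ]; first exact: chain0.
apply: (chainS cR) => // [y /RP /PQ //|]; by exists x => //; apply: PQ.
Qed.

Lemma top_submodule M : submodule (fun _ : M => True).
Proof. by []. Qed.

Lemma chain_cat X Y Z (i : {linear X -> Y}) (p : {linear Y -> Z}) : ses i p ->
  forall (P : X -> Prop) (Q : Z -> Prop) a b, chain P a -> chain Q b ->
  chain (fun y => Q (p y)) (a + b)%N.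
Proof.
move=> s P Q a b cP cQ; have [ii sp hip] := s.
have pre (R : Z -> Prop) : submodule R -> submodule (fun y => R (p y)).
  case=> R0 RD RZ; split=> [|x y|c x]; rewrite ?(linear0, linearD, linearZ_LR) //.
    exact: RD.
  exact: RZ.
elim: {Q b} cQ => [Q hQ|Q R b cR IH hQ RQ [z Qz nRz]]; last first.
  rewrite addnS; apply: (chainS IH) => //; first exact: pre.
    by move=> y /RQ.
  by have [y e] := sp z; exists y; rewrite e.
rewrite addn0.
have im (S : X -> Prop) : submodule S -> submodule (fun y => exists2 x, S x & i x = y).
  case=> S0 SD SZ; split=> [|_ _ [x hx <-] [y hy <-]|c _ [x hx <-]].
  - by exists 0; rewrite ?linear0.
  - by exists (x + y); rewrite ?linearD //; apply: SD.
  - by exists (c *: x); rewrite ?linearZ_LR //; apply: SZ.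
have c1 : chain (fun y => exists2 x, P x & i x = y) a.
  elim: {P a} cP => [P hP|P R a cR IH hP RP [x Px nRx]]; first by apply/chain0/im.
  apply: (chainS IH) => [|y [u /RP ? ?]|]; [exact: im|by exists u|].
  by exists (i x); [exists x|case=> u hu /ii e; apply: nRx; rewrite -e].
apply: (chain_mono c1) => [|_ [x _ <-]]; first exact: pre.
by have [Q0 _ _] := hQ; rewrite (ses0 _ s).
Qed.

Lemma chain_split X Y Z (i : {linear X -> Y}) (p : {linear Y -> Z}) : ses i p ->
  forall (P : Y -> Prop) n, chain P n -> exists a b,
  [/\ chain (fun x => P (i x)) a,
      chain (fun z => exists2 y, P y & p y = z) b & (n <= a + b)%N].
Proof.
move=> s; have [ii sp hip] := s.
have pre (R : Y -> Prop) : submodule R -> submodule (fun x => R (i x)).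
  case=> R0 RD RZ; split=> [|x y|c x]; rewrite ?(linear0, linearD, linearZ_LR) //.
    exact: RD.
  exact: RZ.
have im (S : Y -> Prop) : submodule S -> submodule (fun z => exists2 y, S y & p y = z).
  case=> S0 SD SZ; split=> [|_ _ [x hx <-] [y hy <-]|c _ [x hx <-]].
  - by exists 0; rewrite ?linear0.
  - by exists (x + y); rewrite ?linearD //; apply: SD.
  - by exists (c *: x); rewrite ?linearZ_LR //; apply: SZ.
move=> P n; elim=> {P n} [P hP|P Q n cQ [a [b [ca cb le]]] hP QP [y Py nQy]].
  by exists 0%N, 0%N; split=> //; apply: chain0; [exact: pre|exact: im].
have iQP x : Q (i x) -> P (i x) by apply: QP.
have pQP z : (exists2 y, Q y & p y = z) -> exists2 y, P y & p y = z.
  by case=> u /QP ? ?; exists u.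
have hPi := pre _ hP; have hPp := im _ hP.
(* A strict step from [Q] to [P] is strict on the trace in [X] or on the image in [Z]: an element of
   [P] with the same image as an element of [Q] differs from it by an element of [X]. *)
have [h|h] := pselect (exists2 x, P (i x) & ~ Q (i x)).
  exists a.+1, b; split; [exact: chainS ca _ _ h|exact: chain_mono cb _ _|].
  by rewrite addSn ltnS.
exists a, b.+1; split; [exact: chain_mono ca _ _| |by rewrite addnS ltnS].
apply: (chainS cb) => //; exists (p y); first by exists y.
case=> u Qu e; have /hip [x hx] : p (y - u) = 0 by rewrite linearB e subrr.
have Pix : P (i x) by rewrite hx; apply: submB => //; apply: QP.
have Qix : Q (i x) by apply: contrapT => nq; apply: h; exists x.
apply: nQy; rewrite -(subrK u y) -hx.
by have [_ QD _] := chain_sub cQ; apply: QD.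
Qed.

(** Finiteness is assumed under the existential quantifier so that [len] is a total function; its
    value carries no information when [finlen] fails. *)
Lemma len_ex M : exists l, finlen M ->
  (exists P : M -> Prop, chain P l) /\ forall (P : M -> Prop) n, chain P n -> (n <= l)%N.
Proof.
have [[b hb]|] := pselect (finlen M); last by exists 0%N.
pose p n := `[< exists P : M -> Prop, chain P n >].
have ex : exists n, p n.
  exists 0%N; apply/asboolP; exists (fun=> True); exact/chain0/top_submodule.
have [|l /asboolP hl ml] := ex_maxnP (P := p) (m := b) ex.
  by move=> n /asboolP [P]; apply: hb.
by exists l => _; split=> // P n c; apply: ml; apply/asboolP; exists P.
Qed.

Definition len M := sval (cid (len_ex M)).

Lemma len_max M (P : M -> Prop) n : finlen M -> chain P n -> (n <= len M)%N.
Proof. by move=> h; rewrite /len; case: cid => l /= /(_ h) [_]; apply. Qed.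

Lemma len_chain M : finlen M -> chain (fun _ : M => True) (len M).
Proof.
move=> h; rewrite /len; case: cid => l /= /(_ h) [[P c] _].
by apply: chain_mono c _ _ => //; exact: top_submodule.
Qed.

Lemma finlen_ses X Y Z (i : {linear X -> Y}) (p : {linear Y -> Z}) : ses i p ->
  finlen Y <-> finlen X /\ finlen Z.
Proof.
move=> s; split=> [[b hb]|[[a ha] [b hb]]].
  split; exists b => P n c.
    have := hb _ _ (chain_cat s c (chain0 (top_submodule Z))).
    by rewrite addn0.
  by have := hb _ _ (chain_cat s (chain0 (top_submodule X)) c); rewrite add0n.
exists (a + b)%N => P n /(chain_split s) [u [v [/ha ua /hb vb le]]].
by apply: (leq_trans le); apply: leq_add.
Qed.

Lemma len_ses X Y Z (i : {linear X -> Y}) (p : {linear Y -> Z}) : ses i p ->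
  finlen Y -> len Y = (len X + len Z)%N.
Proof.
move=> s fY; have /(finlen_ses s) [fX fZ] := fY.
apply/eqP; rewrite eqn_leq; apply/andP; split; last first.
  exact: len_max fY (chain_cat s (len_chain fX) (len_chain fZ)).
have [a [b [/(len_max fX) ha /(len_max fZ) hb le]]] := chain_split s (len_chain fY).
by apply: (leq_trans le); apply: leq_add.
Qed.

Lemma finlen_inj X Y (i : {linear X -> Y}) : injective i -> finlen Y -> finlen X.
Proof. by case/coker_ses=> Q [p /finlen_ses s] /s []. Qed.

Lemma finlen_surj X Y (p : {linear X -> Y}) : surjective p -> finlen X -> finlen Y.
Proof. by case/ker_ses=> Q [i /finlen_ses s] /s []. Qed.

Lemma len_inj X Y (i : {linear X -> Y}) : injective i -> finlen Y ->
  (len X <= len Y)%N.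
Proof.
by case/coker_ses=> Q [p s] fY; rewrite (len_ses s fY) leq_addr.
Qed.

Lemma len_surj X Y (p : {linear X -> Y}) : surjective p -> finlen X ->
  (len Y <= len X)%N.
Proof.
by case/ker_ses=> Q [i s] fX; rewrite (len_ses s fX) leq_addl.
Qed.

Lemma len_gt0 X : finlen X -> ~ is_zero X -> (0 < len X)%N.
Proof.
move=> fX nz; have [x nx] : exists x : X, x <> 0.
  by apply: contrapT => h; apply: nz => x; apply: contrapT => hx; apply: h; exists x.
apply: (len_max fX (P := fun=> True)).
apply: (@chainS _ _ (fun x => x = 0)).
- apply: chain0; split=> // [u v -> ->|a u ->]; by rewrite ?addr0 ?scaler0.
- exact: top_submodule.
- by [].
- by exists x.
Qed.

Lemma len_zero X : is_zero X -> finlen X /\ len X = 0%N.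
Proof.
move=> z; have b : forall (P : X -> Prop) n, chain P n -> (n <= 0)%N.
  move=> P n [] // {}P Q {}n /chain_sub [Q0 _ _] _ _ [x _].
  by rewrite (z x).
have f : finlen X by exists 0%N.
by split=> //; apply/eqP; rewrite -leqn0; apply: b (len_chain f).
Qed.

Lemma len0_zero X : finlen X -> len X = 0%N -> is_zero X.
Proof. by move=> f l; apply: contrapT => /(len_gt0 f); rewrite l. Qed.

Lemma inj_len_surj X Y (i : {linear X -> Y}) : injective i -> finlen Y ->
  (len Y <= len X)%N -> surjective i.
Proof.
move=> ii fY; have [Q [p s]] := coker_ses ii.
rewrite (len_ses s fY) -{2}[len X]addn0 leq_add2l leqn0 => /eqP l0 y.
have /(finlen_ses s) [_ fQ] := fY.
by have [_ _ h] := s; apply/h; apply: len0_zero l0 _.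
Qed.

Lemma surj_len_inj X Y (p : {linear X -> Y}) : surjective p -> finlen X ->
  (len X <= len Y)%N -> injective p.
Proof.
move=> sp fX; have [K [i s]] := ker_ses sp.
rewrite (len_ses s fX) -{2}[len Y]add0n leq_add2r leqn0 => /eqP l0.
have /(finlen_ses s) [fK _] := fX.
have [_ _ h] := s; apply: lin_inj => x /h [k <-].
by rewrite (len0_zero fK l0 k) linear0.
Qed.

Lemma finlen_iso X Y : module_iso X Y -> finlen X -> finlen Y.
Proof. by case=> f /bijP [_ sf]; apply: finlen_surj sf. Qed.

Lemma len_iso X Y : module_iso X Y -> finlen X -> len X = len Y.
Proof.
case=> f /bijP [fi fs] fX; apply/eqP; rewrite eqn_leq (len_surj fs) // andbT.
by apply: (len_inj fi); apply: finlen_surj fX.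
Qed.

Lemma endo_bij X (f : {linear X -> X}) : finlen X -> injective f -> bijective f.
Proof. by move=> fX fi; apply/bijP; split=> //; apply: inj_len_surj. Qed.

Lemma endo_surj_bij X (f : {linear X -> X}) : finlen X -> surjective f -> bijective f.
Proof. by move=> fX fi; apply/bijP; split=> //; apply: surj_len_inj. Qed.

Lemma finlen_dsum k (M : 'I_k -> lmodType A) :
  (forall i, finlen (M i)) -> finlen (dsum M).
Proof.
elim: k M => [|k IHk] M hM; first by case: (len_zero (@dsum0_zero _ M)).
have [i [p s]] := dsumS_ses M.
by apply/(finlen_ses s); split=> //; apply: IHk.
Qed.

Lemma fg_finlen X : finlen A^o -> finitely_generated X -> finlen X.
Proof.
by move=> fA /fgP [k [p sp]]; apply: finlen_surj sp _; apply: finlen_dsum.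
Qed.

Lemma finlen_fg X : finlen X -> finitely_generated X.
Proof.
have [n le] := ubnP (len X); elim: n X le => // n IHn X le fX.
have [z|/asboolPn nz] := pselect (is_zero X); first exact: fg_zero.
have [x nx] : exists x : X, x <> 0.
  apply: contrapT => h; move/asboolPn: nz; apply => x.
  by apply: contrapT => hx; apply: h; exists x.
have [h hh] := smul_ex x; have [I [p [i [sp ii ip]]]] := im_ex h.
have [Q [q s]] := coker_ses ii; have /(finlen_ses s) [fI fQ] := fX.
apply: (fg_ext s); first exact: fg_surj sp (fg_free A).
apply: IHn => //; move: le; rewrite (len_ses s fX) ltnS.
apply: leq_trans; rewrite -[X in (X < _)%N]add0n ltn_add2r.
apply: (len_gt0 fI) => zI; apply: nx.
by rewrite -[x]scale1r -hh -ip (zI (p 1)) linear0.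
Qed.

End Length.

(** * Short exact sequences and retracts *)

Section ExactSequences.
Variable A : pzRingType.
Implicit Types M N X Y Z W Q K P R V T U I S CX CY CZ : lmodType A.

Lemma dsum_decomp k (M : 'I_k -> lmodType A) :
  exists h : forall i, {linear M i -> dsum M}, forall x, x = \sum_i h i (x i).
Proof.
pose u i := cid (inj_ex M i); exists (fun i => sval (u i)) => x.
apply: dsumP => j; have [q hq] := proj_ex M j.
rewrite -[RHS]hq linear_sum (bigD1 j) //= big1 ?addr0 => [|i ij].
  by rewrite hq (svalP (u j)).1.
by rewrite hq (svalP (u i)).2 // eq_sym.
Qed.

(** A direct summand without a chosen complement: this pair of maps is carried along by every
    functor. *)
Definition retract X M :=
  exists (a : {linear X -> M}) (b : {linear M -> X}), cancel a b.

Lemma ses_section X Y Z (i : {linear X -> Y}) (p : {linear Y -> Z})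
  (s : {linear Z -> Y}) : ses i p -> (forall z, p (s z) = z) ->
  exists r : {linear Y -> X}, cancel i r.
Proof.
move=> ss ps; have [ii sp hip] := ss.
have [d hd] : exists d : {linear Y -> Y}, forall y, d y = y - s (p y).
  by exists (idfun \+ (\- (s \o p))).
have [|r hr] := @lin_lift A Y Y X d i ii.
  by move=> y; apply: (proj1 (hip _)); rewrite hd linearB ps subrr.
exists r => x; apply: ii; by rewrite hr hd (ses0 _ ss) linear0 subr0.
Qed.

Lemma ses_retraction X Y Z (i : {linear X -> Y}) (p : {linear Y -> Z})
  (r : {linear Y -> X}) : ses i p -> cancel i r ->
  exists2 s : {linear Z -> Y}, (forall z, p (s z) = z)
    & module_iso Y (X * Z)%type.
Proof.
move=> [ii sp hip] ir; have [h hh] := pair_ex r p.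
have ih : injective h.
  apply: lin_inj => y; rewrite hh => -[r0 /hip [x hx]].
  by rewrite -hx -(ir x) hx r0 linear0.
have sh : surjective h.
  move=> [x z]; have [y hy] := sp z; exists (y + i (x - r y)).
  have pi u : p (i u) = 0 by apply/hip; exists u.
  have e : r y + (x - r y) = x by rewrite [LHS]addrC subrK.
  by move: (x - r y) e => u e; rewrite hh !linearD ir e pi addr0 hy.
have [g [hg gh]] := bij_inv ih sh; have [q hq] := inr_ex X Z.
exists (g \o q : {linear Z -> Y}); last by exists h; apply/bijP.
by move=> z /=; have := gh (q z); rewrite hh hq => -[].
Qed.

Lemma retract_prod X Y (i : {linear X -> Y}) (r : {linear Y -> X}) :
  cancel i r -> exists Z, module_iso Y (X * Z)%type.
Proof.
move=> ir; have ii : injective i := can_inj ir.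
have [Q [p s]] := coker_ses ii; exists Q.
by have [] := ses_retraction s ir.
Qed.

Lemma direct_summandP X M : direct_summand X M <-> retract X M.
Proof.
split=> [[Y /isoP [f [g [fK gK]]]]|[a [b ab]]]; last exact: retract_prod ab.
have [l hl] := inl_ex X Y.
exists (g \o l : {linear X -> M}), (fst \o f : {linear M -> X}) => x /=.
by rewrite gK hl.
Qed.

Lemma retract_refl X : retract X X.
Proof. by exists idfun, idfun. Qed.

Lemma retract_trans X Y Z : retract X Y -> retract Y Z -> retract X Z.
Proof.
move=> [a [b ab]] [c [d cd]].
by exists (c \o a : {linear _ -> _}), (b \o d : {linear _ -> _}) => x /=; rewrite cd ab.
Qed.

Lemma retract_iso X Y : module_iso X Y -> retract X Y.
Proof. by case/isoP=> f [g [fK _]]; exists f, g. Qed.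

Lemma retract_fst X Y : retract X (X * Y)%type.
Proof.
have [l hl] := inl_ex X Y; exists l, (fst : {linear (X * Y)%type -> X}) => x.
by rewrite hl.
Qed.

Lemma retract_snd X Y : retract Y (X * Y)%type.
Proof.
have [l hl] := inr_ex X Y; exists l, (snd : {linear (X * Y)%type -> Y}) => x.
by rewrite hl.
Qed.

Lemma retract_fg X M : retract X M -> finitely_generated M -> finitely_generated X.
Proof. by case=> a [b ab]; apply: (fg_surj (p := b)) => x; exists (a x). Qed.

Lemma prod_map_ex X Y Z W (f : {linear X -> Y}) (g : {linear Z -> W}) :
  exists h : {linear (X * Z)%type -> (Y * W)%type}, forall x, h x = (f x.1, g x.2).
Proof.
by have [h hh] := pair_ex (f \o fst : {linear (X * Z)%type -> Y})
   (g \o snd : {linear (X * Z)%type -> W}); exists h.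
Qed.

Lemma ses_prod2 X Y Z (i : {linear X -> Y}) (p : {linear Y -> Z})
    X' Y' Z' (i' : {linear X' -> Y'}) (p' : {linear Y' -> Z'}) :
  ses i p -> ses i' p' ->
  exists (j : {linear (X * X')%type -> (Y * Y')%type})
         (q : {linear (Y * Y')%type -> (Z * Z')%type}),
  [/\ ses j q, forall x, j x = (i x.1, i' x.2) & forall y, q y = (p y.1, p' y.2)].
Proof.
move=> [ii sp h] [ii' sp' h']; have [j hj] := prod_map_ex i i'.
have [q hq] := prod_map_ex p p'; exists j, q; split=> //; split.
- by move=> [u v] [u' v']; rewrite !hj /= => -[/ii -> /ii' ->].
- move=> [z z']; have [y <-] := sp z; have [y' <-] := sp' z'.
  by exists (y, y'); rewrite hq.
- move=> [y y']; rewrite hq /=; split.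
    by case=> /h [x <-] /h' [x' <-]; exists (x, x'); rewrite hj.
  case=> -[x x']; rewrite hj /= => -[<- <-].
  have -> : p (i x) = 0 by apply/h; exists x.
  by have -> : p' (i' x') = 0 by apply/h'; exists x'.
Qed.

Lemma ses_id X Z : is_zero Z -> ses (idfun : {linear X -> X}) (\0 : {linear X -> Z}).
Proof.
move=> z; split=> // [y|y]; first by exists 0; apply: esym; apply: z.
by split=> // _; exists y.
Qed.

Lemma ses_id0 X Z : is_zero Z -> ses (\0 : {linear Z -> X}) (idfun : {linear X -> X}).
Proof.
move=> z; split=> [x y _|y|y]; first by rewrite (z x) (z y).
  by exists y.
by split=> [/= ->|[x <-]] //; exists 0.
Qed.

Lemma ses_iso X Y Z X' Y' Z' (i : {linear X -> Y}) (p : {linear Y -> Z}) :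
  module_iso X X' -> module_iso Y Y' -> module_iso Z Z' -> ses i p ->
  exists (i' : {linear X' -> Y'}) (p' : {linear Y' -> Z'}), ses i' p'.
Proof.
move=> /isoP [f [f' [fK f'K]]] /isoP [g [g' [gK g'K]]] /isoP [h [h' [hK h'K]]].
move=> [ii sp e].
exists (g \o i \o f' : {linear _ -> _}), (h \o p \o g' : {linear _ -> _}); split.
- by move=> x y /= /(can_inj gK) /ii /(can_inj f'K).
- by move=> z /=; have [y hy] := sp (h' z); exists (g y); rewrite /= gK hy h'K.
- move=> y /=; split=> [e0|[x <-]].
    have /e [x hx] : p (g' y) = 0 by apply: (can_inj hK); rewrite e0 linear0.
    by exists (f x); rewrite /= fK hx g'K.
  by rewrite /= gK (_ : p _ = 0) ?linear0 //; apply/e; exists (f' x).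
Qed.

Lemma pullback_ses X Y Z W (i : {linear X -> Y}) (p : {linear Y -> Z})
  (f : {linear W -> Z}) : ses i p ->
  exists Q (j : {linear X -> Q}) (q : {linear Q -> W}) (g : {linear Q -> Y}),
    [/\ ses j q, forall x, g (j x) = i x & forall x, p (g x) = f (q x)].
Proof.
move=> [ii sp h]; have [Q [a [b [e j0 u]]]] := pullback_ex f p.
have [||j hj] := @lin_lift A X (W * Y)%type Q
  (sval (cid (inr_ex W Y)) \o i : {linear _ -> _}) (sval (cid (pair_ex a b))).
- by apply: lin_inj => q; case: cid => /= v ->; case=> ? ?; apply: j0.
- move=> x; have [q [qa qb]] : exists q, a q = 0 /\ b q = i x.
    by apply: u; rewrite linear0; apply/esym/h; exists x.
  by exists q; case: cid => /= v ->; case: cid => /= w ->; rewrite qa qb.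
have {}hj x : a (j x) = 0 /\ b (j x) = i x.
  by move: (hj x); case: cid => /= v ->; case: cid => /= w -> [].
exists Q, j, a, b; split=> [|x|x]; [|exact: (hj x).2|by rewrite e].
split=> [x y exy|w|q]; first by apply: ii; rewrite -!(hj _).2 exy.
  by have [y hy] := sp (f w); have [q [? _]] := u w y (esym hy); exists q.
split=> [aq|[x <-]]; last exact: (hj x).1.
have /h [x hx] : p (b q) = 0 by rewrite -e aq linear0.
exists x; apply/eqP; rewrite -subr_eq0; apply/eqP/j0; rewrite linearB.
  by rewrite (hj x).1 aq subrr.
by rewrite (hj x).2 hx subrr.
Qed.

(** Pulling back one epimorphism along another exhibits the same [Q] as an extension in two ways.
    This gives Schanuel's lemma, and it exchanges right and left approximations in [rapp_lapp]. *)
Lemma pullback2 X Y Z W V (i : {linear X -> Y}) (p : {linear Y -> Z})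
  (k : {linear V -> W}) (f : {linear W -> Z}) : ses i p -> ses k f ->
  exists Q (j : {linear X -> Q}) (q : {linear Q -> W}) (l : {linear V -> Q})
    (g : {linear Q -> Y}), [/\ ses j q, ses l g, forall x, g (j x) = i x,
       forall x, q (l x) = k x & forall x, p (g x) = f (q x)].
Proof.
move=> s [ik sf hf]; have [Q [j [q [g [sj gj pg]]]]] := pullback_ses f s.
have [ij sq hq] := sj; have [ii sp hip] := s.
have lift v y : p y = f v -> exists x, q x = v /\ g x = y.
  move=> e; have [x hx] := sq v; have /hip [z hz] : p (y - g x) = 0.
    by rewrite linearB pg hx e subrr.
  exists (x + j z); split; rewrite linearD; first by rewrite (ses0 _ sj) addr0.
  by rewrite gj hz [LHS]addrC subrK.
pose pr := sval (cid (pair_ex q g)).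
have hpr x : pr x = (q x, g x) by rewrite /pr; case: cid.
have ipr : injective pr.
  apply: lin_inj => x; rewrite hpr => -[/hq [z <-]]; rewrite gj.
  by move=> /(inj0 ii) ->; rewrite linear0.
have [|l hl] := @lin_lift A V (W * Y)%type Q
  (sval (cid (inl_ex W Y)) \o k : {linear _ -> _}) pr ipr.
  move=> v /=; case: cid => /= w ->; have [|x [h1 h2]] := lift (k v) 0.
    by rewrite linear0; apply/esym/hf; exists v.
  by exists x; rewrite hpr h1 h2.
have {}hl v : q (l v) = k v /\ g (l v) = 0.
  by move: (hl v); rewrite hpr /=; case: cid => /= w -> [].
exists Q, j, q, l, g; split=> // [|x]; last exact: (hl x).1.
split=> [x y e|y|x]; first by apply: ik; rewrite -!(hl _).1 e.
  by have [w hw] := sf (p y); have [x [_ ?]] := lift w y (esym hw); exists x.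
split=> [gx|[v <-]]; last exact: (hl v).2.
have /hf [v hv] : f (q x) = 0 by rewrite -pg gx linear0.
by exists v; apply: ipr; rewrite !hpr (hl v).1 (hl v).2 hv gx.
Qed.

Lemma pushout_univ X Y Z W (i : {linear X -> Y}) (p : {linear Y -> Z})
  (f : {linear X -> W}) : ses i p ->
  exists Q (j : {linear W -> Q}) (q : {linear Q -> Z}) (g : {linear Y -> Q}),
    [/\ ses j q, forall x, g (i x) = j (f x), forall y, q (g y) = p y,
        forall x, exists w y, x = j w + g y
      & forall V (h : {linear W -> V}) (k : {linear Y -> V}),
          (forall x, h (f x) = k (i x)) ->
          exists l : {linear Q -> V}, (forall w, l (j w) = h w) /\ forall y, l (g y) = k y].
Proof.
move=> [ii sp h]; have [Q [a [b [e u k]]]] := pushout_ex f i.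
have [c hc] := copair_ex a b.
have sc : surjective c.
  by move=> x; have [w [y ->]] := u x; exists (w, y); rewrite hc.
have pi0 x : p (i x) = 0 by apply/h; exists x.
have b0 y : b y = a 0 + b y by rewrite linear0 add0r.
have a0 w : a w = a w + b 0 by rewrite linear0 addr0.
have univ V (v : {linear W -> V}) (t : {linear Y -> V}) : (forall x, v (f x) = t (i x)) ->
  exists l : {linear Q -> V}, (forall w, l (a w) = v w) /\ forall y, l (b y) = t y.
  move=> vt; have [d hd] := copair_ex v t.
  have [|l hl] := @lin_fact A (W * Y)%type V Q c d sc.
    move=> [w y]; rewrite hc hd /= => /k [z [-> ->]].
    by rewrite linearN vt subrr.
  exists l; split=> [w|y].
    by rewrite a0; have := hl (w, 0); rewrite hc hd /= linear0 addr0 linear0 addr0.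
  by rewrite b0; have := hl (0, y); rewrite hc hd /= linear0 add0r linear0 add0r.
have [q [qa qb]] : exists q : {linear Q -> Z}, (forall w, q (a w) = 0) /\ forall y, q (b y) = p y.
  by have [x|q [q1 q2]] := univ Z \0 p; [rewrite pi0|exists q].
have hq w y : q (a w + b y) = p y by rewrite linearD qa qb add0r.
exists Q, a, q, b; split=> //.
split=> [w w' ew|z|x].
- have /k [z [ez]] : a (w - w') + b 0 = 0 by rewrite -a0 linearB ew subrr.
  move/eqP; rewrite eq_sym oppr_eq0 => /eqP /(inj0 ii) z0.
  by apply/eqP; rewrite -subr_eq0 ez z0 linear0.
- by have [y hy] := sp z; exists (b y); rewrite qb.
- split=> [|[w <-]]; last by rewrite qa.
  have [w [y ->]] := u x; rewrite hq => /h [z <-]; exists (w + f z).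
  by rewrite linearD e.
Qed.

Lemma pushout_ses X Y Z W (i : {linear X -> Y}) (p : {linear Y -> Z})
  (f : {linear X -> W}) : ses i p ->
  exists Q (j : {linear W -> Q}) (q : {linear Q -> Z}) (g : {linear Y -> Q}),
    [/\ ses j q, forall x, g (i x) = j (f x), forall y, q (g y) = p y
      & forall x, exists w y, x = j w + g y].
Proof.
by case/(pushout_univ f)=> Q [j [q [g [? ? ? ? _]]]]; exists Q, j, q, g.
Qed.

Lemma pushout2 X Y Z W V (i : {linear X -> Y}) (p : {linear Y -> Z})
  (f : {linear X -> W}) (k : {linear W -> V}) : ses i p -> ses f k ->
  exists Q (j : {linear W -> Q}) (q : {linear Q -> Z}) (g : {linear Y -> Q})
    (r : {linear Q -> V}), [/\ ses j q, ses g r, forall x, g (i x) = j (f x),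
      forall y, q (g y) = p y & forall w, r (j w) = k w].
Proof.
move=> s [fi sk hk]; have [Q [j [q [g [sj gi qg u]]]]] := pushout_ses f s.
have [ij sq hq] := sj; have [ii sp hip] := s.
have [c hc] := copair_ex j g.
have sc : surjective c.
  by move=> x; have [w [y ->]] := u x; exists (w, y); rewrite hc.
have c0 w y : j w + g y = 0 -> exists x, y = i x /\ w = - f x.
  move=> e; have /hip [x hx] : p y = 0.
    by rewrite -qg -[g y]add0r -(linear0 j) -[in LHS](subrr w) linearB addrAC e add0r linearN (ses0 _ sj) oppr0.
  exists x; split=> //; apply: ij; rewrite linearN -gi hx.
  by apply/eqP; rewrite -addr_eq0 e.
have [|r hr] := @lin_fact A (W * Y)%type V Q c (k \o fst : {linear _ -> _}) sc.
  move=> [w y]; rewrite hc /= => /c0 [x [_ ->]].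
  by rewrite linearN (_ : k _ = 0) ?oppr0 //; apply/hk; exists x.
have {}hr w y : r (j w + g y) = k w by have := hr (w, y); rewrite hc.
have b0 y : g y = j 0 + g y by rewrite linear0 add0r.
have a0 w : j w = j w + g 0 by rewrite linear0 addr0.
exists Q, j, q, g, r; split=> // [|w]; last by rewrite a0 hr.
split=> [|v|x].
- apply: lin_inj => y; rewrite b0 => /c0 [x [-> /esym /eqP]].
  by rewrite oppr_eq0 => /eqP /(inj0 fi) ->; rewrite linear0.
- by have [w hw] := sk v; exists (j w); rewrite a0 hr.
- split=> [|[y <-]]; last by rewrite b0 hr linear0.
  have [w [y ->]] := u x; rewrite hr => /hk [z <-].
  by exists (i z + y); rewrite linearD gi.
Qed.

(** The horseshoe lemma for coresolutions, where [U] need not be injective: all that is used is the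
    single extension [e] of [jX] to [Y], which vanishing of Ext supplies. *)
Lemma horseshoe_co X Y Z U CX W CZ (i : {linear X -> Y}) (p : {linear Y -> Z})
  (jX : {linear X -> U}) (qX : {linear U -> CX})
  (jZ : {linear Z -> W}) (qZ : {linear W -> CZ}) (e : {linear Y -> U}) :
  ses i p -> ses jX qX -> ses jZ qZ -> (forall x, e (i x) = jX x) ->
  exists CY (jY : {linear Y -> (U * W)%type}) (qY : {linear (U * W)%type -> CY})
    (u : {linear CX -> CY}) (v : {linear CY -> CZ}), ses jY qY /\ ses u v.
Proof.
move=> s sX sZ hei; have [ii sp hip] := s; have [ijX sqX hX] := sX.
have [ijZ sqZ hZ] := sZ; have [j hj] := pair_ex e (jZ \o p : {linear _ -> _}).
have ij : injective j.
  apply: lin_inj => y; rewrite hj /= => -[ey /(inj0 ijZ) /hip [x hx]].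
  by move: ey; rewrite -hx hei => /(inj0 ijX) ->; rewrite linear0.
have [CY [q sY]] := coker_ses ij; have [_ sq hq] := sY.
have [l hl] := inl_ex U W.
have [|u hu] := @lin_fact A U CY CX qX (q \o l : {linear _ -> _}) sqX.
  move=> x /hX [y <-] /=; apply/hq; exists (i y).
  by rewrite hj hl hei /= (ses0 _ s) linear0.
have [|v hv] := @lin_fact A _ CZ CY q (qZ \o snd : {linear (U * W)%type -> CZ}) sq.
  by move=> x /hq [y <-] /=; rewrite hj /= (ses0 _ sZ).
exists CY, j, q, u, v; split=> //; split=> [|z|y].
- apply: lin_inj => c; have [x <-] := sqX c; rewrite hu /= => /hq [y].
  rewrite hj hl /= => -[<- /(inj0 ijZ) /hip [z <-]].
  by rewrite hei (ses0 _ sX).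
- have [w <-] := sqZ z; have [r hr] := inr_ex U W; exists (q (r w)).
  by rewrite hv /= hr.
- split=> [|[c <-]]; last first.
    by have [x <-] := sqX c; rewrite hu /= hv /= hl linear0.
  have [[a b] <-] := sq y; rewrite hv /= => /hZ [z hz].
  have [t ht] := sp z; exists (qX (a - e t)); rewrite hu /=.
  apply/eqP; rewrite -subr_eq0 -linearB; apply/eqP/hq; exists (- t).
  rewrite linearN hj hl /= ht hz.
  rewrite -[RHS]/(a - e t - a, 0 - b) sub0r.
  by rewrite -[LHS]/(- e t, - b) addrAC subrr sub0r.
Qed.

End ExactSequences.

(** * Projective dimension and the class [Pf] *)

Section Projective.
Variable A : pzRingType.
Implicit Types M N X Y Z W Q K P R V T U I S KX KY KZ : lmodType A.

Lemma proj_retract X P : retract X P -> projective_module P -> projective_module X.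
Proof.
move=> [a [b ab]] hP M N p f sp.
have [g hg] := hP M N p (f \o b) sp.
by exists (g \o a : {linear _ -> _}) => x /=; rewrite hg /= ab.
Qed.

Lemma proj_iso X Y : module_iso X Y -> projective_module X -> projective_module Y.
Proof. by move=> /iso_sym /retract_iso /proj_retract. Qed.

Lemma proj_free : projective_module A^o.
Proof.
move=> M N p f sp; have [m hm] := sp (f 1); have [g hg] := smul_ex m.
exists g => x; rewrite hg linearZ_LR hm -linearZ_LR.
by rewrite -[_ *: _]/(_ * _) mulr1.
Qed.

Lemma proj_dsum k (M : 'I_k -> lmodType A) :
  (forall i, projective_module (M i)) -> projective_module (dsum M).
Proof.
move=> hM X Y p f sp; have [h hh] := dsum_decomp M.
pose g i := cid (hM i X Y p (f \o h i) sp).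
have [c hc] := cotuple_ex (fun i => sval (g i)); exists c => x.
rewrite hc linear_sum [in RHS](hh x) linear_sum.
by apply: eq_bigr => i _; rewrite (svalP (g i)).
Qed.

Lemma proj_prod X Y :
  projective_module X -> projective_module Y -> projective_module (X * Y)%type.
Proof.
move=> hX hY M N p f sp; have [l hl] := inl_ex X Y; have [r hr] := inr_ex X Y.
have [g hg] := hX M N p (f \o l) sp; have [g' hg'] := hY M N p (f \o r) sp.
have [c hc] := copair_ex g g'; exists c => -[x y].
rewrite hc linearD hg hg' /= -linearD hl hr.
by rewrite -[(x, 0) + _]/(x + 0, 0 + y) addr0 add0r.
Qed.

Lemma proj_zero X : is_zero X -> projective_module X.
Proof.
move=> z M N p f _; exists \0 => x /=.
by rewrite (z x) !linear0.
Qed.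

Lemma proj_section Y Z (p : {linear Y -> Z}) : projective_module Z ->
  surjective p -> exists s : {linear Z -> Y}, forall z, p (s z) = z.
Proof. by move=> hZ sp; have [s hs] := hZ Y Z p idfun sp; exists s. Qed.

Lemma proj_split X Y Z (i : {linear X -> Y}) (p : {linear Y -> Z}) : ses i p ->
  projective_module Z -> (exists r : {linear Y -> X}, cancel i r) /\
    module_iso Y (X * Z)%type.
Proof.
move=> s hZ; have [_ sp _] := s; have [t ht] := proj_section hZ sp.
have [r hr] := ses_section s ht; split; first by exists r.
by have [] := ses_retraction s hr.
Qed.

Lemma free_cover M : finitely_generated M ->
  exists k K (i : {linear K -> powm A^o k}) (p : {linear powm A^o k -> M}), ses i p.
Proof.
move=> /fgP [k [p sp]]; have [K [i s]] := ker_ses sp.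
by exists k, K, i, p.
Qed.

Lemma proj_powm k : projective_module (powm A^o k).
Proof. by apply: proj_dsum => i; apply: proj_free. Qed.

Lemma fg_powm X k : finitely_generated X -> finitely_generated (powm X k).
Proof. by move=> h; apply: fg_dsum. Qed.

Lemma proj_fg_retract P : finitely_generated P -> projective_module P ->
  exists k, retract P (powm A^o k).
Proof.
move=> /fgP [k [p sp]] hP; have [s hs] := proj_section hP sp.
by exists k, s, p.
Qed.

Lemma proj_cover M : finitely_generated M ->
  exists K P (i : {linear K -> P}) (p : {linear P -> M}),
    [/\ ses i p, projective_module P & finitely_generated P].
Proof.
move=> /free_cover [k [K [i [p s]]]]; exists K, (powm A^o k), i, p.
by split=> //; [apply: proj_powm | apply/fg_powm/fg_free].
Qed.

Lemma schanuel K P K' P' M (i : {linear K -> P}) (p : {linear P -> M})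
  (i' : {linear K' -> P'}) (p' : {linear P' -> M}) : ses i p -> ses i' p' ->
  projective_module P -> projective_module P' ->
  module_iso (K * P')%type (K' * P)%type.
Proof.
move=> s s' hP hP'; have [Q [j [q [l [g [s1 s2 _ _ _]]]]]] := pullback2 s s'.
have [_ h1] := proj_split s1 hP'; have [_ h2] := proj_split s2 hP.
exact: iso_trans (iso_sym h1) h2.
Qed.

(** Some chain of syzygies reaches a projective after [d] steps; by Schanuel's lemma every chain
    then does ([pd_kernel]). The projectives may be of any size, as in [finite_pdim]. *)
Fixpoint pd_le d M : Prop := match d with
  | 0 => projective_module M
  | d'.+1 => exists K P (i : {linear K -> P}) (p : {linear P -> M}),
      [/\ ses i p, projective_module P & pd_le d' K]
  end.

Lemma pd_iso d M N : module_iso M N -> pd_le d M -> pd_le d N.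
Proof.
case: d => [|d]; first exact: proj_iso.
move=> h [K [P [i [p [s hP hK]]]]].
have [i' [p' s']] := ses_iso (iso_refl K) (iso_refl P) h s.
by exists K, P, i', p'.
Qed.

Lemma zero_ex : exists X : lmodType A, is_zero X.
Proof.
by exists (dsum (fun _ : 'I_0 => A^o : lmodType A)); apply: dsum0_zero.
Qed.

Lemma pd_S d M : pd_le d M -> pd_le d.+1 M.
Proof.
elim: d M => [|d IHd] M.
  move=> hM; have [X zX] := zero_ex; exists X, M, \0, idfun; split=> //.
    exact: ses_id0.
  exact: proj_zero.
by move=> [K [P [i [p [s hP hK]]]]]; exists K, P, i, p; split=> //; apply: IHd.
Qed.

Lemma pd_mono d d' M : (d <= d')%N -> pd_le d M -> pd_le d' M.
Proof.
by move=> /subnKC <-; elim: (d' - d)%N => [|k IHk]; rewrite ?addn0 ?addnS // => /IHk /pd_S.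
Qed.

Lemma pd_prod_proj d M P : pd_le d M -> projective_module P -> pd_le d (M * P)%type.
Proof.
case: d => [|d] hM hP; first exact: proj_prod.
have [K [R [i [p [s hR hK]]]]] := hM; have [X zX] := zero_ex.
have [j [q [s' _ _]]] := ses_prod2 s (ses_id0 P zX).
exists (K * X)%type, (R * P)%type, j, q; split=> //; first exact: proj_prod.
apply: pd_iso hK; apply/iso_sym; exists fst; apply/bijP; split=> [[x y] [x' y'] /= ->|x].
  by rewrite (zX y) (zX y').
by exists (x, 0).
Qed.

Lemma pd_cancel d M P : projective_module P -> pd_le d (M * P)%type -> pd_le d M.
Proof.
move=> hP; case: d => [|d]; first by apply: proj_retract; apply: retract_fst.
case=> K [R [i [p [s hR hK]]]]; have [ii sp hip] := s.
(* The kernel [Q] of [R -> P] is a summand of [R], hence projective, and it covers [M] with the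
   unchanged kernel [K]. *)
have sq : surjective (snd \o p : {linear R -> P}).
  by move=> y; have [r hr] := sp (0, y); exists r; rewrite /= hr.
have [Q [k sk]] := ker_ses sq; have [ik _ hk] := sk.
have [_ h] := proj_split sk hP.
have [|j hj] := @lin_lift A K R Q i k ik.
  by move=> x; apply: (proj1 (hk _)); rewrite /= (ses0 _ s).
exists K, Q, j, (fst \o p \o k : {linear Q -> M}); split=> //; last first.
  apply: proj_retract hR.
  exact: retract_trans (retract_fst _ _) (retract_iso (iso_sym h)).
split=> [x y e|m|y] /=; first by apply: ii; rewrite -!hj e.
  have [r hr] := sp (m, 0); have /hk [y hy] : (snd \o p) r = 0 by rewrite /= hr.
  by exists y; rewrite hy hr.
split=> [e|[x <-]]; last by rewrite hj (ses0 _ s).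
have /hip [x hx] : p (k y) = 0.
  by move: e (ses0 y sk) => /=; case: (p (k y)) => u v /= -> ->.
by exists x; apply: ik; rewrite hj.
Qed.

Lemma pd_kernel d M K P (i : {linear K -> P}) (p : {linear P -> M}) :
  ses i p -> projective_module P -> pd_le d.+1 M -> pd_le d K.
Proof.
move=> s hP [K' [P' [i' [p' [s' hP' hK']]]]].
have := schanuel s s' hP hP' => h.
by apply: (pd_cancel hP'); apply: pd_iso (iso_sym h) _; apply: pd_prod_proj.
Qed.

(** The product of covers of [M] and [N] has the product of their syzygies as its kernel; finite
    length keeps these finitely generated, so the induction applies to them. *)
Lemma pd_factor d M N : finitely_generated M -> finitely_generated N ->
  finlen A^o -> pd_le d (M * N)%type -> pd_le d M.
Proof.
move=> fM fN fA; elim: d M N fM fN => [|d IHd] M N fM fN.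
  by apply: proj_retract; apply: retract_fst.
have [K [P [i [p [s hP fP]]]]] := proj_cover fM.
have [K' [P' [i' [p' [s' hP' fP']]]]] := proj_cover fN.
have [j [q [s2 _ _]]] := ses_prod2 s s' => h.
exists K, P, i, p; split=> //; apply: (IHd K K').
- by have [ii _ _] := s; apply/finlen_fg/(finlen_inj ii)/fg_finlen.
- by have [ii _ _] := s'; apply/finlen_fg/(finlen_inj ii)/fg_finlen.
- by apply: pd_kernel s2 _ h; apply: proj_prod.
Qed.

Lemma horseshoe X Y Z KX P KZ R (i : {linear X -> Y}) (p : {linear Y -> Z})
  (iX : {linear KX -> P}) (pX : {linear P -> X})
  (iZ : {linear KZ -> R}) (pZ : {linear R -> Z}) :
  ses i p -> ses iX pX -> ses iZ pZ -> projective_module R ->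
  exists KY (iY : {linear KY -> (P * R)%type}) (pY : {linear (P * R)%type -> Y})
    (u : {linear KX -> KY}) (v : {linear KY -> KZ}), ses iY pY /\ ses u v.
Proof.
move=> s sX sZ hR; have [ii sp hip] := s; have [iiX spX hX] := sX.
have [iiZ spZ hZ] := sZ; have [t ht] := hR _ _ p pZ sp.
have [q hq] := copair_ex (i \o pX : {linear _ -> _}) t.
have pq x : p (q x) = pZ x.2 by rewrite hq linearD ht /= (ses0 _ s) add0r.
have sq : surjective q.
  move=> y; have [r hr] := spZ (p y); have /hip [x hx] : p (y - t r) = 0.
    by rewrite linearB ht hr subrr.
  have [a ha] := spX x; exists (a, r); rewrite hq /= ha hx subrK //.
have [KY [iY sY]] := ker_ses sq; have [iiY _ hY] := sY.
have [||u hu] := @lin_lift A KX (P * R)%type KY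
   (sval (cid (inl_ex P R)) \o iX : {linear _ -> _}) iY => //.
  move=> x; apply: (proj1 (hY _)); rewrite hq /=; case: cid => w /= ->.
  by rewrite /= !linear0 (ses0 _ sX) linear0 addr0.
have {}hu x : iY (u x) = (iX x, 0) by rewrite hu /=; case: cid => w /= ->.
have [||v hv] := @lin_lift A KY R KZ (snd \o iY : {linear _ -> _}) iZ => //.
  move=> y /=; apply: (proj1 (hZ _)); rewrite -pq (_ : q _ = 0) ?linear0 //.
  exact: ses0 sY.
exists KY, iY, q, u, v; split=> //; split=> [x y e|z|y].
- by apply: iiX; have := hu x; rewrite e hu => -[].
- have /hip [x hx] : p (t (iZ z)) = 0 by rewrite ht (ses0 _ sZ).
  have [a ha] := spX x; have /hY [y hy] : q (- a, iZ z) = 0.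
    by rewrite hq /= !linearN ha hx addNr.
  by exists y; apply: iiZ; rewrite hv /= hy.
- split=> [vy|[x <-]]; last by apply: iiZ; rewrite hv /= hu linear0.
  have e2 : (iY y).2 = 0 by rewrite -[LHS]hv vy linear0.
  have e1 : i (pX (iY y).1) = 0.
    by have := ses0 y sY; rewrite hq /= e2 linear0 addr0.
  have /hX [x hx] := inj0 ii e1.
  by exists x; apply: iiY; rewrite hu hx; case: (iY y) e2 => a b /= ->.
Qed.

Hypothesis fA : finlen A^o.

Lemma fg_sub X Y (i : {linear X -> Y}) : injective i ->
  finitely_generated Y -> finitely_generated X.
Proof. by move=> ii fY; apply/finlen_fg/(finlen_inj ii)/fg_finlen. Qed.

Lemma pd_ses_mid d X Y Z (i : {linear X -> Y}) (p : {linear Y -> Z}) :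
  finitely_generated X -> finitely_generated Z -> ses i p ->
  pd_le d X -> pd_le d Z -> pd_le d Y.
Proof.
elim: d X Y Z i p => [|d IHd] X Y Z i p fX fZ s.
  move=> hX hZ; have [_ h] := proj_split s hZ.
  by apply: proj_iso (iso_sym h) _; apply: proj_prod.
have [KX [P [iX [pX [sX hP fP]]]]] := proj_cover fX.
have [KZ [R [iZ [pZ [sZ hR fR]]]]] := proj_cover fZ.
move=> /(pd_kernel sX hP) hX /(pd_kernel sZ hR) hZ.
have [KY [iY [pY [u [v [sY uv]]]]]] := horseshoe s sX sZ hR.
have [iiX _ _] := sX; have [iiZ _ _] := sZ.
exists KY, (P * R)%type, iY, pY; split=> //; first exact: proj_prod.
by apply: (IHd _ _ _ u v) => //; [exact: fg_sub iiX fP|exact: fg_sub iiZ fR].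
Qed.

Lemma pd_ses_left d X Y Z (i : {linear X -> Y}) (p : {linear Y -> Z}) :
  finitely_generated X -> finitely_generated Z -> ses i p ->
  pd_le d Y -> pd_le d Z -> pd_le d X.
Proof.
elim: d X Y Z i p => [|d IHd] X Y Z i p fX fZ s.
  move=> hY hZ; have [_ h] := proj_split s hZ.
  by apply: proj_retract hY; apply: retract_trans (retract_iso (iso_sym h)); apply: retract_fst.
have [KX [P [iX [pX [sX hP fP]]]]] := proj_cover fX.
have [KZ [R [iZ [pZ [sZ hR fR]]]]] := proj_cover fZ.
have [KY [iY [pY [u [v [sY uv]]]]]] := horseshoe s sX sZ hR.
move=> /(pd_kernel sY (proj_prod hP hR)) hY /(pd_kernel sZ hR) hZ.
have [iiX _ _] := sX; have [iiZ _ _] := sZ.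
exists KX, P, iX, pX; split=> //.
by apply: (IHd _ _ _ u v) => //; [exact: fg_sub iiX fP|exact: fg_sub iiZ fR].
Qed.

Lemma pd_ses_right d X Y Z (i : {linear X -> Y}) (p : {linear Y -> Z}) :
  finitely_generated X -> finitely_generated Z -> ses i p ->
  pd_le d X -> pd_le d Y -> pd_le d.+1 Z.
Proof.
elim: d X Y Z i p => [|d IHd] X Y Z i p fX fZ s.
  by move=> hX hY; exists X, Y, i, p.
have [KX [P [iX [pX [sX hP fP]]]]] := proj_cover fX.
have [KZ [R [iZ [pZ [sZ hR fR]]]]] := proj_cover fZ.
have [KY [iY [pY [u [v [sY uv]]]]]] := horseshoe s sX sZ hR.
move=> /(pd_kernel sX hP) hX /(pd_kernel sY (proj_prod hP hR)) hY.
have [iiX _ _] := sX; have [iiZ _ _] := sZ.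
exists KZ, R, iZ, pZ; split=> //.
by apply: (IHd _ _ _ u v) => //; [exact: fg_sub iiX fP|exact: fg_sub iiZ fR].
Qed.

(** Working form of [Pfin], identified with it by [PfinP]; over a ring of finite length two terms of
    a short exact sequence in [Pf] force the third. *)
Definition Pf M := finitely_generated M /\ exists d, pd_le d M.

Lemma Pf_mid X Y Z (i : {linear X -> Y}) (p : {linear Y -> Z}) :
  ses i p -> Pf X -> Pf Z -> Pf Y.
Proof.
move=> s [fX [a ha]] [fZ [b hb]]; split; first exact: fg_ext s fX fZ.
exists (maxn a b); apply: pd_ses_mid s _ _ => //.
  exact: pd_mono (leq_maxl _ _) ha.
exact: pd_mono (leq_maxr _ _) hb.
Qed.

Lemma Pf_left X Y Z (i : {linear X -> Y}) (p : {linear Y -> Z}) :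
  ses i p -> Pf Y -> Pf Z -> Pf X.
Proof.
move=> s [fY [a ha]] [fZ [b hb]]; have [ii _ _] := s.
have fX := fg_sub ii fY; split=> //.
exists (maxn a b); apply: pd_ses_left s _ _ => //.
  exact: pd_mono (leq_maxl _ _) ha.
exact: pd_mono (leq_maxr _ _) hb.
Qed.

Lemma Pf_right X Y Z (i : {linear X -> Y}) (p : {linear Y -> Z}) :
  ses i p -> Pf X -> Pf Y -> Pf Z.
Proof.
move=> s [fX [a ha]] [fY [b hb]]; have [_ sp _] := s.
have fZ := fg_surj sp fY; split=> //.
exists (maxn a b).+1; apply: pd_ses_right s _ _ => //.
  exact: pd_mono (leq_maxl _ _) ha.
exact: pd_mono (leq_maxr _ _) hb.
Qed.

Lemma Pf_iso X Y : module_iso X Y -> Pf X -> Pf Y.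
Proof. by move=> h [f [d hd]]; split; [exact: fg_iso f|exists d; exact: pd_iso hd]. Qed.

Lemma pd_retract d X M : finitely_generated M -> retract X M -> pd_le d M -> pd_le d X.
Proof.
move=> fM r; have [a [b ab]] := r; have [Z h] := retract_prod ab.
move=> /(pd_iso h); apply: pd_factor => //; first exact: retract_fg r fM.
have := fg_iso h fM; apply: (fg_surj (p := snd)) => z; by exists (0, z).
Qed.

Lemma Pf_retract X M : retract X M -> Pf M -> Pf X.
Proof.
move=> r [f [d h]]; split; first exact: retract_fg r f.
by exists d; apply: pd_retract r h.
Qed.

Lemma Pf_prod X Y : Pf X -> Pf Y -> Pf (X * Y)%type.
Proof. by have [l hl] := inl_ex X Y; apply: Pf_mid (ses_prod hl). Qed.

Lemma Pf_proj P : finitely_generated P -> projective_module P -> Pf P.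
Proof. by move=> f h; split=> //; exists 0%N. Qed.

Lemma Pf_zero X : is_zero X -> Pf X.
Proof. by move=> z; apply: Pf_proj; [exact: fg_zero|exact: proj_zero]. Qed.

Lemma Pf_dsum k (M : 'I_k -> lmodType A) : (forall i, Pf (M i)) -> Pf (dsum M).
Proof.
elim: k M => [|k IHk] M hM; first by apply/Pf_zero/dsum0_zero.
by have [i [p s]] := dsumS_ses M; apply: Pf_mid s _ _ => //; apply: IHk.
Qed.

Lemma Pf_free : Pf A^o.
Proof. exact: Pf_proj (fg_free A) proj_free. Qed.

End Projective.

(** * Comparison with projective resolutions *)

Section Resolutions.
Variable A : pzRingType.
Implicit Types M N X Y Z W Q K P R V T U I S KX KY KZ : lmodType A.

Lemma res_cons K P M (i : {linear K -> P}) (p : {linear P -> M}) d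
    (R : proj_resolution K) : ses i p -> projective_module P ->
  (forall j, (d < j)%N -> is_zero (pr_obj R j)) ->
  exists R' : proj_resolution M, forall j, (d.+1 < j)%N -> is_zero (pr_obj R' j).
Proof.
move=> s hP hR; have [ii sp hip] := s.
pose ob j := if j is l.+1 then pr_obj R l else P.
pose df j : {linear ob j.+1 -> ob j} :=
  match j with 0 => i \o pr_aug R | l.+1 => pr_diff R l end.
have hpr j : projective_module (ob j) by case: j => //= l; apply: pr_proj.
have e0 x : p x = 0 <-> exists y, df 0%N y = x.
  rewrite hip; split=> [[k <-]|[y <-]]; last by exists (pr_aug R y).
  by have [y <-] := pr_aug_surj R k; exists y.
have eS j x : df j x = 0 <-> exists y, df j.+1 y = x.
  case: j x => [|j] x /=; last exact: pr_exact.
  rewrite -pr_exact0; split=> [/(inj0 ii)|->]; by rewrite ?linear0.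
by exists (ProjResolution hpr sp e0 eS) => -[|j] // /hR.
Qed.

Lemma pd_finite d M : pd_le d M ->
  exists R : proj_resolution M, forall j, (d < j)%N -> is_zero (pr_obj R j).
Proof.
elim: d M => [|d IHd] M; last first.
  by move=> [K [P [i [p [s hP /IHd [R hR]]]]]]; apply: res_cons s hP hR.
move=> hM; have [X zX] := zero_ex A.
pose ob (j : nat) := if j is l.+1 then X else M.
pose df j : {linear ob j.+1 -> ob j} := \0.
have hpr j : projective_module (ob j) by case: j => //= l; apply: proj_zero.
have sp : surjective (idfun : {linear ob 0%N -> M}) by move=> x; exists x.
have e0 x : (idfun : {linear ob 0%N -> M}) x = 0 <-> exists y, df 0%N y = x.
  by split=> [/= ->|[y <-]] //; exists 0.
have eS j x : df j x = 0 <-> exists y, df j.+1 y = x.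
  split=> // _; exists 0; apply/esym/zX.
by exists (ProjResolution hpr sp e0 eS) => -[|j].
Qed.

Lemma res_tail M (R : proj_resolution M) K (i : {linear K -> pr_obj R 0})  :
  ses i (pr_aug R) -> exists R' : proj_resolution K,
    forall j, pr_obj R' j = pr_obj R j.+1.
Proof.
move=> s; have [ii sp hip] := s.
have [|a ha] := @lin_lift A _ _ K (pr_diff R 0) i ii.
  by move=> x; apply: (proj1 (hip _)); apply/pr_exact0; exists x.
have sa : surjective a.
  move=> k; have := ses0 k s => /pr_exact0 [y hy]; exists y.
  by apply: ii; rewrite ha.
have e0 x : a x = 0 <-> exists y, pr_diff R 1 y = x.
  rewrite -pr_exact -ha; split=> [->|/(inj0 ii) //]; exact: linear0.
exists (@ProjResolution A K (fun j => pr_obj R j.+1) (fun j => pr_diff R j.+1)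
  a (fun j => @pr_proj _ _ R j.+1) sa e0 (fun j => @pr_exact _ _ R j.+1)); by [].
Qed.

Lemma finite_pdimP M : finite_pdim M <-> exists d, pd_le d M.
Proof.
split=> [[d [R hR]]|[d /pd_finite [R hR]]]; last by exists d, R.
exists d; elim: d M R hR => [|d IHd] M R hR.
  apply: proj_iso (@pr_proj _ _ R 0%N); exists (pr_aug R); apply/bijP.
  split; last exact: pr_aug_surj.
  apply: lin_inj => x /pr_exact0 [y <-].
  by rewrite (hR 1%N isT y) linear0.
have [K [i s]] := ker_ses (@pr_aug_surj _ _ R).
have [R' eR'] := res_tail s.
exists K, (pr_obj R 0), i, (pr_aug R); split=> //; first exact: (@pr_proj _ _ R 0%N).
by apply: (IHd _ R') => j dj; rewrite eR'; apply: hR.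
Qed.

Lemma PfinP M : Pfin M <-> Pf M.
Proof. by split=> -[f /finite_pdimP h]; split. Qed.

End Resolutions.

(** * Vanishing of the first Ext group *)

Section Ext1.
Variable A : pzRingType.
Implicit Types M N X Y Z W Q K P R V T U I S C : lmodType A.

(** Ext^1([M], [N]) = 0 in Yoneda form: no resolution is chosen, and pushouts and pullbacks act on
    it directly. *)
Definition E1 M N : Prop :=
  forall X Y (i : {linear X -> Y}) (p : {linear Y -> M}), ses i p ->
    forall f : {linear X -> N}, exists g : {linear Y -> N}, forall x, g (i x) = f x.

Lemma E1_split M N :
  (forall Y (i : {linear N -> Y}) (p : {linear Y -> M}), ses i p ->
     exists r : {linear Y -> N}, cancel i r) -> E1 M N.
Proof.
move=> h X Y i p s f; have [Q [j [q [g [sj gi _ _]]]]] := pushout_ses f s.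
have [r rj] := h _ _ _ sj; exists (r \o g : {linear _ -> _}) => x /=.
by rewrite gi rj.
Qed.

(** One projective presentation suffices: [Y] is a quotient of [X * P] by a copy of [K], so a map on
    [Y] is glued from [f] on [X] and an extension of [f \o v] to [P]. *)
Lemma E1_cover M N K P (i : {linear K -> P}) (p : {linear P -> M}) :
  ses i p -> projective_module P ->
  (forall f : {linear K -> N}, exists g : {linear P -> N}, forall x, g (i x) = f x) ->
  E1 M N.
Proof.
move=> s hP h X Y j q s' f; have [ij sq hq] := s'.
have [u hu] := hP _ _ q p sq.
have [|v hv] := @lin_lift A K Y X (u \o i : {linear _ -> _}) j ij.
  by move=> k; apply: (proj1 (hq _)); rewrite /= hu (ses0 _ s).
have [g hg] := h (f \o v); have [c hc] := copair_ex j u.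
have [d hd] := copair_ex f g.
have sc : surjective c.
  move=> y; have [_ sp _] := s; have [x hx] := sp (q y).
  have /hq [z hz] : q (y - u x) = 0 by rewrite linearB hu hx subrr.
  by exists (z, x); rewrite hc /= hz subrK.
have [|e he] := @lin_fact A _ N Y c d sc.
  move=> [x y]; rewrite hc hd /= => e0.
  have : p y = 0.
    by have := congr1 q e0; rewrite linearD linear0 (ses0 _ s') add0r hu.
  have [_ _ hp] := s; move=> /hp [k hk].
  have : x = - v k.
    apply: ij; rewrite linearN hv /= hk; apply/eqP.
    by rewrite -addr_eq0 e0.
  by move=> ->; rewrite linearN -hk hg addNr.
by exists e => x; have := he (x, 0); rewrite hc hd /= !linear0 !addr0.
Qed.

Lemma E1_proj M N : projective_module M -> E1 M N.
Proof.
move=> hM; apply: E1_split => Y i p s.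
by have [h _] := proj_split s hM.
Qed.

Lemma E1_prod_l M M' N : E1 (M * M')%type N -> E1 M N.
Proof.
move=> h X Y i p s f; have [Z zZ] := zero_ex A.
have [j [q [s' hj _]]] := ses_prod2 s (ses_id0 M' zZ).
have [g hg] := h _ _ _ _ s' (f \o fst : {linear (X * Z)%type -> N}).
have [l hl] := inl_ex Y M'; exists (g \o l : {linear _ -> _}) => x /=.
by have := hg (x, 0); rewrite hj hl /=.
Qed.

Lemma E1_iso_l M M' N : module_iso M M' -> E1 M N -> E1 M' N.
Proof.
move=> /isoP [f [f' [fK f'K]]] h X Y i p [ii sp hp].
apply: (h _ _ i (f' \o p : {linear _ -> _})); split=> // [z|y] /=.
  by have [y hy] := sp (f z); exists y; rewrite hy.
by rewrite -hp; split=> [/(inj0 (can_inj f'K))|->] //; rewrite linear0.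
Qed.

Lemma E1_retract_l M M' N : retract M' M -> E1 M N -> E1 M' N.
Proof.
move=> [a [b ab]] h; have [Z /E1_iso_l e] := retract_prod ab.
exact: E1_prod_l (e _ h).
Qed.

Lemma E1_prod_proj M M' N : finitely_generated M -> projective_module M' ->
  E1 M N -> E1 (M * M')%type N.
Proof.
move=> fM hM' h; have [K [P [i [p [s hP _]]]]] := proj_cover fM.
have [Z zZ] := zero_ex A; have [j [q [s' hj _]]] := ses_prod2 s (ses_id0 M' zZ).
apply: (E1_cover s'); first exact: proj_prod.
move=> f; have [l hl] := inl_ex K Z.
have [g hg] := h _ _ _ _ s (f \o l); exists (g \o fst : {linear _ -> _}) => -[x z].
by rewrite hj /= hg /= hl (zZ z).
Qed.

Lemma E1_retract_r M N N' : retract N' N -> E1 M N -> E1 M N'.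
Proof.
move=> [a [b ab]] h X Y i p s f; have [g hg] := h _ _ _ _ s (a \o f).
by exists (b \o g : {linear _ -> _}) => x; rewrite /= hg /= ab.
Qed.

Lemma E1_dsum_r M k (N : 'I_k -> lmodType A) :
  (forall i, E1 M (N i)) -> E1 M (dsum N).
Proof.
move=> h X Y i p s f.
pose u j := cid (h j _ _ _ _ s (sval (cid (proj_ex N j)) \o f)).
have [g hg] := tuple_ex (fun j => sval (u j)); exists g => x.
apply: dsumP => j; rewrite hg (svalP (u j)) /=.
by case: cid => /= w ->.
Qed.

Lemma E1_ext_r M N N' N'' (j : {linear N' -> N}) (q : {linear N -> N''}) :
  finitely_generated M -> ses j q -> E1 M N' -> E1 M N'' -> E1 M N.
Proof.
move=> fM sN h' h''; have [K [P [i [p [s hP _]]]]] := proj_cover fM.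
apply: (E1_cover s hP) => f; have [ij sq hq] := sN.
have [g hg] := h'' _ _ _ _ s (q \o f); have [u hu] := hP _ _ q g sq.
have [|v hv] := @lin_lift A K N N' (f \+ \- (u \o i)) j ij.
  by move=> x; apply: (proj1 (hq _)); rewrite /= linearB hu hg subrr.
have [w hw] := h' _ _ _ _ s v; exists (u \+ (j \o w)) => x /=.
by rewrite hw hv /= addrC subrK.
Qed.

Lemma E1_lift Z N I M (i : {linear N -> I}) (p : {linear I -> M}) (f : {linear Z -> M}) :
  E1 Z N -> ses i p -> exists g : {linear Z -> I}, forall z, p (g z) = f z.
Proof.
move=> h s; have [Q [j [q [g [sj gj pg]]]]] := pullback_ses f s.
have [r rj] := h _ _ _ _ sj idfun.
have [t ht _] := ses_retraction sj rj.
by exists (g \o t : {linear _ -> _}) => z /=; rewrite pg ht.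
Qed.

Lemma E1_ses_split X Y Z (i : {linear X -> Y}) (p : {linear Y -> Z}) :
  ses i p -> E1 Z X -> retract X Y.
Proof. by move=> s /(_ _ _ _ _ s idfun) [r hr]; exists i, r. Qed.

(** * Additive closures and coresolutions *)

Definition pcomp X U T (p : {linear X -> U} * {linear U -> X})
    (q : {linear U -> T} * {linear T -> U}) : {linear X -> T} * {linear T -> X} :=
  ((q.1 \o p.1 : {linear _ -> _}), (p.2 \o q.2 : {linear _ -> _})).

(** Membership in add([T]) becomes a decomposition of the identity of [X] into maps through [T]; an
    additive functor carries it over without any reference to powers of [T]. *)
Lemma in_addP T X : in_add T X <->
  exists s : seq ({linear X -> T} * {linear T -> X}), forall x, x = \sum_(p <- s) p.2 (p.1 x).
Proof.
split=> [[k /direct_summandP [a [b ab]]]|[s hs]].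
  have [h hh] := dsum_decomp (fun _ : 'I_k => T).
  pose q i := sval (cid (proj_ex (fun _ : 'I_k => T) i)).
  exists [seq pcomp (a, b) (q i, h i) | i <- enum 'I_k] => x.
  rewrite big_map big_enum /= -[LHS]ab {1}[a x]hh linear_sum.
  by apply: eq_bigr => i _ /=; rewrite /q; case: cid => /= w ->.
pose d := (\0 : {linear X -> T}, \0 : {linear T -> X}).
have [a ha] := tuple_ex (fun i : 'I_(size s) => (nth d s i).1).
have [b hb] := cotuple_ex (fun i : 'I_(size s) => (nth d s i).2).
exists (size s); apply/direct_summandP; exists a, b => x.
rewrite hb [in RHS](hs x) (big_nth d) big_mkord.
by apply: eq_bigr => i _; rewrite ha.
Qed.

Lemma add_self T : in_add T T.
Proof.
apply/in_addP; exists [:: ((idfun : {linear T -> T}), (idfun : {linear T -> T}))] => x.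
by rewrite big_seq1.
Qed.

Lemma add_trans T U X : in_add T U -> in_add U X -> in_add T X.
Proof.
move=> /in_addP [s hs] /in_addP [t ht]; apply/in_addP.
exists [seq pcomp p q | p <- t, q <- s] => x.
rewrite big_allpairs_dep {1}[x]ht; apply: eq_bigr => p _.
rewrite [in LHS](hs (p.1 x)) linear_sum; exact: eq_bigr.
Qed.

Lemma add_retract T X : retract X T -> in_add T X.
Proof.
move=> [a [b ab]]; apply/in_addP; exists [:: (a, b)] => x.
by rewrite big_seq1 /= ab.
Qed.

Lemma add_prod T X Y : in_add T X -> in_add T Y -> in_add T (X * Y)%type.
Proof.
move=> /in_addP [s hs] /in_addP [t ht]; apply/in_addP.
have [l hl] := inl_ex X Y; have [r hr] := inr_ex X Y.
pose f : {linear (X * Y)%type -> X} := fst; pose g : {linear (X * Y)%type -> Y} := snd.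
exists ([seq pcomp (f, l) p | p <- s] ++ [seq pcomp (g, r) p | p <- t]) => -[x y].
rewrite big_cat !big_map /= -!linear_sum -hs -ht hl hr.
by rewrite -[RHS]/(x + 0, 0 + y) addr0 add0r.
Qed.

Lemma add_zero T X : is_zero X -> in_add T X.
Proof. by move=> z; apply/in_addP; exists [::] => x; rewrite big_nil. Qed.

Lemma add_dsum T k (M : 'I_k -> lmodType A) :
  (forall i, in_add T (M i)) -> in_add T (dsum M).
Proof.
move=> h; have [c hc] := dsum_decomp M; apply/in_addP.
pose u i := cid (proj1 (in_addP _ _) (h i)); pose q i := sval (cid (proj_ex M i)).
exists (flatten [seq [seq pcomp (q i, c i) p | p <- sval (u i)] | i <- enum 'I_k]) => x.
rewrite big_flatten big_map big_enum /= {1}[x]hc; apply: eq_bigr => i _.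
rewrite big_map /= -linear_sum; congr (c i _); rewrite {1}(svalP (u i) (x i)).
by apply: eq_bigr => p _; rewrite /q; case: cid => /= w ->.
Qed.

Lemma add_powm T k : in_add T (powm T k).
Proof. by apply: add_dsum => i; apply: add_self. Qed.

Lemma add_powmP T X : in_add T X -> exists k, retract X (powm T k).
Proof. by case=> k /direct_summandP h; exists k. Qed.

Lemma E1_add M T U : in_add T U -> E1 M T -> E1 M U.
Proof.
by move=> /add_powmP [k r] h; apply: E1_retract_r r _; apply: E1_dsum_r.
Qed.

Lemma proj_add T U : projective_module T -> in_add T U -> projective_module U.
Proof.
by move=> h /add_powmP [k r]; apply: proj_retract r _; apply: proj_dsum.
Qed.

Lemma fg_proj_add P : finitely_generated P -> projective_module P -> in_add A^o P.
Proof.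
move=> f h; have [k r] := proj_fg_retract f h.
exact: add_trans (add_powm _ k) (add_retract r).
Qed.

(** Coresolutions cut into short exact sequences, the form suited to induction; [add_coresolutionP]
    compares it with the exact complex. *)
Fixpoint cores T s X : Prop := match s with
  | 0 => in_add T X
  | s'.+1 => exists U C (i : {linear X -> U}) (p : {linear U -> C}),
      [/\ ses i p, in_add T U & cores T s' C]
  end.

Lemma cores_S T s X : cores T s X -> cores T s.+1 X.
Proof.
elim: s X => [|s IHs] X.
  move=> h; have [Z zZ] := zero_ex A; exists X, Z, idfun, \0; split=> //.
    exact: ses_id.
  exact: add_zero.
by move=> [U [C [i [p [sq hU /IHs hC]]]]]; exists U, C, i, p.
Qed.

Lemma cores_mono T s s' X : (s <= s')%N -> cores T s X -> cores T s' X.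
Proof.
by move=> /subnKC <-; elim: (s' - s)%N => [|k IHk]; rewrite ?addn0 ?addnS // => /IHk /cores_S.
Qed.

Lemma cores_iso T s X Y : module_iso X Y -> cores T s X -> cores T s Y.
Proof.
case: s => [|s] h.
  by move=> hX; apply: add_trans hX _; apply/add_retract/retract_iso/iso_sym.
move=> [U [C [i [p [sq hU hC]]]]].
have [i' [p' s']] := ses_iso h (iso_refl U) (iso_refl C) sq.
by exists U, C, i', p'.
Qed.

Lemma cores_seq T s X : cores T s X ->
  exists (Xs : nat -> lmodType A) (d : forall i, {linear Xs i -> Xs i.+1})
         (i0 : {linear X -> Xs 0%N}),
    [/\ forall i, (i <= s)%N -> in_add T (Xs i),
        forall i, (s < i)%N -> is_zero (Xs i),
        injective i0,
        forall x, d 0%N x = 0 <-> exists y, i0 y = x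
      & forall i x, d i.+1 x = 0 <-> exists y, d i y = x].
Proof.
elim: s X => [|s IHs] X.
  move=> hX; have [Z zZ] := zero_ex A.
  pose ob (j : nat) := if j is l.+1 then Z else X.
  pose df j : {linear ob j -> ob j.+1} := \0.
  exists ob, df, (idfun : {linear X -> ob 0%N}); split=> //.
  - by case.
  - by case.
  - by move=> x; split=> // _; exists x.
  - by move=> j x; split=> // _; exists 0; apply: esym; apply: zZ.
move=> [U [C [i [p [sq hU /IHs]]]]] [Xs [d [i0 [h1 h2 h3 h4 h5]]]].
have [ii sp hip] := sq.
pose ob (j : nat) := if j is l.+1 then Xs l else U.
pose df j : {linear ob j -> ob j.+1} :=
  match j with 0 => i0 \o p | l.+1 => d l end.
exists ob, df, i; split=> // [[|j] // /h1 //|[|j] // /h2 //|x|[|j] x] /=.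
- by rewrite -hip; split=> [/(inj0 h3)|->] //; rewrite linear0.
- rewrite h4; split=> [[y <-]|[y <-]]; last by exists (p y).
  by have [z <-] := sp y; exists z.
- exact: h5.
Qed.

Lemma seq_cores T s X (Xs : nat -> lmodType A) (d : forall i, {linear Xs i -> Xs i.+1})
    (i0 : {linear X -> Xs 0%N}) :
  (forall i, (i <= s)%N -> in_add T (Xs i)) ->
  (forall i, (s < i)%N -> is_zero (Xs i)) ->
  injective i0 ->
  (forall x, d 0%N x = 0 <-> exists y, i0 y = x) ->
  (forall i x, d i.+1 x = 0 <-> exists y, d i y = x) -> cores T s X.
Proof.
elim: s X Xs d i0 => [|s IHs] X Xs d i0 h1 h2 h3 h4 h5.
  have si : surjective i0 by move=> x; apply/h4; apply: (h2 1%N).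
  have e : module_iso X (Xs 0%N) by exists i0; apply/bijP.
  by apply: add_trans (h1 0%N isT) _; apply/add_retract/retract_iso.
have [C [p sp]] := coker_ses h3; have [_ spp hp] := sp.
exists (Xs 0%N), C, i0, p; split=> //; first exact: h1.
have [|e he] := @lin_fact A _ (Xs 1%N) C p (d 0%N) spp.
  by move=> x /hp [y <-]; apply/h4; exists y.
apply: (IHs C (fun j => Xs j.+1) (fun j => d j.+1) e) => //.
- by move=> j js; apply: h1.
- by move=> j js; apply: h2.
- apply: lin_inj => c; have [x <-] := spp c; rewrite he => /h4 [y <-].
  exact: ses0 sp.
- move=> x; rewrite h5; split=> [[y <-]|[c <-]]; first by exists (p y).
  by have [y <-] := spp c; exists y.
Qed.

Lemma add_coresolutionP T : add_coresolution T <-> exists s, cores T s A^o.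
Proof.
split=> [[s [Xs [d [i0 [h1 h2 h3 h4 h5]]]]]|[s /cores_seq h]]; last by exists s.
by exists s; apply: seq_cores h1 h2 h3 h4 h5.
Qed.

Hypothesis fA : finlen A^o.

Lemma Pf_add T U : Pf T -> in_add T U -> Pf U.
Proof.
by move=> h /add_powmP [k r]; apply: Pf_retract r _ => //; apply: Pf_dsum.
Qed.

Lemma cores_Pf T s X : Pf T -> cores T s X -> Pf X.
Proof.
move=> hT; elim: s X => [|s IHs] X; first exact: Pf_add.
by move=> [U [C [i [p [sq hU /IHs hC]]]]]; apply: Pf_left sq _ hC => //; exact: Pf_add hU.
Qed.

Lemma Pf_syz M K P (i : {linear K -> P}) (p : {linear P -> M}) :
  ses i p -> projective_module P -> finitely_generated P -> Pf M -> Pf K.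
Proof. by move=> s hP fP hM; apply: Pf_left s _ hM => //; apply: Pf_proj. Qed.

(** [Ext_succ_vanishes] quantifies over all projective resolutions, whose terms, and hence syzygies,
    need not be finitely generated. Up to projective summands these syzygies still belong to [Pf],
    and that suffices to shift dimensions. *)
Definition stably_Pf M := exists X P Q, [/\ Pf X, projective_module P,
  projective_module Q & module_iso (M * P)%type (X * Q)%type].

Lemma Ext_E1 T : (forall M, Pf M -> E1 M T) ->
  forall i M, stably_Pf M -> Ext_succ_vanishes i M T.
Proof.
move=> hT i; elim: i => [|i IHi] M sM R f hf.
  have [X [P [Q [hX hP hQ e]]]] := sM.
  have h : E1 M T.
    apply: E1_prod_l; apply: E1_iso_l (iso_sym e) _.
    by apply: E1_prod_proj => //; [case: hX | apply: hT].
  have [I [p [j [sp ij jp]]]] := im_ex (pr_diff R 0).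
  have [|g hg] := @lin_fact A _ T I p f sp.
    move=> x px; have : pr_diff R 0 x = 0 by rewrite -jp px linear0.
    by move=> /pr_exact [y <-].
  have s : ses j (pr_aug R).
    split=> //; first exact: pr_aug_surj.
    move=> x; rewrite pr_exact0; split=> [[y <-]|[y <-]]; first by exists (p y); rewrite jp.
    by have [z <-] := sp y; exists z; rewrite jp.
  have [u hu] := h _ _ _ _ s g; exists u => x.
  by rewrite -jp hu hg.
have [K [j s]] := ker_ses (@pr_aug_surj _ _ R).
have [ij _ hj] := s.
have [|a ha] := @lin_lift A _ _ K (pr_diff R 0) j ij.
  by move=> x; apply: (proj1 (hj _)); apply/pr_exact0; exists x.
have sa : surjective a.
  move=> k; have := ses0 k s => /pr_exact0 [y hy]; exists y.
  by apply: ij; rewrite ha.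
have e0 x : a x = 0 <-> exists y, pr_diff R 1 y = x.
  rewrite -pr_exact -ha; split=> [->|/(inj0 ij) //]; exact: linear0.
pose R' := @ProjResolution A K (fun j => pr_obj R j.+1) (fun j => pr_diff R j.+1)
  a (fun j => @pr_proj _ _ R j.+1) sa e0 (fun j => @pr_exact _ _ R j.+1).
apply: (IHi K _ R' f hf); have [X [P [Q [hX hP hQ e]]]] := sM.
have [L [B [v [q [sL hB fB]]]]] := proj_cover hX.1.
have [Z zZ] := zero_ex A.
have [v' [q' [sL' _ _]]] := ses_prod2 sL (ses_id0 Q zZ).
have [u' [p' [sK' _ _]]] := ses_prod2 s (ses_id0 P zZ).
have [w [r s3]] := ses_iso (iso_refl _) (iso_refl _) e sK'.
have h0 := @pr_proj _ _ R 0%N.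
have := schanuel s3 sL' (proj_prod h0 hP) (proj_prod hB hQ).
have kz (N : lmodType A) : module_iso (N * Z)%type N.
  exists fst; apply/bijP; split=> [[x y] [x' y'] /= ->|x]; last by exists (x, 0).
  by rewrite (zZ y) (zZ y').
have pk (N N' B' : lmodType A) : module_iso N N' -> module_iso (N * B')%type (N' * B')%type.
  move=> /isoP [g [g' [gK g'K]]]; have [k hk] := prod_map_ex g (idfun : {linear B' -> B'}).
  have [k' hk'] := prod_map_ex g' (idfun : {linear B' -> B'}).
  by apply/isoP; exists k, k'; split=> -[x y]; rewrite hk hk' /= ?gK ?g'K.
move=> e3; exists L, (B * Q)%type, (pr_obj R 0 * P)%type; split.
- exact: Pf_syz sL hB fB hX.
- exact: proj_prod.
- exact: proj_prod.
apply: iso_trans (pk _ _ _ (iso_sym (kz K))) _.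
exact: iso_trans e3 (pk _ _ _ (kz L)).
Qed.

Lemma Pf_stably M : Pf M -> stably_Pf M.
Proof.
move=> h; have [Z zZ] := zero_ex A; exists M, Z, Z.
by split=> //; [exact: proj_zero|exact: proj_zero|exact: iso_refl].
Qed.

Lemma Ext0_E1 M T : (exists d, pd_le d M) -> Ext_succ_vanishes 0 M T -> E1 M T.
Proof.
move=> [d /pd_finite [R _]] h.
have [K [j s]] := ker_ses (@pr_aug_surj _ _ R).
have [ij _ hj] := s; apply: (E1_cover s (@pr_proj _ _ R 0%N)) => f.
have [|a ha] := @lin_lift A _ _ K (pr_diff R 0) j ij.
  by move=> x; apply: (proj1 (hj _)); apply/pr_exact0; exists x.
have [x /=|g hg] := h R (f \o a).
  rewrite (_ : a _ = 0) ?linear0 //; apply: ij; rewrite ha linear0.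
  by apply/pr_exact; exists x.
exists g => k; have := ses0 k s => /pr_exact0 [y hy].
by rewrite -hy hg /=; congr (f _); apply: ij; rewrite ha.
Qed.

(** Vanishing against [Pf] is asked in degree one only: [Pf] is closed under syzygies, so [Ext_E1]
    yields every higher degree. *)
Definition strong T := [/\ Pf T, forall M, Pf M -> E1 M T & exists s, cores T s A^o].

Lemma strongP T : strong_tilting T <-> strong T.
Proof.
split=> [[[/PfinP hT _ /add_coresolutionP hc] hE]|[hT hE hc]].
  by split=> // M hM; apply: Ext0_E1; [exact: hM.2|apply: hE; apply/PfinP].
have e M : Pfin M -> forall i, Ext_succ_vanishes i M T.
  by move=> /PfinP hM i; apply: Ext_E1 => //; apply: Pf_stably.
split=> //; split; [exact/PfinP|by apply: e; apply/PfinP|exact/add_coresolutionP].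
Qed.

End Ext1.

(** * Fitting's lemma and Krull-Schmidt decompositions *)

Section Fitting.
Variable A : pzRingType.
Implicit Types M N X Y Z W Q K P R V T U I S C : lmodType A.

Lemma lin_iter X (u : {linear X -> X}) n :
  exists v : {linear X -> X}, forall x, v x = iter n u x.
Proof.
elim: n => [|n [v hv]]; first by exists idfun.
by exists (u \o v : {linear _ -> _}) => x /=; rewrite hv.
Qed.

(** Among the images of the powers u^n with [n > 0], one of least length is mapped isomorphically to
    itself by u^n, because the image of u^(2n) is no shorter. Hence it is a retract of [X]. *)
Lemma fitting X (u : {linear X -> X}) : finlen X ->
  exists n I (p : {linear X -> I}) (i : {linear I -> X}) (t : {linear I -> I}),
    [/\ (0 < n)%N, surjective p, injective i, forall x, i (p x) = iter n u x
      & cancel (p \o i) t].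
Proof.
move=> fX; pose Pr k := `[< exists n I (p : {linear X -> I}) (i : {linear I -> X}),
  [/\ (0 < n)%N, surjective p, injective i, forall x, i (p x) = iter n u x & len I = k] >].
have ex : exists k, Pr k.
  have [I [p [i [sp ii ip]]]] := im_ex u; exists (len I); apply/asboolP.
  by exists 1%N, I, p, i.
have [k /asboolP [n [I [p [i [n0 sp ii ip lk]]]]] mk] := ex_minnP ex.
exists n, I, p, i.
have fI : finlen I := finlen_surj sp fX.
have [J [p' [j [sp' ij jp]]]] := im_ex (p \o i).
have /mk : Pr (len J).
  apply/asboolP; exists (n + n)%N, J, (p' \o p : {linear _ -> _}), (i \o j : {linear _ -> _}).
  split=> // [|y|x y /ii /ij //|x] /=; first by rewrite addn_gt0 n0.
    by have [z <-] := sp' y; have [x <-] := sp z; exists x.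
  by rewrite jp /= ip ip -iterD.
rewrite -lk => /(inj_len_surj ij fI) sj.
have spi : surjective (p \o i).
  move=> y; have [z <-] := sj y; have [x <-] := sp' z.
  by exists x; rewrite jp.
have /bijP [ipi _] := endo_surj_bij fI spi.
by have [t [ht _]] := bij_inv ipi spi; exists t.
Qed.

Lemma indec_fitting X (u : {linear X -> X}) : finlen X -> indecomposable X ->
  bijective u \/ exists n, forall x, iter n u x = 0.
Proof.
move=> fX [nz hX]; have [n [I [p [i [t [n0 sp ii ip ht]]]]]] := fitting u fX.
have r : cancel i (t \o p : {linear _ -> _}) by move=> x; apply: ht.
have [Z /[dup] e /hX [zI|zZ]] := retract_prod r.
  by right; exists n => x; rewrite -ip (zI (p x)) linear0.
left; apply: endo_bij => //; apply: lin_inj => x ux.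
have un : iter n u x = 0.
  by case: n n0 {ip} => // n _; rewrite iterSr ux; elim: n => //= n ->; rewrite linear0.
have px : p x = 0 by apply: (inj0 ii); rewrite ip.
have eIX : (len X <= len I)%N.
  have fXX := finlen_iso e fX; have [l /ses_prod s] := inl_ex I Z.
  by rewrite (len_iso e fX) (len_ses s fXX) (len_zero zZ).2 addn0.
exact: (inj0 (surj_len_inj sp fX eIX)).
Qed.

Lemma nil_one_sub X (u v : {linear X -> X}) n : (forall x, iter n u x = 0) ->
  (forall x, u x + v x = x) -> injective v.
Proof.
move=> un e; apply: lin_inj => x vx.
have ux : u x = x by rewrite -[RHS]e vx addr0.
by rewrite -(un x); elim: n {un} => //= n <-.
Qed.

(** The endomorphism ring of an indecomposable module of finite length is local: a term that is not
    invertible is nilpotent up to a unit, and removing it leaves the sum injective. *)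
Lemma local_sum X (B : Type) (s : seq B) (f : B -> {linear X -> X}) (w : {linear X -> X}) :
  finlen X -> indecomposable X -> bijective w ->
  (forall x, w x = \sum_(b <- s) f b x) -> exists b, bijective (f b).
Proof.
move=> fX hX; elim: s w => [|b s IHs] w /bijP [iw sw] hw.
  case: hX => -[]; move=> x; apply: iw; by rewrite !hw !big_nil.
have [w' [ww' w'w]] := bij_inv iw sw.
pose g x := \sum_(b <- s) f b x.
have [r hr] : exists r : {linear X -> X}, forall x, r x = g x.
  apply: linear_ex => a x y; rewrite /g scaler_sumr -big_split.
  by apply: eq_bigr => c _ /=; rewrite -linearP.
have e x : (w' \o f b) x + (w' \o r) x = x.
  rewrite /= -linearD hr; have -> : f b x + g x = w x by rewrite hw big_cons.
  exact: ww'.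
have [/bijP [i1 s1]|[n hn]] := indec_fitting (w' \o f b) fX hX.
  exists b; apply: endo_bij => //; apply: lin_inj => x fx; apply: (inj0 i1).
  by rewrite /= fx linear0.
have i2 := nil_one_sub hn e.
apply: (IHs r) => //; apply: endo_bij => //; apply: lin_inj => x rx.
by apply: (inj0 i2); rewrite /= rx linear0.
Qed.

Lemma bij_retract X Y (a : {linear X -> Y}) (b : {linear Y -> X}) :
  bijective (b \o a) -> retract X Y.
Proof.
move=> /bijP [ii ss]; have [t [ht _]] := bij_inv ii ss.
by exists a, (t \o b : {linear _ -> _}) => x; apply: ht.
Qed.

Lemma indec_add T X : finlen X -> indecomposable X -> in_add T X -> retract X T.
Proof.
move=> fX hX /in_addP [s hs].
have b1 : bijective (idfun : {linear X -> X}) by exists idfun.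
have [p hp] := local_sum (f := fun p : {linear X -> T} * {linear T -> X} => p.2 \o p.1 : {linear X -> X}) fX hX b1 hs.
exact: bij_retract hp.
Qed.

Lemma indec_dsum k (M : 'I_k -> lmodType A) X : finlen X -> indecomposable X ->
  retract X (dsum M) -> exists i, retract X (M i).
Proof.
move=> fX hX [a [b ab]]; have [h hh] := dsum_decomp M.
pose q i := sval (cid (proj_ex M i)).
have b1 : bijective (idfun : {linear X -> X}) by exists idfun.
have [|i hi] := @local_sum X 'I_k (index_enum 'I_k)
  (fun i => (b \o h i) \o (q i \o a) : {linear X -> X}) idfun fX hX b1.
  move=> x /=; rewrite -[LHS]ab {1}[a x]hh linear_sum.
  by apply: eq_bigr => i _; rewrite /q; case: cid => /= w ->.
by exists i; apply: (bij_retract hi).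
Qed.

Lemma indec_retract_iso X Y : ~ is_zero X -> indecomposable Y -> retract X Y ->
  module_iso X Y.
Proof.
move=> nz [_ hY] [a [b ab]]; have ia : injective a := can_inj ab.
have [Q [p s]] := coker_ses ia; have [t _ e] := ses_retraction s ab.
have [//|zQ] := hY _ _ e; exists a; apply/bijP; split=> // y.
by have [_ _ h] := s; apply/h; apply: zQ.
Qed.

Lemma nonzero_ex X : ~ is_zero X -> exists x : X, x <> 0.
Proof.
by move=> nz; apply: contrapT => h; apply: nz => x; apply: contrapT => hx; apply: h; exists x.
Qed.

(** A summand recorded by its projection and its inclusion. Lists of summands are handled with
    [List.In], since modules are not given an [eqType]. *)
Definition summand M := {N : lmodType A & ({linear M -> N} * {linear N -> M})%type}.

Lemma decomposition M : finlen M -> exists s : seq (summand M),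
  (forall p, List.In p s -> indecomposable (projT1 p) /\
     forall x, (projT2 p).1 ((projT2 p).2 x) = x) /\
  forall x, x = \sum_(p <- s) (projT2 p).2 ((projT2 p).1 x).
Proof.
have [n] := ubnP (len M); elim: n M => // n IHn M le fM.
have [z|nz] := pselect (is_zero M).
  by exists [::]; split=> // x; rewrite big_nil; apply: z.
have [h|nh] := pselect (indecomposable M).
  exists [:: existT _ M ((idfun : {linear M -> M}), (idfun : {linear M -> M}))].
  by split=> [p [<-|[]] //|x]; rewrite big_seq1.
have [X [Y [e nX nY]]] : exists X Y, [/\ module_iso M (X * Y)%type, ~ is_zero X & ~ is_zero Y].
  apply: contrapT => hn; apply: nh; split=> // X Y e; apply: contrapT => no.
  by apply: hn; exists X, Y; split=> // z; apply: no; [left|right].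
have fXY := finlen_iso e fM; have [l hl] := inl_ex X Y; have [r hr] := inr_ex X Y.
have sl := ses_prod hl; have /(finlen_ses sl) [fX fY] := fXY.
have := le; rewrite (len_iso e fM) (len_ses sl fXY) ltnS => le'.
have [|s [hs1 hs2]] := IHn X _ fX.
  by apply: leq_trans le'; rewrite -addn1 leq_add2l; apply: len_gt0.
have [|t [ht1 ht2]] := IHn Y _ fY.
  by apply: leq_trans le'; rewrite -add1n leq_add2r; apply: len_gt0.
have /isoP [f [g [fK gK]]] := e.
pose c W (a : {linear M -> W}) (b : {linear W -> M}) (p : summand W) : summand M :=
  existT _ (projT1 p) (((projT2 p).1 \o a : {linear _ -> _}),
     (b \o (projT2 p).2 : {linear _ -> _})).
exists ([seq c X (fst \o f) (g \o l) p | p <- s] ++ [seq c Y (snd \o f) (g \o r) p | p <- t]).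
split=> [p /List.in_app_iff [] /List.in_map_iff [q [<- /[dup]]]|x].
- by move=> /hs1 [h1 h2] hq; split=> //= x; rewrite gK hl h2.
- by move=> /ht1 [h1 h2] hq; split=> //= x; rewrite gK hr h2.
rewrite big_cat !big_map /= -!linear_sum -hs2 -ht2 hl hr -linearD -{1}[x]fK.
congr (g _); case: (f x) => u v; rewrite -[RHS]/(u + 0, 0 + v).
by rewrite addr0 add0r.
Qed.

Lemma simple_sub M : finlen M -> ~ is_zero M ->
  exists S (i : {linear S -> M}), injective i /\ simple_module S.
Proof.
have [n] := ubnP (len M); elim: n M => // n IHn M le fM nz.
have [h|nh] := pselect (simple_module M); first by exists M, idfun; split=> // x y.
have [N [hN n0 n1]] : exists N : M -> Prop, [/\ submodule N,
    ~ (forall x, N x -> x = 0) & ~ (forall x, N x)].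
  apply: contrapT => hn; apply: nh; split=> // N hN; apply: contrapT => no.
  by apply: hn; exists N; split=> // hh; apply: no; [left|right].
have [X [i [ii hi]]] := sub_ex hN.
have ltX : (len X < len M)%N.
  rewrite ltnNge; apply/negP => /(inj_len_surj ii fM) si; apply: n1 => x.
  by apply/hi; apply: si.
have nX : ~ is_zero X.
  by move=> zX; apply: n0 => x /hi [y <-]; rewrite (zX y) linear0.
have [|S [j [ij hS]]] := IHn X _ (finlen_inj ii fM) nX; first exact: leq_trans ltX le.
by exists S, (i \o j : {linear _ -> _}); split=> // x y /= /ii /ij.
Qed.

End Fitting.

(** * Approximations by modules of finite projective dimension *)

Section Approximations.
Variable A : pzRingType.
Implicit Types M N X Y Z W Q K P R V T U I S C L O B D CY : lmodType A.
Hypothesis fA : finlen A^o.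

Definition approx M X (phi : {linear X -> M}) := Pf X /\
  forall Y (f : {linear Y -> M}), Pf Y -> exists g : {linear Y -> X}, forall y, phi (g y) = f y.

Lemma approxP M X (phi : {linear X -> M}) : Pfin_approximation phi <-> approx phi.
Proof.
by split=> -[/PfinP hX h]; split=> // Y f /PfinP; apply: h.
Qed.

Definition minapp M X (phi : {linear X -> M}) := approx phi /\
  forall u : {linear X -> X}, (forall x, phi (u x) = phi x) -> bijective u.

Definition cf := forall M, finitely_generated M ->
  exists X (phi : {linear X -> M}), approx phi.

Lemma cfP : Pfin_contravariantly_finite A <-> cf.
Proof.
by split=> h M /h [X [phi /approxP ?]]; exists X, phi.
Qed.

Lemma Pf_finlen X : Pf X -> finlen X.
Proof. by case=> f _; apply: fg_finlen. Qed.

(** A retract of [X] of least length that still approximates [M] is minimal: if [u] is compatible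
    with the approximation, its Fitting image is again such a retract, so [u] is injective. *)
Lemma minapp_ex M X (phi : {linear X -> M}) : approx phi ->
  exists X' (phi' : {linear X' -> M}), minapp phi' /\ retract X' X.
Proof.
move=> ha; pose Pr k := `[< exists X' (phi' : {linear X' -> M}),
  [/\ approx phi', retract X' X & len X' = k] >].
have ex : exists k, Pr k.
  by exists (len X); apply/asboolP; exists X, phi; split=> //; apply: retract_refl.
have [k /asboolP [X' [f [[hX' hf] r lk]]] mk] := ex_minnP ex.
exists X', f; split=> //; split=> // u fu.
have fX := Pf_finlen hX'.
have [n [I [p [i [t [n0 sp ii ip ht]]]]]] := fitting u fX.
have fun_ x : f (iter n u x) = f x by elim: n {n0 ip} => //= n <-; rewrite fu.
have rI : retract I X' by exists i, (t \o p : {linear _ -> _}) => x; apply: ht.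
have /mk : Pr (len I).
  apply/asboolP; exists I, (f \o i : {linear _ -> _}); split=> //.
    split=> [|Y g hY]; first exact: Pf_retract rI hX'.
    have [h hh] := hf Y g hY; exists (p \o h : {linear _ -> _}) => y /=.
    by rewrite ip fun_ hh.
  exact: retract_trans rI r.
rewrite -lk => le; have ipp := surj_len_inj sp fX le.
apply: endo_bij => //; apply: lin_inj => x ux; apply: (inj0 ipp); apply: ii.
rewrite ip linear0; case: n n0 {ip fun_} => // n _.
by rewrite iterSr ux; elim: n => //= n ->; rewrite linear0.
Qed.

Definition perp N := forall Y, Pf Y -> E1 Y N.

(** Wakamatsu's lemma. An extension of [Y] by [K] is pushed out to one of [Y] by [X], whose middle
    term [Q] stays in [Pf]. The map to [M] that is [phi] on [X] and zero on [Z] lifts to [X];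
    minimality inverts the lift on [X], which turns it into a retraction onto [K]. *)
Lemma wakamatsu M X (phi : {linear X -> M}) K (i : {linear K -> X}) :
  minapp phi -> injective i -> (forall x, phi x = 0 <-> exists k, i k = x) -> perp K.
Proof.
move=> [[hX hphi] mphi] ii hi Y hY; apply: E1_split => Z j q s.
have [Q [j' [q' [g [s' gj _ _ univ]]]]] := pushout_univ i s.
have [|r [rj rg]] := univ M phi \0.
  by move=> k /=; apply/hi; exists k.
have hQ : Pf Q := Pf_mid fA s' hX hY.
have [h hh] := hphi Q r hQ.
have [|t tK hK] := mphi (h \o j'); first by move=> x /=; rewrite hh rj.
have [t' ht'] : exists t' : {linear X -> X}, forall x, t' x = t x.
  have /bijP [i1 s1] : bijective (h \o j') by exists t.
  have [t' [a b]] := bij_inv i1 s1; exists t' => x.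
  by rewrite -{1}(hK x) a.
have phit x : phi (t' x) = phi x.
  by rewrite -{2}(hK x) /= hh rj ht'.
have [|w hw] := @lin_lift A Z X K (t' \o h \o g : {linear _ -> _}) i ii.
  by move=> z; apply: (proj1 (hi _)); rewrite /= phit hh rg.
exists w => k; apply: ii; rewrite hw /= gj ht'.
exact: tK.
Qed.

(** Injectivity tested on finitely generated modules, in the range where [basic_enough_inj] provides
    it. *)
Definition fginj I := forall X Y (i : {linear X -> Y}) (f : {linear X -> I}),
  finitely_generated Y -> injective i ->
  exists g : {linear Y -> I}, forall x, g (i x) = f x.

(** As in Wakamatsu's lemma, except that [phi] itself extends over the middle term because [I] is
    injective; so the whole approximation, not just its kernel, is Ext-orthogonal. *)
Lemma minapp_inj_perp I T (phi : {linear T -> I}) :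
  finitely_generated T -> fginj I -> minapp phi -> perp T.
Proof.
move=> fT hI [[hT hphi] mphi] Y hY; apply: E1_split => Z j q s.
have hZ : Pf Z := Pf_mid fA s hT hY; have [ij _ _] := s.
have [psi hpsi] := hI _ _ j phi hZ.1 ij.
have [h hh] := hphi Z psi hZ.
have [|t tK _] := mphi (h \o j); first by move=> x /=; rewrite hh hpsi.
have /bijP [i1 s1] : bijective (h \o j) by apply: mphi => x /=; rewrite hh hpsi.
have [t' [a b]] := bij_inv i1 s1; exists (t' \o h : {linear _ -> _}) => x.
exact: a.
Qed.

Lemma approx_surj M X (phi : {linear X -> M}) : finitely_generated M ->
  approx phi -> surjective phi.
Proof.
move=> fM [_ h] m; have [K [P [i [p [[_ sp _] hP fP]]]]] := proj_cover fM.
have [g hg] := h P p (Pf_proj fP hP); have [x hx] := sp m.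
by exists (g x); rewrite hg.
Qed.

(** The bound [d] is recorded because it ends up bounding the finitistic dimension: a module of [Pf]
    is a summand of its special approximation. *)
Definition special d M := exists K X (i : {linear K -> X}) (phi : {linear X -> M}),
  [/\ ses i phi, Pf X, pd_le d X & perp K].

Lemma special_ex M : cf -> finitely_generated M -> exists d, special d M.
Proof.
move=> h fM; have [X [phi hphi]] := h M fM.
have [X' [phi' [hm _]]] := minapp_ex hphi.
have sp := approx_surj fM hm.1; have [K [i s]] := ker_ses sp.
have [[hX' _] _] := hm; have [d hd] := hX'.2.
by exists d, K, X', i, phi'; split=> //; have [ii _ hi] := s; apply: wakamatsu hm ii hi.
Qed.

Lemma special_mono d d' M : (d <= d')%N -> special d M -> special d' M.
Proof.
move=> le [K [X [i [p [s h1 h2 h3]]]]]; exists K, X, i, p; split=> //.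
exact: pd_mono le h2.
Qed.

Lemma special_iso d M N : module_iso M N -> special d M -> special d N.
Proof.
move=> e [K [X [i [p [s h1 h2 h3]]]]].
have [i' [p' s']] := ses_iso (iso_refl _) (iso_refl _) e s.
by exists K, X, i', p'.
Qed.

Lemma ses_comp K X Q N M (i : {linear K -> X}) (p : {linear X -> Q})
  (l : {linear N -> Q}) (g : {linear Q -> M}) : ses i p -> ses l g ->
  exists L (m : {linear L -> X}) (u : {linear K -> L}) (v : {linear L -> N}),
    ses m (g \o p) /\ ses u v.
Proof.
move=> s s'; have [ii sp hp] := s; have [il sg hg] := s'.
have sgp : surjective (g \o p).
  by move=> y; have [z <-] := sg y; have [x <-] := sp z; exists x.
have [L [m sm]] := ker_ses sgp; have [im _ hm] := sm.
have [|u hu] := @lin_lift A K X L i m im.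
  by move=> x; apply: (proj1 (hm _)); rewrite /= (ses0 _ s) linear0.
have [|v hv] := @lin_lift A L Q N (p \o m : {linear _ -> _}) l il.
  by move=> x; apply: (proj1 (hg _)); exact: ses0 sm.
exists L, m, u, v; split=> //; split=> [x y e|n|x].
- by apply: ii; rewrite -!hu e.
- have [x hx] := sp (l n); have /hm [y hy] : (g \o p) x = 0 by rewrite /= hx (ses0 _ s').
  by exists y; apply: il; rewrite hv /= hy hx.
- split=> [vx|[k <-]]; last by apply: il; rewrite hv /= hu (ses0 _ s) linear0.
  have /hp [k hk] : p (m x) = 0 by rewrite -[LHS]hv vx linear0.
  by exists k; apply: im; rewrite hu.
Qed.

(** The extension [Q] of [X''] by [M'] has to be lifted to an extension by [X']. Its class is a map
    from the syzygy [O] of [X''] to [M'], and this lifts to [X'] because [O] lies in [Pf] and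
    Ext^1([O], [K']) = 0. *)
Lemma special_ext d M' M M'' (i : {linear M' -> M}) (p : {linear M -> M''}) :
  ses i p -> special d M' -> special d M'' -> special d M.
Proof.
move=> s [K' [X' [i' [f' [s' hX' dX' pK']]]]] [K'' [X'' [i'' [f'' [s'' hX'' dX'' pK'']]]]].
have [Q [j [q [l [g [sj sl gj ql pg]]]]]] := pullback2 s s''.
have [O [P [o [c [so hP fP]]]]] := proj_cover hX''.1.
have [_ sq hq] := sj; have [ij _ _] := sj.
have [c0 hc0] := hP _ _ q c sq.
have [|c1 hc1] := @lin_lift A O Q M' (c0 \o o : {linear _ -> _}) j ij.
  by move=> x; apply: (proj1 (hq _)); rewrite /= hc0 (ses0 _ so).
have hO : Pf O := Pf_syz fA so hP fP hX''.
have [e he] := E1_lift c1 (pK' O hO) s'.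
have [X [a [b [t [sX _ bt gen univ]]]]] := pushout_univ e so.
have [|h [ha ht]] := univ Q (j \o f' : {linear _ -> _}) c0.
  by move=> x /=; rewrite he hc1.
have hb x : q (h x) = b x.
  have [w [y ->]] := gen x; rewrite !linearD ha ht /= hc0 bt.
  by rewrite (ses0 _ sj) (ses0 _ sX).
have [ia sb hbk] := sX; have [_ sf' hf'] := s'.
have sh : ses (a \o i' : {linear K' -> X}) h.
  have [ii' _ _] := s'; split=> [x y /= /ia /ii' //|y|x].
    have [x hx] := sb (q y); have /hq [m hm] : q (y - h x) = 0.
      by rewrite linearB hb hx subrr.
    have [x' hx'] := sf' m; exists (x + a x').
    by rewrite linearD ha /= hx' hm [LHS]addrC subrK.
  split=> [hx|[k <-]] /=; last by rewrite ha /= (ses0 _ s') linear0.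
  have /hbk [x' e'] : b x = 0 by rewrite -hb hx linear0.
  have /hf' [k hk] : f' x' = 0.
    by apply: (inj0 ij); move: hx; rewrite -e' ha.
  by exists k; rewrite /= hk.
have [L [m [u [v [sm suv]]]]] := ses_comp sh sl.
exists L, X, m, (g \o h : {linear _ -> _}); split=> //.
- exact: Pf_mid sX hX' hX''.
- exact: pd_ses_mid hX'.1 hX''.1 sX dX' dX''.
- by move=> Y hY; apply: E1_ext_r hY.1 suv (pK' Y hY) (pK'' Y hY).
Qed.

Lemma special_zero d M : is_zero M -> special d M.
Proof.
move=> z; exists M, M, idfun, \0; split.
- exact: ses_id.
- exact: Pf_zero.
- by apply: pd_mono (leq0n d) _; apply: proj_zero.
- move=> Y _; apply: E1_split => Z i p s; exists \0 => x /=.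
  by apply/esym/z.
Qed.

Definition finite_simples := exists k (S : 'I_k -> lmodType A),
  (forall i, finitely_generated (S i)) /\ forall X, simple_module X -> exists i, module_iso X (S i).

Lemma special_all : finite_simples -> cf -> exists d, forall M, finitely_generated M ->
  special d M.
Proof.
move=> [k [S [fS hS]]] h.
pose D i := sval (cid (special_ex h (fS i))).
have hD i : special (\max_j D j) (S i).
  apply: special_mono (svalP (cid (special_ex h (fS i)))).
  exact: (leq_bigmax (F := D)).
exists (\max_j D j) => M fM; have {fM} := fg_finlen fA fM.
have [n] := ubnP (len M); elim: n M => // n IHn M le fM.
have [z|nz] := pselect (is_zero M); first exact: special_zero.
have [X [i [ii hX]]] := simple_sub fM nz; have [j e] := hS X hX.
have [Q [p s]] := coker_ses ii; have /(finlen_ses s) [fX fQ] := fM.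
apply: (special_ext s); first exact: special_iso (iso_sym e) (hD j).
apply: IHn => //; move: le; rewrite (len_ses s fM) ltnS.
apply: leq_trans; rewrite -[X in (X < _)%N]add0n ltn_add2r.
by apply: (len_gt0 fX); case: hX.
Qed.

Definition findim_le d := forall Y, Pf Y -> pd_le d Y.

Lemma special_pd d Y : special d Y -> Pf Y -> pd_le d Y.
Proof.
move=> [K [X [i [p [s hX dX pK]]]]] hY.
have [r hr] := pK Y hY _ _ _ _ s idfun.
have [t ht _] := ses_retraction s hr.
apply: (pd_retract fA hX.1 _ dX); by exists t, p.
Qed.

(** A theorem of Auslander and Reiten. The special approximations of the finitely many simple
    modules have a common bound, and [special_ext] passes it to all finitely generated modules by
    induction on length. *)
Lemma cf_findim : finite_simples -> cf -> exists d, findim_le d.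
Proof.
move=> fS /(special_all fS) [d h]; exists d => Y hY.
by apply: special_pd (hY); apply: h; case: hY.
Qed.

(** * Strong tilting modules and contravariant finiteness *)

(** [Z] is an [s]-th syzygy of a module in [Pf]. Statements about Ext^(s+1) on [Pf] are phrased as
    [E1] on these modules, so that higher Ext does not occur in the argument. *)
Fixpoint syzc s Z : Prop := match s with
  | 0 => Pf Z
  | s'.+1 => exists Y P (i : {linear Z -> P}) (p : {linear P -> Y}),
     [/\ ses i p, projective_module P, finitely_generated P & syzc s' Y]
  end.

Lemma syzc_S s Z : syzc s.+1 Z -> syzc s Z.
Proof.
elim: s Z => [|s IHs] Z [Y [P [i [p [sq hP fP hY]]]]]; first exact: Pf_syz sq hP fP hY.
by exists Y, P, i, p; split=> //; apply: IHs.
Qed.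

Lemma syzc_Pf s Z : syzc s Z -> Pf Z.
Proof. by elim: s => // s IHs /syzc_S /IHs. Qed.

Lemma syzc_proj s t : findim_le (s + t) -> forall Z, syzc s Z -> pd_le t Z.
Proof.
elim: s t => [|s IHs] t h Z; first exact: h.
move=> [Y [P [i [p [sq hP fP hY]]]]]; apply: pd_kernel sq hP _.
by apply: (IHs t.+1) => //; rewrite addnS -addSn.
Qed.

Lemma shift_syzc s M I N (i : {linear M -> I}) (p : {linear I -> N}) :
  ses i p -> perp I -> (forall Z, syzc s.+1 Z -> E1 Z M) ->
  forall Z, syzc s Z -> E1 Z N.
Proof.
move=> sM hI h Z hZ; have hZ' := syzc_Pf hZ.
have [K [P [j [q [s' hP fP]]]]] := proj_cover hZ'.1.
apply: (E1_cover s' hP) => f; have hK : syzc s.+1 K by exists Z, P, j, q.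
have [g hg] := E1_lift f (h K hK) sM.
have [u hu] := hI Z hZ' _ _ _ _ s' g; exists (p \o u : {linear _ -> _}) => x /=.
by rewrite hu hg.
Qed.

Definition separates T X := forall x : X, x <> 0 -> exists f : {linear X -> T}, f x <> 0.

(** A map into add([T]) with kernel of least length is injective: otherwise one more map to [T] cuts
    the kernel down. *)
Lemma sep_embed T X : finlen X -> separates T X ->
  exists U (h : {linear X -> U}), in_add T U /\ injective h.
Proof.
move=> fX hs; pose Pr n := `[< exists U (h : {linear X -> U}) K (i : {linear K -> X}),
   [/\ in_add T U, injective i, forall x, h x = 0 <-> exists k, i k = x & len K = n] >].
have ex : exists n, Pr n.
  have [Z zZ] := zero_ex A; have [K [i [ii hi]]] := ker_ex (\0 : {linear X -> Z}).
  exists (len K); apply/asboolP; exists Z, \0, K, i; split=> //.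
  exact: add_zero.
have [n /asboolP [U [h [K [i [hU ii hi lK]]]]] mn] := ex_minnP ex.
have fK := finlen_inj ii fX.
have [zK|/nonzero_ex [y ny]] := pselect (is_zero K).
  exists U, h; split=> //; apply: lin_inj => x /hi [y <-].
  by rewrite (zK y) linear0.
have [|f nf] := hs (i y); first by move=> /(inj0 ii).
have [h' hh'] := pair_ex h f.
have [K' [i' [ii' hi']]] := ker_ex h'.
have hk x : h (i' x) = 0 /\ f (i' x) = 0.
  have : h' (i' x) = 0 by apply/hi'; exists x.
  by rewrite hh' => -[].
have [|u hu] := @lin_lift A K' X K i' i ii.
  by move=> x; apply: (proj1 (hi _)); case: (hk x).
have iu : injective u by move=> x x' e; apply: ii'; rewrite -!hu e.
have /mn : Pr (len K').
  apply/asboolP; exists (U * T)%type, h', K', i'; split=> //.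
  by apply: add_prod => //; apply: add_self.
rewrite -lK => /(inj_len_surj iu fK) su; have [x hx] := su y.
by case: nf; rewrite -hx hu; case: (hk x).
Qed.

Lemma perp_add T U : perp T -> in_add T U -> perp U.
Proof. by move=> h hU Y hY; apply: E1_add hU (h Y hY). Qed.

(** An elementary form of strong tilting: separation of points and a bound on the finitistic
    dimension stand in for the coresolution. [SC_strong] and [strong_SC] give the equivalence. *)
Definition SC T := [/\ Pf T, perp T, forall X, Pf X -> separates T X
  & exists d, findim_le d].

Lemma SC_embed T X : SC T -> Pf X -> exists U C (i : {linear X -> U}) (p : {linear U -> C}),
  [/\ ses i p, in_add T U & Pf C].
Proof.
move=> [hT _ hs _] hX; have [U [h [hU ih]]] := sep_embed (Pf_finlen hX) (hs X hX).
have [C [p s]] := coker_ses ih; exists U, C, h, p; split=> //.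
by apply: Pf_right s hX _ => //; apply: Pf_add hU.
Qed.

Lemma SC_cores T : SC T -> exists s, forall X, Pf X -> cores T s X.
Proof.
move=> h; have [hT pT hs [d hd]] := h; exists d.
have hp Z : syzc d Z -> projective_module Z.
  by move=> hZ; apply: (syzc_proj (t := 0) _ hZ); rewrite addn0.
(* Embeddings into add([T]) are iterated; each cokernel lowers by one the order of the syzygies on
   which Ext^1 vanishes. At order 0 the embedding splits. One may start at order [d], since syzygies
   of that order are projective. *)
suff gen s X : Pf X -> (forall Z, syzc s Z -> E1 Z X) -> cores T s X.
  by move=> X hX; apply: gen => // Z /hp; apply: E1_proj.
elim: s X => [|s IHs] X hX hE.
all: have [U [C [i [p [sq hU hC]]]]] := SC_embed h hX.
  exact: add_trans hU (add_retract (E1_ses_split sq (hE C hC))).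
exists U, C, i, p; split=> //; apply: IHs => //.
exact: shift_syzc sq (perp_add pT hU) hE.
Qed.

Lemma SC_strong T : SC T -> strong T.
Proof.
move=> h; have [s hs] := SC_cores h; have [hT pT _ _] := h.
by split=> //; exists s; apply: hs; apply: Pf_free.
Qed.

Lemma cores_ext T s X Y Z (i : {linear X -> Y}) (p : {linear Y -> Z}) : strong T ->
  ses i p -> cores T s X -> cores T s Z -> cores T s Y.
Proof.
move=> [hT pT _]; elim: s X Y Z i p => [|s IHs] X Y Z i p sq hX hZ.
  have [r hr] := E1_add hX (pT Z (Pf_add fA hT hZ)) sq idfun.
  have [t _ e] := ses_retraction sq hr.
  by apply: add_trans (add_prod hX hZ) _; apply/add_retract/retract_iso.
have pZ := cores_Pf fA hT hZ.
move: hX hZ => [U [C [jX [qX [sX hU hC]]]]] [W [D [jZ [qZ [sZ hW hD]]]]].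
have [e he] := E1_add hU (pT Z pZ) sq jX.
have [CY [jY [qY [u [v [sY suv]]]]]] := horseshoe_co sq sX sZ he.
exists (U * W)%type, CY, jY, qY; split=> //; first exact: add_prod.
exact: IHs suv hC hD.
Qed.

Lemma cores_prod T s X Y : strong T -> cores T s X -> cores T s Y ->
  cores T s (X * Y)%type.
Proof. by move=> h; have [l hl] := inl_ex X Y; apply: cores_ext (ses_prod hl). Qed.

Lemma cores_powm T s X k : strong T -> cores T s X -> cores T s (powm X k).
Proof.
move=> h hX; rewrite /powm; elim: k => [|k IHk].
  apply: (cores_mono (leq0n s)); apply: add_zero; exact: dsum0_zero.
by have [i [p sq]] := dsumS_ses (fun _ : 'I_k.+1 => X); apply: cores_ext sq _ _.
Qed.

Lemma strong_coresolved T X : strong T -> Pf X ->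
  exists Z s, retract X Z /\ cores T s Z.
Proof.
move=> h [fX [d hd]]; have [hT pT [s0 hs0]] := h.
elim: d X fX hd => [|d IHd] X fX hd.
  have [k r] := proj_fg_retract fX hd; exists (powm A^o k), s0.
  by split=> //; apply: cores_powm.
have [K [P [i [p [sq hP fP]]]]] := proj_cover fX.
have hK := pd_kernel sq hP hd; have [ii sp hip] := sq.
have [W [a [[a' [b' ab']] hW]]] := IHd K (fg_sub fA ii fP) hK.
have [k [a2 [b2 ab2]]] := proj_fg_retract fP hP.
have hB : cores T (maxn a s0) (powm A^o k * W)%type.
  apply: cores_prod => //; last exact: cores_mono (leq_maxl _ _) hW.
  by apply: cores_powm => //; apply: cores_mono (leq_maxr _ _) hs0.
(* On the summand [K] of [W] this is the embedding into the free module, on its complement the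
   inclusion into [W]; so the cokernel [Q] contains [X] as a summand. *)
have [kk hkk] := pair_ex (a2 \o i \o b' : {linear W -> powm A^o k}) (idfun \+ \- (a' \o b') : {linear W -> W}).
have ik : injective kk.
  apply: lin_inj => w; rewrite hkk /= => -[e1 e2].
  have e3 : b' w = 0 by apply: (inj0 ii); apply: (inj0 (can_inj ab2)).
  by move: e2; rewrite e3 !linear0 addr0.
have [Q [q sQ]] := coker_ses ik; have [_ sqq hq] := sQ.
have [|g hg] := @lin_fact A _ X Q q (p \o b2 \o fst : {linear (powm A^o k * W)%type -> X}) sqq.
  by move=> x /hq [w <-]; rewrite /= hkk /= ab2 (ses0 _ sq).
have [l hl] := inl_ex (powm A^o k) W.
have [|f hf] := @lin_fact A P Q X p (q \o l \o a2 : {linear _ -> _}) sp.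
  move=> x /hip [y <-]; rewrite /=; apply/hq; exists (a' y).
  by rewrite hkk hl /= ab' subrr.
have rXQ : retract X Q.
  exists f, g => x; have [y <-] := sp x.
  by rewrite hf /= hg /= hl /= ab2.
have hQ : Pf Q by apply: Pf_right sQ (cores_Pf fA hT hW) (cores_Pf fA hT hB).
case: a hW hB => [|a] hW hB.
  exists (powm A^o k * W)%type, (maxn 0 s0); split=> //.
  apply: retract_trans rXQ _.
  have [r hr] := E1_add hW (pT Q hQ) sQ idfun.
  by have [t ht _] := ses_retraction sQ hr; exists t, q.
(* Pushing [W -> powm A^o k * W] out along [W -> U] gives [R]. It contains [Q] as a summand since
   Ext^1([Q], [U]) = 0, and it is an extension of [C] by a coresolved module. *)
have [U [C [j [qU [sU hU hC]]]]] := hW.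
have [R [jR [qR [gR [rR [s1 s2 _ _ _]]]]]] := pushout2 sQ sU.
exists R, (maxn a.+1 s0); split.
  apply: retract_trans rXQ _.
  have [r hr] := E1_add hU (pT Q hQ) s1 idfun.
  by have [t ht _] := ses_retraction s1 hr; exists t, qR.
apply: cores_ext s2 hB _ => //; apply: cores_mono hC.
exact: leq_trans (leqnSn _) (leq_maxl _ _).
Qed.

(** Ext^1 of an [s]-th syzygy into [N] is pushed along the coresolution to Ext^1 into its last term,
    where it vanishes. *)
Lemma cores_syzc T s N : strong T -> cores T s N -> forall Z, syzc s Z -> E1 Z N.
Proof.
move=> [hT pT _]; elim: s N => [|s IHs] N; first by move=> hN Z hZ; apply: E1_add hN (pT Z hZ).
move=> [U [C [j [q [sN hU hC]]]]] Z hZ; have pZ := syzc_Pf hZ.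
have [Y [P [i [p [sY hP fP hY]]]]] := hZ.
have [K [P' [i' [p' [sZ hP' fP']]]]] := proj_cover pZ.1.
apply: (E1_cover sZ hP') => g; have pU := perp_add pT hU.
have [h hh] := pU Z pZ _ _ _ _ sZ (j \o g).
have [ij sq hq] := sN; have [_ sp' hp'] := sZ.
have [|h1 hh1] := @lin_fact A P' C Z p' (q \o h : {linear _ -> _}) sp'.
  by move=> x /hp' [k <-] /=; rewrite hh /= (ses0 _ sN).
have [e he] := IHs C hC Y hY _ _ _ _ sY h1.
have [e' he'] := hP _ _ q e sq.
have [|w hw] := @lin_lift A P' U N (h \+ \- (e' \o i \o p')) j ij.
  move=> x; apply: (proj1 (hq _)); rewrite /= linearB he' he hh1 /=.
  by rewrite subrr.
exists w => k; apply: ij; rewrite hw /= hh /= (ses0 _ sZ) !linear0.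
by rewrite addr0.
Qed.

Lemma syzc_pd r s : (forall Z, syzc (r + s) Z -> projective_module Z) ->
  forall Y, syzc s Y -> pd_le r Y.
Proof.
elim: r s => [|r IHr] s h Y hY; first exact: h.
have [K [P [i [p [sq hP fP]]]]] := proj_cover (syzc_Pf hY).1.
exists K, P, i, p; split=> //; apply: (IHr s.+1); last by exists Y, P, i, p.
by move=> Z; rewrite addnS -addSn; apply: h.
Qed.

Lemma strong_SC T : strong T -> SC T.
Proof.
move=> h; have [hT pT [s hs]] := h; split=> // [X hX|].
  have [Z [t [[a [b ab]] hZ]]] := strong_coresolved h hX.
  have [U [j [hU ij]]] : exists U (j : {linear Z -> U}), in_add T U /\ injective j.
    case: t hZ => [|t]; first by exists Z, idfun; split=> // x y.
    by move=> [U [C [i [p [[ii _ _] hU _]]]]]; exists U, i.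
  have [k [c [d cd]]] := add_powmP hU.
  move=> x nx; apply: contrapT => hn; apply: nx.
  apply: (can_inj ab); apply: ij; apply: (can_inj cd); apply: dsumP => l.
  have [q hq] := proj_ex (fun _ : 'I_k => T) l; rewrite -!hq.
  rewrite !linear0; apply: contrapT => nz; apply: hn.
  by exists (q \o c \o j \o a : {linear _ -> _}).
exists s => Y hY; apply: (syzc_pd (s := 0)) => // Z; rewrite addn0.
(* An [s]-th syzygy [Z] of finite projective dimension is projective: by induction its own syzygy
   [K] is projective, Ext^1([Z], [K]) = 0 by the coresolution of the ring, and so the cover of [Z]
   splits. *)
suff gen q : forall Z', syzc s Z' -> pd_le q Z' -> projective_module Z'.
  by move=> hZ; have [_ [q hq]] := syzc_Pf hZ; apply: gen hq.
elim: q {Y hY Z} => // q IHq Z hZ hq.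
have [K [P [i [p [sq hP fP]]]]] := proj_cover (syzc_Pf hZ).1.
have hK : syzc s K by apply: syzc_S; exists Z, P, i, p.
have pK := IHq K hK (pd_kernel sq hP hq).
have e : E1 Z K by apply: E1_add (fg_proj_add (syzc_Pf hK).1 pK) (cores_syzc h hs hZ).
have [r hr] := e _ _ _ _ sq idfun; have [t ht _] := ses_retraction sq hr.
by apply: proj_retract hP; exists t, p.
Qed.

Definition enough_inj := forall M, finitely_generated M ->
  exists I (i : {linear M -> I}), [/\ finitely_generated I, fginj I & injective i].

(** Hom([X], [Y]) is finitely generated over the endomorphisms of [X]; generators of Hom([T], [N])
    then give an approximation of [N] by a power of [T]. *)
Definition hom_fg := forall X Y, finitely_generated X -> finitely_generated Y ->
  exists k (h : 'I_k -> {linear X -> Y}), forall f : {linear X -> Y},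
    exists c : 'I_k -> {linear X -> X}, forall x, f x = \sum_i h i (c i x).

Lemma fginj_perp I : fginj I -> perp I.
Proof.
move=> h Y hY; have [K [P [i [p [sq hP fP]]]]] := proj_cover hY.1.
by apply: (E1_cover sq hP) => f; have [ii _ _] := sq; apply: h.
Qed.

(** [lapp] and [rapp] are the special left and right approximations belonging to the orthogonal
    classes [perp] and [Pf]; as in Salce's argument, each kind produces the other. *)
Definition lapp M := exists N X (i : {linear M -> N}) (p : {linear N -> X}),
  [/\ ses i p, finitely_generated N, perp N & Pf X].
Definition rapp M := exists K X (i : {linear K -> X}) (p : {linear X -> M}),
  [/\ ses i p, Pf X & perp K].

Lemma perp_ext X Y Z (i : {linear X -> Y}) (p : {linear Y -> Z}) : ses i p ->
  perp X -> perp Z -> perp Y.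
Proof. by move=> s hX hZ M hM; apply: E1_ext_r hM.1 s (hX M hM) (hZ M hM). Qed.

(** A map from a module of [Pf] to [N] extends along an embedding into add([T]) with cokernel in
    [Pf], hence factors through the power of [T] built from generators of Hom([T], [N]). This
    factorization makes the kernel orthogonal to [Pf]. *)
Lemma perp_cover T N : SC T -> hom_fg -> finitely_generated N -> perp N ->
  exists K U (i : {linear K -> U}) (p : {linear U -> N}),
    [/\ ses i p, in_add T U & perp K].
Proof.
move=> h hh fN pN; have [hT pT hs _] := h.
have [k [g hg]] := hh T N hT.1 fN; have [p hp] := cotuple_ex g.
have lift X (f : {linear X -> N}) : Pf X -> exists f' : {linear X -> powm T k}, forall x, p (f' x) = f x.
  move=> hX; have [U [C [i [q [sq hU hC]]]]] := SC_embed h hX.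
  have [f1 hf1] := pN C hC _ _ _ _ sq f.
  have [l [a [b ab]]] := add_powmP hU.
  have [ii hii] := dsum_decomp (fun _ : 'I_l => T).
  pose c j := sval (cid (hg (f1 \o b \o ii j))).
  have hc j x : f1 (b (ii j x)) = \sum_i g i (c j i x).
    by rewrite -(svalP (cid (hg (f1 \o b \o ii j)))).
  pose pr j := sval (cid (proj_ex (fun _ : 'I_l => T) j)).
  have hpr j x : pr j x = x j by rewrite /pr; case: cid.
  have [v hv] : exists v : 'I_k -> {linear powm T l -> T},
      forall i x, v i x = \sum_j c j i (x j).
    pose w i := cid (cotuple_ex (fun j => c j i)).
    by exists (fun i => sval (w i)) => i' x; apply: (svalP (w i')).
  have [f' hf'] := tuple_ex (fun i' => v i' \o a \o i : {linear X -> T}).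
  exists f' => x; rewrite hp -hf1 -(ab (i x)) [a (i x) in RHS](hii (a (i x))).
  rewrite linear_sum linear_sum; under [RHS]eq_bigr => j _ do rewrite hc.
  rewrite exchange_big; apply: eq_bigr => i' _; rewrite hf' /= hv linear_sum.
  by [].
have sp : surjective p.
  move=> n; have [m hm] := smul_ex n; have [m' hm'] := lift _ m (Pf_free A).
  by exists (m' 1); rewrite hm' hm scale1r.
have [K [i sq]] := ker_ses sp; exists K, (powm T k), i, p; split=> //.
  exact: add_powm.
move=> X hX; have [L [P [j [q [sX hP fP]]]]] := proj_cover hX.1.
apply: (E1_cover sX hP) => f; have pU := perp_add pT (add_powm T k).
have [g1 hg1] := pU X hX _ _ _ _ sX (i \o f).
have [ij sqq hq] := sX; have [ii _ hi] := sq.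
have [|g2 hg2] := @lin_fact A P N X q (p \o g1 : {linear _ -> _}) sqq.
  by move=> x /hq [y <-] /=; rewrite hg1 /= (ses0 _ sq).
have [g3 hg3] := lift X g2 hX.
have [|w hw] := @lin_lift A P (powm T k) K (g1 \+ \- (g3 \o q)) i ii.
  by move=> x; apply: (proj1 (hi _)); rewrite /= linearB hg3 hg2 /= subrr.
by exists w => x; apply: ii; rewrite hw /= hg1 /= (ses0 _ sX) !linear0 addr0.
Qed.

Lemma lapp_rapp T M : SC T -> hom_fg -> lapp M -> rapp M.
Proof.
move=> h hh [N [X [i [p [sM fN pN hX]]]]]; have [hT pT _ _] := h.
have [K [U [j [q [sN hU pK]]]]] := perp_cover h hh fN pN.
have [L [m [u [v [sm suv]]]]] := ses_comp sN sM.
exists K, L, u, v; split=> //.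
by apply: Pf_left sm (Pf_add fA hT hU) hX.
Qed.

Lemma rapp_lapp M I N (i : {linear M -> I}) (p : {linear I -> N}) :
  finitely_generated M -> ses i p -> perp I -> rapp N -> lapp M.
Proof.
move=> fM sM pI [K [X [j [q [sN hX pK]]]]].
have [Z [a [b [c [d [s1 s2 _ _ _]]]]]] := pullback2 sM sN.
exists Z, X, a, b; split=> //; first exact: fg_ext s1 fM hX.1.
exact: perp_ext s2 pK pI.
Qed.

(** Induction on the number of cosyzygies after which [M] becomes orthogonal to [Pf], at most the
    finitistic dimension. A right approximation of the cosyzygy in an injective module gives a left
    one of [M], and [T] turns that into a right one. *)
Lemma SC_cf T : SC T -> enough_inj -> hom_fg -> cf.
Proof.
move=> h hi hh; have [hT pT hs [d hd]] := h.
have hp Z : syzc d Z -> projective_module Z.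
  by move=> hZ; apply: (syzc_proj (t := 0) _ hZ); rewrite addn0.
suff gen s M : finitely_generated M -> (forall Z, syzc s Z -> E1 Z M) -> lapp M.
  move=> M fM; have [|K [X [i [p [sq hX pK]]]]] := lapp_rapp h hh (M := M).
    by apply: gen fM _ => Z /hp; apply: E1_proj.
  by exists X, p; split=> // Y f hY; apply: E1_lift f (pK Y hY) sq.
elim: s M => [|s IHs] M fM hE.
  have [Z zZ] := zero_ex A; exists M, Z, idfun, \0; split=> //; first exact: ses_id.
  exact: Pf_zero.
have [I [i [fI hI ii]]] := hi M fM; have [N [p sq]] := coker_ses ii.
have pI := fginj_perp hI; have [_ sp _] := sq.
apply: (rapp_lapp fM sq pI); apply: lapp_rapp h hh _; apply: IHs.
  exact: fg_surj sp fI.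
exact: shift_syzc sq pI hE.
Qed.

(** A simple submodule of the cyclic module generated by [x] embeds in some [I i]; an extension of
    this embedding to [X] cannot kill [x]. *)
Lemma cogenerate k (S I : 'I_k -> lmodType A) (j : forall i, {linear S i -> I i}) :
  (forall i, fginj (I i)) -> (forall i, injective (j i)) ->
  forall X (x : X), finitely_generated X -> x <> 0 ->
  (forall N (u : {linear N -> X}), simple_module N -> injective u ->
     (forall y, exists a : A, u y = a *: x) -> exists i, module_iso N (S i)) ->
  exists i (f : {linear X -> I i}), f x <> 0.
Proof.
move=> hI ij X x fX nx hS; have [m hm] := smul_ex x.
have [C [p [i [sp ii ip]]]] := im_ex m.
have fC : finlen C := finlen_inj ii (fg_finlen fA fX).
have nC : ~ is_zero C.
  by move=> z; apply: nx; rewrite -[x]scale1r -hm -ip (z (p 1)) linear0.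
have [N [u [iu sN]]] := simple_sub fC nC.
have [||l /isoP [f [f' [fK _]]]] := hS N (i \o u) sN.
- by move=> y z /= /ii /iu.
- by move=> y /=; have [a ha] := sp (u y); exists a; rewrite -ha ip hm.
have iiu : injective (i \o u) by move=> y z /= /ii /iu.
have [g hg] := hI l N X (i \o u) (j l \o f) fX iiu; exists l, g => gx.
case: sN => nN _; apply: nN => y; have := hg y => /= e.
apply: (can_inj fK); apply: (ij l); rewrite !linear0 -e.
by have [a ha] := sp (u y); rewrite -ha ip hm linearZ_LR gx scaler0.
Qed.

(** Points are separated by maps to the injective modules, and from a module of [Pf] such maps
    factor through the approximations. *)
Lemma minapps_SC k (S I T : 'I_k -> lmodType A) (j : forall i, {linear S i -> I i})
    (phi : forall i, {linear T i -> I i}) :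
  (forall X, simple_module X -> exists i, module_iso X (S i)) ->
  (exists d, findim_le d) -> (forall i, fginj (I i)) -> (forall i, injective (j i)) ->
  (forall i, minapp (phi i)) -> SC (dsum T).
Proof.
move=> hS hd hI ij hphi; have hT i : Pf (T i) by case: (hphi i) => -[].
have pT i : perp (T i) := minapp_inj_perp (hT i).1 (@hI i) (hphi i).
split=> //; first exact: Pf_dsum.
  by move=> Y hY; apply: E1_dsum_r => i; apply: pT.
move=> X hX x nx.
have [|i [f nf]] := cogenerate hI ij hX.1 nx.
  by move=> N u sN _ _; apply: hS.
have [[_ h] _] := hphi i; have [g hg] := h X f hX.
have [u [hu _]] := inj_ex T i; exists (u \o g : {linear _ -> _}) => /= e.
by apply: nf; rewrite -hg -[g x]hu e linear0.
Qed.

Lemma cf_SC : finite_simples -> enough_inj -> cf -> exists T, SC T.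
Proof.
move=> hS hi h; have hd := cf_findim hS h; have [k [S [fS cS]]] := hS.
pose I i := cid (hi (S i) (fS i)).
pose j i := cid (svalP (I i)).
have hj i := svalP (j i).
pose X i := cid (h (sval (I i)) (let: And3 f _ _ := hj i in f)).
pose phi i := cid (svalP (X i)).
pose T i := cid (minapp_ex (svalP (phi i))).
pose psi i := cid (svalP (T i)).
exists (dsum (fun i => sval (T i))).
apply: (@minapps_SC k S (fun i => sval (I i)) _ (fun i => sval (j i)) (fun i => sval (psi i))) => //.
- by move=> i; case: (hj i).
- by move=> i; case: (hj i).
- by move=> i; case: (svalP (psi i)).
Qed.

End Approximations.

(** * Finite length of commutative artinian rings *)

Section CommutativeArtinian.
Variable K : comPzRingType.
Hypothesis hK : artinian_ring K.

Lemma artinian_min (Pr : (K^o -> Prop) -> Prop) :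
  (forall P, Pr P -> submodule P) -> (exists P, Pr P) ->
  exists P, Pr P /\ forall Q, Pr Q -> (forall x, Q x -> P x) -> forall x, P x -> Q x.
Proof.
move=> hs [P0 hP0]; apply: contrapT => hn.
have nx (P : {P | Pr P}) : exists Q : {P | Pr P},
    (forall x, sval Q x -> sval P x) /\ exists x, sval P x /\ ~ sval Q x.
  apply: contrapT => h; apply: hn; exists (sval P); split; first exact: (svalP P).
  move=> Q hQ QP x Px; apply: contrapT => nQ; apply: h.
  by exists (exist _ Q hQ); split=> //; exists x.
pose f P := sval (cid (nx P)).
pose I n := iter n f (exist _ P0 hP0).
have [||N hN] := hK (I := fun n => sval (I n)).
- by move=> k; apply: hs; apply: (svalP (I k)).
- by move=> k x; apply: (svalP (cid (nx (I k)))).1.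
have [x [h1 h2]] := (svalP (cid (nx (I N)))).2.
by apply: h2; apply: (hN N.+1).
Qed.

Lemma scale_ex (M : lmodType K) (c : K) : exists h : {linear M -> M}, forall x, h x = c *: x.
Proof.
by apply: linear_ex => a x y; rewrite scalerDr !scalerA mulrC.
Qed.

Section MinimalBad.
Variable I : lmodType K.
Hypothesis dccI : forall V : nat -> I -> Prop, (forall k, submodule (V k)) ->
  (forall k x, V k.+1 x -> V k x) -> exists N, forall x, V N x -> V N.+1 x.
Hypothesis div : forall c : K, (forall x : I, c *: x = 0) \/ exists d : K, forall x : I, d *: (c *: x) = x.

Let span (s : seq I) (y : I) := exists c : nat -> K, y = \sum_(0 <= j < size s) c j *: s`_j.

(** By [div], scalars act on [I] like elements of a field. An infinite independent sequence would
    give a strictly descending chain of spans of its tails. *)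
Lemma divisible_fg : finitely_generated I.
Proof.
apply: contrapT => nfg.
have ext s : exists x, ~ span s x.
  apply: contrapT => h; apply: nfg; exists (size s), (fun j => s`_j) => x.
  have [c ->] : span s x by apply: contrapT => nx; apply: h; exists x.
  by exists (fun j => c j); rewrite big_mkord.
pose g s := sval (cid (ext s)).
pose L := fix L n := if n is n'.+1 then rcons (L n') (g (L n')) else [::].
pose x n := g (L n).
have Lx n : L n = mkseq x n by elim: n => // n IHn; rewrite mkseqS -IHn.
have indep n (c : nat -> K) : x n <> \sum_(0 <= j < n) c j *: x j.
  move=> e; apply: (svalP (cid (ext (L n)))); exists c.
  apply: (etrans e); rewrite Lx size_mkseq; apply: eq_big_nat => j jn.
  by rewrite nth_mkseq.
pose V k y := exists m (c : nat -> K), y = \sum_(k <= j < m) c j *: x j.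
have [||N hN] := dccI (V := V).
- move=> k; split; first by exists 0%N, (fun=> 0); rewrite big_geq.
    move=> _ _ [m [c ->]] [m' [c' ->]]; exists (maxn m m').
    exists (fun j => (if (j < m)%N then c j else 0) + (if (j < m')%N then c' j else 0)).
    have cut n (d : nat -> K) : (n <= maxn m m')%N ->
        \sum_(k <= j < n) d j *: x j = \sum_(k <= j < maxn m m') (if (j < n)%N then d j else 0) *: x j.
      move=> le; have [kn|nk] := leqP k n.
        rewrite (big_cat_nat kn le) /= [X in _ + X]big_nat [X in _ + X]big1 ?addr0.
          by apply: eq_big_nat => j /andP[_ ->].
        by move=> j /andP[nj _]; rewrite ltnNge nj scale0r.
      rewrite big_geq 1?ltnW // big_nat big1 // => j /andP[kj _].
      by rewrite ltnNge (leq_trans (ltnW nk) kj) scale0r.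
    rewrite (cut m) ?leq_maxl // (cut m') ?leq_maxr // -big_split.
    by apply: eq_bigr => j _; rewrite scalerDl.
  move=> a _ [m [c ->]]; exists m, (fun j => a * c j).
  by rewrite scaler_sumr; apply: eq_bigr => j _; rewrite scalerA.
- move=> k _ [m [c ->]]; have [km|mk] := ltnP k m.
    exists m, (fun j => if j == k then 0 else c j).
    rewrite [RHS]big_ltn // eqxx scale0r add0r; apply: eq_big_nat => j /andP[kj _].
    by rewrite gtn_eqF.
  by exists 0%N, (fun=> 0); rewrite !big_geq // leqW.
have [|m [c]] := hN (x N).
  by exists N.+1, (fun=> 1); rewrite big_nat1 scale1r.
elim: m c => [|m IHm] c.
  rewrite big_geq // => e; apply: (indep N (fun=> 0)); rewrite e big1 // => j _.
  by rewrite scale0r.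
have [Nm|mN] := ltnP N m; last first.
  rewrite big_geq // => e; apply: (indep N (fun=> 0)); rewrite e big1 // => j _.
  by rewrite scale0r.
(* If the last coefficient acts as zero it is dropped; otherwise it is inverted, and [x m] becomes a
   combination of earlier terms. *)
rewrite big_nat_recr //=; have [h0|[d hd]] := div (c m).
  by rewrite h0 addr0; apply: IHm.
move=> e; apply: (indep m (fun j => if (j < N)%N then 0 else if j == N then d else - (d * c j))).
have : d *: (x N - \sum_(N.+1 <= i < m) c i *: x i) = x m.
  by rewrite {1}e addrAC subrr add0r hd.
move=> <-; rewrite (big_cat_nat (leq0n N) (ltnW Nm)) /= [X in _ = X + _]big_nat [X in _ = X + _]big1 => [|j /andP[_ ->]]; last by rewrite scale0r.
rewrite add0r [RHS]big_ltn // ltnn eqxx scalerBr; congr (_ + _).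
rewrite scaler_sumr -sumrN; apply: eq_big_nat => j /andP[Nj _].
by rewrite ltnNge (ltnW Nj) /= gtn_eqF // scaleNr scalerA.
Qed.

Lemma divisible_finlen : finlen I.
Proof.
have [k [p sp]] := (fgP I).1 divisible_fg.
have [ii hii] := dsum_decomp (fun _ : 'I_k => K^o : lmodType K).
pose J i := cid (im_ex (p \o ii i)).
pose q i := cid (svalP (J i)).
pose u i := cid (svalP (q i)).
have hu i := svalP (u i).
have [c hc] := cotuple_ex (fun i => sval (u i)).
apply: (finlen_surj (p := c)).
  move=> x; have [y <-] := sp x.
  have [t ht] := tuple_ex (fun i => sval (q i) \o sval (cid (proj_ex (fun _ : 'I_k => K^o : lmodType K) i))).
  exists (t y); rewrite hc [in RHS](hii y) linear_sum; apply: eq_bigr => i _.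
  rewrite ht /=; case: (hu i) => _ _ -> /=; congr (p (ii i _)).
  by case: cid => /= w ->.
apply: finlen_dsum => i; have [sq iu hq] := hu i.
have gen (z : sval (J i)) : z <> 0 -> forall w, exists b : K, w = b *: z.
  move=> nz w; have [c0 e] := sq z; have [b <-] := sq w.
  have ez (y : K^o) : sval (u i) (sval (q i) y) = (y : K) *: p (ii i 1).
    by rewrite hq /= -!linearZ_LR; congr (p (ii i _)); rewrite -[RHS]/(y * 1 : K) mulr1.
  have [h0|[d hd]] := div c0.
    by case: nz; apply: (inj0 iu); rewrite -e ez h0.
  exists (b * d); apply: iu; rewrite linearZ_LR -e !ez -scalerA.
  by rewrite hd.
exists 1%N => P n [] // {P n} P Q n cQ hP QP [x Px nQx].
move: nQx; case: cQ => // {Q n QP} Q R n cR hQ RQ [y Qy nRy] nQx.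
have [R0 _ _] := chain_sub cR; case: nQx.
have [|b ->] := gen y _ x; first by move=> y0; apply: nRy; rewrite y0.
by case: hQ => _ _; apply.
Qed.

End MinimalBad.

(** Take an ideal [I] minimal among those of infinite length. Multiplication by [c] on [I] cannot
    have both kernel and image proper, so it is zero or surjective; in the second case the chain of
    powers of [c] stabilises and yields an inverse on [I]. So [divisible_finlen] applies and
    contradicts the choice of [I]. *)
Lemma artinian_finlen : finlen K^o.
Proof.
apply: contrapT => nK.
pose Pr (P : K^o -> Prop) := submodule P /\ exists (I : lmodType K) (i : {linear I -> K^o}),
  [/\ injective i, forall x, P x <-> exists y, i y = x & ~ finlen I].
have [||P [[hP [I [i [ii hi nI]]]] mP]] := artinian_min (Pr := Pr); first by move=> P [].
  exists (fun=> True); split; first exact: top_submodule.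
  by exists K^o, idfun; split=> // x; split=> // _; exists x.
have small (X : lmodType K) (v : {linear X -> I}) : injective v -> ~ surjective v -> finlen X.
  move=> iv nsv; apply: contrapT => nX; apply: nsv => x.
  have hPr : Pr (fun y => exists z, (i \o v) z = y).
    split; first exact: im_submodule.
    by exists X, (i \o v : {linear _ -> _}); split=> // y z /ii /iv.
  have [||z /ii e] := mP _ hPr _ (i x) _; last by exists z.
    by move=> _ [z <-]; apply/hi; exists (v z).
  by apply/hi; exists x.
apply: (nI); apply: divisible_finlen.
  move=> V hV dV; have [||N hN] := hK (I := fun k x => exists2 y, V k y & i y = x).
  - move=> k; have [V0 VD VZ] := hV k; split=> [|_ _ [x hx <-] [y hy <-]|c _ [x hx <-]].
    + by exists 0; rewrite ?linear0.
    + by exists (x + y); rewrite ?linearD //; apply: VD.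
    + by exists (c *: x); rewrite ?linearZ_LR //; apply: VZ.
  - by move=> k x [y /dV ? <-]; exists y.
  exists N => x Vx; have [|y Vy /ii <- //] := hN N.+1 (leqnSn N) (i x).
  by exists x.
move=> c; have [m hm] := scale_ex I c.
have [sm|nsm] : surjective m \/ ~ surjective m by apply: EM.
  right; have [||N hN] := hK (I := fun n x => exists y, x = c ^+ n * y).
  - move=> n; split=> [|_ _ [x ->] [y ->]|a _ [x ->]].
    + by exists 0; rewrite mulr0.
    + by exists (x + y); rewrite mulrDr.
    + by exists (a * x); rewrite -[_ *: _]/(_ * _) mulrCA.
  - by move=> n _ [x ->]; exists (c * x); rewrite exprSr mulrA.
  have [|d hd] := hN N.+1 (leqnSn N) (c ^+ N); first by exists 1; rewrite mulr1.
  have dv n (x : I) : exists y, x = c ^+ n *: y.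
    elim: n => [|n [y ->]]; first by exists x; rewrite scale1r.
    by have [z <-] := sm y; exists z; rewrite hm scalerA exprSr.
  exists d => x; have [y ->] := dv N x.
  by rewrite !scalerA; congr (_ *: _); rewrite [RHS]hd exprS -mulrA mulrC.
left=> x; have [J [p [j [sp ij jp]]]] := im_ex m.
have [L [l s]] := ker_ses sp; have [il _ hl] := s.
have fJ : finlen J.
  apply: (small J j ij) => sj; apply: nsm => y; have [z <-] := sj y.
  by have [w <-] := sp z; exists w; rewrite jp.
have [sl|nsl] : surjective l \/ ~ surjective l by apply: EM.
  by have [y <-] := sl x; rewrite -hm -jp (ses0 _ s) linear0.
by case: nI; apply/(finlen_ses s); split=> //; apply: small nsl.
Qed.

End CommutativeArtinian.

(** * Restriction of scalars *)

Section Restriction.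
Variables (A B : pzRingType) (f : {rmorphism A -> B}).

(** The carrier is that of [M]; the phantom argument keeps [f] in the type, where the action of [A]
    is read off. *)
Definition res of {rmorphism A -> B} := fun M : lmodType B => (M : Type).

Section ResModule.
Variable M : lmodType B.
Local Notation R := (res f M).

HB.instance Definition _ := GRing.Zmodule.copy R M.

Definition res_scale (a : A) (x : R) : R := f a *: (x : M).

Lemma res_scaleA a b (x : R) : res_scale a (res_scale b x) = res_scale (a * b) x.
Proof. by rewrite /res_scale scalerA rmorphM. Qed.
Lemma res_scale1 : left_id 1 res_scale.
Proof. by move=> x; rewrite /res_scale rmorph1 scale1r. Qed.
Lemma res_scaleDr : right_distributive res_scale +%R.
Proof. by move=> a x y; rewrite /res_scale scalerDr. Qed.
Lemma res_scaleDl (x : R) : {morph res_scale^~ x : a b / a + b}.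
Proof. by move=> a b; rewrite /res_scale rmorphD scalerDl. Qed.

HB.instance Definition _ := GRing.Zmodule_isLmodule.Build A R
  res_scaleA res_scale1 res_scaleDr res_scaleDl.

Lemma res_scaleE (a : A) (x : R) : a *: x = (f a *: (x : M) : M).
Proof. by []. Qed.

End ResModule.

Definition resm (M : lmodType B) : lmodType A := res f M.

Lemma res_lin (M N : lmodType B) (h : {linear M -> N}) :
  exists g : {linear resm M -> resm N}, forall x : M, g x = h x.
Proof.
have [|g hg] := @linear_ex A (resm M) (resm N) h; last by exists g.
move=> a x y; rewrite -[a *: x + y]/((f a *: (x : M) + (y : M)) : M).
by rewrite linearP.
Qed.

Lemma res_ses (X Y Z : lmodType B) (i : {linear X -> Y}) (p : {linear Y -> Z})
  (i' : {linear resm X -> resm Y}) (p' : {linear resm Y -> resm Z}) :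
  (forall x : X, i' x = i x) -> (forall y : Y, p' y = p y) -> ses i p -> ses i' p'.
Proof.
move=> hi hp [ii sp h]; split=> [x y|z|y].
- by rewrite !hi; apply: ii.
- by have [y hy] := sp z; exists y; rewrite hp.
- rewrite hp; split=> [/h [x hx]|[x hx]]; first by exists x; rewrite hi.
  by apply/h; exists x; rewrite -hi.
Qed.

Lemma chain_res (M : lmodType B) (P : M -> Prop) n :
  chain P n -> chain (P : resm M -> Prop) n.
Proof.
have sr (Q : M -> Prop) : submodule Q -> submodule (Q : resm M -> Prop).
  by case=> Q0 QD QZ; split=> // a x; apply: QZ.
elim=> {P n} [P hP|P Q n cQ IH hP QP h]; first exact/chain0/sr.
exact: chainS IH (sr _ hP) QP h.
Qed.

Lemma res_finlen (M : lmodType B) : finlen (resm M) -> finlen M.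
Proof. by move=> [b hb]; exists b => P n /chain_res /hb. Qed.

Lemma res_fg (M : lmodType B) : finitely_generated (resm M) -> finitely_generated M.
Proof. by move=> [k [g hg]]; exists k, g => x; have [c ->] := hg x; exists (f \o c). Qed.

Lemma res_dsum_fg (M : lmodType B) k : finitely_generated (resm M) ->
  finitely_generated (resm (powm M k)).
Proof.
move=> h; rewrite /powm; elim: k => [|k IHk].
  by apply: fg_zero; apply: dsum0_zero.
have [i [p s]] := dsumS_ses (fun _ : 'I_k.+1 => M).
have [i' hi] := res_lin i; have [p' hp] := res_lin p.
exact: fg_ext (res_ses hi hp s) IHk h.
Qed.

Lemma fg_res (M : lmodType B) : finitely_generated (resm B^o) ->
  finitely_generated M -> finitely_generated (resm M).
Proof.
move=> h /fgP [k [p sp]]; have [p' hp] := res_lin p.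
by apply: (fg_surj (p := p')) (res_dsum_fg k h) => y; have [x hx] := sp y; exists x; rewrite hp.
Qed.

End Restriction.

(** * Groups of homomorphisms *)

Section Hom.
Variables (A : pzRingType) (M N : lmodType A).

Definition lhom := {linear M -> N}.

HB.instance Definition _ := gen_eqMixin lhom.
HB.instance Definition _ := gen_choiceMixin lhom.

Lemma homP (u v : lhom) : (forall x, u x = v x) -> u = v.
Proof.
case: u v => [u [[hu1] [hu2]]] [v [[hv1] [hv2]]] /= uv.
have {}uv : u = v by apply: functional_extensionality_dep.
move: hu1 hu2; rewrite uv => hu1 hu2.
by rewrite (Prop_irrelevance hu1 hv1) (Prop_irrelevance hu2 hv2).
Qed.

Definition hom_zero : lhom := [the {linear M -> N} of \0].
Definition hom_add (u v : lhom) : lhom := [the {linear M -> N} of u \+ v].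
Definition hom_opp (u : lhom) : lhom := [the {linear M -> N} of \- u].

Lemma hom_addA : associative hom_add.
Proof. by move=> u v w; apply: homP => x /=; rewrite addrA. Qed.
Lemma hom_addC : commutative hom_add.
Proof. by move=> u v; apply: homP => x /=; rewrite addrC. Qed.
Lemma hom_add0 : left_id hom_zero hom_add.
Proof. by move=> u; apply: homP => x /=; rewrite add0r. Qed.
Lemma hom_addN : left_inverse hom_zero hom_opp hom_add.
Proof. by move=> u; apply: homP => x /=; rewrite addNr. Qed.

HB.instance Definition _ :=
  GRing.isZmodule.Build lhom hom_addA hom_addC hom_add0 hom_addN.

Lemma hom_sumE (I : Type) (r : seq I) (F : I -> lhom) x :
  (\sum_(i <- r) F i : lhom) x = \sum_(i <- r) F i x.
Proof. by elim: r => [|i r IHr]; rewrite ?big_nil ?big_cons //= -IHr. Qed.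

End Hom.

Lemma endo_sumE (A : pzRingType) (T : lmodType A) (I : Type) (r : seq I) (P : pred I)
  (F : I -> endo T) x : (\sum_(i <- r | P i) F i : endo T) x = \sum_(i <- r | P i) F i x.
Proof.
elim: r => [|i r IHr]; rewrite ?big_nil ?big_cons //.
by case: (P i); rewrite -?IHr.
Qed.

(** * Modules over endomorphism rings *)

Section EndoModules.
Variables (A : pzRingType) (T : lmodType A).

Definition evm_sort := (T : Type).
HB.instance Definition _ := GRing.Zmodule.copy evm_sort T.

Definition evm_scale (u : endo T) (x : evm_sort) : evm_sort := u (x : T).

Lemma evm_scaleA a b x : evm_scale a (evm_scale b x) = evm_scale (a * b) x.
Proof. by []. Qed.
Lemma evm_scale1 : left_id 1 evm_scale.
Proof. by []. Qed.
Lemma evm_scaleDr : right_distributive evm_scale +%R.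
Proof. by move=> a x y; apply: linearD. Qed.
Lemma evm_scaleDl x : {morph evm_scale^~ x : a b / a + b}.
Proof. by []. Qed.

HB.instance Definition _ := GRing.Zmodule_isLmodule.Build (endo T) evm_sort
  evm_scaleA evm_scale1 evm_scaleDr evm_scaleDl.

Definition evm : lmodType (endo T) := evm_sort.

Definition homT_sort (M : lmodType A) := lhom M T.

Section HomT.
Variable M : lmodType A.
Local Notation H := (homT_sort M).
HB.instance Definition _ := GRing.Zmodule.copy H (lhom M T).

Definition homT_scale (u : endo T) (g : H) : H := [the {linear M -> T} of u \o g].

Lemma homT_scaleA a b x : homT_scale a (homT_scale b x) = homT_scale (a * b) x.
Proof. exact: homP. Qed.
Lemma homT_scale1 : left_id 1 homT_scale.
Proof. by move=> x; apply: homP. Qed.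
Lemma homT_scaleDr : right_distributive homT_scale +%R.
Proof. by move=> a x y; apply: homP => z /=; apply: linearD. Qed.
Lemma homT_scaleDl x : {morph homT_scale^~ x : a b / a + b}.
Proof. by move=> a b; apply: homP. Qed.

HB.instance Definition _ := GRing.Zmodule_isLmodule.Build (endo T) H
  homT_scaleA homT_scale1 homT_scaleDr homT_scaleDl.

End HomT.

(** Tilting from the left leads to right modules over End(T)^op, that is, to left modules over
    [endo T]. Hence the functor to use is the contravariant Hom(-, [T]), which sends the regular
    module to [evm T]. *)
Definition homT (M : lmodType A) : lmodType (endo T) := homT_sort M.

End EndoModules.

(** * Artin algebras and finiteness of their homomorphism modules *)

Section ArtinAlgebra.
Variables (A : pzRingType) (K : comPzRingType) (eta : {rmorphism K -> A}).
Hypothesis hK : artinian_ring K.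
Hypothesis central : forall c a, eta c * a = a * eta c.
Hypothesis gens : finitely_generated (resm eta A^o).
Implicit Types M N X Y T : lmodType A.

Definition Kfg M := finitely_generated (resm eta M).

Lemma KfgP M : finitely_generated M <-> Kfg M.
Proof. by split; [apply: fg_res | apply: res_fg]. Qed.

Lemma artin_finlen M : finitely_generated M -> finlen (resm eta M).
Proof. by move=> /KfgP; apply: fg_finlen; apply: artinian_finlen. Qed.

Lemma artin_fA : finlen A^o.
Proof. exact/res_finlen/artin_finlen/fg_free. Qed.

(** The argument [c] keeps the base ring [K] in the type, so that the action of [K] can be attached
    to it. *)
Definition homK_sort (c : K) M N := lhom M N.

Section HomK.
Variables M N : lmodType A.
Local Notation H := (homK_sort 1 M N).
HB.instance Definition _ := GRing.Zmodule.copy H (lhom M N).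

Lemma homK_subproof (c : K) (g : H) : linear (fun x => eta c *: g x).
Proof.
move=> a x y; rewrite linearP scalerDr; congr (_ + _).
by rewrite scalerA central -scalerA.
Qed.

Definition homK_scale (c : K) (g : H) : H :=
  HB.pack (fun x => eta c *: g x) (GRing.isLinear.Build A M N *:%R _ (homK_subproof c g)).

Lemma homK_scaleA a b x : homK_scale a (homK_scale b x) = homK_scale (a * b) x.
Proof. by apply: homP => z /=; rewrite scalerA rmorphM. Qed.
Lemma homK_scale1 : left_id 1 homK_scale.
Proof. by move=> x; apply: homP => z /=; rewrite rmorph1 scale1r. Qed.
Lemma homK_scaleDr : right_distributive homK_scale +%R.
Proof. by move=> a x y; apply: homP => z /=; rewrite -scalerDr. Qed.
Lemma homK_scaleDl x : {morph homK_scale^~ x : a b / a + b}.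
Proof. by move=> a b; apply: homP => z /=; rewrite rmorphD scalerDl. Qed.

HB.instance Definition _ := GRing.Zmodule_isLmodule.Build K H
  homK_scaleA homK_scale1 homK_scaleDr homK_scaleDl.
End HomK.

Definition homK M N : lmodType K := homK_sort 1 M N.

(** A homomorphism is determined by its values on [k] generators, so this is a submodule of a power
    of [N] over [K], and [K] has finite length. *)
Lemma homK_fg M N : finitely_generated M -> finitely_generated N ->
  finitely_generated (homK M N).
Proof.
move=> [k [g hg]] fN.
have [|ev hev] := @linear_ex K (homK M N) (powm (resm eta N) k)
    (fun (u : lhom M N) i => u (g i)).
  by move=> a x y; apply: dsumP.
apply: (fg_sub (artinian_finlen hK) (i := ev)).
  move=> u v; rewrite !hev => e; apply: homP => x; have [c ->] := hg x.
  rewrite !linear_sum; apply: eq_bigr => i _; rewrite !linearZ_LR.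
  by have /(congr1 (fun w => w i)) /= -> := e.
by apply: fg_powm; apply/KfgP.
Qed.

Lemma homK_gens M N : finitely_generated M -> finitely_generated N ->
  exists k (h : 'I_k -> {linear M -> N}), forall f : {linear M -> N},
    exists c : 'I_k -> K, forall x, f x = \sum_i eta (c i) *: h i x.
Proof.
move=> fM fN; have [k [h hh]] := homK_fg fM fN; exists k, h => f.
have [c e] := hh f; exists c => x.
by rewrite [in LHS]e (@hom_sumE A M N 'I_k).
Qed.

Lemma artin_hom_fg : @hom_fg A.
Proof.
move=> X Y fX fY; have [k [h hh]] := homK_gens fX fY; exists k, h => f.
have [c hc] := hh f.
have s i : linear (fun x : X => eta (c i) *: x).
  by move=> a x y; rewrite scalerDr !scalerA central.
exists (fun i => sval (cid (linear_ex (s i)))) => x; rewrite hc.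
by apply: eq_bigr => i _ /=; rewrite (svalP (cid (linear_ex (s i)))) linearZ_LR.
Qed.

Section EndoArtin.
Variable T : lmodType A.
Hypothesis fT : finitely_generated T.

Definition etaT_fun (c : K) : endo T := @homK_scale T T c (idfun : {linear T -> T}).

Lemma etaT_zmod : zmod_morphism etaT_fun.
Proof. by move=> a b; apply: endoP => x /=; rewrite rmorphB scalerBl. Qed.

Lemma etaT_monoid : monoid_morphism etaT_fun.
Proof.
split=> [|a b]; apply: endoP => x /=; first by rewrite rmorph1 scale1r.
by rewrite rmorphM scalerA.
Qed.

HB.instance Definition _ := GRing.isZmodMorphism.Build K (endo T) etaT_fun etaT_zmod.
HB.instance Definition _ := GRing.isMonoidMorphism.Build K (endo T) etaT_fun etaT_monoid.

Definition etaT : {rmorphism K -> endo T} := etaT_fun.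

Lemma etaT_central c (u : endo T) : etaT c * u = u * etaT c.
Proof. by apply: endoP => x /=; rewrite linearZ_LR. Qed.

Lemma homT_fg M : finitely_generated M -> finitely_generated (homT T M).
Proof.
move=> fM; have [k [h hh]] := homK_gens fM fT; exists k, h => f.
have [c hc] := hh f; exists (fun i => etaT (c i)).
apply: homP => x; rewrite hc (@hom_sumE A M T 'I_k).
by apply: eq_bigr => i _.
Qed.

Lemma etaT_gens : finitely_generated (resm etaT (endo T)^o).
Proof.
have [k [h hh]] := homK_gens fT fT; exists k, h => f.
have [c hc] := hh f; exists c; apply: endoP => x; rewrite hc.
by rewrite (@endo_sumE A T 'I_k).
Qed.

End EndoArtin.

End ArtinAlgebra.

(** * Maximal left ideals and the radical *)

Section Radical.
Variable A : pzRingType.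
Hypothesis fA : finlen A^o.

Lemma max_ideal_ex (I : A^o -> Prop) : submodule I -> ~ I 1 ->
  exists I', maximal_left_ideal I' /\ forall x, I x -> I' x.
Proof.
move=> hI nI1; have [b hb] := fA.
pose Pr n := `[< exists Q : A^o -> Prop, [/\ chain Q n, ~ Q 1 & forall x, I x -> Q x] >].
have ex : exists n, Pr n by exists 0%N; apply/asboolP; exists I; split=> //; apply: chain0.
have [|n /asboolP [Q [cQ nQ IQ]] mn] := ex_maxnP (P := Pr) (m := b) ex.
  by move=> n /asboolP [Q [/hb]].
exists Q; split=> //; split=> //; first exact: chain_sub cQ.
move=> I' hI' QI'; have [h1|h1] := pselect (I' 1).
  right=> x; have [_ _ hZ] := hI'; have := hZ x _ h1.
  by rewrite -[_ *: _]/(x * 1) mulr1.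
left=> x I'x; apply: contrapT => nQx.
have : Pr n.+1.
  apply/asboolP; exists I'; split=> // [|y /IQ /QI' //].
  by apply: (chainS cQ) => //; exists x.
by move/mn; rewrite ltnn.
Qed.

Lemma jacobson_left_inv x : jacobson x -> exists u : A, u * (1 - x) = 1.
Proof.
move=> jx; apply: contrapT => h.
have [h0 hm] := smul_ex (1 - x : A^o).
have [||I' [mI' sI']] := @max_ideal_ex (fun y => exists u, h0 u = y).
- exact: im_submodule.
- by case=> u e; apply: h; exists u; rewrite -[RHS]e hm.
have I'x : I' x by apply: jx.
case: mI' => [[_ hD _] nI' _]; apply: nI'.
rewrite -[1](subrK x); apply: hD => //; apply: sI'; exists 1; rewrite hm.
by rewrite -[LHS]/(1 * (1 - x)) mul1r.
Qed.

Lemma simple_ann (S : lmodType A) (x : S) : simple_module S -> x <> 0 ->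
  maximal_left_ideal (fun a : A^o => (a : A) *: x = 0).
Proof.
move=> [nz hS] nx; split.
- split=> [|a b ha hb|a b hb]; first exact: scale0r.
    by rewrite scalerDl ha hb addr0.
  by rewrite -[a *: b]/(a * b) -scalerA hb scaler0.
- by rewrite scale1r.
- move=> I' [h0 hD hZ] sI'.
  have [|h|h] := hS (fun y => exists2 a, I' a & (a : A) *: x = y).
    split=> [|_ _ [a ha <-] [b hb <-]|c _ [a ha <-]].
    - by exists 0 => //; rewrite scale0r.
    - by exists (a + b); rewrite ?scalerDl //; apply: hD.
    - by exists (c *: a); [apply: hZ | rewrite scalerA].
  + by left=> a ha; apply: h; exists a.
  + right=> a; have [b hb e] := h ((a : A) *: x).
    rewrite -(subrK b a); apply: hD => //; apply: sI'.
    by rewrite scalerBl e subrr.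
Qed.

Lemma jacobson_simple (S : lmodType A) a (x : S) : simple_module S -> jacobson a -> a *: x = 0.
Proof.
move=> hS ja; have [->|nx] := pselect (x = 0); first exact: scaler0.
exact: ja (simple_ann hS nx).
Qed.

End Radical.

(** * Basic algebras: simple modules, nilpotency of the radical, injective hulls *)

Section Basic.
Variables (A : pzRingType) (k : nat) (D : 'I_k -> nzRingType) (p : forall i, {rmorphism A -> D i}).
Hypothesis fA : finlen A^o.
Hypothesis hD : forall i, division_ring (D i).
Hypothesis hp : forall y : (forall i, D i), exists x, forall i, p i x = y i.
Hypothesis hJ : forall x, (forall i, p i x = 0) <-> jacobson x.
Implicit Types M N X Y Z Q P U V C I S : lmodType A.

Lemma jacobson_mulr (x a : A) : jacobson x -> jacobson (x * a).
Proof. by move=> /hJ h; apply/hJ => i; rewrite rmorphM h mul0r. Qed.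

Lemma jacobson_mull (x a : A) : jacobson x -> jacobson (a * x).
Proof. by move=> /hJ h; apply/hJ => i; rewrite rmorphM h mulr0. Qed.

Lemma jacobsonD (x y : A) : jacobson x -> jacobson y -> jacobson (x + y).
Proof. by move=> /hJ h /hJ h'; apply/hJ => i; rewrite rmorphD h h' addr0. Qed.

Lemma jacobson0 : jacobson (0 : A).
Proof. by apply/hJ => i; rewrite rmorph0. Qed.

(** Lifts of the unit vectors of the product of division rings. They are orthogonal idempotents
    modulo the radical, which is enough to split modules killed by the radical. *)
Definition unit_lift_ex (i : 'I_k) := cid (hp (fun j => (i == j)%:R)).
Definition ulift i := sval (unit_lift_ex i).

Lemma uliftE i j : p j (ulift i) = (i == j)%:R.
Proof. exact: (svalP (unit_lift_ex i)). Qed.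

Lemma ulift_sum : jacobson (1 - \sum_i ulift i).
Proof.
apply/hJ => j; rewrite rmorphB rmorph1 rmorph_sum (bigD1 j) //= uliftE eqxx.
by rewrite big1 ?addr0 ?subrr // => i ij; rewrite uliftE (negPf ij).
Qed.

Lemma ulift_ker i (a : A) : p i a = 0 -> jacobson (a * ulift i).
Proof.
move=> pa; apply/hJ => j; rewrite rmorphM uliftE.
by have [<-|_] := eqVneq i j; rewrite ?pa ?mul0r ?mulr0.
Qed.

Lemma ulift_decomp M (y : M) : (forall a, jacobson a -> a *: y = 0) ->
  y = \sum_i ulift i *: y.
Proof.
move=> h; apply/eqP; rewrite -subr_eq0 -scaler_suml -{1}[y]scale1r -scalerBl.
by rewrite h //; apply: ulift_sum.
Qed.

Lemma ker_inv M i (z : M) (a : A) : (forall b, p i b = 0 -> b *: z = 0) -> p i a <> 0 ->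
  exists b, (b * a) *: z = z.
Proof.
move=> hz na; have /eqP /(hD (x := p i a)) [d [_ da]] := na.
(* The family with value [d] at [i] and 0 elsewhere; [eq_rect] carries [d] to [D j] along the
   equality of indices. *)
have [b hb] := hp (fun j => if eqP : reflect (i = j) _ is ReflectT e then eq_rect i D d j e else 0).
exists b; apply/eqP; rewrite eq_sym -subr_eq0 -{1}[z]scale1r -scalerBl hz //.
rewrite rmorphB rmorph1 rmorphM hb; case: eqP => // e.
by rewrite (Prop_irrelevance e erefl) /= da subrr.
Qed.

Lemma ker_p_submodule i : submodule (fun a : A^o => p i a = 0).
Proof.
split=> [|a b ha hb|a b hb]; rewrite ?rmorph0 ?rmorphD ?ha ?hb ?addr0 //.
by rewrite rmorphM hb mulr0.
Qed.

Definition tops_ex i := cid (quot_ex (ker_p_submodule i)).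
Definition tops i : lmodType A := sval (tops_ex i).
Definition tops_pi i := sval (cid (svalP (tops_ex i))).

Lemma tops_piP i : surjective (tops_pi i) /\ forall x : A^o, tops_pi i x = 0 <-> p i x = 0.
Proof. exact: (svalP (cid (svalP (tops_ex i)))). Qed.

Lemma simple_tops S i (y : S) : simple_module S -> y <> 0 ->
  (forall b, p i b = 0 -> b *: y = 0) -> module_iso (tops i) S.
Proof.
move=> [nS hS] ny hy; have [m hm] := smul_ex y; have [sp hpi] := tops_piP i.
have [|g hg] := @lin_fact A _ S (tops i) (tops_pi i) m sp.
  by move=> x /hpi /hy; rewrite hm.
have sm : surjective m.
  have [|h|//] := hS (fun z => exists a, m a = z); first exact: im_submodule.
  by case: ny; apply: h; exists 1; rewrite hm scale1r.
exists g; apply/bijP; split=> [|z]; last first.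
  by have [x <-] := sm z; exists (tops_pi i x); rewrite hg.
apply: lin_inj => z; have [x <-] := sp z; rewrite hg hm => e; apply/hpi.
apply: contrapT => nx; have [b hb] := ker_inv hy nx.
by apply: ny; rewrite -hb -scalerA e scaler0.
Qed.

Lemma basic_finite_simples : finite_simples A.
Proof.
exists k, tops; split=> [i|S hS].
  have [sp _] := tops_piP i; exact: fg_surj sp (fg_free A).
have [nS _] := hS; have [x nx] := nonzero_ex nS.
have jx a : jacobson a -> a *: x = 0 by apply: jacobson_simple.
have [i ni] : exists i, ulift i *: x <> 0.
  apply: contrapT => h; apply: nx; rewrite (ulift_decomp jx) big1 // => i _.
  by apply: contrapT => hh; apply: h; exists i.
exists i; apply: iso_sym; apply: (simple_tops hS ni) => b pb.
by rewrite scalerA; apply: jx; apply: ulift_ker pb.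
Qed.

(** J^t annihilates [x], said without forming powers of the ideal; in [t] this is the socle
    filtration. *)
Fixpoint annJ M t (x : M) : Prop := match t with
  | 0 => x = 0
  | t'.+1 => forall a, jacobson a -> annJ t' (a *: x)
  end.

Lemma annJ_submodule M t : submodule (@annJ M t).
Proof.
elim: t => [|t [h0 hDD hZ]] /=.
  by split=> [//|x y -> ->|a x ->]; rewrite ?addr0 ?scaler0.
split=> [a _|x y hx hy a ja|a x hx b jb]; first by rewrite scaler0.
  by rewrite scalerDr; apply: hDD; [apply: hx|apply: hy].
by rewrite scalerA; apply: hx; apply: jacobson_mulr.
Qed.

Lemma annJ_S M t (x : M) : annJ t x -> annJ t.+1 x.
Proof.
elim: t x => [|t IHt] x /=; first by move=> -> a _; rewrite scaler0.
by move=> h a ja; apply: IHt; apply: h.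
Qed.

(** Nilpotency of the radical. While [annJ t] is proper in the ring, the quotient has a simple
    submodule, killed by the radical, so [annJ t.+1] is strictly larger; finite length stops
    this. *)
Lemma annJ_top : exists t, forall M (x : M), annJ t x.
Proof.
suff [t ht] : exists t, forall x : A^o, annJ t x.
  have tr s M (a : A^o) (x : M) : annJ s a -> annJ s ((a : A) *: x).
    elim: s a => [|s IHs] a /=; first by move=> ->; rewrite scale0r.
    by move=> h b jb; rewrite scalerA; apply: (IHs (b * a)); apply: h.
  by exists t => M x; rewrite -[x]scale1r; apply: tr.
apply: contrapT => h; have [b hb] := fA.
have c t : chain (@annJ A^o t) t.
  elim: t => [|t IHt]; first exact/chain0/annJ_submodule.
  apply: (chainS IHt) => [|x|]; [exact: annJ_submodule|exact: annJ_S|].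
  have [Q [q [sq hq]]] := quot_ex (annJ_submodule A^o t).
  have fQ : finlen Q := finlen_surj sq fA.
  have nQ : ~ is_zero Q.
    by move=> z; apply: h; exists t => x; apply/hq; apply: z.
  have [S [i [ii hS]]] := simple_sub fQ nQ.
  have [nS _] := hS; have [x nx] := nonzero_ex nS; have [y hy] := sq (i x).
  exists y => [a ja|/hq y0]; last by apply: nx; apply: (inj0 ii); rewrite -hy.
  by apply/hq; rewrite linearZ_LR hy -linearZ_LR (jacobson_simple _ hS ja) linear0.
by have := hb _ _ (c b.+1); rewrite ltnn.
Qed.

Variables (K : comPzRingType) (eta : {rmorphism K -> A}).
Hypothesis hK : artinian_ring K.
Hypothesis central : forall c a, eta c * a = a * eta c.
Hypothesis gens : finitely_generated (resm eta A^o).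

Lemma jacobson_gens : exists l (j : 'I_l -> A), (forall i, jacobson (j i)) /\
  forall x, jacobson x -> exists c : 'I_l -> K, x = \sum_i eta (c i) * j i.
Proof.
have sJ : submodule (fun x : resm eta A^o => jacobson (x : A)).
  split=> [|x y|a x]; [exact: jacobson0|exact: jacobsonD|].
  by move=> jx; apply: (jacobson_mull (eta a) jx).
have [J [i [ii hi]]] := sub_ex sJ.
have [l [g hg]] : finitely_generated J.
  by apply: (fg_sub (artinian_finlen hK) ii).
exists l, (fun j => i (g j) : A); split=> [j|x /hi [y <-]]; first by apply/hi; exists (g j).
have [c ->] := hg y; exists c; rewrite linear_sum.
by apply: eq_bigr => j _; rewrite linearZ_LR.
Qed.

Definition essential X M (i : {linear X -> M}) :=
  forall y : M, y <> 0 -> exists a x, a *: y = i x /\ i x <> 0.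

(** An essential extension adds nothing to the socle: on elements killed by the kernel of [p j]
    scalars outside that kernel are invertible, so a nonzero multiple lying in [X] can be scaled
    back. *)
Lemma essential_soc X M (i : {linear X -> M}) (y : M) : essential i ->
  annJ 1 y -> exists x, i x = y.
Proof.
move=> he hy; have sI := im_submodule i.
rewrite (ulift_decomp hy); apply: (subm_sum sI) => j.
have hz b : p j b = 0 -> b *: (ulift j *: y) = 0.
  by move=> pb; rewrite scalerA; apply: hy; apply: ulift_ker pb.
have [->|nz] := pselect (ulift j *: y = 0); first by exists 0; rewrite linear0.
have [a [x [e nx]]] := he _ nz.
have na : p j a <> 0 by move=> /hz; rewrite e.
have [b hb] := ker_inv hz na; exists (b *: x).
by rewrite linearZ_LR -e scalerA.
Qed.

Lemma len_powm (R : pzRingType) (X : lmodType R) n : finlen X ->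
  len (powm X n) = (n * len X)%N.
Proof.
move=> fX; rewrite /powm; elim: n => [|n IHn].
  by rewrite mul0n (len_zero (@dsum0_zero _ _)).2.
have [i [q s]] := dsumS_ses (fun _ : 'I_n.+1 => X).
rewrite (len_ses s) ?IHn; last exact: finlen_dsum.
by rewrite mulSn addnC.
Qed.

(** On the part of [M] killed by t+1 factors of the radical, multiplication by its [l] generators
    over [K] maps to [l] copies of the part killed by [t] factors. The kernel is killed by the
    radical, hence lies in [X] by [essential_soc]. This is the recursion for [b]. *)
Lemma essential_bound X : finitely_generated X -> exists b, forall M (i : {linear X -> M}),
  finitely_generated M -> injective i -> essential i -> (len (resm eta M) <= b)%N.
Proof.
move=> fX; have [t0 ht0] := annJ_top; have [l [j [hj gj]]] := jacobson_gens.
pose b := fix b t := if t is t'.+1 then (len (resm eta X) + l * b t')%N else 0%N.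
exists (b t0) => M i fM ii he.
have fKM := artin_finlen hK gens fM.
suff gen t N (u : {linear N -> M}) : injective u ->
    (forall x, annJ t (u x)) -> (len (resm eta N) <= b t)%N.
  by apply: (gen t0 M idfun) => // x y.
elim: t N u => [|t IHt] N u iu hu.
  have z : is_zero (resm eta N) by move=> x; apply: (inj0 iu (hu x)).
  by rewrite (len_zero z).2.
have [U [v [iv hv]]] := sub_ex (annJ_submodule M t).
have [v' hv'] := res_lin eta v; have [u' hu'] := res_lin eta u.
have iv' : injective v' by move=> x y; rewrite !hv'; apply: iv.
have iu' : injective u' by move=> x y; rewrite !hu'; apply: iu.
have lU : (len (resm eta U) <= b t)%N by apply: IHt iv _ => x; apply/hv; exists x.
have sj a : linear (fun x : resm eta N => (j a *: (u x : M) : resm eta M)).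
  move=> c x y; rewrite -[c *: x + y]/((eta c *: (x : N) + (y : N)) : N).
  rewrite linearP scalerDr; congr (_ + _).
  by rewrite -[RHS]/(eta c *: (j a *: u x)) !scalerA central.
pose ja a := cid (linear_ex (sj a)).
have [h0 hh0] : exists h : 'I_l -> {linear resm eta N -> resm eta U},
    forall a x, v (h a x) = j a *: u x.
  have ex a : exists g : {linear resm eta N -> resm eta U}, forall x, v (g x) = j a *: u x.
    have [x|g hg] := @lin_lift K _ _ _ (sval (ja a)) v' iv'.
      rewrite (svalP (ja a)); have /hv [z hz] : annJ t (j a *: u x) by apply: (hu x).
      by exists z; rewrite hv'.
    by exists g => x; rewrite -hv' hg (svalP (ja a)).
  by exists (fun a => sval (cid (ex a))) => a; apply: (svalP (cid (ex a))).
have [h hh] := tuple_ex h0.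
have [I [q [w [sq iw hw]]]] := im_ex h; have [L [m s]] := ker_ses sq.
have fN : finlen (resm eta N) := finlen_inj iu' fKM.
have fU : finlen (resm eta U) := finlen_inj iv' fKM.
rewrite (len_ses s fN); apply: leq_add; last first.
  apply: leq_trans (len_inj iw _) _; first exact: finlen_dsum.
  by rewrite -/(powm _ _) len_powm // leq_mul2l lU orbT.
have [im _ hm] := s; have [i' hi'] := res_lin eta i.
have ii' : injective i' by move=> x y; rewrite !hi'; apply: ii.
have [x|z hz] := @lin_lift K L _ _ (u' \o m) i' ii'.
  have [|y hy] := essential_soc (y := u (m x)) he; last by exists y; rewrite hi' hy /= hu'.
  move=> a /gj [c ->]; rewrite scaler_suml big1 // => f _.
  have e0 : h (m x) = 0 by rewrite -hw (ses0 _ s) linear0.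
  rewrite -scalerA -hh0 -hh e0.
  exact: (etrans (congr1 ( *:%R (eta (c f)) ) (linear0 v)) (scaler0 _ _)).
apply: (len_inj (i := z)); last exact: artin_finlen.
by move=> x y e; apply: im; apply: iu'; have := hz x; rewrite e hz.
Qed.

(** An essential extension [M] of maximal length is injective: push out along an embedding and pass
    to the shortest quotient in which [M] still embeds; that embedding is essential, hence onto by
    maximality. *)
Lemma basic_enough_inj : enough_inj A.
Proof.
move=> X fX; have [b hb] := essential_bound fX.
pose Pr n := `[< exists M (i : {linear X -> M}), [/\ finitely_generated M, injective i,
  essential i & len (resm eta M) = n] >].
have ex : exists n, Pr n.
  exists (len (resm eta X)); apply/asboolP; exists X, idfun; split=> //.
  by move=> y ny; exists 1, y; rewrite scale1r.
have [|n /asboolP [M [i [fM ii he lM]]] mn] := ex_maxnP (P := Pr) (m := b) ex.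
  by move=> n /asboolP [M [i [h1 h2 h3 <-]]]; apply: hb h2 h3.
exists M, i; split=> // U V u f fV iu.
have [C [c su]] := coker_ses iu.
have [Q [a [q [g [sa gu _ _]]]]] := pushout_ses f su; have [ia _ _] := sa.
have fC : finitely_generated C by have [_ sc _] := su; apply: fg_surj sc fV.
have fQ : finlen Q := fg_finlen fA (fg_ext sa fM fC).
pose Pq m := `[< exists Q' (r : {linear Q -> Q'}), [/\ surjective r, injective (r \o a) & len Q' = m] >].
have exq : exists m, Pq m.
  exists (len Q); apply/asboolP; exists Q, idfun; split=> // y; by exists y.
have [m /asboolP [Q' [r [sr ira lQ']]] mm] := ex_minnP exq.
have fQ' : finlen Q' := finlen_surj sr fQ.
have era : essential (r \o a : {linear _ -> _}).
  move=> y ny; apply: contrapT => hn.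
  have [h hh] := smul_ex y; have [Q2 [r2 [sr2 hr2]]] := quot_ex (im_submodule h).
  have /mm : Pq (len Q2).
    apply/asboolP; exists Q2, (r2 \o r : {linear _ -> _}); split=> //.
      by move=> z; have [w <-] := sr2 z; have [x <-] := sr w; exists x.
    apply: lin_inj => x /= /hr2 [d]; rewrite hh => e.
    apply: (inj0 ira); apply: contrapT => nx; apply: hn.
    by exists d, x; rewrite e.
  rewrite -lQ' => /(surj_len_inj sr2 fQ') ir2; apply: ny; apply: (inj0 ir2).
  by apply/hr2; exists 1; rewrite hh scale1r.
have : Pr (len (resm eta Q')).
  apply/asboolP; exists Q', (r \o a \o i : {linear _ -> _}); split=> //.
  - exact: finlen_fg fQ'.
  - by move=> x y /= /ira /ii.
  - move=> y ny; have [d [x [e nx]]] := era y ny.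
    have nx' : x <> 0 by move=> x0; apply: nx; rewrite x0 linear0.
    have [d' [x' [e' nx2]]] := he x nx'; exists (d' * d), x'.
    rewrite -scalerA e -linearZ_LR e'; split=> // /= e0; apply: nx2.
    exact: (inj0 ira).
move/mn; rewrite -lM => le; have [ra hra] := res_lin eta (r \o a : {linear M -> Q'}).
have sra : surjective (r \o a).
  have ira' : injective ra by move=> x z; rewrite !hra; apply: ira.
  have fKQ := artin_finlen hK gens (finlen_fg fQ').
  move=> y; have [x hx] := inj_len_surj ira' fKQ le y.
  by exists x; rewrite -hra.
have [s [h1 h2]] := bij_inv ira sra.
exists (s \o r \o g : {linear _ -> _}) => x /=; rewrite gu.
exact: h1.
Qed.

End Basic.

(** * Ring isomorphisms; opposite rings and corners of basic algebras *)

Section RingIso.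
Implicit Types B C : pzRingType.

Lemma rm_ex B C (f : B -> C) : f 1 = 1 -> (forall x y, f (x - y) = f x - f y) ->
  (forall x y, f (x * y) = f x * f y) -> exists g : {rmorphism B -> C}, forall x, g x = f x.
Proof.
move=> h1 hB hM.
exists (HB.pack_for {rmorphism B -> C} f (GRing.isZmodMorphism.Build B C f hB)
   (GRing.isMonoidMorphism.Build B C f (conj h1 hM))).
by [].
Qed.

Lemma ring_isoP B C : ring_iso B C <->
  exists (f : {rmorphism B -> C}) (g : {rmorphism C -> B}), cancel f g /\ cancel g f.
Proof.
split=> [[f [g fK gK]]|[f [g [fK gK]]]]; last by exists f, g.
have fi := can_inj fK; have [|||g' hg'] := @rm_ex C B g.
- by apply: fi; rewrite gK rmorph1.
- by move=> x y; apply: fi; rewrite gK rmorphB !gK.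
- by move=> x y; apply: fi; rewrite gK rmorphM !gK.
by exists f, g'; split=> x; rewrite hg'.
Qed.

Lemma ring_iso_refl B : ring_iso B B.
Proof. by exists idfun, idfun. Qed.

Lemma ring_iso_sym B C : ring_iso B C -> ring_iso C B.
Proof. by case/ring_isoP=> f [g [fK gK]]; exists g, f. Qed.

Lemma ring_iso_trans B C (D : pzRingType) : ring_iso B C -> ring_iso C D -> ring_iso B D.
Proof. by case=> f bf [g bg]; exists (g \o f : {rmorphism B -> D}); apply: bij_comp. Qed.

Lemma ring_iso_conv B C : ring_iso B C -> ring_iso B^c C^c.
Proof.
case/ring_isoP=> f [g [fK gK]]; have [|||h hh] := @rm_ex B^c C^c f.
- exact: (rmorph1 f).
- exact: (rmorphB f).
- by move=> x y; apply: (rmorphM f y x).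
by exists h; exists g => x; rewrite ?hh ?fK // -[RHS]gK -hh.
Qed.

Lemma conv_conv B : ring_iso (B^c)^c B.
Proof. by have [|||h hh] := @rm_ex (B^c)^c B id => //; exists h; exists id => x; rewrite hh. Qed.

Lemma artin_iso B C : ring_iso B C -> artin_algebra B -> artin_algebra C.
Proof.
move=> [f [g fK gK]] [K [eta [hK hc [k [h hh]]]]].
exists K, (f \o eta : {rmorphism K -> C}); split=> //= [c a|].
  by rewrite -[a]gK -!rmorphM hc.
exists k, (fun i => f (h i)) => a; have [c e] := hh (g a); exists c.
by rewrite -[a]gK e rmorph_sum; apply: eq_bigr => i _; rewrite rmorphM.
Qed.

Lemma artin_conv B : artin_algebra B -> artin_algebra B^c.
Proof.
move=> [K [eta [hK hc [k [h hh]]]]].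
have [|||f hf] := @rm_ex K B^c eta.
- exact: (rmorph1 eta).
- exact: (rmorphB eta).
- by move=> x y; rewrite rmorphM; apply: hc.
exists K, f; split=> // [c a|]; first by rewrite hf; apply: esym; apply: hc.
exists k, h => a; have [c ->] := hh a; exists c.
by apply: eq_bigr => i _; rewrite hf; apply: hc.
Qed.

(** [jacobson] refers to maximal left ideals, which are awkward to move between rings. Left
    quasi-regularity of the kernel can be checked elementwise for opposite rings, corners and
    endomorphism rings. *)
Lemma basic_crit B (k : nat) (D : 'I_k -> nzRingType) (p : forall i, {rmorphism B -> D i}) :
  (forall i, division_ring (D i)) ->
  (forall y : (forall i, D i), exists x, forall i, p i x = y i) ->
  (forall x, (forall i, p i x = 0) -> exists u, u * (1 - x) = 1) ->
  forall x, (forall i, p i x = 0) <-> jacobson x.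
Proof.
move=> hD hp hu x; split=> [hx I mI|jx i].
  have [hI nI1 hmax] := mI; have [h0 hDD hZ] := hI.
  have [||h|h] := hmax (fun y => exists a b, I a /\ y = a + b * x).
  - split=> [|_ _ [a [b [ha ->]]] [a' [b' [ha' ->]]]|c _ [a [b [ha ->]]]].
    + by exists 0, 0; rewrite mul0r addr0.
    + exists (a + a'), (b + b'); split; first exact: hDD.
      by rewrite mulrDl addrACA.
    + exists (c * a), (c * b); split; first exact: (hZ c a).
      by rewrite -[LHS]/(c * (a + b * x)) mulrDr mulrA.
  - by move=> y hy; exists y, 0; rewrite mul0r addr0.
  - by apply: h; exists 0, 1; rewrite add0r mul1r.
  have [a [b [ha e]]] := h 1; case: nI1.
  have [|u hu1] := hu (b * x); first by move=> i; rewrite rmorphM hx mulr0.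
  rewrite -hu1; apply: (hZ u); rewrite (_ : 1 - b * x = a) //.
  by rewrite [X in X - _]e addrK.
apply: (jx (fun a : B^o => p i a = 0)); split.
- split=> [|a b ha hb|a b hb]; rewrite ?rmorph0 ?rmorphD ?ha ?hb ?addr0 //.
  by rewrite rmorphM hb mulr0.
- by rewrite rmorph1 => /eqP; rewrite oner_eq0.
- move=> I' [h0 hDD hZ] sI'; have [h|h] := pselect (forall y, I' y -> p i y = 0); first by left.
  right=> y; have [a [Ia na]] : exists a, I' a /\ p i a <> 0.
    by apply: contrapT => hn; apply: h => b Ib; apply: contrapT => nb; apply: hn; exists b.
  have /eqP /(hD i (p i a)) [d [_ da]] := na.
  have [b hb] : exists b, p i b = d.
    have [b hb] := hp (fun j => if eqP : reflect (i = j) _ is ReflectT e then eq_rect i D d j e else 0).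
    exists b; rewrite hb; case: eqP => // e.
    by rewrite (Prop_irrelevance e erefl).
  have e : I' (1 - b * a) by apply: sI'; rewrite rmorphB rmorph1 rmorphM hb da subrr.
  have e1 : I' 1.
    by rewrite -(subrK (b * a) 1); apply: hDD => //; apply: (hZ b).
  by have := hZ y 1 e1; rewrite -[_ *: _]/(y * 1) mulr1.
Qed.

Lemma basic_iso B C : finlen B^o -> ring_iso B C -> basic_algebra B -> basic_algebra C.
Proof.
move=> fB /ring_isoP [f [g [fK gK]]] [k [D [p [hD hp hJ]]]].
exists k, D, (fun i => p i \o g : {rmorphism C -> D i}).
have hp' (y : forall i, D i) : exists x, forall i, (p i \o g) x = y i.
  by have [x hx] := hp y; exists (f x) => i; rewrite -(hx i); congr (p i _); apply: fK.
split=> //; apply: basic_crit => // x hx.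
have /hJ /(jacobson_left_inv fB) [u hu] : forall i, p i (g x) = 0 by [].
by exists (f u); apply: (can_inj gK); rewrite rmorphM fK rmorphB rmorph1 hu.
Qed.

Lemma basic_conv B : finlen B^o -> basic_algebra B -> basic_algebra B^c.
Proof.
move=> fB [k [D [p [hD hp hJ]]]].
have ex i : exists g : {rmorphism B^c -> (D i)^c}, forall x, g x = p i x.
  by apply: rm_ex => [|x y|x y]; [apply: (rmorph1 (p i))|apply: (rmorphB (p i))|apply: (rmorphM (p i) y x)].
pose q i := sval (cid (ex i)).
have hq i x : q i x = p i x by apply: (svalP (cid (ex i))).
exists k, (fun i => (D i)^c), q.
have hD' i : division_ring (D i)^c.
  by move=> x /(hD i) [y [h1 h2]]; exists y.
have hq' (y : forall i, (D i)^c) : exists x, forall i, q i x = y i.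
  by have [x hx] := hp y; exists x => i; rewrite hq hx.
split=> //; apply: basic_crit => // x hx.
have /hJ /(jacobson_left_inv fB) [u hu] : forall i, p i x = 0 by move=> i; rewrite -hq hx.
(* A left inverse [u] of [1 - x] is 1 modulo the radical, hence itself left invertible; so [u] is a
   two-sided inverse, as the opposite ring requires. *)
have hu' : u = 1 + u * x by rewrite -hu mulrBr mulr1 subrK.
have [|v hv] := @jacobson_left_inv B fB (1 - u).
  by apply/hJ => i; rewrite hu' opprD addrA subrr sub0r rmorphN rmorphM -(hq i x) hx mulr0 oppr0.
have e : v * u = 1 by rewrite -hv opprB addrC subrK.
have : v * (u * (1 - (x : B))) = 1 - (x : B) by rewrite mulrA e mul1r.
rewrite hu mulr1 => e2; exists u.
exact: (etrans (congr1 (fun z : B => z * u) (esym e2)) e).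
Qed.

Lemma basic_corner B (e : B) (he : idempotent_elt e) : finlen B^o ->
  basic_algebra B -> basic_algebra (corner he).
Proof.
move=> fB [k [D [p [hD hp hJ]]]].
have pe i : p i e = 0 \/ p i e = 1.
  have [|/eqP ne] := pselect (p i e = 0); first by left.
  right; have [d [_ de]] := hD i _ ne.
  have : p i e * p i e = p i e by rewrite -rmorphM he.
  by move=> /(congr1 (fun z => d * z)); rewrite mulrA de mul1r.
(* An idempotent maps to 0 or 1 in a division ring; the factors of the corner are those in which [e]
   maps to 1. *)
pose I := [pred i | p i e == 1].
pose D' (j : 'I_#|I|) := D (enum_val j).
have ev (j : 'I_#|I|) : p (enum_val j) e = 1 by have := enum_valP j; rewrite inE => /eqP.
have ex (j : 'I_#|I|) : exists g : {rmorphism corner he -> D' j}, forall x, g x = p (enum_val j) (val x).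
  by apply: rm_ex => [|x y|x y]; [apply: ev|apply: (rmorphB (p (enum_val j)) (val x) (val y))|apply: (rmorphM (p (enum_val j)) (val x) (val y))].
pose q j := sval (cid (ex j)).
have hq j x : q j x = p (enum_val j) (val x) by apply: (svalP (cid (ex j))).
exists #|I|, D', q.
have hq' (y : forall i, D' i) : exists x, forall i, q i x = y i.
  have sel j : exists a, forall l, p l a = if eqP : reflect (enum_val j = l) _ is ReflectT e0
     then eq_rect (enum_val j) D (y j) l e0 else 0 by apply: hp.
  pose x0 := e * (\sum_j sval (cid (sel j))) * e.
  have hx0 : x0 \in peirce_pred e e by apply/andP; rewrite /x0 !mulrA he -!mulrA he.
  exists (exist _ x0 hx0) => l; rewrite hq /= !rmorphM ev mul1r mulr1 rmorph_sum (bigD1 l) //=.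
  rewrite big1 ?addr0 => [|j jl]; rewrite (svalP (cid (sel _))); case: eqP => //.
    by move=> e0; rewrite (Prop_irrelevance e0 erefl).
  by move=> e0; exfalso; move: jl; rewrite (enum_val_inj e0) eqxx.
split=> // [j|]; first exact: hD.
apply: basic_crit => // [j|x hx]; first exact: hD.
have [ex1 xe1] := peirceP x.
have /hJ /(jacobson_left_inv fB) [u hu] : forall i, p i (val x) = 0.
  move=> i; have [h0|h1] := pe i; first by rewrite -ex1 rmorphM h0 mul0r.
  have hi : i \in I by apply/eqP.
  have h2 (j : 'I_#|I|) l : enum_val j = l -> p l (val x) = 0.
    by move=> <-; apply: (etrans (esym (hq j x))); apply: hx.
  exact: h2 (enum_rankK_in hi hi).
have hu0 : e * u * e \in peirce_pred e e by apply/andP; rewrite !mulrA he -!mulrA he.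
exists (exist _ (e * u * e) hu0); apply: val_inj => /=.
rewrite -[RHS]/e -[X in _ * X]/(e - val x).
have -> : e * u * e * (e - val x) = e * (u * (1 - val x)) * e.
  by rewrite -!mulrA; congr (_ * (_ * _)); rewrite mulrBr mulrBl mul1r he ex1 xe1.
by rewrite hu mulr1 he.
Qed.

Lemma artin_data B : artin_algebra B -> finlen B^o /\ @hom_fg B.
Proof.
move=> [K [eta [hK hc hg]]]; split; first exact: (artin_fA hK hg).
exact: (@artin_hom_fg B K eta hK hc hg).
Qed.

Lemma artin_endo B (T : lmodType B) : artin_algebra B -> finitely_generated T ->
  artin_algebra (endo T).
Proof.
move=> [K [eta [hK hc hg]]] fT; exists K, (etaT hc T); split=> //.
  by move=> c u; apply: etaT_central.
exact: (@etaT_gens B K eta hK hc hg T fT).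
Qed.

Lemma basic_data B : artin_algebra B -> basic_algebra B ->
  finite_simples B /\ enough_inj B.
Proof.
move=> [K [eta [hK hc hg]]] [k [D [p [hD hp hJ]]]].
have fB := artin_fA hK hg; split; first exact: (basic_finite_simples hD hp hJ).
exact: (@basic_enough_inj B k D p fB hD hp hJ K eta hK hc hg).
Qed.

Lemma cf_strong B : artin_algebra B -> basic_algebra B -> cf B -> exists T : lmodType B, strong T.
Proof.
move=> hA hB h; have [fB _] := artin_data hA; have [hs hi] := basic_data hA hB.
by have [T hT] := cf_SC fB hs hi h; exists T; apply: SC_strong.
Qed.

Lemma strong_cf B (T : lmodType B) : artin_algebra B -> basic_algebra B -> strong T -> cf B.
Proof.
move=> hA hB h; have [fB hh] := artin_data hA; have [hs hi] := basic_data hA hB.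
exact: SC_cf (strong_SC fB h) hi hh.
Qed.

End RingIso.

(** * Quotient rings *)

Section QuotientRing.
Variables (R : pzRingType) (I : R^o -> Prop).
Hypothesis hI : submodule I.
Hypothesis hr : forall a x : R, I x -> I (x * a).
Hypothesis h1 : ~ I 1.

Definition qring of ~ I 1 & (forall a x : R, I x -> I (x * a)) := quot hI.
Local Notation Q := (qring h1 hr).

HB.instance Definition _ := GRing.Zmodule.copy Q (quot hI).

Definition qring_mul (x y : Q) : Q := qpi hI (sval x * sval y : R).

Lemma qring_pi (x y : R) : qring_mul (qpi hI x) (qpi hI y) = qpi hI (x * y : R).
Proof.
have [_ hDD hZ] := hI.
apply/qpi_eq => /=; set x' := qrep _ _; set y' := qrep _ _.
have -> : x' * y' - x * y = - ((x - x') * y') - x * (y - y').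
  by rewrite mulrBl mulrBr opprB opprB addrA subrK.
apply: (submB hI); first exact: (submN hI (hr _ (qrepP hI x))).
exact: (hZ x _ (qrepP hI y)).
Qed.

Lemma qring_ind (P : Q -> Prop) : (forall x : R, P (qpi hI x)) -> forall q, P q.
Proof. by move=> h q; rewrite -(qpi_val q). Qed.

Lemma qring_mulA : associative qring_mul.
Proof.
elim/qring_ind=> x; elim/qring_ind=> y; elim/qring_ind=> z.
by rewrite !qring_pi mulrA.
Qed.
Lemma qring_mul1l : left_id (qpi hI (1 : R)) qring_mul.
Proof. by elim/qring_ind=> x; rewrite qring_pi mul1r. Qed.
Lemma qring_mul1r : right_id (qpi hI (1 : R)) qring_mul.
Proof. by elim/qring_ind=> x; rewrite qring_pi mulr1. Qed.
Lemma qring_mulDl : left_distributive qring_mul +%R.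
Proof.
elim/qring_ind=> x; elim/qring_ind=> y; elim/qring_ind=> z.
by rewrite [_ + _]qpi_add !qring_pi [RHS]qpi_add mulrDl.
Qed.
Lemma qring_mulDr : right_distributive qring_mul +%R.
Proof.
elim/qring_ind=> x; elim/qring_ind=> y; elim/qring_ind=> z.
by rewrite [_ + _]qpi_add !qring_pi [RHS]qpi_add mulrDr.
Qed.
Lemma qring_nz : (qpi hI (1 : R) : Q) != 0.
Proof. by apply/eqP => /qpi_eq; rewrite subr0; apply: h1. Qed.

HB.instance Definition _ := GRing.Zmodule_isNzRing.Build Q
  qring_mulA qring_mul1l qring_mul1r qring_mulDl qring_mulDr qring_nz.

Definition qring_nzRing : nzRingType := Q.

End QuotientRing.

Lemma quot_ring_ex (R : pzRingType) (I : R^o -> Prop) : submodule I ->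
  (forall a x : R, I x -> I (x * a)) -> ~ I 1 ->
  exists (D : nzRingType) (p : {rmorphism R -> D}), surjective p /\ forall x, p x = 0 <-> I x.
Proof.
move=> hI hr h1; exists (qring_nzRing hI hr h1).
have [|||p hp] := @rm_ex R (qring_nzRing hI hr h1) (qpi hI).
- by [].
- by move=> x y; rewrite -[RHS]/((qpi hI x + - qpi hI y : quot hI)) -[- qpi hI y]/(quot_opp (qpi hI y)) qpiN qpi_add.
- by move=> x y; rewrite -[RHS]/(@qring_mul R I hI hr h1 (qpi hI x) (qpi hI y)) qring_pi.
exists p; split=> [q|x]; first by exists (sval q); rewrite hp; apply: (qpi_val q).
by rewrite hp -[0]/(qpi hI 0) qpi_eq subr0.
Qed.

(** * Endomorphism rings of multiplicity-free modules *)

Section EndoBasic.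
Variables (A : pzRingType).
Implicit Types M N X Y I : lmodType A.

Section Coordinates.
Variables (t : nat) (F : 'I_t -> lmodType A).

Definition dpj i := sval (cid (proj_ex F i)).
Definition din i := sval (cid (inj_ex F i)).

Lemma dpjE i x : dpj i x = x i.
Proof. exact: (svalP (cid (proj_ex F i))). Qed.

Lemma dpj_in i x : dpj i (din i x) = x.
Proof. by rewrite dpjE; apply: (svalP (cid (inj_ex F i))).1. Qed.

Lemma dpj_in0 i j x : j != i -> dpj j (din i x) = 0.
Proof. by rewrite dpjE; apply: (svalP (cid (inj_ex F i))).2. Qed.

Lemma din_sum x : x = \sum_i din i (dpj i x).
Proof.
apply: dsumP => j; rewrite -!dpjE linear_sum (bigD1 j) //= dpj_in big1 ?addr0 //.
by move=> i ij; rewrite dpj_in0 // eq_sym.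
Qed.

Definition deps i : endo (dsum F) := [the {linear dsum F -> dsum F} of din i \o dpj i].

End Coordinates.

Lemma indec_retract_ex I : finlen I -> ~ is_zero I ->
  exists X, indecomposable X /\ retract X I.
Proof.
move=> fI nI; have [[|p s] [h1 h2]] := decomposition fI.
  by case: nI => x; rewrite [x]h2 big_nil.
have [|hX e] := h1 p; first by left.
by exists (projT1 p); split=> //; exists (projT2 p).2, (projT2 p).1.
Qed.

Variables (t : nat) (F : 'I_t -> lmodType A).
Hypothesis fF : forall i, finlen (F i).
Hypothesis iF : forall i, indecomposable (F i).
Hypothesis nF : forall i j, module_iso (F i) (F j) -> i = j.

Definition nonunit i (u : endo (F i)) := ~ bijective u.

Lemma nonunit_submodule i : submodule (@nonunit i : (endo (F i))^o -> Prop).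
Proof.
split=> [b0|u v hu hv buv|a u hu bau].
- case: (iF i) => nz _; apply: nz => x; have /bijP [i0 _] := b0; exact: i0.
- have [|[] //] := @local_sum A (F i) bool [:: true; false] (fun b => if b then u else v) (u + v) (fF i) (iF i) buv.
  by move=> x; rewrite big_cons big_seq1.
- apply: hu; apply: endo_bij => //; apply: lin_inj => x ux.
  have /bijP [ib _] := bau; apply: ib; rewrite linear0.
  by rewrite -[LHS]/(a (u x)) ux linear0.
Qed.

Lemma nonunit_mulr i (a u : endo (F i)) : nonunit u -> nonunit (u * a).
Proof.
move=> hu /bijP [_ sb]; apply: hu; apply: endo_surj_bij => // y.
by have [x hx] := sb y; exists (a x).
Qed.

Lemma nonunit1 i : ~ nonunit (1 : endo (F i)).
Proof. by case; exists id. Qed.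

Lemma nonunit_comp i j (a : {linear F i -> F j}) (b : {linear F j -> F i}) :
  i != j -> nonunit ([the {linear F i -> F i} of b \o a] : endo (F i)).
Proof.
move=> ij hb; have [nz _] := iF i.
have := nF (indec_retract_iso nz (iF j) (bij_retract hb)).
by move/eqP; rewrite (negPf ij).
Qed.

(** The factor [D i] is the local ring End([F i]) modulo its nonunits, and [p i] takes the diagonal
    entry. It is multiplicative because a map through some [F j] with [j] different from [i] is a
    nonunit of End([F i]). *)
Lemma endo_basic : exists (D : 'I_t -> nzRingType)
    (p : forall i, {rmorphism endo (dsum F) -> D i}),
  [/\ forall i, division_ring (D i),
      forall y : (forall i, D i), exists x, forall i, p i x = y i,
      forall x, (forall i, p i x = 0) <-> jacobson x
    & forall i j, p i (deps F j) = (i == j)%:R].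
Proof.
pose q i := cid (quot_ring_ex (nonunit_submodule i) (@nonunit_mulr i) (@nonunit1 i)).
pose D i := sval (q i); pose r i := sval (cid (svalP (q i))).
have hr i : surjective (r i) /\ forall x, r i x = 0 <-> nonunit x := svalP (cid (svalP (q i))).
pose f i (u : endo (dsum F)) : endo (F i) := [the {linear F i -> F i} of dpj F i \o u \o din F i].
have ex i : exists g : {rmorphism endo (dsum F) -> D i}, forall u, g u = r i (f i u).
  apply: rm_ex => [|u v|u v].
  - rewrite -[RHS](rmorph1 (r i)); congr (r i _); apply: endoP => x.
    by rewrite /= dpj_in.
  - rewrite -rmorphB; congr (r i _); apply: endoP => x.
    by rewrite /= linearB.
  - rewrite -rmorphM; apply/eqP; rewrite -subr_eq0 -rmorphB; apply/eqP/(hr i).2.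
    have e : f i (u * v) - f i u * f i v = \sum_(j | j != i)
       ([the {linear F i -> F i} of (dpj F i \o u \o din F j) \o (dpj F j \o v \o din F i)] : endo (F i)).
      apply: endoP => x; rewrite endo_sumE /= -[LHS]/(dpj F i (u (v (din F i x))) - dpj F i (u (din F i (dpj F i (v (din F i x)))))).
      rewrite {1}[v (din F i x)]din_sum !linear_sum (bigD1 i) //=.
      by rewrite addrAC subrr add0r.
    rewrite e; have [n0 nD _] := nonunit_submodule i.
    apply: (big_ind (fun u : (endo (F i))^o => nonunit (u : endo (F i)))) => // j ij.
    by apply: nonunit_comp; rewrite eq_sym.
pose p i := sval (cid (ex i)).
have hp i u : p i u = r i (f i u) := svalP (cid (ex i)) u.
exists D, p.
have hD i : division_ring (D i).
  move=> x /eqP nx; have [u hu] := (hr i).1 x.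
  have bu : bijective u by apply: contrapT => h; apply: nx; rewrite -hu; apply/(hr i).2.
  have /bijP [i1 s1] := bu; have [v [uv vu]] := bij_inv i1 s1.
  exists (r i (v : endo (F i))); rewrite -hu -!rmorphM -(rmorph1 (r i)).
  by split; congr (r i _); apply: endoP => z /=; rewrite ?uv ?vu.
have hs (y : forall i, D i) : exists x, forall i, p i x = y i.
  pose s i := sval (cid ((hr i).1 (y i))).
  have hsi i : r i (s i) = y i := svalP (cid ((hr i).1 (y i))).
  exists (\sum_j ([the {linear dsum F -> dsum F} of din F j \o s j \o dpj F j] : endo (dsum F))) => i.
  rewrite hp -hsi; congr (r i _); apply: endoP => x /=.
  rewrite endo_sumE linear_sum (bigD1 i) //= !dpj_in big1 ?addr0 // => j ji.
  by rewrite dpj_in0 // eq_sym.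
have he i j : p i (deps F j) = (i == j)%:R.
  rewrite hp; have [<-|ij] := eqVneq i j.
    rewrite -(rmorph1 (r i)); congr (r i _); apply: endoP => x /=.
    by rewrite !dpj_in.
  apply: (etrans _ (rmorph0 (r i))); congr (r i _); apply: endoP => x /=.
  by rewrite dpj_in0 ?linear0.
split=> //; apply: basic_crit => // x hx.
have fT : finlen (dsum F) := finlen_dsum fF.
(* An element [x] killed by all [p i] is nilpotent: otherwise its Fitting image contains some [F k]
   as a summand, and the idempotent of [F k] factors through a power of [x], although [p k] sends
   that idempotent to 1. *)
have [n [I [a [b [s [n0 sa ib ba hsI]]]]]] := fitting x fT.
have [v hv] : exists v : {linear dsum F -> dsum F}, forall z, v z = z - x z.
  by exists (idfun \+ \- (x : {linear dsum F -> dsum F})).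
have [zI|nI] := pselect (is_zero I).
  have xn z : iter n x z = 0 by rewrite -ba (zI (a z)) linear0.
  have iv : injective v.
    by apply: (nil_one_sub (u := x) xn) => z; rewrite hv addrC subrK.
  have /bijP [i1 s1] := endo_bij fT iv; have [w [h1 h2]] := bij_inv i1 s1.
  exists (w : endo (dsum F)); apply: endoP => z; rewrite /= -[RHS]h1 hv.
  by [].
have fI := finlen_surj sa fT; have [X [hX [c [d cd]]]] := indec_retract_ex fI nI.
have fX : finlen X := finlen_inj (can_inj cd) fI.
have rI : retract I (dsum F) by exists b, (s \o a : {linear _ -> _}) => z; apply: hsI.
have [k rk] : exists k, retract X (F k).
  by apply: indec_dsum fX hX _; apply: retract_trans rI; exists c, d.
have /iso_sym /isoP [g [g' [gK g'K]]] := indec_retract_iso hX.1 (iF k) rk.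
have [y hy] := lin_iter x n.
have py l : p l y = 0.
  have -> : (y : endo (dsum F)) = (x : endo (dsum F)) ^+ n.
    apply: endoP => z; rewrite hy; elim: n {n0 ba hy y} z => // m IHm z.
    by rewrite exprS iterS IHm.
  by rewrite rmorphXn hx expr0n gtn_eqF.
pose L : endo (dsum F) := [the {linear dsum F -> dsum F} of din F k \o g' \o d \o s \o s \o a].
pose R : endo (dsum F) := [the {linear dsum F -> dsum F} of b \o c \o g \o dpj F k].
have : p k (L * (y : endo (dsum F)) * R) = 0 by rewrite !rmorphM py mulr0 mul0r.
have -> : L * (y : endo (dsum F)) * R = deps F k.
  apply: endoP => z; rewrite /= hy -ba; congr (din F k _).
  have h1 w : s (a (b w)) = w := hsI w.
  by rewrite !h1 cd gK.
by rewrite he eqxx => /eqP; rewrite oner_eq0.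
Qed.

End EndoBasic.

Section BasicModules.
Variable A : pzRingType.
Implicit Types M N X Y T : lmodType A.

(** A summand [X * X] gives orthogonal idempotents f1 = g h and f2 = h g. In a division ring f1 f2 =
    0 forces g or h to vanish, so f1 lies in the radical, and an idempotent of the radical is 0. *)
Lemma basic_endo_module T : finlen (endo T)^o -> basic_algebra (endo T) -> basic_module T.
Proof.
move=> fE [k [D [p [hD hp hJ]]]] X [nX _] /direct_summandP [a [b ab]].
have [l hl] := inl_ex X X; have [r hr] := inr_ex X X.
pose f1 : endo T := [the {linear T -> T} of a \o l \o fst \o b].
pose f2 : endo T := [the {linear T -> T} of a \o r \o snd \o b].
pose g : endo T := [the {linear T -> T} of a \o l \o snd \o b].
pose h : endo T := [the {linear T -> T} of a \o r \o fst \o b].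
have e12 : f1 * f2 = 0 by apply: endoP => x /=; rewrite ab hr /= linear0 linear0.
have egh : f1 = g * h by apply: endoP => x /=; rewrite ab hr.
have ehg : f2 = h * g by apply: endoP => x /=; rewrite ab hl.
have /hJ /(jacobson_left_inv fE) [u hu] : forall i, p i f1 = 0.
  move=> i; apply: contrapT => n1.
  have ng : p i g <> 0 by move=> e; apply: n1; rewrite egh rmorphM e mul0r.
  have nh : p i h <> 0 by move=> e; apply: n1; rewrite egh rmorphM e mulr0.
  have [g' [_ hg']] := hD i _ (introN eqP ng); have [h' [_ hh']] := hD i _ (introN eqP nh).
  have c1 z : h' * (p i h * z) = z by rewrite mulrA hh' mul1r.
  have c2 z : g' * (p i g * z) = z by rewrite mulrA hg' mul1r.
  have e : p i g * p i h * (p i h * p i g) = 0.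
    by rewrite -!rmorphM -egh -ehg e12 rmorph0.
  have := congr1 (fun z => h' * (h' * (g' * z))) e.
  by rewrite /= !mulr0 -!mulrA c2 !c1 => /ng.
have e1 : f1 = 0.
  rewrite -[LHS]mul1r -hu -mulrA mulrBl mul1r.
  have -> : f1 * f1 = f1 by apply: endoP => z /=; rewrite ab !hl.
  by rewrite subrr mulr0.
apply: nX => x; have e2 : f1 (a (l x)) = a (l x) by rewrite /= ab !hl.
have := ab (l x); rewrite -e2 e1 /= linear0 hl => -[].
by [].
Qed.

End BasicModules.

Section Simple.
Variable A : pzRingType.
Implicit Types M N X Y S V : lmodType A.

Lemma simple_quotient M : finlen M -> ~ is_zero M ->
  exists S (p : {linear M -> S}), surjective p /\ simple_module S.
Proof.
have [n] := ubnP (len M); elim: n M => // n IHn M le fM nz.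
have [h|nh] := pselect (simple_module M).
  by exists M, idfun; split=> // x; exists x.
have [N [hN n0 n1]] : exists N : M -> Prop, [/\ submodule N,
    ~ (forall x, N x -> x = 0) & ~ (forall x, N x)].
  apply: contrapT => hn; apply: nh; split=> // N hN; apply: contrapT => no.
  by apply: hn; exists N; split=> // hh; apply: no; [left|right].
have [X [p [sp hp]]] := quot_ex hN.
have ltX : (len X < len M)%N.
  rewrite ltnNge; apply/negP => /(surj_len_inj sp fM) ip; apply: n0 => x /hp.
  exact: inj0.
have nX : ~ is_zero X.
  by move=> zX; apply: n1 => x; apply/hp; apply: zX.
have [|S [q [sq hS]]] := IHn X _ (finlen_surj sp fM) nX; first exact: leq_trans ltX le.
exists S, (q \o p : {linear _ -> _}); split=> // y.
by have [z <-] := sq y; have [x <-] := sp z; exists x.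
Qed.

Lemma simple_inj S M (f : {linear S -> M}) : simple_module S ->
  (exists x, f x <> 0) -> injective f.
Proof.
move=> [_ hS] [x nx]; have [h|h] := hS _ (ker_submodule f); last by case: nx.
exact: lin_inj.
Qed.

End Simple.

(** * The contravariant functor Hom(-, T) *)

Section HomFunctor.
Variables (A : pzRingType) (T : lmodType A).
Implicit Types M N X Y Z U V W Q P S C K : lmodType A.
Local Notation F := (homT T).
Local Notation D := (endo T).

Lemma homT_map M N (h : {linear M -> N}) :
  exists u : {linear F N -> F M}, forall (g : lhom N T) x, (u g : lhom M T) x = g (h x).
Proof.
have [|u hu] := @linear_ex D (F N) (F M)
   (fun g : lhom N T => [the {linear M -> T} of g \o h] : lhom M T).
  by move=> a x y; apply: homP.
by exists u => g x; rewrite hu.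
Qed.

Lemma homT_ses X Y Z (i : {linear X -> Y}) (p : {linear Y -> Z}) (u : {linear F Z -> F Y})
    (v : {linear F Y -> F X}) :
  (forall (g : lhom Z T) x, (u g : lhom Y T) x = g (p x)) ->
  (forall (g : lhom Y T) x, (v g : lhom X T) x = g (i x)) ->
  ses i p -> E1 Z T -> ses u v.
Proof.
move=> hu hv s hE; have [ii sp hp] := s; split.
- move=> g g' e; apply: homP => z; have [y <-] := sp z.
  by rewrite -!hu e.
- move=> g; have [g' hg'] := hE _ _ _ _ s g; exists g'.
  by apply: homP => x; rewrite hv hg'.
- move=> g; split=> [e|[g' <-]].
    have [|g' hg'] := @lin_fact A Y T Z p g sp.
      by move=> y /hp [x <-]; rewrite -hv e.
    by exists g'; apply: homP => y; rewrite hu hg'.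
  by apply: homP => x; rewrite hv hu (ses0 _ s) linear0.
Qed.

Lemma homT_ses_ex X Y Z (i : {linear X -> Y}) (p : {linear Y -> Z}) :
  ses i p -> E1 Z T -> exists (u : {linear F Z -> F Y}) (v : {linear F Y -> F X}),
  [/\ ses u v, forall (g : lhom Z T) x, (u g : lhom Y T) x = g (p x)
    & forall (g : lhom Y T) x, (v g : lhom X T) x = g (i x)].
Proof.
have [u hu] := homT_map p; have [v hv] := homT_map i.
by move=> s hE; exists u, v; split=> //; apply: homT_ses hu hv s hE.
Qed.

Lemma homT_retract X Y : retract X Y -> retract (F X) (F Y).
Proof.
move=> [a [b ab]]; have [u hu] := homT_map b; have [v hv] := homT_map a.
by exists u, v => g; apply: homP => x; rewrite hv hu ab.
Qed.

Lemma homT_iso X Y : module_iso X Y -> module_iso (F X) (F Y).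
Proof.
move=> /isoP [f [g [fK gK]]]; have [u hu] := homT_map g; have [v hv] := homT_map f.
by apply/isoP; exists u, v; split=> h; apply: homP => x; rewrite ?hu ?hv ?hu ?fK ?gK.
Qed.

Lemma homT_add U X : in_add U X -> in_add (F U) (F X).
Proof.
move=> /in_addP [s hs]; apply/in_addP.
pose c (p : {linear X -> U} * {linear U -> X}) :=
  (sval (cid (homT_map p.2)), sval (cid (homT_map p.1))).
exists [seq c p | p <- s] => f; apply: homP => x.
rewrite [in LHS](hs x) linear_sum.
have -> : (\sum_(p <- [seq c p | p <- s]) p.2 (p.1 f) : lhom X T) x =
          \sum_(p <- s) ((c p).2 ((c p).1 f) : lhom X T) x.
  elim: s {hs} => [|p s IHs]; first by rewrite !big_nil.
  by rewrite /= !big_cons -IHs.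
apply: eq_bigr => p _; rewrite /c /=.
by rewrite (svalP (cid (homT_map p.1))) (svalP (cid (homT_map p.2))).
Qed.

Lemma lin_at1 X (g : {linear A^o -> X}) (x : A^o) : g x = (x : A) *: g 1.
Proof.
have {1}-> : x = (x : A) *: (1 : A^o) by rewrite -[RHS]/(x * 1) mulr1.
exact: linearZ_LR.
Qed.

Lemma homT_free_ev : exists2 u : {linear F A^o -> evm T}, bijective u &
  forall g : lhom A^o T, u g = (g 1 : T).
Proof.
have [|u hu] := @linear_ex D (F A^o) (evm T) (fun g : lhom A^o T => g 1 : T); first by [].
exists u => //; apply/bijP; split=> [g g'|t].
  rewrite !hu => e; apply: homP => x.
  by rewrite lin_at1 [RHS]lin_at1; congr (_ *: _).
have [g hg] := @smul_ex A T t; exists g; rewrite hu.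
by apply: (etrans (hg 1)); rewrite scale1r.
Qed.

Lemma homT_free : module_iso (F A^o) (evm T).
Proof. by have [u bu _] := homT_free_ev; exists u. Qed.

Lemma homT_self : module_iso (F T) D^o.
Proof.
have [|u hu] := @linear_ex D (F T) D^o (fun g : lhom T T => g : endo T).
  by move=> a x y; apply: endoP.
exists u; apply/bijP; split=> [g g'|g]; first by rewrite !hu.
by exists (g : lhom T T); rewrite hu.
Qed.

Lemma homT_powm X k : retract (powm (F X) k) (F (powm X k)).
Proof.
have [ii hii] := dsum_decomp (fun _ : 'I_k => X).
have sp i : exists q : {linear powm X k -> X}, forall x, q x = x i by apply: proj_ex.
pose a1 (f : 'I_k -> lhom X T) : lhom (powm X k) T :=
  \sum_i ([the {linear powm X k -> T} of f i \o sval (cid (sp i))] : lhom (powm X k) T).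
have ha1 f x : a1 f x = \sum_i f i (x i).
  rewrite (@hom_sumE A (powm X k) T 'I_k); apply: eq_bigr => i _ /=.
  by rewrite (svalP (cid (sp i))).
have [|a ha] := @linear_ex D (powm (F X) k) (F (powm X k)) a1.
  move=> c f g; apply: homP => x; rewrite ha1.
  transitivity (c (a1 f x) + a1 g x); last by [].
  by rewrite !ha1 linear_sum -big_split.
pose u i := cid (inj_ex (fun _ : 'I_k => X) i).
pose v i := cid (homT_map (sval (u i))).
have [b hb] := tuple_ex (fun i => sval (v i)).
exists a, b => f; apply: dsumP => i; rewrite hb; apply: homP => x.
rewrite (svalP (v i)) ha ha1 (bigD1 i) //= (svalP (u i)).1 big1 ?addr0 // => j ji.
by rewrite (svalP (u i)).2 ?linear0.
Qed.

End HomFunctor.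

(** * Endomorphism rings of strong tilting modules *)

Section Tilting.
Variables (A : pzRingType) (T : lmodType A).
Implicit Types M N X Y Z U V W Q P S C K : lmodType A.
Local Notation F := (homT T).
Local Notation D := (endo T).
Hypothesis hA : artin_algebra A.
Hypothesis hT : strong T.

Let fA : finlen A^o := (artin_data hA).1.
Let pT : Pf T. Proof. by case: hT. Qed.
Let eT : perp T. Proof. by case: hT. Qed.
Let hD : artin_algebra D := artin_endo hA pT.1.
Let fD : finlen D^o := (artin_data hD).1.
Let hSC : SC T := strong_SC fA hT.

Lemma homT_fg' M : finitely_generated M -> finitely_generated (F M).
Proof.
by have [K [eta [hK hc hg]]] := hA => fM; apply: (homT_fg hK hc hg pT.1 fM).
Qed.

Lemma homT_proj X : in_add T X -> projective_module (F X).
Proof.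
move=> /(homT_add T) h; apply: proj_add h.
exact: proj_iso (iso_sym (homT_self T)) (@proj_free D).
Qed.

(** Ext^1([C], [T]) = 0 keeps the pieces of a coresolution by add([T]) exact under Hom(-, [T]),
    which turns it into a projective resolution. *)
Lemma homT_Pf X : Pf X -> Pf (F X).
Proof.
move=> hX; have [Z [s [r hZ]]] := strong_coresolved fA hT hX.
have pZ := cores_Pf fA pT hZ.
apply: (Pf_retract fD (homT_retract T r)); split; first exact: homT_fg' pZ.1.
exists s; elim: s Z {r pZ} hZ => [|s IHs] Z; first exact: homT_proj.
move=> [U [C [i [p [sq hU hC]]]]]; have pC := cores_Pf fA pT hC.
have [u [v [suv _ _]]] := homT_ses_ex sq (eT pC).
exists (F C), (F U), u, v; split=> //; first exact: homT_proj.
exact: IHs.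
Qed.

Lemma evm_Pf : Pf (evm T).
Proof. exact: Pf_iso (homT_free T) (homT_Pf (Pf_free A)). Qed.

(** Generators of [I] form a map from [T] to a power of [T]. If it were injective its cokernel would
    be in [Pf], the identity of [T] would extend along it, and 1 would lie in [I]. *)
Lemma endo_max_ideal (I : D^o -> Prop) : maximal_left_ideal I ->
  exists t : T, t <> 0 /\ forall u : D, I u -> u t = 0.
Proof.
move=> [hI nI1 _]; have [L [j [ij hj]]] := sub_ex hI.
have [k [g hg]] := fg_sub fD ij (fg_free D).
pose f i : {linear T -> T} := j (g i).
have [h hh] := tuple_ex f.
have If i : I (j (g i)) by apply/hj; exists (g i).
have [ih|nih] := pselect (injective h).
  have [C [q s]] := coker_ses ih.
  have pC : Pf C.
    by apply: Pf_right s pT _ => //; apply: Pf_dsum.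
  have [r hr] := eT pC s idfun; case: nI1.
  have [ii hii] := dsum_decomp (fun _ : 'I_k => T).
  have -> : (1 : D) = \sum_i ((r \o ii i : {linear T -> T}) : D) * (j (g i) : D).
    apply: endoP => x; rewrite endo_sumE /= -[LHS]hr /= [in LHS](hii (h x)) linear_sum.
    by apply: eq_bigr => i _; rewrite hh.
  apply: (subm_sum hI) => i; have [_ _ hZ] := hI; exact: (hZ (r \o ii i : {linear T -> T})).
have [t [ht nt]] : exists t, h t = 0 /\ t <> 0.
  apply: contrapT => hn; apply: nih; apply: lin_inj => x hx; apply: contrapT => nx.
  by apply: hn; exists x.
exists t; split=> // u /hj [x <-]; have [c ->] := hg x.
rewrite linear_sum endo_sumE big1 // => i _; rewrite linearZ_LR.
have fi : f i t = 0 by rewrite -hh ht.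
by rewrite -[LHS]/(c i (f i t)) fi linear0.
Qed.

Lemma endo_simple_embed (V : lmodType D) : simple_module V ->
  exists u : {linear V -> evm T}, injective u.
Proof.
move=> hV; have [nV hV2] := hV; have [v nv] := nonzero_ex nV.
have mI := simple_ann hV nv; have [t [nt ht]] := endo_max_ideal mI.
have [m hm] := smul_ex v; have [m' hm'] := @smul_ex D (evm T) t.
have sm : surjective m.
  have [|h|//] := hV2 (fun z => exists a, m a = z); first exact: im_submodule.
  by case: nv; apply: h; exists 1; rewrite hm scale1r.
have [|u hu] := @lin_fact D _ (evm T) V m m' sm.
  by move=> x; rewrite hm hm' => /ht.
exists u; apply: simple_inj hV _; exists v.
have -> : v = m 1 by rewrite hm scale1r.
by rewrite hu hm' scale1r.
Qed.

(* The unit of the contravariant adjunction given by [T] is bijective on modules of finite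
   projective dimension, because they embed in [add T] with cokernel of the same kind. *)
Lemma homT_eval X (g : {linear F X -> evm T}) : Pf X ->
  exists x, forall f : lhom X T, g f = f x.
Proof.
move=> hX; have [U [C [i [p [s hU hC]]]]] := SC_embed fA hSC hX.
have evU (k : {linear F U -> evm T}) : exists u, forall f : lhom U T, k f = f u.
  have [r hr] := (in_addP _ _).1 hU.
  exists (\sum_(q <- r) q.2 (k (q.1 : lhom U T))) => f.
  have -> : f = \sum_(q <- r) (([the {linear T -> T} of f \o q.2] : D) *: (q.1 : F U)).
    apply: homP => x; rewrite [in LHS](hr x) linear_sum.
    elim: r {hr} => [|q r IHr]; first by rewrite !big_nil.
    by rewrite !big_cons IHr.
  rewrite linear_sum.
  transitivity (\sum_(q <- r) f (q.2 (k (q.1 : lhom U T)))).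
    by apply: eq_bigr => q _; rewrite linearZ_LR.
  rewrite -linear_sum; set z := \sum_(q <- r) _.
  have e y : (\sum_(q <- r) (([the {linear T -> T} of f \o q.2] : D) *: (q.1 : F U)) : lhom U T) y = f y.
    rewrite [in RHS](hr y) linear_sum; elim: r {hr z} => [|q r IHr]; first by rewrite !big_nil.
    by rewrite !big_cons -IHr.
  by rewrite e.
have [u [v [suv hu hv]]] := homT_ses_ex s (eT hC).
have [y hy] := evU (g \o v); have [_ _ hp] := s.
have [_ _ hs _] := hSC.
have /hp [x hx] : p y = 0.
  apply: contrapT => ny; have [h nh] := hs C hC _ ny; apply: nh.
  have := hy (u h); rewrite /= (ses0 _ suv) linear0 hu => <-.
  by [].
exists x => f; have [_ sv _] := suv; have [f' <-] := sv f.
by apply: (etrans (hy f')); rewrite hv hx.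
Qed.

Lemma homT_E1 X : Pf X -> E1 (F X) (evm T).
Proof.
move=> hX; have [U [C [i [p [s hU hC]]]]] := SC_embed fA hSC hX.
have [u [v [suv hu hv]]] := homT_ses_ex s (eT hC).
apply: (E1_cover suv (homT_proj hU)) => g; have [c hc] := homT_eval g hC.
have [_ sp _] := s; have [y hy] := sp c.
have [|e he] := @linear_ex D (F U) (evm T) (fun f : lhom U T => f y : T); first by [].
by exists e => f; rewrite he hc -hy hu.
Qed.

(** Evaluating [k] at a point of [Y] gives a functional on Hom([X], [T]), hence a point of [X] by
    [homT_eval]; linearity follows since [T] separates the points of [X]. *)
Lemma homT_full X Y (k : {linear F X -> F Y}) : Pf X ->
  exists h : {linear Y -> X}, forall (f : lhom X T) y, (k f : lhom Y T) y = f (h y).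
Proof.
move=> hX; have ev y : exists x, forall f : lhom X T, (k f : lhom Y T) y = f x.
  have [|g hg] := @linear_ex D (F X) (evm T) (fun f => (k f : lhom Y T) y : T).
    by move=> a f f'; rewrite linearP.
  by have [x hx] := homT_eval g hX; exists x => f; rewrite -hx hg.
pose h y := sval (cid (ev y)).
have hh y (f : lhom X T) : (k f : lhom Y T) y = f (h y) := svalP (cid (ev y)) f.
have sep x x' : (forall f : lhom X T, f x = f x') -> x = x'.
  move=> e; apply/eqP; rewrite -subr_eq0; apply/eqP; apply: contrapT => nx.
  have [_ _ hs _] := hSC; have [f nf] := hs X hX _ nx; apply: nf.
  by rewrite linearB (e f) subrr.
have [|h' hh'] := @linear_ex A Y X h.
  by move=> a y z; apply: sep => f; rewrite -hh !linearP -!hh.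
by exists h' => f y; rewrite hh'.
Qed.

Hypothesis simple_T : forall S, simple_module S -> exists u : {linear S -> T}, injective u.

(** Up to summands, Hom(-, [T]) reaches all of [Pf] over [endo T]. A syzygy of [M] comes from some
    [X1], its inclusion into a projective from a map [h] over [A], and [M] from the kernel of [h],
    provided that [h] is onto. *)
Lemma Pf_homT_retract (M : lmodType D) : Pf M -> exists X, Pf X /\ retract M (F X).
Proof.
move=> [fM [d hd]]; elim: d M fM hd => [|d IHd] M fM hd.
  have h1 : in_add (F T) M.
    apply: add_trans (fg_proj_add fM hd); apply/add_retract/retract_iso/iso_sym/homT_self.
  have [k r] := add_powmP h1; exists (powm T k); split; first exact: Pf_dsum.
  exact: retract_trans r (homT_powm T T k).
have [k [q sq]] := (fgP M).1 fM.
have [U [pi [hU spi]]] : exists U (pi : {linear F U -> M}), in_add T U /\ surjective pi.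
  have [a [b ab]] := homT_powm T T k; have /isoP [f [f' [fK f'K]]] := homT_self T.
  have [w hw] : exists w : {linear powm (F T) k -> powm D^o k}, surjective w.
    pose pr i := sval (cid (proj_ex (fun _ : 'I_k => F T) i)).
    have hpr i x : pr i x = x i := svalP (cid (proj_ex (fun _ : 'I_k => F T) i)) x.
    have [w hw] := tuple_ex (fun i => f \o pr i); exists w => x.
    exists (fun i => f' (x i)); apply: dsumP => i; rewrite hw /= hpr.
    exact: f'K.
  exists (powm T k), (q \o w \o b : {linear _ -> _}); split; first exact: add_powm.
  by move=> m; have [z <-] := sq m; have [y <-] := hw z; exists (a y); rewrite /= ab.
have pU := Pf_add fA pT hU.
have [M1 [i si]] := ker_ses spi; have [ii _ hpi] := si.
have fM1 := fg_sub fD ii (homT_fg' pU.1).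
have [X1 [hX1 [a' [b' ab']]]] := IHd M1 fM1 (pd_kernel si (homT_proj hU) hd).
have pY := Pf_prod fA pU hX1.
(* [F U * F X1] is identified with [F (U * X1)]. *)
have [kf hkf] : exists kf : {linear F X1 -> F (U * X1)%type},
    forall (w : lhom X1 T) y, (kf w : lhom (U * X1)%type T) y =
       (i (b' w) : lhom U T) y.1 + ((w : lhom X1 T) y.2 - (a' (b' w) : lhom X1 T) y.2).
  have [f1 hf1] := homT_map T (fst : {linear (U * X1)%type -> U}).
  have [f2 hf2] := homT_map T (snd : {linear (U * X1)%type -> X1}).
  exists ((f1 \o i \o b') \+ (f2 \o (idfun \+ \- (a' \o b')))) => w y.
  rewrite -[LHS]/((f1 (i (b' w)) : lhom (U * X1)%type T) y + (f2 (w - a' (b' w)) : lhom (U * X1)%type T) y).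
  by rewrite hf1 hf2.
have [h hh] := homT_full kf hX1.
have ikf : injective kf.
  apply: lin_inj => w kw.
  have e y1 y2 : (i (b' w) : lhom U T) y1 + ((w : lhom X1 T) y2 - (a' (b' w) : lhom X1 T) y2) = 0.
    by have := hkf w (y1, y2); rewrite kw => <-.
  have b0 : b' w = 0.
    apply: (inj0 ii); apply: homP => y; have := e y 0.
    by rewrite !linear0 !addr0.
  apply: homP => x; have := e 0 x.
  rewrite (linear0 (i (b' w) : lhom U T)) add0r b0 (linear0 a') => h0.
  exact: (etrans (esym (subr0 _)) h0).
(* A simple quotient of the cokernel would embed in [T] and give a nonzero element of Hom([X1], [T])
   killed by [kf]; this is where simple modules must embed in [T]. *)
have sh : surjective h.
  have [N [p [sp hp]]] := quot_ex (im_submodule h).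
  have [zN x|nN] := pselect (is_zero N); first by apply/hp; apply: zN.
  have fN : finlen N := finlen_surj sp (Pf_finlen fA hX1).
  have [S [s [ss hS]]] := simple_quotient fN nN; have [u iu] := simple_T hS.
  have w0 : (u \o s \o p : {linear X1 -> T}) = 0 :> F X1.
    apply: (inj0 ikf); apply: homP => y; rewrite hh /=.
    have -> : p (h y) = 0 by apply/hp; exists y.
    by rewrite !linear0.
  case: (hS) => nS _; case: nS => y; have [n <-] := ss y; have [x <-] := sp n.
  apply: iu; rewrite linear0.
  by have := congr1 (fun f : lhom X1 T => f x) w0.
have [X [j sj]] := ker_ses sh.
have hX : Pf X := Pf_left fA sj pY hX1.
have [v1 [v2 [sv hv1 hv2]]] := homT_ses_ex sj (eT hX1).
have ev w : v1 w = kf w by apply: homP => y; rewrite hv1 hh.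
exists X; split=> //; have [_ sv2 hv2'] := sv.
have [l hl] := homT_map T (fst : {linear (U * X1)%type -> U}).
have [inl hinl] := inl_ex U X1; have [inr hinr] := inr_ex U X1.
have [rl hrl] := homT_map T inl.
have [|g hg] := @lin_fact D _ M (F X) v2 (pi \o rl : {linear _ -> _}) sv2.
  move=> f /hv2' [w <-]; rewrite /= ev.
  have -> : rl (kf w) = i (b' w).
    apply: homP => y; rewrite hrl hkf hinl /=.
    by rewrite !linear0 !addr0.
  exact: ses0 si.
have [|f hf] := @lin_fact D _ (F X) M pi (v2 \o l : {linear _ -> _}) spi.
  move=> y /hpi [x <-]; rewrite /=; apply/hv2'; exists (a' x).
  rewrite ev; apply: homP => z; rewrite hkf hl ab'.
  by rewrite subrr addr0.
exists f, g => m; have [y <-] := spi m; rewrite hf /= hg /=.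
congr (pi _); apply: homP => z; by rewrite hrl hl hinl.
Qed.

(** The coresolution of [endo T], which is Hom([T], [T]), is the image of a projective resolution of
    [T], since Hom(-, [T]) sends the regular module to [evm T]. *)
Lemma evm_strong : strong (evm T).
Proof.
split; first exact: evm_Pf.
  move=> M /Pf_homT_retract [X [hX r]]; exact: E1_retract_l r (homT_E1 hX).
have [_ [d hd]] := pT; exists d.
apply: cores_iso (homT_self T) _.
suff gen n X : pd_le n X -> Pf X -> cores (evm T) n (F X) by apply: gen.
elim: n X {hd} => [|n IHn] X hd hX.
  have h := homT_add T (fg_proj_add hX.1 hd).
  by apply: (add_trans _ h); apply/add_retract/retract_iso/homT_free.
have [K [P [i [p [s hP fP]]]]] := proj_cover hX.1.
have [u [v [suv _ _]]] := homT_ses_ex s (eT hX).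
exists (F P), (F K), u, v; split=> //; last first.
  by apply: IHn; [exact: pd_kernel s hP hd | exact: Pf_syz s hP fP hX].
apply: (add_trans _ (homT_add T (fg_proj_add fP hP))).
exact/add_retract/retract_iso/homT_free.
Qed.

(** Since Hom([A], [T]) is [evm T], an endomorphism of [evm T] is evaluation at an element of [A] by
    [homT_eval]; faithfulness is separation of the points of [A]. *)
Lemma double_centralizer : ring_iso A (endo (evm T)).
Proof.
have lin (a : A) : linear (fun t : evm T => (a *: (t : T) : evm T)).
  move=> u x y; rewrite -[u *: x + y]/((u (x : T) + (y : T)) : T) scalerDr.
  by rewrite -linearZ_LR.
pose f a : endo (evm T) := sval (cid (linear_ex (lin a))).
have hf a t : f a t = (a *: (t : T) : T) := svalP (cid (linear_ex (lin a))) t.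
have [|||phi hphi] := @rm_ex A (endo (evm T)) f.
- by apply: endoP => t; rewrite hf scale1r.
- move=> a b; apply: endoP => t; rewrite hf scalerBl.
  by rewrite -[RHS]/((f a t - f b t) : T) !hf.
- by move=> a b; apply: endoP => t; rewrite hf -scalerA -[RHS]/(f a (f b t)) !hf.
exists phi; have inj : injective phi.
  move=> a b e; apply/eqP; rewrite -subr_eq0; apply/eqP; apply: contrapT => nab.
  have [_ _ hs _] := hSC; have [g ng] := hs A^o (Pf_free A) (a - b) nab; apply: ng.
  have -> : (a - b : A^o) = (a - b : A) *: (1 : A^o) by rewrite -[RHS]/((a - b) * 1) mulr1.
  rewrite linearZ_LR scalerBl; apply/eqP; rewrite subr_eq0; apply/eqP.
  by have := congr1 (fun u : endo (evm T) => u (g 1)) e; rewrite !hphi !hf.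
have sur g : exists a, phi a = g.
  have [u /bijP [_ su] hu] := homT_free_ev T.
  have [a ha] := homT_eval ((g : {linear evm T -> evm T}) \o u) (Pf_free A).
  exists (a : A); apply: endoP => t; rewrite hphi hf; have [k <-] := su t.
  by apply: esym; apply: (etrans (ha k)); rewrite lin_at1 hu.
pose psi g := sval (cid (sur g)).
have hpsi g : phi (psi g) = g := svalP (cid (sur g)).
by exists psi => // a; apply: inj; rewrite hpsi.
Qed.

End Tilting.

(** * Transport along ring isomorphisms *)

Section Transport.
Variables (A B : pzRingType) (f : {rmorphism A -> B}) (g : {rmorphism B -> A}).
Hypothesis fK : cancel f g.
Hypothesis gK : cancel g f.

Lemma to_res (X : lmodType A) (M : lmodType B) (h : {linear resm g X -> M}) :
  exists k : {linear X -> resm f M}, forall x : X, k x = h x.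
Proof.
have [|k hk] := @linear_ex A X (resm f M) h; last by exists k.
move=> a x y; rewrite -[X in h X]/((a *: x + y) : X).
have -> : (a *: x + y : X) = (f a *: (x : resm g X) + (y : resm g X) : resm g X).
  by rewrite res_scaleE fK.
by rewrite linearP.
Qed.

Lemma of_res (X : lmodType A) (M : lmodType B) (k : {linear X -> resm f M}) :
  exists h : {linear resm g X -> M}, forall x : X, h x = k x.
Proof.
have [|h hh] := @linear_ex B (resm g X) M k; last by exists h.
move=> b x y; rewrite -[X in k X]/((g b *: (x : X) + (y : X)) : X) linearP.
by rewrite res_scaleE gK.
Qed.

Lemma res_fg_iso (X : lmodType A) : finitely_generated X -> finitely_generated (resm g X).
Proof.
move=> [k [h hh]]; exists k, h => x; have [c e] := hh x; exists (fun i => f (c i)).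
rewrite e; apply: eq_bigr => i _.
by rewrite res_scaleE fK.
Qed.

Lemma res_proj (X : lmodType A) : projective_module X -> projective_module (resm g X).
Proof.
move=> hX M N p h sp; have [p' hp'] := res_lin f p; have [k hk] := to_res h.
have [|l hl] := hX _ _ p' k; first by move=> y; have [x hx] := sp y; exists x; rewrite hp'.
have [l' hl'] := of_res l; exists l' => x.
by rewrite hl' -hk -hl hp'.
Qed.

Lemma res_Pf (X : lmodType A) : Pf X -> Pf (resm g X).
Proof.
move=> [fX [d hd]]; split; first exact: res_fg_iso.
exists d; elim: d X hd {fX} => [|d IHd] X; first exact: res_proj.
move=> [K [P [i [p [s hP hK]]]]].
have [i' hi] := res_lin g i; have [p' hp] := res_lin g p.
exists (resm g K), (resm g P), i', p'; split; [exact: res_ses hi hp s|exact: res_proj|exact: IHd].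
Qed.

Lemma Pf_semi (X : lmodType A) (M : lmodType B) (h : X -> M) : bijective h ->
  (forall x y, h (x + y) = h x + h y) -> (forall a x, h (a *: x) = f a *: h x) ->
  Pf X -> Pf M.
Proof.
move=> bh hD hZ /res_Pf; apply: Pf_iso.
have [|k hk] := @linear_ex B (resm g X) M h.
  by move=> b x y; rewrite hD -[_ *: x]/(g b *: (x : X)) hZ gK.
by exists k; apply: (eq_bij bh) => x; rewrite hk.
Qed.

Lemma res_simple (S : lmodType A) : simple_module S -> simple_module (resm g S).
Proof.
move=> [nS hS]; split=> // N [N0 ND NZ]; apply: hS; split=> // a x Nx.
have := NZ (f a) x Nx; by rewrite res_scaleE fK.
Qed.

End Transport.

Lemma cf_ring_iso (A B : pzRingType) : ring_iso A B -> cf A -> cf B.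
Proof.
move=> /ring_isoP [f [g [fK gK]]] h M fM.
have fM' : finitely_generated (resm f M) := res_fg_iso gK fM.
have [X [phi [hX hphi]]] := h _ fM'.
have [phi' hp] := of_res gK phi; exists (resm g X), phi'; split; first exact: (res_Pf fK gK hX).
move=> Y k hY; have [k' hk'] := res_lin f k.
have [l hl] := hphi _ k' (res_Pf gK fK hY).
have [l' hl'] := to_res gK l; exists l' => y.
by rewrite hp hl' hl hk'.
Qed.

(** The condition from which [simples_embed] places all simple modules inside any strong tilting
    module; in this form it is invariant under ring isomorphism. *)
Definition cogenerated (A : pzRingType) := exists X : lmodType A, Pf X /\
  forall S : lmodType A, simple_module S -> exists u : {linear S -> X}, injective u.

Lemma cog_ring_iso (A B : pzRingType) : ring_iso A B -> cogenerated A -> cogenerated B.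
Proof.
move=> /ring_isoP [f [g [fK gK]]] [X [hX h]]; exists (resm g X); split.
  exact: (res_Pf fK gK hX).
move=> S /(res_simple gK) /h [u iu]; have [u' hu'] := to_res gK u.
by exists u' => x y; rewrite !hu'; apply: iu.
Qed.

(** * Corner rings *)

Section Cut.
Variables (A : pzRingType) (e : A) (he : idempotent_elt e).
Local Notation c := (corner he).

Section CutModule.
Variable M : lmodType A.

Definition cut_pred of idempotent_elt e : {pred M} := fun x => e *: x == x.

Lemma cut_subproof : zmod_closed (cut_pred he).
Proof.
split; first by rewrite unfold_in /cut_pred scaler0.
by move=> x y /eqP hx /eqP hy; apply/eqP; rewrite scalerBr hx hy.
Qed.

HB.instance Definition _ := GRing.isZmodClosed.Build M (cut_pred he) cut_subproof.

Definition cut_sort := {x : M | x \in cut_pred he}.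

HB.instance Definition _ := [isSub of cut_sort for @sval _ _].
HB.instance Definition _ := [Choice of cut_sort by <:].
HB.instance Definition _ := [SubChoice_isSubZmodule of cut_sort by <:].

Lemma cutP (x : cut_sort) : e *: val x = val x.
Proof. by case: x => x /= /eqP. Qed.

Lemma cut_scale_subproof (a : A) (x : M) : e * a = a -> a *: x \in cut_pred he.
Proof. by move=> ea; apply/eqP; rewrite scalerA ea. Qed.

Definition cut_act (f : A) (a : peirce e f) (x : M) : cut_sort :=
  exist _ (val a *: x) (cut_scale_subproof x (peirceP a).1).

Definition cut_scale (a : c) (x : cut_sort) : cut_sort := cut_act a (val x).

Lemma cut_scaleA a b (x : cut_sort) : cut_scale a (cut_scale b x) = cut_scale (a * b) x.
Proof. by apply: val_inj; rewrite /= scalerA. Qed.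
Lemma cut_scale1 : left_id 1 cut_scale.
Proof. by move=> x; apply: val_inj; rewrite /= cutP. Qed.
Lemma cut_scaleDr : right_distributive cut_scale +%R.
Proof. by move=> a x y; apply: val_inj; rewrite /= scalerDr. Qed.
Lemma cut_scaleDl (x : cut_sort) : {morph cut_scale^~ x : a b / a + b}.
Proof. by move=> a b; apply: val_inj; rewrite /= scalerDl. Qed.

HB.instance Definition _ := GRing.Zmodule_isLmodule.Build c cut_sort
  cut_scaleA cut_scale1 cut_scaleDr cut_scaleDl.

Definition cut : lmodType c := cut_sort.

Definition cut_in (x : M) : cut_sort := cut_act (corner_one he) x.

Lemma cut_inE (x : M) : val (cut_in x) = e *: x.
Proof. by []. Qed.

End CutModule.

Implicit Types M N X Y Z U : lmodType A.

Lemma cut_map M N (h : {linear M -> N}) :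
  exists k : {linear cut M -> cut N}, forall x, val (k x) = h (val x).
Proof.
have sp (x : cut M) : h (val x) \in cut_pred he.
  by apply/eqP; rewrite -linearZ_LR cutP.
have [|k hk] := @linear_ex c (cut M) (cut N) (fun x => exist _ (h (val x)) (sp x)).
  by move=> a x y; apply: val_inj; rewrite /= linearP.
by exists k => x; rewrite hk.
Qed.

Lemma cut_ses X Y Z (i : {linear X -> Y}) (p : {linear Y -> Z}) (i' : {linear cut X -> cut Y})
  (p' : {linear cut Y -> cut Z}) : (forall x, val (i' x) = i (val x)) ->
  (forall x, val (p' x) = p (val x)) -> ses i p -> ses i' p'.
Proof.
move=> hi hp [ii sp h]; split=> [x y e'|z|y].
- by apply/val_inj/ii; rewrite -!hi e'.
- have [y hy] := sp (val z); exists (cut_in y); apply: val_inj.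
  by rewrite hp cut_inE linearZ_LR hy cutP.
- split=> [e'|[x <-]]; last first.
    by apply: val_inj; rewrite hp hi; apply/h; exists (val x).
  have /h [x hx] : p (val y) = 0 by rewrite -hp e'.
  exists (cut_in x); apply: val_inj; rewrite hi cut_inE linearZ_LR hx.
  exact: cutP.
Qed.

Lemma cut_ses_ex X Y Z (i : {linear X -> Y}) (p : {linear Y -> Z}) : ses i p ->
  exists (i' : {linear cut X -> cut Y}) (p' : {linear cut Y -> cut Z}),
  [/\ ses i' p', forall x, val (i' x) = i (val x) & forall x, val (p' x) = p (val x)].
Proof.
have [i' hi] := cut_map i; have [p' hp] := cut_map p.
by move=> s; exists i', p'; split=> //; apply: cut_ses hi hp s.
Qed.

Lemma cut_add U X : in_add U X -> in_add (cut U) (cut X).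
Proof.
move=> /in_addP [s hs]; apply/in_addP.
pose t (p : {linear X -> U} * {linear U -> X}) :=
  (sval (cid (cut_map p.1)), sval (cid (cut_map p.2))).
exists [seq t p | p <- s] => x; apply: val_inj; rewrite [LHS]hs.
elim: s {hs} => [|p s IHs]; first by rewrite !big_nil.
rewrite /= !big_cons IHs -[RHS]/(val ((t p).2 ((t p).1 x)) + val (\sum_(q <- [seq t p | p <- s]) q.2 (q.1 x))).
congr (_ + _).
by rewrite /= (svalP (cid (cut_map p.2))) (svalP (cid (cut_map p.1))).
Qed.

Local Notation PE := (corner_module he 1).

Lemma cut_free : module_iso PE (cut A^o).
Proof.
have sp (x : PE) : (val x : A^o) \in cut_pred he.
  by apply/eqP; rewrite -[LHS]/(e * val x) (peirceP x).1.
have [|k hk] := @linear_ex c PE (cut A^o) (fun x => exist _ (val x : A^o) (sp x)).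
  by move=> a x y; apply: val_inj.
exists k; apply/bijP; split=> [x y|y].
  by rewrite !hk => e'; apply: val_inj; have := congr1 val e'.
have sy : (val y : A) \in peirce_pred e 1.
  by apply/andP; rewrite mulr1 eqxx -[X in e * X == X]/(val y : A) -[e * _]/(e *: val y) cutP.
by exists (exist _ (val y : A) sy); rewrite hk; apply: val_inj.
Qed.

(** * Coinduction from a corner *)

Section Coinduction.
Variable Y : lmodType c.

(* Hom_(e A e)(e A, Y): coinduction is right adjoint to [cut], the functor [M |-> e M]. *)
Definition coind_sort := lhom PE Y.
HB.instance Definition _ := GRing.Zmodule.copy coind_sort (lhom PE Y).

Lemma rmul_subproof (a : A) (x : PE) : val x * a \in peirce_pred e 1.
Proof. by apply/andP; rewrite mulr1 eqxx mulrA (peirceP x).1. Qed.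

Definition rmul (a : A) (x : PE) : PE := exist _ (val x * a) (rmul_subproof a x).

Lemma rmul_linear a : linear (rmul a).
Proof. by move=> b x y; apply: val_inj; rewrite /= mulrDl mulrA. Qed.

HB.instance Definition _ a := GRing.isLinear.Build c PE PE *:%R (rmul a) (rmul_linear a).

Definition coind_scale (a : A) (f : coind_sort) : coind_sort :=
  [the {linear PE -> Y} of f \o rmul a].

Lemma coind_scaleA a b x : coind_scale a (coind_scale b x) = coind_scale (a * b) x.
Proof. by apply: homP => z /=; congr (x _); apply: val_inj; rewrite /= mulrA. Qed.
Lemma coind_scale1 : left_id 1 coind_scale.
Proof. by move=> x; apply: homP => z /=; congr (x _); apply: val_inj; rewrite /= mulr1. Qed.
Lemma coind_scaleDr : right_distributive coind_scale +%R.
Proof. by move=> a x y; apply: homP. Qed.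
Lemma coind_scaleDl x : {morph coind_scale^~ x : a b / a + b}.
Proof.
move=> a b; apply: homP => z /=; rewrite -[RHS]/(x (rmul a z) + x (rmul b z)) -linearD.
by congr (x _); apply: val_inj; rewrite /= mulrDr.
Qed.

HB.instance Definition _ := GRing.Zmodule_isLmodule.Build A coind_sort
  coind_scaleA coind_scale1 coind_scaleDr coind_scaleDl.

Definition coind : lmodType A := coind_sort.

Lemma coindZ (a : A) (f : coind) (x : PE) :
  (a *: f : lhom PE Y) x = (f : lhom PE Y) (rmul a x).
Proof. by []. Qed.

End Coinduction.

Definition pe1 : PE := exist _ e (introT andP (conj (introT eqP he) (introT eqP (mulr1 e)))).

Definition to_corner (x : PE) : c := exist _ (val x * e)
  (introT andP (conj (introT eqP (etrans (mulrA _ _ _) (congr1 ( *%R^~ e) (peirceP x).1)))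
    (introT eqP (etrans (esym (mulrA _ _ _)) (congr1 ( *%R (val x)) he))))).

Lemma coind_cutE (Y : lmodType c) (f : cut (coind Y)) (x : PE) :
  (val f : lhom PE Y) x = to_corner x *: (val f : lhom PE Y) pe1.
Proof.
rewrite -linearZ_LR -[in LHS](cutP f) coindZ; congr ((val f : lhom PE Y) _).
by apply: val_inj; rewrite /= -mulrA he.
Qed.

(** Evaluation at [e] identifies e Hom(eA, [Y]) with [Y]; so [coind], right adjoint to [cut], is
    fully faithful. *)
Lemma cut_coind (Y : lmodType c) : exists2 h : {linear cut (coind Y) -> Y}, bijective h &
  forall f, h f = (val f : lhom PE Y) pe1.
Proof.
have [|h hh] := @linear_ex c (cut (coind Y)) Y (fun f => (val f : lhom PE Y) pe1).
  move=> a f g /=; rewrite -[LHS]/((val f : lhom PE Y) (rmul (val a) pe1) + (val g : lhom PE Y) pe1).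
  congr (_ + _); rewrite -linearZ_LR; congr ((val f : lhom PE Y) _).
  by apply: val_inj; rewrite /= (peirceP a).1 (peirceP a).2.
exists h => //; apply/bijP; split=> [f g|y].
  by rewrite !hh => e'; apply/val_inj/homP => x; rewrite coind_cutE e' -coind_cutE.
have [|k hk] := @linear_ex c PE Y (fun x => to_corner x *: y).
  move=> a x x'; rewrite -[RHS]/(a *: (to_corner x *: y) + to_corner x' *: y).
  rewrite scalerA -scalerDl; congr (_ *: _); apply: val_inj.
  by rewrite /= mulrDl mulrA.
have sk : (k : coind Y) \in cut_pred he.
  apply/eqP; apply: homP => x; rewrite coindZ !hk; congr (_ *: _).
  by apply: val_inj; rewrite /= -mulrA he.
exists (exist _ (k : coind Y) sk); rewrite hh /= hk.
have -> : to_corner pe1 = 1 by apply: val_inj; rewrite /= he.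
exact: scale1r.
Qed.

Lemma coind_map (Y Z : lmodType c) (h : {linear Y -> Z}) :
  exists k : {linear coind Y -> coind Z}, forall (f : lhom PE Y) x, (k f : lhom PE Z) x = h (f x).
Proof.
have [|k hk] := @linear_ex A (coind Y) (coind Z)
   (fun f : lhom PE Y => [the {linear PE -> Z} of h \o f] : lhom PE Z).
  move=> a f g; apply: homP => x /=.
  by rewrite -[LHS]/(h (((f : lhom PE Y) (rmul a x)) + (g : lhom PE Y) x)) linearD.
by exists k => f x; rewrite hk.
Qed.

Lemma coind_adj M (Y : lmodType c) (h : {linear cut M -> Y}) :
  exists k : {linear M -> coind Y}, forall m x, (k m : lhom PE Y) x = h (cut_act x m).
Proof.
have lx m : linear (fun x : PE => h (cut_act x m)).
  move=> a x y; rewrite -linearP; congr (h _); apply: val_inj.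
  by rewrite /= scalerDl scalerA.
pose f m : lhom PE Y := sval (cid (linear_ex (lx m))).
have hf m x : f m x = h (cut_act x m) := svalP (cid (linear_ex (lx m))) x.
have [|k hk] := @linear_ex A M (coind Y) f.
  move=> a m n; apply: homP => x; rewrite hf.
  rewrite -[RHS]/((f m : lhom PE Y) (rmul a x) + (f n : lhom PE Y) x) !hf -linearD.
  by congr (h _); apply: val_inj; rewrite /= scalerDr scalerA.
by exists k => m x; rewrite hk hf.
Qed.

Section Artin.
Hypothesis hA : artin_algebra A.
Let fA : finlen A^o := (artin_data hA).1.

Lemma corner_eta : exists (K : comPzRingType) (eta : {rmorphism K -> A}) (eta' : {rmorphism K -> c}),
  [/\ artinian_ring K, forall c a, eta c * a = a * eta c, finitely_generated (resm eta A^o)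
    & forall k, val (eta' k) = eta k * e].
Proof.
have [K [eta [hK hc hg]]] := hA.
have sp k : eta k * e \in peirce_pred e e.
  by apply/andP; rewrite mulrA -[e * eta k]hc -!mulrA he.
have [|||eta' h'] := @rm_ex K c (fun k => exist _ (eta k * e) (sp k)).
- by apply: val_inj; rewrite /= rmorph1 mul1r.
- by move=> x y; apply: val_inj; rewrite /= rmorphB mulrBl.
- move=> x y; apply: val_inj; rewrite /= rmorphM -mulrA [in RHS]mulrA.
  by rewrite -[eta x * e * eta y]mulrA -[e * eta y]hc mulrA -!mulrA he mulrA.
by exists K, eta, eta'; split=> // k; rewrite h'.
Qed.

Lemma artin_corner : artin_algebra c.
Proof.
have [K [eta [eta' [hK hc hg h']]]] := corner_eta.
exists K, eta'; split=> // [k a|].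
  by apply: val_inj; rewrite /= h' -mulrA (peirceP a).1 mulrA -hc -mulrA (peirceP a).2.
have [|i hi] := @linear_ex K (resm eta' c^o) (resm eta A^o) (fun x : c => val x : A).
  by move=> a x y; rewrite /= -[X in X + _]/(val (eta' a) * val x) h' -mulrA (peirceP _).1.
change (finitely_generated (resm eta' c^o)).
have ii : injective i by move=> x y; rewrite !hi; apply: val_inj.
exact: (@fg_sub K (artinian_finlen hK) _ _ i ii hg).
Qed.

Let fc : finlen c^o := (artin_data artin_corner).1.

Lemma cut_fg M : finitely_generated M -> finitely_generated (cut M).
Proof.
have [K [eta [eta' [hK hc hg h']]]] := corner_eta.
move=> fM; apply: (res_fg (f := eta')).
have [|i hi] := @linear_ex K (resm eta' (cut M)) (resm eta M) (fun x : cut M => val x : M).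
  by move=> a x y; rewrite /= -[X in X + _]/(val (eta' a) *: val x) h' -scalerA cutP.
have ii : injective i by move=> x y; rewrite !hi; apply: val_inj.
exact: (@fg_sub K (artinian_finlen hK) _ _ i ii (fg_res hg fM)).
Qed.

Hypothesis H2 : Pf PE.

Lemma cut_Pf M : Pf M -> Pf (cut M).
Proof.
move=> [fM [d hd]]; elim: d M fM hd => [|d IHd] M fM hd.
  apply: (Pf_add fc (T := cut A^o)); first exact: Pf_iso cut_free H2.
  by apply/cut_add/fg_proj_add.
have [K [P [i [p [s hP fP]]]]] := proj_cover fM.
have [i' [p' [s' _ _]]] := cut_ses_ex s; have [ii _ _] := s.
have hK := pd_kernel s hP hd; apply: (Pf_right fc s').
  by apply: IHd hK; exact: (fg_sub fA ii fP).
apply: (Pf_add fc (T := cut A^o)); first exact: Pf_iso cut_free H2.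
by apply/cut_add/fg_proj_add.
Qed.

Lemma coind_fg (Y : lmodType c) : finitely_generated Y -> finitely_generated (coind Y).
Proof.
have [K [eta [eta' [hK hc hg h']]]] := corner_eta; move=> fY.
have [k [g hg']] := H2.1; apply: (res_fg (f := eta)).
have [|i hi] := @linear_ex K (resm eta (coind Y)) (powm (resm eta' Y) k)
    (fun (f : lhom PE Y) i => f (g i)).
  move=> a f f'; apply: dsumP => i.
  rewrite -[LHS]/((f : lhom PE Y) (rmul (eta a) (g i)) + (f' : lhom PE Y) (g i)).
  rewrite -[RHS]/(eta' a *: (f : lhom PE Y) (g i) + (f' : lhom PE Y) (g i)).
  congr (_ + _); rewrite -linearZ_LR; congr ((f : lhom PE Y) _); apply: val_inj.
  by rewrite /= h' -mulrA (peirceP _).1 hc.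
have ii : injective i.
  move=> f f'; rewrite !hi => e'; apply: homP => x; have [r ->] := hg' x.
  rewrite !linear_sum; apply: eq_bigr => j _; rewrite !linearZ_LR.
  by have /(congr1 (fun w => w j)) /= -> := e'.
apply: (@fg_sub K (artinian_finlen hK) _ _ i ii).
apply: fg_powm; apply: fg_res fY.
have [|i' hi'] := @linear_ex K (resm eta' c^o) (resm eta A^o) (fun x : c => val x : A).
  by move=> a x y; rewrite /= -[X in X + _]/(val (eta' a) * val x) h' -mulrA (peirceP _).1.
have ii' : injective i' by move=> x y; rewrite !hi'; apply: val_inj.
exact: (@fg_sub K (artinian_finlen hK) _ _ i' ii' hg).
Qed.

Hypothesis H1 : forall S : lmodType A, simple_module S -> (forall x : S, e *: x = 0) -> Pf S.

Lemma killed_Pf M : finitely_generated M -> (forall x : M, e *: x = 0) -> Pf M.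
Proof.
move=> /(fg_finlen fA) fM; have [n] := ubnP (len M); elim: n M fM => // n IHn M fM le hM.
have [z|nz] := pselect (is_zero M); first exact: Pf_zero.
have [S [i [ii hS]]] := simple_sub fM nz; have [Q [p s]] := coker_ses ii.
have [_ sp _] := s; have /(finlen_ses s) [fS fQ] := fM.
apply: (Pf_mid fA s).
  by apply: H1 => // x; apply: ii; rewrite linearZ_LR hM linear0.
apply: IHn => //; last by move=> y; have [x <-] := sp y; rewrite -linearZ_LR hM linear0.
move: le; rewrite (len_ses s fM) ltnS; apply: leq_trans.
by rewrite -[X in (X < _)%N]add0n ltn_add2r; apply: (len_gt0 fS); case: hS.
Qed.

(** The unit of the adjunction becomes bijective on multiplying by [e]; its kernel and cokernel are
    thus killed by [e] and, when finitely generated, lie in [Pf] by [killed_Pf]. *)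
Lemma unit_ex M : exists k : {linear M -> coind (cut M)},
  [/\ forall m x, (k m : lhom PE (cut M)) x = cut_act x m,
      forall m, k m = 0 -> e *: m = 0
    & forall u : coind (cut M), exists m, k m = e *: u].
Proof.
have [k hk] := coind_adj (idfun : {linear cut M -> cut M}); exists k; split=> [//|m k0|u].
  have := hk m pe1; rewrite k0 => /(congr1 val) /= <-.
  by [].
exists (val ((u : lhom PE (cut M)) pe1)); apply: homP => x; rewrite hk coindZ.
have -> : rmul e x = to_corner x *: pe1 by apply: val_inj; rewrite /= -mulrA he.
rewrite linearZ_LR; apply: val_inj; rewrite /=.
by rewrite -scalerA cutP.
Qed.

Lemma coind_cut_Pf M : Pf M -> Pf (coind (cut M)).
Proof.
move=> hM; have [k [_ k1 k2]] := unit_ex M; have [I [p [i [sp ii ip]]]] := im_ex k.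
have [L [j sj]] := ker_ses sp; have [Q [q sq]] := coker_ses ii.
have [ij _ _] := sj; have [_ sqq hq] := sq.
have hL : Pf L.
  apply: killed_Pf; first exact: (fg_sub fA ij hM.1).
  move=> x; apply: ij; rewrite linearZ_LR linear0; apply: k1.
  by rewrite -ip (ses0 _ sj) linear0.
apply: (Pf_mid fA sq); first exact: Pf_right sj hL hM.
apply: killed_Pf; first by apply: fg_surj sqq _; apply/coind_fg/cut_fg; case: hM.
move=> y; have [u <-] := sqq y; rewrite -linearZ_LR; apply/hq.
by have [m hm] := k2 u; exists (p m); rewrite ip hm.
Qed.

(** The ring eAe is a summand of eA, which is [cut] of the regular module, so the projective case
    reduces to [coind_cut_Pf]. *)
Lemma coind_proj_Pf (Y : lmodType c) :
  finitely_generated Y -> projective_module Y -> Pf (coind Y).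
Proof.
move=> fY hd.
have h1 : in_add (cut A^o) Y.
  apply: (add_trans _ (fg_proj_add fY hd)); apply: add_retract.
  apply: retract_trans (retract_iso cut_free).
  have sp (x : c) : val x \in peirce_pred e 1 by apply/andP; rewrite (peirceP x).1 mulr1 eqxx.
  have [|a ha] := @linear_ex c c^o PE (fun x : c => exist _ (val x) (sp x)); first by move=> r x y; apply: val_inj.
  have [|b hb] := @linear_ex c PE c^o to_corner.
    by move=> r x y; apply: val_inj; rewrite /= mulrDl mulrA.
  exists a, b => x; apply: val_inj; rewrite hb ha /=.
  exact: (peirceP x).2.
have [s hs] := (in_addP _ _).1 h1.
apply: (Pf_add fA (T := coind (cut A^o))); first exact/coind_cut_Pf/Pf_free.
apply/in_addP.
pose t (p : {linear Y -> cut A^o} * {linear cut A^o -> Y}) :=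
  (sval (cid (coind_map p.1)), sval (cid (coind_map p.2))).
exists [seq t p | p <- s] => f; apply: homP => x; rewrite [LHS]hs.
elim: s {hs h1} => [|p s IHs]; first by rewrite !big_nil.
rewrite /= !big_cons IHs -[RHS]/(((t p).2 ((t p).1 f) : lhom PE Y) x + ((\sum_(q <- [seq t p | p <- s]) q.2 (q.1 f)) : lhom PE Y) x).
congr (_ + _).
by rewrite /= (svalP (cid (coind_map p.2))) (svalP (cid (coind_map p.1))).
Qed.

(** Coinduction is only left exact, but the cokernel of [coind P -> coind Y] is killed by [e],
    because [cut] turns this map back into [P -> Y]; so the error again lies in [Pf]. *)
Lemma coind_Pf (Y : lmodType c) : Pf Y -> Pf (coind Y).
Proof.
move=> [fY [d hd]]; elim: d Y fY hd => [|d IHd] Y fY hd; first exact: coind_proj_Pf.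
have [K [P [i [p [s hP fP]]]]] := proj_cover fY; have [ii sp hip] := s.
have gP : Pf (coind P) := coind_proj_Pf fP hP.
have gK : Pf (coind K) by apply: IHd (pd_kernel s hP hd); exact: (fg_sub fc ii fP).
have [i' hi] := coind_map i; have [p' hp] := coind_map p.
have [I [q [j [sq ij jq]]]] := im_ex p'; have [C [r sr]] := coker_ses ij.
have [_ srr hr] := sr.
apply: (Pf_mid fA sr).
  apply: (Pf_right fA (i := i') (p := q) _ gK gP); split=> // [f f' e'|f].
    by apply: homP => x; apply: ii; rewrite -!hi e'.
  split=> [q0|[f' <-]].
    have p0 x : p ((f : lhom PE P) x) = 0 by rewrite -hp -jq q0 linear0.
    have [x|f' hf'] := @lin_lift c PE P K (f : lhom PE P) i ii.
      exact/hip/p0.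
    by exists f'; apply: homP => x; rewrite hi hf'.
  apply: ij; rewrite jq linear0; apply: homP => x; rewrite hp hi.
  exact: ses0 s.
apply: killed_Pf; first by apply: fg_surj srr _; apply: coind_fg.
move=> y; have [u <-] := srr y; rewrite -linearZ_LR; apply/hr.
have [z hz] := sp ((u : lhom PE Y) pe1); have [h bh hh] := cut_coind P.
have /bijP [_ sh] := bh; have [v hv] := sh z; exists (q (val v)); rewrite jq.
apply: homP => x; rewrite hp coindZ coind_cutE linearZ_LR -hh hv hz -linearZ_LR.
by congr ((u : lhom PE Y) _); apply: val_inj; rewrite /= -mulrA he.
Qed.

(** [cut] of an approximation of [coind M] approximates [M], because [coind] carries the test
    modules into [Pf] over [A]. *)
Lemma cf_corner : cf A -> cf c.
Proof.
move=> h M fM; have [X [phi [hX hphi]]] := h _ (coind_fg fM).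
have [phi' hp'] := cut_map phi; have [k /bijP [ik sk] hk] := cut_coind M.
exists (cut X), (k \o phi' : {linear cut X -> M}); split; first exact: cut_Pf.
move=> Y f hY; have [f' hf'] := coind_map f; have [g hg] := hphi _ f' (coind_Pf hY).
have [g' hg'] := cut_map g; have [j /bijP [ij sj] hj] := cut_coind Y.
have [j' [_ jK]] := bij_inv ij sj; exists (g' \o j' : {linear Y -> cut X}) => y /=.
by rewrite hk hp' hg' hg hf' -hj jK.
Qed.

(** An approximation over the corner, coinduced and pulled back along the unit of [M], approximates
    [M]: the pullback differs from [coind X] by modules killed by [e], and the adjunction supplies
    the factorizations. *)
Lemma corner_cf : cf c -> cf A.
Proof.
move=> h M fM; have [X [phi [hX hphi]]] := h _ (cut_fg fM).
have [phi' hp'] := coind_map phi; have [k [hk k1 k2]] := unit_ex M.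
have [P [a [b [hab ab0 abP]]]] := pullback_ex phi' k.
have gX := coind_Pf hX.
have [ab hab'] := pair_ex a b.
have iab : injective ab.
  by apply: lin_inj => q; rewrite hab' => -[]; apply: ab0.
have fP : finitely_generated P := fg_sub fA iab (fg_prod gX.1 fM).
have [I [p [i [sp ii ip]]]] := im_ex a; have [N [j sj]] := ker_ses sp.
have [Q [q sq]] := coker_ses ii; have [ij _ _] := sj; have [_ sqq hq] := sq.
exists P, b; split.
  apply: (Pf_mid fA sj).
    apply: killed_Pf => [|x]; first exact: (fg_sub fA ij fP).
    have a0 : a (j x) = 0 by rewrite -ip (ses0 _ sj) linear0.
    apply: ij; rewrite linearZ_LR linear0; apply: ab0; rewrite linearZ_LR ?a0 ?scaler0 //.
    by apply: k1; rewrite -hab a0 linear0.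
  apply: (Pf_left fA sq gX); apply: killed_Pf; first exact: fg_surj sqq gX.1.
  move=> y; have [u <-] := sqq y; rewrite -linearZ_LR; apply/hq.
  have [m hm] := k2 (phi' u); have [r [<- _]] : exists r, a r = e *: u /\ b r = m.
    by apply: abP; rewrite linearZ_LR hm.
  by exists (p r); rewrite ip.
move=> Y f hY; have [f' hf'] := cut_map f; have [g hg] := hphi _ f' (cut_Pf hY).
have [g' hg'] := coind_adj g; have [gf hgf] := pair_ex g' f.
have [|l hl] := @lin_lift A Y _ P gf ab iab.
  move=> y; have [r [e1 e2]] : exists r, a r = g' y /\ b r = f y.
    apply: abP; apply: homP => x; rewrite hp' hg' hg hk.
    by apply: val_inj; rewrite hf' /= linearZ_LR.
  by exists r; rewrite hab' hgf e1 e2.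
by exists l => y; have := hl y; rewrite hab' hgf => -[].
Qed.

End Artin.
End Cut.

Definition peirce_of (A : pzRingType) (e f x : A) (h : x \in peirce_pred e f) : peirce e f :=
  exist _ x h.

(** * Endomorphism rings of summands as corners *)

Section Component.
Variables (A : pzRingType) (M N : lmodType A) (a : {linear N -> M}) (b : {linear M -> N}).
Hypothesis ab : cancel a b.
Local Notation D := (endo M).

Definition comp_idem : D := [the {linear M -> M} of a \o b].

Lemma comp_idemP : idempotent_elt comp_idem.
Proof. by apply: endoP => x /=; rewrite ab. Qed.

Local Notation eps := comp_idem.
Local Notation he := comp_idemP.

Lemma comp_ring : exists (f : {rmorphism endo N -> corner he}) (g : {rmorphism corner he -> endo N}),
  [/\ cancel f g, cancel g f & forall u x, (val (f u) : D) x = a (u (b x))].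
Proof.
have sp (u : endo N) : ([the {linear M -> M} of a \o u \o b] : D) \in peirce_pred eps eps.
  by apply/andP; split; apply/eqP; apply: endoP => x /=; rewrite ab.
pose f0 (u : endo N) : corner he := peirce_of (sp u).
have hf0 u x : (val (f0 u) : D) x = a (u (b x)) by [].
have [|||f hf] := @rm_ex (endo N) (corner he) f0.
- by apply: val_inj; apply: endoP => x.
- move=> u v; apply: val_inj; apply: endoP => x.
  exact: linearB.
- by move=> u v; apply: val_inj; apply: endoP => x /=; rewrite ab.
have fi : injective f.
  move=> u v; rewrite !hf => e; apply: endoP => x; apply: (can_inj ab).
  have := congr1 (fun w : corner he => (val w : D) (a x)) e.
  by rewrite !hf0 ab.
have [g gK] : exists g, cancel g f.
  suff sf w : exists u, f u = w.
    by exists (fun w => sval (cid (sf w))) => w; exact: svalP (cid (sf w)).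
  exists ([the {linear N -> N} of b \o (val w : D) \o a] : endo N).
  rewrite hf; apply: val_inj; apply: endoP => x; rewrite hf0 /=.
  have /(congr1 (fun d : D => d x)) e1 := (peirceP w).1.
  have /(congr1 (fun d : D => d x)) e2 := (peirceP w).2.
  by move: e1 e2; rewrite /= => e1 e2; rewrite [X in a (b X)]e2 e1.
have fK : cancel f g by move=> u; apply: fi; rewrite gK.
have [|||g' hg'] := @rm_ex (corner he) (endo N) g.
- by apply: fi; rewrite gK rmorph1.
- by move=> x y; apply: fi; rewrite rmorphB !gK.
- by move=> x y; apply: fi; rewrite rmorphM !gK.
exists f, g'; split=> [u|w|u x]; rewrite ?hg' ?fK ?gK //.
by rewrite hf.
Qed.

(** With [eps] the idempotent of the summand [N], the module [eps D] is Hom([M], [N]) over the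
    corner End([N]). *)
Lemma comp_Pf : Pf (homT N M) -> Pf (corner_module he 1).
Proof.
have [f [g [fK gK hf]]] := comp_ring.
have sp (u : lhom M N) : ([the {linear M -> M} of a \o u] : D) \in peirce_pred eps 1.
  by apply/andP; split; apply/eqP; apply: endoP => x /=; rewrite ?ab.
apply: (Pf_semi fK gK (h := fun u : homT N M => peirce_of (sp u) : corner_module he 1)).
- have e (w : corner_module he 1) : exists u : homT N M,
      peirce_of (sp u) = w :> corner_module he 1.
    exists ([the {linear M -> N} of b \o (val w : D)] : lhom M N); apply: val_inj.
    apply: endoP => x /=; have /(congr1 (fun d : D => d x)) := (peirceP w).1.
    by [].
  exists (fun w => sval (cid (e w))) => [u|w]; last exact: svalP (cid (e w)).
  have := svalP (cid (e (peirce_of (sp u)))); move: (sval _) => u' e'.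
  apply: homP => x; apply: (can_inj ab).
  by have := congr1 (fun w : corner_module he 1 => (val w : D) x) e'.
- move=> u v; apply: val_inj; apply: endoP => x.
  by rewrite -[RHS]/(a ((u : lhom M N) x) + a ((v : lhom M N) x)) -linearD.
- by move=> u v; apply: val_inj; apply: endoP => x /=; rewrite [RHS]hf /= ab.
Qed.

Lemma cf_component : artin_algebra D -> Pf (homT N M) ->
  (forall V : lmodType D, simple_module V -> (forall x : V, eps *: x = 0) -> Pf V) ->
  cf D <-> cf (endo N).
Proof.
move=> hD hP h1; have [f [g [fK gK _]]] := comp_ring.
have h2 := comp_Pf hP; split=> h.
  by apply: cf_ring_iso (cf_corner hD h2 h1 h); apply/ring_isoP; exists g, f.
by apply: (corner_cf hD h2 h1); apply: cf_ring_iso h; apply/ring_isoP; exists f, g.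
Qed.

End Component.

(** * Strong tilting modules over a corner *)

Lemma cores_add (A : pzRingType) (T M X : lmodType A) s : in_add M T -> cores T s X -> cores M s X.
Proof.
move=> h; elim: s X => [|s IHs] X; first exact: add_trans.
move=> [U [C [i [p [sq hU hC]]]]]; exists U, C, i, p; split=> //; first exact: add_trans hU.
exact: IHs.
Qed.

Section CornerTilting.
Variables (A : pzRingType) (e : A) (he : idempotent_elt e).
Local Notation c := (corner he).
Local Notation PE := (corner_module he 1).
Implicit Types M N X Y Z U V S T : lmodType A.

Lemma coind_coadj M (Y : lmodType c) (k : {linear M -> coind Y}) :
  exists h : {linear cut he M -> Y}, forall m x, (k m : lhom PE Y) x = h (cut_act he x m).
Proof.
have [|h hh] := @linear_ex c (cut he M) Y (fun m => (k (val m) : lhom PE Y) (pe1 he)).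
  move=> a m m'; rewrite linearD linearZ_LR.
  rewrite -[LHS]/((k (val m) : lhom PE Y) (rmul (val a) (pe1 he)) + (k (val m') : lhom PE Y) (pe1 he)).
  congr (_ + _); rewrite -linearZ_LR; congr ((k (val m) : lhom PE Y) _).
  by apply: val_inj; rewrite /= (peirceP a).1 (peirceP a).2.
exists h => m x; rewrite hh /= linearZ_LR coindZ; congr ((k m : lhom PE Y) _).
by apply: val_inj; rewrite /= (peirceP x).1.
Qed.

Lemma cut_act1 M (m : cut he M) : cut_act he (pe1 he) (val m) = m.
Proof. by apply: val_inj; rewrite /= cutP. Qed.

(** [cut] is exact and left adjoint to [coind], so an extension problem with values in [coind Y] is
    solved after applying [cut]. *)
Lemma perp_coind (Y : lmodType c) : (forall M, Pf M -> Pf (cut he M)) -> perp Y -> perp (coind Y).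
Proof.
move=> hc hY M hM; apply: E1_split => Z j q s.
have [j' [q' [s' hj _]]] := cut_ses_ex he s.
have [h _ hh] := cut_coind Y; have [r hr] := hY _ (hc M hM) _ _ _ _ s' h.
have [k hk] := coind_adj r; exists k => f; apply: homP => x; rewrite hk.
have -> : cut_act he x (j f) = j' (cut_act he x f).
  by apply: val_inj; rewrite hj /= linearZ_LR.
rewrite hr hh coindZ; congr ((f : lhom PE Y) _).
by apply: val_inj; rewrite /= (peirceP x).1.
Qed.

Lemma endo_coind (W : lmodType c) :
  exists (f : {rmorphism endo W -> endo (coind W)}) (g : {rmorphism endo (coind W) -> endo W}),
  [/\ cancel f g, cancel g f & forall u (k : lhom PE W) x, (f u k : lhom PE W) x = u (k x)].
Proof.
pose f0 (u : endo W) : endo (coind W) := sval (cid (@coind_map _ _ he _ _ (u : {linear W -> W}))).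
have hf0 (u : endo W) (k : lhom PE W) x : (f0 u k : lhom PE W) x = u (k x).
  by rewrite /f0; case: cid => w /= hw; rewrite hw.
have [|||f hf] := @rm_ex (endo W) (endo (coind W)) f0.
- by apply: endoP => k; apply: homP => x; rewrite hf0.
- move=> u v; apply: endoP => k; apply: homP => x; rewrite hf0.
  by rewrite -[RHS]/((f0 u k : lhom PE W) x - (f0 v k : lhom PE W) x) !hf0.
- move=> u v; apply: endoP => k; apply: homP => x; rewrite hf0.
  by rewrite -[RHS]/((f0 u (f0 v k) : lhom PE W) x) !hf0.
have {hf0} hf u k x : (f u k : lhom PE W) x = u ((k : lhom PE W) x) by rewrite hf hf0.
have [h /bijP [ih sh] hh] := @cut_coind _ _ he W; have [h' [hK h'K]] := bij_inv ih sh.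
have fi : injective f.
  move=> u v e0; apply: endoP => y; have [k <-] := sh y; rewrite hh.
  by have := congr1 (fun w : endo (coind W) => (w (val k) : lhom PE W) (pe1 he)) e0; rewrite !hf.
have sf w : exists u, f u = w.
  have [l hl] := @coind_coadj _ W (w : {linear coind W -> coind W}).
  exists ([the {linear W -> W} of l \o h'] : endo W); apply: endoP => k; apply: homP => x.
  rewrite hf hl /=; congr (l _); apply: ih; rewrite h'K hh coindZ.
  by congr ((k : lhom PE W) _); apply: val_inj; rewrite /= (peirceP x).1.
pose g w := sval (cid (sf w)); have gK : cancel g f by move=> w; exact: svalP (cid (sf w)).
have [|||g' hg'] := @rm_ex (endo (coind W)) (endo W) g.
- by apply: fi; rewrite gK rmorph1.
- by move=> x y; apply: fi; rewrite rmorphB !gK.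
- by move=> x y; apply: fi; rewrite rmorphM !gK.
exists f, g'; split=> [u|w|//]; rewrite ?hg' ?gK //.
by apply: fi; rewrite gK.
Qed.

Lemma homT_coind_Pf (W : lmodType c) M : Pf (homT W (cut he M)) -> Pf (homT (coind W) M).
Proof.
have [f [g [fK gK hf]]] := endo_coind W.
pose h (u : homT W (cut he M)) : homT (coind W) M :=
  sval (cid (coind_adj (u : {linear cut he M -> W}))).
have hh (u : lhom (cut he M) W) m x : ((h u : lhom M (coind W)) m : lhom PE W) x = u (cut_act he x m).
  by rewrite /h; case: cid => w /= hw; rewrite hw.
apply: (Pf_semi fK gK (h := h)).
- have sf w : exists u, h u = w.
    have [l hl] := @coind_coadj _ W (w : {linear M -> coind W}).
    by exists (l : lhom _ _); apply: homP => m; apply: homP => x; rewrite hh hl.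
  exists (fun w => sval (cid (sf w))) => [u|w]; last exact: svalP (cid (sf w)).
  have := svalP (cid (sf (h u))); move: (sval _) => u' e'.
  apply: homP => m.
  have := congr1 (fun w : homT (coind W) M => ((w : lhom M (coind W)) (val m) : lhom PE W) (pe1 he)) e'.
  by rewrite !hh cut_act1.
- move=> u v; apply: homP => m; apply: homP => x; rewrite hh.
  rewrite -[RHS]/(((h u : lhom M (coind W)) m : lhom PE W) x + ((h v : lhom M (coind W)) m : lhom PE W) x).
  by rewrite !hh.
- move=> u v; apply: homP => m; apply: homP => x; rewrite hh.
  rewrite -[RHS]/((f u ((h v : lhom M (coind W)) m) : lhom PE W) x).
  by rewrite hf hh.
Qed.

Hypothesis hA : artin_algebra A.
Hypothesis H2 : Pf PE.
Hypothesis H1 : forall S, simple_module S -> (forall x : S, e *: x = 0) -> Pf S.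
Let fA : finlen A^o := (artin_data hA).1.
Let hc : artin_algebra c := artin_corner he hA.
Let fc : finlen c^o := (artin_data hc).1.

Section Compare.
Variables (T : lmodType A) (W : lmodType c).
Hypothesis hT : strong T.
Hypothesis hW : strong W.

Let pW : Pf (coind W).
Proof. by apply: (coind_Pf hA H2 H1); case: hW. Qed.

Let eW : perp (coind W).
Proof. by case: hW => _ h _; apply: perp_coind h => M; apply: cut_Pf. Qed.

(** A module of [Pf] that is itself orthogonal to [Pf] lies in add([T]): its embedding into add([T])
    with cokernel in [Pf] splits. *)
Let addW : in_add T (coind W).
Proof.
have [U [C [i [p [s hU hC]]]]] := SC_embed fA (strong_SC fA hT) pW.
exact: add_trans hU (add_retract (E1_ses_split s (eW hC))).
Qed.

Local Notation M := (T * coind W)%type.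

Lemma strong_join : strong M.
Proof.
have [hT1 hT2 [s hs]] := hT; split; first exact: Pf_prod.
  move=> Y hY; have [l hl] := inl_ex T (coind W).
  exact: E1_ext_r hY.1 (ses_prod hl) (hT2 Y hY) (eW hY).
by exists s; apply: cores_add hs; apply/add_retract/retract_fst.
Qed.

Let hM : strong M := strong_join.
Let fM : finitely_generated M. Proof. by case: hM => -[]. Qed.
Let hD : artin_algebra (endo M) := artin_endo hA fM.

(* No simple module over [endo M] is killed by the projection onto [T], because [M] lies in
   add [T]. *)
Lemma cf_join_left : cf (endo M) <-> cf (endo T).
Proof.
have [l hl] := inl_ex T (coind W).
have lK : cancel l (fst : {linear M -> T}) by move=> x; rewrite hl.
apply: (cf_component lK hD); first by apply: homT_Pf => //; case: hM.
move=> V [nV _] hV; case: nV => v.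
have [r hr] : in_add T M by apply: add_prod => //; exact: add_self.
have [s hs] := (in_addP T M).1 (ex_intro _ r hr).
have -> : v = (1 : endo M) *: v by rewrite scale1r.
have -> : (1 : endo M) = \sum_(q <- s) ((([the {linear M -> M} of q.2 \o fst] : endo M) *
    comp_idem l fst) * ([the {linear M -> M} of l \o q.1] : endo M)).
  apply: endoP => x; rewrite [LHS]hs.
  have -> (r' : seq ({linear M -> T} * {linear T -> M})) (F : _ -> endo M) :
      (\sum_(q <- r') F q) x = \sum_(q <- r') F q x.
    by elim: r' => [|q r' IHr]; rewrite ?big_nil // !big_cons -IHr.
  by apply: eq_bigr => q _; rewrite /= lK lK.
rewrite scaler_suml big1 // => q _.
by rewrite -!scalerA hV scaler0.
Qed.

(* A simple [endo M]-module [V] killed by the projection onto [coind W] is Hom(S, M), for a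
   simple submodule [S] of [M] killed by the annihilator of an element of [V]: [e S = 0], since
   [W] separates the points of [e M]. *)
Lemma cf_join_right : cf (endo M) <-> cf (endo (coind W)).
Proof.
have [r hr] := inr_ex T (coind W).
have rK : cancel r (snd : {linear M -> coind W}) by move=> x; rewrite hr.
apply: (cf_component rK hD).
  apply: homT_coind_Pf; apply: (homT_Pf hc hW); apply: (cut_Pf hA H2).
  by case: hM.
move=> V hV eV; have [nV _] := hV; have [v nv] := nonzero_ex nV.
have mI := simple_ann hV nv; have [t [nt ht]] := endo_max_ideal hA hM mI.
pose N0 (s : M) := forall u : endo M, u *: v = 0 -> u s = 0.
have sN : submodule N0.
  split=> [u _|x y hx hy u hu|a x hx u hu]; first exact: linear0.
    by rewrite linearD hx ?hy ?addr0.
  by rewrite linearZ_LR hx ?scaler0.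
have [N [j [ij hj]]] := sub_ex sN.
have nN : ~ is_zero N.
  move=> zN; have /hj [y hy] : N0 t by move=> u hu; apply: ht.
  by apply: nt; rewrite -hy (zN y) linear0.
have fN := finlen_inj ij (fg_finlen fA fM).
have [S [k [ik hS]]] := simple_sub fN nN.
pose i : {linear S -> M} := j \o k.
have ii : injective i by move=> x y /ij /ik.
have hi (u : endo M) s : u *: v = 0 -> u (i s) = 0.
  by have /hj h : exists y, j y = i s by [exists (k s)]; exact: h.
have pM : Pf M by case: hM.
have eS (s : S) : e *: s = 0.
  apply: contrapT => ns; have [_ _ sW _] := strong_SC fc hW.
  have [|g ng] := sW _ (cut_Pf hA H2 pM) (cut_in he (i s)).
    move=> /(congr1 val) /= h; apply: ns; apply: ii.
    by rewrite linearZ_LR h linear0.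
  have [l hl] := coind_adj g; apply: ng.
  have hd : ([the {linear M -> M} of r \o l] : endo M) *: v = 0.
    have -> : ([the {linear M -> M} of r \o l] : endo M) =
              comp_idem r snd * ([the {linear M -> M} of r \o l] : endo M).
      by apply: endoP => x; rewrite /= rK.
    by rewrite -scalerA eV.
  have /(can_inj rK) /= l0 := etrans (hi _ s hd) (esym (linear0 r)).
  rewrite -[RHS]/((0 : lhom PE W) (pe1 he)) -[0 in RHS]l0 hl.
  by congr (g _); apply: val_inj.
have pS := H1 hS eS; have [Q [q sq]] := coker_ses ii; have pQ := Pf_right fA sq pS pM.
have eQ : E1 Q M by case: hM => _ h _; apply: h.
have pF := homT_Pf hA hM pS.
have [m hm] := smul_ex v.
(* Restriction to [S] has the annihilator of [v] as its kernel, by maximality of this left ideal,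
   and is onto because Ext^1([Q], [M]) = 0. *)
have [|w hw] := @linear_ex (endo M) (endo M)^o (homT M S) (fun u : endo M => [the {linear S -> M} of u \o i] : lhom S M).
  by move=> a u u'; apply: homP.
have wi u : w u = 0 -> u *: v = 0.
  case: mI => hI nI1 hmax w0; have [|h|h] := hmax _ (ker_submodule w).
  - move=> x hx; rewrite hw; apply: homP => s; exact: hi.
  - exact: h.
  - have [s ns] := nonzero_ex hS.1; case: ns; apply: ii; rewrite linear0.
    by have := congr1 (fun f : lhom S M => f s) (h 1); rewrite hw.
have sw : surjective w.
  move=> g; have [g' hg'] := eQ _ _ _ _ sq g; exists (g' : endo M).
  by rewrite hw; apply: homP => s; rewrite /= hg'.
have [|z hz] := @lin_fact _ _ V _ w m sw; first by move=> u /wi; rewrite hm.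
apply: Pf_iso pF; exists z; apply/bijP; split.
  apply: lin_inj => f; have [u <-] := sw f; rewrite hz hm => hu.
  by rewrite hw; apply: homP => s; apply: hi.
move=> y; have [h|h] := hV.2 _ (im_submodule m).
  by case: nv; apply: h; exists 1; rewrite hm scale1r.
by have [u <-] := h y; exists (w u); rewrite hz.
Qed.

Lemma cf_corner_tilting : cf (endo T) <-> cf (endo W).
Proof.
have [f [g [fK gK _]]] := endo_coind W; rewrite -cf_join_left cf_join_right.
by split; apply: cf_ring_iso; apply/ring_isoP; [exists g, f|exists f, g].
Qed.

End Compare.
End CornerTilting.

(** * Basic strong tilting modules *)

Section Distinct.
Variable A : pzRingType.
Implicit Types M N X Y T U : lmodType A.

Lemma iso_representatives (s : seq (lmodType A)) : exists t (F : 'I_t -> lmodType A),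
  [/\ forall i, List.In (F i) s, forall i j, module_iso (F i) (F j) -> i = j
    & forall X, List.In X s -> exists i, module_iso X (F i)].
Proof.
elim: s => [|x s [t [F [F1 F2 F3]]]].
  by exists 0%N, (fun _ => A^o : lmodType A); split=> // -[].
have [[i hi]|h] := pselect (exists i, module_iso x (F i)).
  exists t, F; split=> // [i'|X [<-|/F3 //]]; [by right|by exists i].
pose G i := if unlift (@ord0 t) i is Some j then F j else x.
have G0 : G ord0 = x by rewrite /G unlift_none.
have GS j : G (lift ord0 j) = F j by rewrite /G liftK.
exists t.+1, G; split=> [i|i j|X].
- by case: (unliftP ord0 i) => [j ->|->]; rewrite ?G0 ?GS; [right|left].
- case: (unliftP ord0 i) => [i' ->|->]; case: (unliftP ord0 j) => [j' ->|->]; rewrite ?G0 ?GS //.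
  + by move=> /F2 ->.
  + by move=> /iso_sym e; case: h; exists i'.
  + by move=> e; case: h; exists j'.
- move=> [<-|/F3 [i hi]]; first by exists ord0; rewrite G0; apply: iso_refl.
  by exists (lift ord0 i); rewrite GS.
Qed.

Lemma add_summands T M (s : seq (summand M)) :
  (forall p, List.In p s -> in_add T (projT1 p)) ->
  (forall x, x = \sum_(p <- s) (projT2 p).2 ((projT2 p).1 x)) -> in_add T M.
Proof.
move=> h hs; suff [r hr] : exists r : seq ({linear M -> T} * {linear T -> M}),
    forall x, \sum_(p <- s) (projT2 p).2 ((projT2 p).1 x) = \sum_(q <- r) q.2 (q.1 x).
  by apply/in_addP; exists r => x; rewrite -hr -hs.
elim: s h {hs} => [|p s IHs] h; first by exists [::] => x; rewrite !big_nil.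
have [|r hr] := IHs; first by move=> q hq; apply: h; right.
have /in_addP [r' hr'] : in_add T (projT1 p) by apply: h; left.
pose c (q : {linear projT1 p -> T} * {linear T -> projT1 p}) : {linear M -> T} * {linear T -> M} :=
  (q.1 \o (projT2 p).1 : {linear M -> T}, (projT2 p).2 \o q.2 : {linear T -> M}).
exists ([seq c q | q <- r'] ++ r) => x.
rewrite big_cons big_cat hr big_map /=; congr (_ + _).
by rewrite [in LHS](hr' ((projT2 p).1 x)) linear_sum.
Qed.

Definition distinct_summands t (F : 'I_t -> lmodType A) M :=
  [/\ forall i, indecomposable (F i) /\ retract (F i) M,
      forall i j, module_iso (F i) (F j) -> i = j
    & forall X, indecomposable X -> retract X M -> exists i, module_iso X (F i)].

Lemma distinct_summandsP t (F : 'I_t -> lmodType A) M :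
  distinct_indecomposable_summands F M <-> distinct_summands F M.
Proof.
by split=> -[h1 h2 h3]; split=> // [i|X hX /direct_summandP];
  try exact: h3; have [? /direct_summandP] := h1 i.
Qed.

Lemma distinct_ex M : finlen M -> exists t (F : 'I_t -> lmodType A),
  [/\ distinct_summands F M, in_add (dsum F) M & in_add M (dsum F)].
Proof.
move=> fM; have [s [hs1 hs2]] := decomposition fM.
have [t [F [F1 F2 F3]]] := iso_representatives (map (fun p : summand M => projT1 p) s).
have iF i : indecomposable (F i) /\ retract (F i) M.
  have [p [<- /hs1 [h1 h2]]] := (List.in_map_iff _ _ _).1 (F1 i).
  by split=> //; exists (projT2 p).2, (projT2 p).1.
have a1 : in_add (dsum F) M.
  apply: (add_summands _ hs2) => p hp.
  have [|i hi] := F3 (projT1 p); first by apply/List.in_map_iff; exists p.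
  apply: add_retract; apply: retract_trans (retract_iso hi) _.
  have [l [hl _]] := inj_ex F i; have [q hq] := proj_ex F i.
  by exists l, q => x; rewrite hq hl.
have a2 : in_add M (dsum F) by apply: add_dsum => i; apply: add_retract; case: (iF i).
exists t, F; split=> //; split=> // X hX r.
have fX : finlen X by have [a [b ab]] := r; apply: finlen_inj (can_inj ab) fM.
have /(indec_add fX hX) /(indec_dsum fX hX) [i ri] : in_add (dsum F) X.
  exact: add_trans a1 (add_retract r).
by exists i; apply: indec_retract_iso ri; case: hX => //; case: (iF i).
Qed.

Hypothesis hA : artin_algebra A.
Let fA : finlen A^o := (artin_data hA).1.

Lemma strong_add T U : strong T -> in_add T U -> in_add U T -> strong U.
Proof.
move=> [h1 h2 [s hs]] TU UT; split; [exact: Pf_add TU|exact: perp_add TU|].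
by exists s; apply: cores_add hs.
Qed.

(** One copy of each indecomposable summand has the same additive closure and, by [endo_basic], a
    basic endomorphism ring. *)
Lemma basic_strong_ex T : strong T -> exists U,
  [/\ strong U, basic_algebra (endo U) & basic_module U].
Proof.
move=> hT; have fT : finlen T by apply: (Pf_finlen fA); case: hT.
have [t [F [[F1 F2 F3] TU UT]]] := distinct_ex fT.
have hU := strong_add hT UT TU; exists (dsum F).
have fF i : finlen (F i).
  by have [_ [a [b ab]]] := F1 i; apply: finlen_inj (can_inj ab) fT.
have [D [p [h1 h2 h3 _]]] := endo_basic fF (fun i => (F1 i).1) F2.
have hb : basic_algebra (endo (dsum F)) by exists t, D, p.
split=> //; apply: basic_endo_module hb; apply: (artin_data _).1.
by apply: artin_endo hA _; case: hU => -[].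
Qed.

Lemma simples_embed T : cogenerated A -> strong T ->
  forall S : lmodType A, simple_module S -> exists u : {linear S -> T}, injective u.
Proof.
move=> [X [hX h]] hT S hS; have [u iu] := h S hS.
have [U [C [i [p [[ii _ _] hU _]]]]] := SC_embed fA (strong_SC fA hT) hX.
have [s hs] := (in_addP _ _).1 hU; have [x nx] := nonzero_ex hS.1.
have [q nq] : exists q : {linear U -> T} * {linear T -> U}, q.1 (i (u x)) <> 0.
  apply: contrapT => hn; apply: nx; apply: iu; apply: ii.
  rewrite !linear0 [LHS]hs big1 // => q _.
  by have -> : q.1 (i (u x)) = 0; [apply: contrapT => nq; apply: hn; exists q|exact: linear0].
by exists (q.1 \o i \o u : {linear S -> T}); apply: simple_inj hS _; exists x.
Qed.

End Distinct.

(** * Unlimited iteration *)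

(** Two steps of the iteration already give this: a strong tilting module on the second side forces
    contravariant finiteness over End(T). *)
Lemma unlimited_cf (A : pzRingType) : unlimited_strong_tilting A ->
  exists2 T : lmodType A, strong T & cf (endo T).
Proof.
move=> [As [<- h1 h2]].
have [T [/(strongP (artin_data (h1 0%N).1).1) hT _ iT]] := h2 0%N; exists T => //.
have aB := artin_conv (h1 1%N).1; have bB := basic_conv (artin_data (h1 1%N).1).1 (h1 1%N).2.
have [U [/(strongP (artin_data aB).1) hU _ _]] := h2 1%N.
apply: cf_ring_iso (strong_cf aB bB hU).
exact: ring_iso_trans (ring_iso_conv iT) (conv_conv _).
Qed.

(** If [T2] is strong tilting over End(T), then [evm T2] is strong tilting over End(T2), with
    endomorphism ring End(T) again; so the iteration alternates between two algebras. *)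
Lemma cf_unlimited (A : pzRingType) (T : lmodType A) : artin_algebra A -> basic_algebra A ->
  strong T -> basic_algebra (endo T) -> basic_module T -> cf (endo T) ->
  unlimited_strong_tilting A.
Proof.
move=> aA bA hT bE bT hcf; have fA := (artin_data aA).1.
have aE : artin_algebra (endo T) by apply: artin_endo aA _; case: hT => -[].
pose B : pzRingType := (endo T)^c.
have aB : artin_algebra B := artin_conv aE.
have bB : basic_algebra B := basic_conv (artin_data aE).1 bE.
have aBc : artin_algebra B^c := artin_conv aB.
have bBc : basic_algebra B^c := basic_conv (artin_data aB).1 bB.
have iB : ring_iso (endo T) B^c by apply: ring_iso_sym; apply: conv_conv.
have [T2' hT2'] := cf_strong aBc bBc (cf_ring_iso iB hcf).
have [T2 [hT2 bE2 bT2]] := basic_strong_ex aBc hT2'.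
(* [evm T] lies in [Pf] and contains every simple module over [endo T]; hence [T2] contains them
   too, as [evm_strong] requires. *)
have cB : cogenerated B^c.
  apply: cog_ring_iso iB _; exists (evm T); split; first exact: evm_Pf.
  exact: endo_simple_embed.
have emb := simples_embed aBc cB hT2.
have aC : artin_algebra (endo T2) by apply: artin_endo aBc _; case: hT2 => -[].
have hT3 := evm_strong aBc hT2 emb; have dc := double_centralizer aBc hT2.
have aF := artin_iso dc aBc; have bF := basic_iso (artin_data aBc).1 dc bBc.
(* After [A] at position 0, [B] stands at the odd and [endo T2] at the even positions. *)
exists (fun i => if i == 0%N then A else if odd i then B else endo T2); split=> [//|[|i]|[|i]] /=.
- by [].
- by case: odd.
- by exists T; split=> //; [exact/(strongP fA)|exact: ring_iso_refl].
- case: (odd i) => /=.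
    exists (evm T2); split; first exact/(strongP (artin_data aC).1).
      exact: basic_endo_module (artin_data aF).1 bF.
    exact: ring_iso_trans (ring_iso_sym (conv_conv B)) (ring_iso_conv dc).
  exists T2; split=> //; [exact/(strongP (artin_data aBc).1)|exact: ring_iso_refl].
Qed.

(** * Primitive idempotents *)

Section LeftIdealModule.
Variables (A : pzRingType) (e : A).
Hypothesis he : idempotent_elt e.
Local Notation P := (left_ideal e).

Lemma left_ideal_gen_subproof : (e : A^o) \in left_ideal_pred e.
Proof. exact/eqP. Qed.

Definition left_ideal_gen : P := exist _ (e : A^o) left_ideal_gen_subproof.

Lemma left_idealP (x : P) : (val x : A) * e = val x.
Proof. by case: x => x /= /eqP. Qed.

Lemma left_ideal_genE (x : P) : x = (val x : A) *: left_ideal_gen.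
Proof. by apply: val_inj; rewrite /= -[RHS]/((val x : A) * e) left_idealP. Qed.

Lemma left_ideal_map (M : lmodType A) (x : M) :
  exists h : {linear P -> M}, forall a, h a = (val a : A) *: x.
Proof. by apply: linear_ex => a b c; rewrite /= scalerDl scalerA. Qed.

Lemma left_ideal_retract : retract P A^o.
Proof.
have [|a ha] := @linear_ex A P A^o (fun x : P => val x); first by [].
have [b hb] := smul_ex left_ideal_gen.
by exists a, b => x; rewrite hb ha -left_ideal_genE.
Qed.

Lemma left_ideal_fg : finitely_generated P.
Proof. exact: retract_fg left_ideal_retract (fg_free A). Qed.

Lemma left_ideal_proj : projective_module P.
Proof. exact: proj_retract left_ideal_retract (@proj_free A). Qed.

End LeftIdealModule.

(** Endomorphisms of the left ideal are right multiplications by elements of eAe, so a decomposition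
    of the module gives one of [e] into orthogonal idempotents. *)
Lemma left_ideal_indec (A : pzRingType) (e : A) : primitive_idempotent e ->
  indecomposable (left_ideal e : lmodType A).
Proof.
move=> [he ne prim]; pose g0 := left_ideal_gen he; split=> [z|X Y].
  by move/eqP: ne; apply; have := congr1 val (z g0).
move=> /isoP [f [g [fK gK]]].
have [l hl] := inl_ex X Y; have [r hr] := inr_ex X Y.
pose pl : {linear left_ideal e -> left_ideal e} := g \o l \o (fst : {linear (X * Y)%type -> X}) \o f.
pose pr : {linear left_ideal e -> left_ideal e} := g \o r \o (snd : {linear (X * Y)%type -> Y}) \o f.
have pE x : pl x + pr x = x.
  rewrite /pl /pr /= -linearD hl hr -[RHS]fK; congr (g _); case: (f x) => u v.
  by rewrite -[LHS]/(u + 0, 0 + v) addr0 add0r.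
have pll x : pl (pl x) = pl x by rewrite /pl /= gK !hl.
have prr x : pr (pr x) = pr x by rewrite /pr /= gK !hr.
have plr x : pl (pr x) = 0 by rewrite /pl /pr /= gK hr /= !linear0.
have prl x : pr (pl x) = 0 by rewrite /pl /pr /= gK hl /= !linear0.
have act (h : {linear left_ideal e -> left_ideal e}) x : (val (h x) : A) = (val x : A) * val (h g0).
  by rewrite {1}[x](left_ideal_genE he) linearZ_LR.
have [|||||z|z] := prim (val (pl g0)) (val (pr g0)).
- by rewrite /idempotent_elt -[LHS](act pl) pll.
- by rewrite /idempotent_elt -[LHS](act pr) prr.
- by rewrite -[LHS](act pr) prl.
- by rewrite -[LHS](act pl) plr.
- exact: (congr1 val (esym (pE g0))).
- left=> x; have : pl (g (l x)) = 0 by apply: val_inj; rewrite act z mulr0.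
  by rewrite /pl /= gK hl /= => /(congr1 f); rewrite gK hl linear0 => -[].
- right=> x; have : pr (g (r x)) = 0 by apply: val_inj; rewrite act z mulr0.
  by rewrite /pr /= gK hr /= => /(congr1 f); rewrite gK hr linear0 => -[].
Qed.

Lemma simple_bij (A : pzRingType) (S V : lmodType A) (f : {linear S -> V}) :
  simple_module S -> simple_module V -> (exists x, f x <> 0) -> bijective f.
Proof.
move=> hS [_ hV] [x nx]; apply/bijP; split; first by apply: simple_inj => //; exists x.
by have [h|//] := hV _ (im_submodule f); case: nx; apply: h; exists x.
Qed.

(** * Simple tops of primitive idempotents *)

Section Idempotents.
Variables (A : pzRingType) (k : nat) (D : 'I_k -> nzRingType) (p : forall i, {rmorphism A -> D i}).
Hypothesis fA : finlen A^o.
Hypothesis hD : forall i, division_ring (D i).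
Hypothesis hp : forall y : (forall i, D i), exists x, forall i, p i x = y i.
Hypothesis hJ : forall x, (forall i, p i x = 0) <-> jacobson x.
Variables (n : nat) (e : 'I_n -> A).
Hypothesis he : complete_primitive_idempotents e.

(** If [e i] mapped to 1 in two factors, let u lift the unit of only one of them. Right
    multiplication by e u e, where e is [e i], would be an endomorphism of an indecomposable left
    ideal that is neither bijective nor nilpotent. *)
Lemma primitive_class (i : 'I_n) : exists l, forall j, p j (e i) = (j == l)%:R.
Proof.
have [pe _ _] := he; have [ie ne _] := pe i; have iP := left_ideal_indec (pe i).
have pi l : p l (e i) = 0 \/ p l (e i) = 1.
  have [|/eqP nl] := pselect (p l (e i) = 0); first by left.
  right; have [d [_ de]] := hD nl.
  have : p l (e i) * p l (e i) = p l (e i) by rewrite -rmorphM ie.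
  by move=> /(congr1 (fun z => d * z)); rewrite mulrA de mul1r.
have [l hl] : exists l, p l (e i) = 1.
  apply: contrapT => hn; have /hJ /(jacobson_left_inv fA) [u hu] : forall l, p l (e i) = 0.
    by move=> l; have [//|h] := pi l; case: hn; exists l.
  by move/eqP: ne; apply; rewrite -[e i]mul1r -hu -mulrA mulrBl mul1r ie subrr mulr0.
exists l => j; have [->//|jl] := eqVneq j l; have [//|hj] := pi j; exfalso.
pose y := e i * ulift hp l * e i.
have hy : (y : A^o) \in left_ideal_pred (e i) by apply/eqP; rewrite /y -mulrA ie.
have [r hr] := @left_ideal_map A (e i) _ (exist _ (y : A^o) hy : left_ideal (e i)).
have fP : finlen (left_ideal (e i) : lmodType A) by apply: fg_finlen => //; apply: left_ideal_fg.
have [/bijP [_ sr]|[m hm]] := indec_fitting r fP iP.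
  have [a /(congr1 (fun x => p j (val x : A)))] := sr (left_ideal_gen ie).
  rewrite hr /= -[X in p j X]/((val a : A) * y) !rmorphM hj uliftE eq_sym (negPf jl).
  by rewrite mulr0 mul0r mulr0 => /eqP; rewrite eq_sym oner_eq0.
have : p l (val (iter m r (left_ideal_gen ie)) : A) = 1.
  elim: {hm} m => [|m IHm]; first exact: hl.
  by rewrite /= hr -[X in p l X]/((val (iter m r (left_ideal_gen ie)) : A) * y) rmorphM IHm !rmorphM hl uliftE eqxx !mulr1.
by rewrite hm rmorph0 => /eqP; rewrite eq_sym oner_eq0.
Qed.

Definition pclass i := sval (cid (primitive_class i)).

Lemma pclassE i j : p j (e i) = (j == pclass i)%:R.
Proof. exact: svalP (cid (primitive_class i)) j. Qed.

Lemma pclass_inj : injective pclass.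
Proof.
move=> i j eij; apply/eqP; apply: contrapT => /negP nij; have [_ oe _] := he.
have := pclassE i (pclass i); rewrite eqxx => h1.
have := pclassE j (pclass i); rewrite eij eqxx -eij => h2.
have := congr1 (p (pclass i)) (oe i j nij); rewrite rmorphM h1 h2 rmorph0 mul1r.
by move/eqP; rewrite oner_eq0.
Qed.

Variables (S : 'I_n -> lmodType A).
Hypothesis hS : forall i, is_top_of (e i) (S i).

Lemma top_data i : exists2 q : {linear left_ideal (e i) -> S i}, surjective q &
  forall x, q x = 0 <-> p (pclass i) (val x : A) = 0.
Proof.
have [pe _ _] := he; have [ie _ _] := pe i.
have [q sq hq] := hS i; exists q => // x; split=> [/hq [y /hJ jy ->]|px].
  by rewrite rmorphM jy mul0r.
apply/hq; exists (val x : A); last by rewrite left_idealP.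
apply/hJ => j; rewrite -(left_idealP x) rmorphM pclassE.
by have [->|_] := eqVneq j (pclass i); rewrite ?px ?mul0r ?mulr0.
Qed.

Lemma top_gen i : exists g : S i, [/\ g <> 0, e i *: g = g,
  forall s, exists a, s = a *: g & forall a, p (pclass i) a = 0 <-> a *: g = 0].
Proof.
have [pe _ _] := he; have [ie _ _] := pe i; have [q sq hq] := top_data i.
pose g0 := left_ideal_gen ie.
have h a : p (pclass i) a = 0 <-> a *: q g0 = 0.
  rewrite -linearZ_LR hq -[X in p _ X = 0 <-> _]mulr1.
  by rewrite -[X in _ <-> p _ X = 0]/(a * e i) !rmorphM pclassE eqxx rmorph1.
exists (q g0); split=> //.
- by move/hq; rewrite /= pclassE eqxx => /eqP; rewrite oner_eq0.
- by rewrite -linearZ_LR; congr (q _); apply: val_inj; rewrite /= -[LHS]/(e i * e i) ie.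
- by move=> s; have [x <-] := sq s; exists (val x : A); rewrite {1}[x](left_ideal_genE ie) linearZ_LR.
Qed.

Lemma top_simple i : simple_module (S i).
Proof.
have [g [ng eg gg ag]] := top_gen i; split=> [z|N [N0 ND NZ]]; first exact/ng/z.
have [h|h] := pselect (forall x, N x -> x = 0); [by left|right=> s].
have [x [Nx nx]] : exists x, N x /\ x <> 0.
  by apply: contrapT => hn; apply: h => x Nx; apply: contrapT => nx; apply: hn; exists x.
have [a xa] := gg x; have na : p (pclass i) a <> 0 by move=> /ag; rewrite -xa.
have [b hb] := ker_inv hD hp (fun b => (ag b).1) na.
have [c ->] := gg s; apply: (NZ); rewrite -hb -scalerA -xa.
exact: NZ.
Qed.

Lemma top_other i j (s : S i) : j != i -> e j *: s = 0.
Proof.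
move=> ji; have [g [_ _ gg ag]] := top_gen i; have [a ->] := gg s.
rewrite scalerA; apply/ag; rewrite rmorphM pclassE (inj_eq pclass_inj) eq_sym (negPf ji).
exact: mul0r.
Qed.

Lemma simple_top (V : lmodType A) i (v : V) : simple_module V -> e i *: v <> 0 ->
  module_iso (S i) V.
Proof.
move=> hV nv; have [pe _ _] := he; have [ie _ _] := pe i; have [q sq hq] := hS i.
have [h hh] := @left_ideal_map A (e i) _ v.
have [|z hz] := @lin_fact A _ V (S i) q h sq.
  by move=> x /hq [y jy xy]; rewrite hh xy -scalerA; apply: jacobson_simple.
exists z; apply: simple_bij => //; first exact: top_simple.
by exists (q (left_ideal_gen ie)); rewrite hz hh.
Qed.

Lemma top_iso i j : module_iso (S i) (S j) -> i = j.
Proof.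
move=> /isoP [f [f' [fK _]]]; apply/eqP; apply: contrapT => /negP nij.
have [g [ng eg _ _]] := top_gen i; apply: ng; apply: (can_inj fK).
by rewrite linear0 -eg linearZ_LR top_other.
Qed.

Lemma simple_top_ex (V : lmodType A) : simple_module V -> exists i, module_iso (S i) V.
Proof.
move=> hV; have [v nv] := nonzero_ex hV.1; apply: contrapT => hn; apply: nv.
have [_ _ se] := he; rewrite -[v]scale1r -se scaler_suml big1 // => i _.
by apply: contrapT => ni; apply: hn; exists i; apply: simple_top ni.
Qed.

End Idempotents.

(** * Iterated tilting over a corner *)

(** The Peirce decomposition of eA; it reduces finite projective dimension of eA to that of eA(1 -
    e). *)
Lemma corner_split (A : pzRingType) (e : A) (he : idempotent_elt e) :
  module_iso (corner_module he 1) ((corner he)^o * corner_module he (1 - e))%type.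
Proof.
pose c := corner he.
have s1 (x : corner_module he 1) : val x * e \in peirce_pred e e.
  by apply/andP; rewrite mulrA (peirceP x).1 -mulrA he.
have he' : (1 - e) * (1 - e) = 1 - e by rewrite mulrBr mulr1 mulrBl mul1r he subrr subr0.
have s2 (x : corner_module he 1) : val x * (1 - e) \in peirce_pred e (1 - e).
  by apply/andP; rewrite mulrA (peirceP x).1 -mulrA he'.
have [|f hf] := @linear_ex c (corner_module he 1) ((corner he)^o * corner_module he (1 - e))%type
    (fun x => (peirce_of (s1 x) : c^o, peirce_of (s2 x) : corner_module he (1 - e))).
  by move=> a x y; congr pair; apply: val_inj; rewrite /= mulrDl -mulrA.
exists f; apply/bijP; split=> [x y|[x y]].
  rewrite !hf => -[h1 h2]; apply: val_inj.
  have d a : a = a * (1 - e) + a * e by rewrite mulrBr mulr1 subrK.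
  by rewrite (d (val x)) (d (val y)) h1 h2.
have sz : val x + val y \in peirce_pred e 1.
  by apply/andP; rewrite mulr1 mulrDr (peirceP x).1 (peirceP y).1.
have xe : val x * (1 - e) = 0 by rewrite mulrBr mulr1 (peirceP x).2 subrr.
have ye : val y * e = 0.
  by rewrite -(peirceP y).2 -mulrA mulrBl mul1r he subrr mulr0.
exists (peirce_of sz : corner_module he 1); rewrite hf.
congr pair; apply: val_inj; rewrite /= mulrDl ?xe ?ye ?addr0 ?add0r.
  exact: (peirceP x).2.
exact: (peirceP y).2.
Qed.

Lemma corner_module_Pf (A : pzRingType) (e : A) (he : idempotent_elt e) : artin_algebra A ->
  finite_pdim (corner_module he (1 - e)) -> Pf (corner_module he 1).
Proof.
move=> hA hd; have fc := (artin_data (artin_corner he hA)).1.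
apply: (Pf_iso (iso_sym (corner_split he))); apply: (Pf_prod fc (Pf_free _)).
apply/PfinP; split=> //.
apply: (@fg_surj _ ((corner he)^o * corner_module he (1 - e))%type _ snd) => [y|].
  by exists (0, y).
apply: fg_iso (corner_split he) _; apply: fg_iso (iso_sym (cut_free he)) _.
exact: (cut_fg he hA (fg_free A)).
Qed.

Lemma unlimited_corner (A : pzRingType) (e : A) (he : idempotent_elt e) :
  artin_algebra A -> basic_algebra A -> cf A -> Pf (corner_module he 1) ->
  (forall S : lmodType A, simple_module S -> (forall x : S, e *: x = 0) -> Pf S) ->
  unlimited_strong_tilting A <-> unlimited_strong_tilting (corner he).
Proof.
move=> aA bA cA H2 H1; have aC := artin_corner he aA.
have bC := basic_corner he (artin_data aA).1 bA.
split=> /unlimited_cf [T hT cT].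
  have [W0 /(basic_strong_ex aC) [W [hW bE bW]]] := cf_strong aC bC (cf_corner aA H2 H1 cA).
  by apply: (cf_unlimited aC bC hW bE bW); apply/(cf_corner_tilting aA H2 H1 hT hW).
have [W0 /(basic_strong_ex aA) [W [hW bE bW]]] := cf_strong aA bA cA.
by apply: (cf_unlimited aA bA hW bE bW); apply/(cf_corner_tilting aA H2 H1 hW hT).
Qed.

(** * Additive functions on modules of finite projective dimension *)

Section Euler.
Variable A : pzRingType.
Hypothesis hA : artin_algebra A.
Variable V : lmodType A.
Hypothesis fV : finitely_generated V.
Implicit Types X Y Z K P Q M : lmodType A.
Let fA : finlen A^o := (artin_data hA).1.

Lemma homT_finlen X : finitely_generated X -> finlen (homT V X).
Proof.
have [K [eta [hK hc hg]]] := hA => fX; apply: fg_finlen (homT_fg hK hc hg fV fX).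
exact: (artin_data (artin_endo hA fV)).1.
Qed.

(** Values are rational so that additive functions can be compared by linear algebra; the length is
    taken over End([V]). *)
Definition homlen X : rat := (len (homT V X))%:R.

Lemma homlen_iso X Y : module_iso X Y -> finitely_generated X -> homlen X = homlen Y.
Proof. by move=> e fX; rewrite /homlen (len_iso (homT_iso V e)) //; apply: homT_finlen. Qed.

Lemma homlen_ses X Y Z (i : {linear X -> Y}) (p : {linear Y -> Z}) : ses i p ->
  projective_module Z -> finitely_generated Y -> homlen Y = homlen X + homlen Z.
Proof.
move=> s hZ fY; have [u [v [suv _ _]]] := homT_ses_ex s (@E1_proj _ _ V hZ).
by rewrite /homlen (len_ses suv (homT_finlen fY)) natrD addrC.
Qed.

Lemma homlen_prod X Y : projective_module Y -> finitely_generated X -> finitely_generated Y ->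
  homlen (X * Y)%type = homlen X + homlen Y.
Proof.
move=> hY fX fY; have [l hl] := inl_ex X Y.
exact: homlen_ses (ses_prod hl) hY (fg_prod fX fY).
Qed.

Lemma homlen_zero X : is_zero X -> homlen X = 0.
Proof.
move=> z; have [|_ e] := @len_zero _ (homT V X); last by rewrite /homlen e.
by move=> f; apply: homP => x; rewrite (z x) !linear0.
Qed.

(* [euler d X z]: a resolution of [X] by [d + 1] finitely generated projectives has
   alternating sum of [homlen] equal to [z]. *)
Fixpoint euler d X (z : rat) : Prop := match d with
  | 0 => [/\ finitely_generated X, projective_module X & z = homlen X]
  | d'.+1 => exists K P (i : {linear K -> P}) (p : {linear P -> X}) z',
      [/\ ses i p, projective_module P, finitely_generated P, euler d' K z' & z = homlen P - z']
  end.

Lemma euler_ex d X : finitely_generated X -> pd_le d X -> exists z, euler d X z.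
Proof.
elim: d X => [|d IHd] X fX hX; first by exists (homlen X).
have [K [P [i [p [s hP fP]]]]] := proj_cover fX; have [ii _ _] := s.
have [z hz] := IHd K (fg_sub fA ii fP) (pd_kernel s hP hX).
by exists (homlen P - z), K, P, i, p, z.
Qed.

Lemma euler_iso d X Y z : module_iso X Y -> euler d X z -> euler d Y z.
Proof.
case: d => [|d] h.
  move=> [fX hX ->]; split; [exact: fg_iso h fX|exact: proj_iso h hX|exact: homlen_iso].
move=> [K [P [i [p [z' [s hP fP hK e]]]]]].
have [i' [p' s']] := ses_iso (iso_refl K) (iso_refl P) h s.
by exists K, P, i', p', z'.
Qed.

Lemma euler_S d X z : euler d X z -> euler d.+1 X z.
Proof.
elim: d X z => [|d IHd] X z.
  move=> [fX hX ->]; have [Z hZ] := zero_ex A.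
  exists Z, X, \0, idfun, 0; split=> //; first exact: ses_id0.
    by split; [exact: fg_zero|exact: proj_zero|rewrite homlen_zero].
  by rewrite subr0.
move=> [K [P [i [p [z' [s hP fP hK e]]]]]].
by exists K, P, i, p, z'; split=> //; apply: IHd.
Qed.

Lemma euler_mono d d' X z : (d <= d')%N -> euler d X z -> euler d' X z.
Proof.
by move=> /subnKC <-; elim: (d' - d)%N => [|k IHk]; rewrite ?addn0 ?addnS // => /IHk /euler_S.
Qed.

Lemma euler_prod_proj d X Q z : euler d X z -> projective_module Q -> finitely_generated Q ->
  euler d (X * Q)%type (z + homlen Q).
Proof.
case: d => [|d] hX hQ fQ.
  have [fX pX ->] := hX; split; [exact: fg_prod|exact: proj_prod|by rewrite homlen_prod].
have [K [P [i [p [z' [s hP fP hK ->]]]]]] := hX; have [Z hZ] := zero_ex A.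
have [j [q [sj _ _]]] := ses_prod2 s (ses_id0 Q hZ).
have eK : module_iso (K * Z)%type K.
  have [l hl] := inl_ex K Z; apply: iso_sym; exists l; apply/bijP; split=> [x y|[x y]].
    by rewrite !hl => -[].
  by exists x; rewrite hl (hZ y).
have [i' [p' s']] := ses_iso eK (iso_refl _) (iso_refl _) sj.
exists K, (P * Q)%type, i', p', z'; split=> //; [exact: proj_prod|exact: fg_prod|].
by rewrite homlen_prod // addrAC.
Qed.

Lemma euler_uniq d X z z' : euler d X z -> euler d X z' -> z = z'.
Proof.
elim: d X z z' => [|d IHd] X z z'; first by move=> [_ _ ->] [_ _ ->].
move=> [K [P [i [p [w [s hP fP hK ->]]]]]] [K' [P' [i' [p' [w' [s' hP' fP' hK' ->]]]]]].
have e := schanuel s s' hP hP'.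
have /(euler_iso e) h1 := euler_prod_proj hK hP' fP'.
have h2 := euler_prod_proj hK' hP fP.
have e2 := IHd _ _ _ h1 h2.
by rewrite -(addrK w' (homlen P)) [homlen P + w']addrC -e2 [w + _]addrC addrAC addrK.
Qed.

Lemma euler_ses d X Y Z (i : {linear X -> Y}) (p : {linear Y -> Z}) a b : ses i p ->
  euler d X a -> euler d Z b -> euler d Y (a + b).
Proof.
elim: d X Y Z i p a b => [|d IHd] X Y Z i p a b s.
  move=> [fX hX ->] [fZ hZ ->]; have [_ h] := proj_split s hZ.
  have := proj_iso (iso_sym h) (proj_prod hX hZ); have fY := fg_iso (iso_sym h) (fg_prod fX fZ).
  by split=> //; rewrite (homlen_ses s).
move=> [K [P [j [q [z [sj hP fP hK ->]]]]]] [K' [P' [j' [q' [z' [sj' hP' fP' hK' ->]]]]]].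
have [KY [iY [pY [u [v [sY suv]]]]]] := horseshoe s sj sj' hP'.
exists KY, (P * P')%type, iY, pY, (z + z'); split=> //.
- exact: proj_prod.
- exact: fg_prod.
- exact: IHd suv hK hK'.
- by rewrite homlen_prod // opprD addrACA.
Qed.

End Euler.

Definition additive_on_Pf (A : pzRingType) (r : lmodType A -> rat) : Prop :=
  forall (X Y Z : lmodType A) (i : {linear X -> Y}) (p : {linear Y -> Z}),
    ses i p -> Pf X -> Pf Y -> Pf Z -> r Y = r X + r Z.

(** The Euler characteristic of Hom(-, [V]) on a finite projective resolution is independent of the
    resolution by Schanuel's lemma and additive by the horseshoe lemma. *)
Lemma euler_char (A : pzRingType) (V : lmodType A) : artin_algebra A -> finitely_generated V ->
  exists r : lmodType A -> rat, additive_on_Pf r /\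
    forall P : lmodType A, finitely_generated P -> projective_module P ->
      (r P = 0 <-> forall f : {linear P -> V}, forall x, f x = 0).
Proof.
move=> hA fV; pose Q (X : lmodType A) z := exists d, euler V d X z.
(* The value is 0 by default for modules without a finite resolution by finitely generated
   projectives. *)
pose r (X : lmodType A) := if pselect (exists z, Q X z) is left h then sval (cid h) else 0.
have un X z z' : Q X z -> Q X z' -> z = z'.
  move=> [d /(euler_mono (leq_maxl d _)) h] [d' /(euler_mono (leq_maxr _ d')) h'].
  exact: (euler_uniq hA fV (h d') (h' d)).
have rE X z : Q X z -> r X = z.
  move=> h; rewrite /r; case: pselect => [h'|[]]; last by exists z.
  exact: un (svalP (cid h')) h.
have ex X : Pf X -> exists z, Q X z.
  by move=> [fX [d hd]]; have [z hz] := euler_ex hA V fX hd; exists z, d.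
exists r; split=> [X Y Z i p s hX hY hZ|P fP hP].
  have [x qX] := ex X hX; have [z qZ] := ex Z hZ; rewrite (rE X x) // (rE Z z) //.
  move: qX qZ => [d /(euler_mono (leq_maxl d _)) h] [d' /(euler_mono (leq_maxr _ d')) h'].
  by apply: rE; exists (maxn d d'); apply: (euler_ses hA fV s (h d') (h' d)).
have -> : r P = homlen V P by apply: rE; exists 0%N.
have fF := homT_finlen hA fV fP.
split=> [h f x|h].
  have zF : is_zero (homT V P).
    apply: contrapT => nz; have := len_gt0 fF nz; move: h; rewrite /homlen.
    by move/eqP; rewrite Num.Theory.pnatr_eq0 => /eqP ->.
  by have := congr1 (fun g : lhom P V => g x) (zF (f : lhom P V)).
have [|_ e] := @len_zero _ (homT V P); last by rewrite /homlen e.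
by move=> f; apply: homP => x; rewrite h.
Qed.

Section Additive.
Variable A : pzRingType.
Hypothesis fA : finlen A^o.
Variable r : lmodType A -> rat.
Hypothesis hr : additive_on_Pf r.
Implicit Types X Y Z : lmodType A.

Lemma additive_zero X : is_zero X -> r X = 0.
Proof.
move=> z; have hX := Pf_zero z.
have := hr (ses_id X z) hX hX hX; rewrite -[LHS]addr0 => /addrI h.
exact: esym.
Qed.

Lemma additive_iso X Y : Pf X -> module_iso X Y -> r X = r Y.
Proof.
move=> hX e; have [Z hZ] := zero_ex A; have hY := Pf_iso e hX.
have [i [p s]] := ses_iso (iso_refl X) e (iso_refl Z) (ses_id X hZ).
by rewrite (hr s hX hY (Pf_zero hZ)) (additive_zero hZ) addr0.
Qed.

Lemma additive_add t (G : 'I_t -> lmodType A) X : (forall i, Pf (G i)) ->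
  (forall i, indecomposable (G i)) -> (forall i, r (G i) = 0) -> in_add (dsum G) X -> r X = 0.
Proof.
move=> hG iG rG hX; have pX : Pf X by apply: Pf_add hX => //; apply: Pf_dsum.
have fX := Pf_finlen fA pX.
have [n] := ubnP (len X); elim: n X hX pX fX => // n IHn X hX pX fX le.
have [z|nz] := pselect (is_zero X); first exact: additive_zero.
have [iX|nX] := pselect (indecomposable X).
  have [i ri] := indec_dsum fX iX (indec_add fX iX hX).
  by rewrite (additive_iso pX (indec_retract_iso nz (iG i) ri)).
have [Y [Z [e nY nZ]]] : exists Y Z, [/\ module_iso X (Y * Z)%type, ~ is_zero Y & ~ is_zero Z].
  apply: contrapT => hn; apply: nX; split=> // Y Z e; apply: contrapT => no.
  by apply: hn; exists Y, Z; split=> // z; apply: no; [left|right].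
have fYZ := finlen_iso e fX; have [l hl] := inl_ex Y Z; have sl := ses_prod hl.
have /(finlen_ses sl) [fY fZ] := fYZ.
have rY : retract Y X.
  by apply: retract_trans (retract_iso (iso_sym e)); apply: retract_fst.
have rZ : retract Z X.
  by apply: retract_trans (retract_iso (iso_sym e)); apply: retract_snd.
have pY := Pf_retract fA rY pX; have pZ := Pf_retract fA rZ pX.
move: le; rewrite (len_iso e fX) (len_ses sl fYZ) ltnS => le.
rewrite (additive_iso pX e) (hr sl pY (Pf_prod fA pY pZ) pZ).
rewrite (IHn Y) //; [rewrite (IHn Z) ?addr0 //| |]; try exact: add_trans hX (add_retract _).
  by apply: leq_trans le; rewrite -add1n leq_add2r; apply: len_gt0.
by apply: leq_trans le; rewrite -addn1 leq_add2l; apply: len_gt0.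
Qed.

Lemma additive_proj t (G : 'I_t -> lmodType A) : (forall i, Pf (G i)) ->
  (forall i, indecomposable (G i)) -> in_add (dsum G) A^o -> (forall i, r (G i) = 0) ->
  forall X, Pf X -> r X = 0.
Proof.
move=> hG iG aG rG X [fX [d hd]]; have h := additive_add hG iG rG.
elim: d X fX hd => [|d IHd] X fX hd; first exact/h/(add_trans aG)/fg_proj_add.
have [K [P [i [p [s hP fP]]]]] := proj_cover fX; have [ii _ _] := s.
have pX : Pf X by split=> //; exists d.+1.
have fK := fg_sub fA ii fP; have dK := pd_kernel s hP hd.
have pK : Pf K by split=> //; exists d.
have := hr s pK (Pf_proj fP hP) pX; rewrite (IHd K fK dK) add0r => <-.
exact/h/(add_trans aG)/fg_proj_add.
Qed.

(** The indecomposable summands of a strong tilting module generate the Grothendieck group of [Pf]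
    through coresolutions, as the projectives do through resolutions. *)
Lemma additive_tilting t (G : 'I_t -> lmodType A) : (forall i, indecomposable (G i)) ->
  strong (dsum G) -> (forall i, r (G i) = 0) -> forall X, Pf X -> r X = 0.
Proof.
move=> iG hT rG X pX; have [s hs] := SC_cores fA (strong_SC fA hT).
have pT : Pf (dsum G) by case: hT.
have hG i : Pf (G i).
  have [l [hl _]] := inj_ex G i; have [q hq] := proj_ex G i.
  by apply: (Pf_retract fA _ pT); exists l, q => x; rewrite hq hl.
have h := additive_add hG iG rG; have {hs} := hs X pX.
elim: s X pX => [|s IHs] X pX; first exact: h.
move=> [U [C [i [p [sq hU hC]]]]]; have pC := cores_Pf fA pT hC.
have := hr sq pX (Pf_add fA pT hU) pC; rewrite (h U hU) (IHs C pC hC) addr0.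
by move=> ->.
Qed.

End Additive.

(** If [k] exceeded [l], some nonzero combination of the [r i] would vanish on all the [G i], hence
    on [Pf]; evaluating it at [H j] isolates its [j]-th coefficient, which is then 0. *)
Lemma dual_families_le (A : pzRingType) k l (H : 'I_k -> lmodType A) (G : 'I_l -> lmodType A)
    (r : 'I_k -> lmodType A -> rat) :
  (forall i, additive_on_Pf (r i)) -> (forall i, Pf (H i)) ->
  (forall i j, r i (H j) = 0 <-> i != j) ->
  (forall f, additive_on_Pf f -> (forall i, f (G i) = 0) -> forall X : lmodType A, Pf X -> f X = 0) ->
  (k <= l)%N.
Proof.
move=> hr hH dual gen; rewrite leqNgt; apply/negP => lk.
pose M : 'M[rat]_(k, l) := \matrix_(i, j) r i (G j).
have : kermx M != 0.
  by rewrite kermx_eq0 -row_leq_rank -ltnNge; apply: leq_ltn_trans (rank_leq_col M) lk.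
move=> /rowV0Pn [c /sub_kermxP cM /eqP nc]; apply: nc; apply/rowP => j; rewrite mxE.
pose f X := \sum_i c 0 i * r i X.
have af : additive_on_Pf f.
  move=> X Y Z i p s hX hY hZ; rewrite /f -big_split; apply: eq_bigr => q _.
  by rewrite (hr q _ _ _ _ _ s hX hY hZ) mulrDr.
have fG i : f (G i) = 0.
  have := congr1 (fun N : 'rV_l => N 0 i) cM; rewrite !mxE => e.
  by rewrite -[RHS]e; apply: eq_bigr => q _; rewrite mxE.
have := gen f af fG (H j) (hH j); rewrite /f (bigD1 j) //= big1 ?addr0 => [|q qj].
  move=> /eqP; rewrite mulf_eq0 => /orP [/eqP //|/eqP /dual].
  by rewrite eqxx.
by have /dual -> := qj; rewrite mulr0.
Qed.

(** * Counting the summands of a strong tilting module *)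

Section Count.
Variables (A : pzRingType) (k : nat) (D : 'I_k -> nzRingType) (p : forall i, {rmorphism A -> D i}).
Hypothesis hA : artin_algebra A.
Hypothesis hD : forall i, division_ring (D i).
Hypothesis hp : forall y : (forall i, D i), exists x, forall i, p i x = y i.
Hypothesis hJ : forall x, (forall i, p i x = 0) <-> jacobson x.
Variables (n : nat) (e : 'I_n -> A).
Hypothesis he : complete_primitive_idempotents e.
Variables (S : 'I_n -> lmodType A).
Hypothesis hS : forall i, is_top_of (e i) (S i).
Variables (t : nat) (F : 'I_t -> lmodType A).
Hypothesis iF : forall i, indecomposable (F i).
Hypothesis nF : forall i j, module_iso (F i) (F j) -> i = j.
Hypothesis hT : strong (dsum F).

Let fA : finlen A^o := (artin_data hA).1.
Let ie i : idempotent_elt (e i). Proof. by have [pe _ _] := he; case: (pe i). Qed.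
Let P i : lmodType A := left_ideal (e i).

Let fP i : finitely_generated (P i). Proof. exact: left_ideal_fg. Qed.
Let prP i : projective_module (P i). Proof. exact: left_ideal_proj. Qed.
Let iP i : indecomposable (P i).
Proof. by have [pe _ _] := he; apply: left_ideal_indec. Qed.

Let pT : Pf (dsum F). Proof. by case: hT. Qed.

Let pF i : Pf (F i).
Proof. by apply: (Pf_retract fA _ pT); exists (din F i), (dpj F i) => x; apply: dpj_in. Qed.

Let addP : in_add (dsum P) A^o.
Proof.
have a i : exists a : {linear A^o -> P i}, forall x : A, val (a x) = x * e i :> A.
  have [h hh] := smul_ex (left_ideal_gen (ie i) : P i).
  by exists h => x; rewrite hh.
pose u i : {linear A^o -> P i} := sval (cid (a i)).
have hu i (x : A) : val (u i x) = x * e i :> A := svalP (cid (a i)) x.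
have b i : exists b : {linear P i -> A^o}, forall x, b x = val x by apply: linear_ex.
pose v i : {linear P i -> A^o} := sval (cid (b i)).
have hv i x : v i x = val x := svalP (cid (b i)) x.
apply/in_addP; exists [seq ((din P i \o u i : {linear A^o -> dsum P}), (v i \o dpj P i : {linear dsum P -> A^o})) | i <- index_enum 'I_n].
move=> x; rewrite big_map /=.
transitivity (\sum_i (x : A) * e i : A).
  by have [_ _ se] := he; rewrite -mulr_sumr se mulr1.
by apply: eq_bigr => i _; rewrite dpj_in hv hu.
Qed.

(** The projectives [P i] are dual to the Euler characteristics of Hom(-, [S i]), while additive
    functions are determined by their values on the summands of the tilting module. *)
Lemma simples_le_summands : (n <= t)%N.
Proof.
have fS i : finitely_generated (S i).
  by have [q sq _] := hS i; apply: fg_surj sq (fP i).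
pose r i := sval (cid (euler_char hA (fS i))).
have hr i := svalP (cid (euler_char hA (fS i))); rewrite -/(r _) in hr.
apply: (@dual_families_le A n t P F r).
- by move=> i; case: (hr i).
- by move=> i; apply: Pf_proj.
- move=> i j; have [_ h] := hr i; rewrite (h _ (fP j) (@prP j)); split=> [f0|ij f x].
    apply/eqP => ij; move: f0; rewrite -ij => f0.
    have [g [ng eg _ _]] := top_gen fA hD hp hJ he hS i.
    have [l hl] := @left_ideal_map A (e i) _ g.
    by apply: ng; rewrite -eg -(f0 l (left_ideal_gen (ie i))) hl.
  rewrite [x](left_ideal_genE (ie j)) linearZ_LR.
  have -> : left_ideal_gen (ie j) = e j *: left_ideal_gen (ie j) :> P j.
    by apply: val_inj; rewrite /= -[RHS]/(e j * e j) ie.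
  by rewrite linearZ_LR (top_other fA hD hp hJ he hS) ?scaler0 // eq_sym.
- by move=> f af; apply: additive_tilting.
Qed.

(** The same count with the roles exchanged: Hom(-, [U]) makes the summands of [U] projective over
    [endo U], where they are dual to its simple modules, and the [n] projectives [P i] determine
    additive functions. *)
Lemma summands_le_simples : (t <= n)%N.
Proof.
pose U := dsum F; pose C := endo U.
have fF i : finlen (F i) := Pf_finlen fA (pF i).
have [E [q [hE hq hJq qe]]] := endo_basic fF iF nF.
have hC : artin_algebra C := artin_endo hA pT.1.
have fC := (artin_data hC).1.
have fV i : finitely_generated (tops q i).
  by have [s _] := tops_piP q i; apply: fg_surj s (fg_free C).
pose r i := sval (cid (euler_char hC (fV i))).
have hr i := svalP (cid (euler_char hC (fV i))); rewrite -/(r _) in hr.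
have addF i : in_add U (F i).
  by apply: add_retract; exists (din F i), (dpj F i) => x; apply: dpj_in.
have eV i j (y : tops q i) : i != j -> deps F j *: y = 0.
  move=> ij; have [s h] := tops_piP q i; have [x <-] := s y; rewrite -linearZ_LR; apply/h.
  by rewrite -[X in q i X]/(deps F j * (x : C)) rmorphM qe (negPf ij) mul0r.
apply: (@dual_families_le A t n F P (fun i X => r i (homT U X))).
- move=> i X Y Z j s sq hX hY hZ; have [_ eT _] := hT.
  have [u [v [suv _ _]]] := homT_ses_ex sq (eT Z hZ).
  by have [ar _] := hr i; rewrite [RHS]addrC; apply: (ar _ _ _ _ _ suv); apply: homT_Pf.
- exact: pF.
- move=> i j; have [_ h] := hr i.
  rewrite (h _ (homT_fg' hA hT (pF j).1) (homT_proj (addF j))).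
  split=> [f0|ij f g].
    apply/eqP => ij; move: f0; rewrite -ij => f0.
    have [s hs] := tops_piP q i.
    have [|l hl] := @linear_ex C (homT U (F i)) (tops q i)
        (fun g : lhom (F i) U => ([the {linear U -> U} of g \o dpj F i] : C) *: tops_pi q i 1).
      by move=> a g g'; rewrite scalerA -scalerDl; congr (_ *: _); apply: endoP.
    have : deps F i *: tops_pi q i 1 = 0 by rewrite -[RHS](f0 l (din F i : lhom (F i) U)) hl.
    rewrite -linearZ_LR => /hs /eqP.
    by rewrite -[X in q i X]/(deps F i * 1) mulr1 qe eqxx oner_eq0.
  have -> : g = (([the {linear U -> U} of (g : lhom (F j) U) \o dpj F j] : C) * deps F j) *:
      (din F j : homT U (F j)).
    by apply: homP => x; rewrite /= -[RHS]/((g : lhom (F j) U) (dpj F j (din F j (dpj F j (din F j x))))) !dpj_in.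
  by rewrite linearZ_LR -scalerA eV // scaler0.
- move=> f af h X hX; apply: (additive_proj fA af _ iP addP) => // i.
  exact: Pf_proj.
Qed.

Lemma summands_eq_simples : t = n.
Proof. by apply/eqP; rewrite eqn_leq summands_le_simples simples_le_summands. Qed.

End Count.

Lemma iso_swap (A : pzRingType) (X Y : lmodType A) : module_iso (X * Y)%type (Y * X)%type.
Proof.
have [f hf] := pair_ex (snd : {linear (X * Y)%type -> Y}) (fst : {linear (X * Y)%type -> X}).
have [g hg] := pair_ex (snd : {linear (Y * X)%type -> X}) (fst : {linear (Y * X)%type -> Y}).
by apply/isoP; exists f, g; split=> -[x y]; rewrite ?hf ?hg ?hf.
Qed.

(** * Socles of minimal approximations *)

Section Socle.
Variable A : pzRingType.
Implicit Types M N X Y V S T : lmodType A.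

Lemma simple_image V M (f : {linear V -> M}) : simple_module V -> injective f ->
  simple_submodule (fun y => exists x, f x = y).
Proof.
move=> [nV hV] fi; split; first exact: im_submodule.
  have [v nv] := nonzero_ex nV; exists (f v); first by exists v.
  by apply/eqP => /(inj0 fi).
move=> N [N0 ND NZ] sN; have [|h|h] := hV (fun x => N (f x)).
- by split=> [|x y|a x]; rewrite ?linear0 ?linearD ?linearZ_LR //; [apply: ND|apply: NZ].
- by left=> x /[dup] /sN [y <-] /h ->; rewrite linear0.
- by right=> _ [x <-].
Qed.

Lemma socle_image V M (f : {linear V -> M}) x : simple_module V -> injective f -> socle (f x).
Proof.
move=> hV fi; exists 1%N, (fun _ => f x); rewrite big_ord1; split=> // _.
by exists (fun y => exists x, f x = y); [exact: simple_image|exists x].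
Qed.

Lemma nonzero_component M V (s : seq (summand M)) (f : {linear V -> M}) v :
  (forall x, x = \sum_(p <- s) (projT2 p).2 ((projT2 p).1 x)) -> f v <> 0 ->
  exists2 p, List.In p s & (projT2 p).1 (f v) <> 0.
Proof.
move=> hs nf; apply: contrapT => hn; apply: nf; rewrite [LHS]hs.
have {}hn p : List.In p s -> (projT2 p).1 (f v) = 0.
  by move=> ip; apply: contrapT => h; apply: hn; exists p.
elim: s hn {hs} => [|p s IHs] hn; first by rewrite big_nil.
rewrite big_cons hn ?linear0 ?add0r; last by left.
by apply: IHs => q hq; apply: hn; right.
Qed.

(** [phi] factors through the quotient of [X] by [N], which is in [Pf]. The induced map lifts back
    to [X], and minimality makes the projection to the quotient injective. *)
Lemma minapp_kernel M X N (phi : {linear X -> M}) (i : {linear N -> X}) : finlen A^o ->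
  minapp phi -> injective i -> Pf N -> (forall x, phi (i x) = 0) -> is_zero N.
Proof.
move=> fA [[hX hphi] mphi] ii hN h0; have [Q [q s]] := coker_ses ii; have [_ sq hq] := s.
have [|f hf] := @lin_fact A X M Q q phi sq; first by move=> x /hq [y <-].
have [g hg] := hphi Q f (Pf_right fA s hN hX).
have /bijP [qi _] : bijective (g \o q) by apply: mphi => x /=; rewrite hg hf.
by move=> x; apply: ii; apply: qi; rewrite /= (ses0 _ s) linear0 !linear0.
Qed.

(* A simple module [V] of finite projective dimension embeds in at most one way, up to
   automorphisms of [V], in the minimal approximation of an injective module with simple
   socle: the difference of two embeddings would give a submodule of the kernel. *)
Section MinimalApproximation.
Hypothesis fA : finlen A^o.
Variables (S I X : lmodType A) (phi : {linear X -> I}) (iota : {linear S -> I}).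
Hypothesis hS : simple_module S.
Hypothesis hiota : forall x, socle x <-> exists s, iota s = x.
Hypothesis ii : injective iota.
Hypothesis hphi : minapp phi.

Lemma minapp_simple V (f : {linear V -> X}) : simple_module V -> Pf V -> (exists v, f v <> 0) ->
  exists2 h : {linear V -> S}, bijective h & forall v, iota (h v) = phi (f v).
Proof.
move=> hV pV nf; have fi := simple_inj hV nf.
have ng : exists v, (phi \o f) v <> 0.
  apply: contrapT => hn; case: (hV) => nV _; apply: nV.
  apply: (minapp_kernel fA hphi fi pV) => x.
  by apply: contrapT => nx; apply: hn; exists x.
have gi := simple_inj hV ng.
have [v|h hh] := @lin_lift A V I S (phi \o f) iota ii; first by apply/hiota/socle_image.
exists h => //; apply: simple_bij => //; have [v nv] := ng; exists v => h0.
by apply: nv; rewrite -hh h0 linear0.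
Qed.

Lemma minapp_simple_unique V (a b : {linear V -> X}) : simple_module V -> Pf V ->
  (exists v, a v <> 0) -> (exists v, b v <> 0) -> forall v, exists w, b v = a w.
Proof.
move=> hV pV na nb.
have [ha /bijP [ia sa] ea] := minapp_simple hV pV na; have [hb _ eb] := minapp_simple hV pV nb.
have [ha' [aK a'K]] := bij_inv ia sa.
pose d : {linear V -> X} := b \+ (\- (a \o ha' \o hb) : {linear V -> X}).
have dE v : d v = b v - a (ha' (hb v)) by [].
have [nd|zd v] := pselect (exists v, d v <> 0).
  have [hd /bijP [id _] ed] := minapp_simple hV pV nd; exfalso.
  have [v nv] := nonzero_ex hV.1; apply: nv; apply: id; apply: ii.
  by rewrite linear0 linear0 ed dE linearB -eb -ea a'K subrr.
exists (ha' (hb v)); apply/eqP; rewrite -subr_eq0 -dE; apply/eqP.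
by apply: contrapT => nv; apply: zd; exists v.
Qed.

(** [T] is an indecomposable summand on which a lift [a] of the socle embedding is nonzero. A simple
    module of [Pf] inside the complement would be a copy of [S]; by uniqueness it would meet the
    image of [a] in points where the component in [T] does not vanish. *)
Lemma minapp_split : Pf S -> exists T Y, [/\ module_iso X (T * Y)%type, indecomposable T,
  exists f : {linear S -> T}, injective f & forall V (g : {linear V -> Y}),
    simple_module V -> Pf V -> ~ injective g].
Proof.
move=> pS; have [[hX happ] _] := hphi.
have [a ha] := happ S iota pS; have [s0 ns] := nonzero_ex hS.1.
have na : a s0 <> 0 by move=> h; apply: ns; apply: ii; rewrite -ha h !linear0.
have [s [hs1 hs2]] := decomposition (Pf_finlen fA hX).
have [[T [r i]] /hs1 /= [iT ri] nr] := nonzero_component hs2 na.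
have sr : surjective r by move=> x; exists (i x).
have [Y [k sk]] := ker_ses sr; have [ik _ _] := sk; have [q qk] := ses_section sk ri.
have [_ _ e] := ses_retraction sk qk.
exists T, Y; split=> //; first exact: iso_trans e (iso_swap Y T).
  by exists (r \o a : {linear S -> T}); apply: simple_inj hS _; exists s0.
move=> V g hV pV ig; have [v nv] := nonzero_ex hV.1.
have nb : exists v, (k \o g) v <> 0.
  by exists v => h; apply: nv; apply: ig; apply: ik; rewrite !linear0.
have [h /bijP [ih sh] _] := minapp_simple hV pV nb; have [w hw] := sh s0.
have na' : exists v, (a \o h) v <> 0 by exists w; rewrite /= hw.
have [w' e'] := minapp_simple_unique hV pV nb na' w.
by apply: nr; rewrite -hw [a (h w)]e'; apply: ses0 sk.
Qed.

End MinimalApproximation.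
End Socle.

(** * Summands of the approximations of the injective modules *)

Section Approximations.
Variables (A : pzRingType) (k : nat) (D : 'I_k -> nzRingType) (p : forall i, {rmorphism A -> D i}).
Hypothesis hA : artin_algebra A.
Hypothesis hD : forall i, division_ring (D i).
Hypothesis hp : forall y : (forall i, D i), exists x, forall i, p i x = y i.
Hypothesis hJ : forall x, (forall i, p i x = 0) <-> jacobson x.
Hypothesis hcf : cf A.
Variables (n : nat) (e : 'I_n -> A).
Hypothesis he : complete_primitive_idempotents e.
Variables (S E X : 'I_n -> lmodType A).
Hypothesis hS : forall i, is_top_of (e i) (S i).
Hypothesis hE : forall i, indecomposable_injective_with_socle (S i) (E i).
Hypothesis hX : forall i, minimal_Pfin_approximation (E i) (X i).
Variable m : nat.
Hypothesis mn : (m <= n)%N.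
Hypothesis hpd : forall j : 'I_n, (m <= j)%N -> finite_pdim (S j).
Implicit Types M N Y Z V T U : lmodType A.

Let fA : finlen A^o := (artin_data hA).1.
Let sS i : simple_module (S i) := top_simple fA hD hp hJ he hS i.

Let fS i : finitely_generated (S i).
Proof.
have [pe _ _] := he; have [ie _ _] := pe i.
by have [q sq _] := hS i; apply: fg_surj sq (left_ideal_fg ie).
Qed.

Let simple_ex V : simple_module V -> exists i, module_iso (S i) V.
Proof. exact: (simple_top_ex fA hD hp hJ he hS). Qed.

Lemma simple_Pf V : simple_module V -> finite_pdim V -> Pf V.
Proof.
by move=> /simple_ex [i hi] fV; apply/PfinP; split=> //; apply: fg_iso hi (fS i).
Qed.

Let pS (j : 'I_n) : (m <= j)%N -> Pf (S j).
Proof. by move=> mj; apply: simple_Pf (hpd mj). Qed.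

Let iota_ex i : exists f : {linear S i -> E i}, injective f /\
  forall x, socle x <-> exists s, f s = x.
Proof. by have [_ _ _ [f fi hf]] := hE i; exists f. Qed.

Let phi_ex i : exists f : {linear X i -> E i}, minapp f.
Proof. by have [f /approxP h1 h2] := hX i; exists f. Qed.

Let iota i := sval (cid (iota_ex i)).
Let iotaP i := svalP (cid (iota_ex i)).
Let phi i := sval (cid (phi_ex i)).
Let phiP i : minapp (phi i) := svalP (cid (phi_ex i)).

Let injE i : injective_module (E i).
Proof. by case: (hE i). Qed.

Let pX i : Pf (X i). Proof. by case: (phiP i) => -[]. Qed.

Let eX i : perp (X i).
Proof.
have h : fginj (E i) by move=> Y Z j f _; apply: injE.
exact: (minapp_inj_perp fA (pX i).1 h (phiP i)).
Qed.

Lemma approximations_strong : strong (dsum X).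
Proof.
have hb : basic_algebra A by exists k, D, p.
have [fs _] := basic_data hA hb.
apply: (SC_strong fA); apply: (minapps_SC fA (S := S) (I := E) (j := iota) (phi := phi)) => //.
- by move=> V /simple_ex [i /iso_sym]; exists i.
- exact: cf_findim fA fs hcf.
- by move=> i Y Z j f _; apply: injE.
- by move=> i; case: (iotaP i).
Qed.

Let X0 (i : 'I_m) := X (widen_ord mn i).
Let T0 := dsum X0.

Let pT0 : Pf T0. Proof. by apply: Pf_dsum => // i; apply: pX. Qed.

Let X_T0 (l : 'I_n) : (l < m)%N -> retract (X l) T0.
Proof.
move=> lm; have el : widen_ord mn (Ordinal lm) = l by apply: val_inj.
by rewrite -el; exists (din X0 (Ordinal lm)), (dpj X0 (Ordinal lm)) => x; apply: dpj_in.
Qed.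

(* The socle of [Y] has only constituents [S i] with [i < m]; each embeds in [E i], and
   maps to [E i] lift to the approximation. *)
Lemma in_add_approximations Y : Pf Y -> perp Y ->
  (forall V (g : {linear V -> Y}), simple_module V -> Pf V -> ~ injective g) -> in_add T0 Y.
Proof.
move=> pY eY hY; have sep : separates T0 Y.
  move=> x nx; have [h hh] := smul_ex x; have [I [q [i [sq ii iq]]]] := im_ex h.
  have hx : i (q 1) = x by rewrite iq hh scale1r.
  have nI : ~ is_zero I by move=> z; apply: nx; rewrite -hx (z (q 1)) linear0.
  have fI := finlen_surj sq fA; have [V [u [iu sV]]] := simple_sub fI nI.
  have [l /isoP [f [f' [fK f'K]]]] := simple_ex sV.
  have iiu : injective (i \o u : {linear V -> Y}) by move=> a b /ii /iu.
  have lm : (l < m)%N.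
    rewrite ltnNge; apply/negP => ml; apply: (hY V _ sV _ iiu).
    by apply: Pf_iso (pS ml); apply/isoP; exists f, f'.
  have [G hG] := injE (iota l \o f') iiu; have [[_ happ] _] := phiP l.
  have [G' hG'] := happ Y G pY; have [a [b ab]] := X_T0 lm.
  exists (a \o G' : {linear Y -> T0}) => /= aG.
  have G0 : G x = 0 by rewrite -hG' -(ab (G' x)) aG !linear0.
  have [v nv] := nonzero_ex sV.1; apply: nv; have [c hc] := sq (u v).
  have : iota l (f' v) = 0.
    by rewrite -[LHS]hG /= -hc iq hh linearZ_LR G0 scaler0.
  have [i1 _] := iotaP l; move=> /(inj0 i1) f0.
  by rewrite -(f'K v) f0 linear0.
have [U [h [hU ih]]] := sep_embed (Pf_finlen fA pY) sep.
have [C [q s]] := coker_ses ih; have pU := Pf_add fA pT0 hU.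
exact: add_trans hU (add_retract (E1_ses_split s (eY C (Pf_right fA s pY pU)))).
Qed.

(** The summands [F] of [T0] together with one [T1 j] for each index from [m] on are pairwise
    non-isomorphic and have the additive closure of the strong tilting module [dsum X], so their
    number is [n]; taking away the [n - m] modules [T1 j] leaves exactly [m]. *)
Theorem approximation_summands :
  exists T : 'I_m -> lmodType A, distinct_summands T T0 /\
    forall j : 'I_n, (m <= j)%N -> exists Tj Uj : lmodType A,
      [/\ module_iso (X j) (Tj * Uj)%type, indecomposable Tj,
          only_Pfin_simple_in_socle (S j) Tj
        & forall M, indecomposable M -> retract M Uj -> retract M (dsum T)].
Proof.
have topI i j : module_iso (S i) (S j) -> i = j := @top_iso _ _ _ _ fA hD hp hJ _ _ he _ hS i j.
have [t [F [dF aF1 aF2]]] := distinct_ex (Pf_finlen fA pT0).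
have split_ex (j : 'I_n) : (m <= j)%N -> exists T Y, [/\ module_iso (X j) (T * Y)%type,
    indecomposable T, exists f : {linear S j -> T}, injective f & in_add T0 Y].
  move=> mj; have [i1 i2] := iotaP j.
  have [T [Y [e1 iT hf hY]]] := minapp_split fA (sS j) i2 i1 (phiP j) (pS mj).
  exists T, Y; split=> //.
  have r : retract Y (X j).
    by apply: retract_trans (retract_iso (iso_sym e1)); apply: retract_snd.
  apply: in_add_approximations => //; first exact: (Pf_retract fA r (pX j)).
  by move=> Z hZ; apply: E1_retract_r r (eX hZ).
have only (i : 'I_n) V T (f : {linear V -> T}) : retract T (X i) -> simple_module V -> Pf V ->
    injective f -> module_iso V (S i).
  move=> [a [b ab]] sV pV fi; have [i1 i2] := iotaP i; have [v nv] := nonzero_ex sV.1.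
  have [|h bh _] := @minapp_simple _ fA _ _ _ _ _ (sS i) i2 i1 (phiP i) V (a \o f) sV pV.
    by exists v => /= h; apply: nv; apply: fi; apply: (can_inj ab); rewrite !linear0.
  by exists h.
(* Numbers the indices from [m] to [n - 1] by ['I_(n - m)]. *)
pose jm (j : 'I_(n - m)) : 'I_n := cast_ord (subnKC mn) (rshift m j).
have mjm j : (m <= jm j)%N by rewrite /= leq_addr.
pose T1 j := sval (cid (split_ex (jm j) (mjm j))).
have hT1 j : exists Y, [/\ module_iso (X (jm j)) (T1 j * Y)%type, indecomposable (T1 j),
    exists f : {linear S (jm j) -> T1 j}, injective f & in_add T0 Y].
  exact: svalP (cid (split_ex (jm j) (mjm j))).
have rT1 j : retract (T1 j) (X (jm j)).
  have [Y [e1 _ _ _]] := hT1 j.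
  by apply: retract_trans (retract_iso (iso_sym e1)); apply: retract_fst.
(* [T1 b] contains the simple module of index [jm b], which has finite projective dimension, whereas
   a simple submodule of [T0] of finite projective dimension has index below [m]. *)
have FT a b : ~ module_iso (T1 b) (F a).
  move=> /isoP [u [u' [uK _]]]; have [_ [_ _ [f fi] _]] := hT1 b.
  have [dF1 _ _] := dF; have [_ [g [g' gK]]] := dF1 a.
  have hi : injective (g \o u \o f : {linear _ -> _}).
    by move=> x y /= /(can_inj gK) /(can_inj uK) /fi.
  have [v nv] := nonzero_ex (sS (jm b)).1.
  have [i ni] : exists i, (g (u (f v)) : T0) i <> 0.
    apply: contrapT => hn; apply: nv; apply: hi; rewrite linear0; apply: dsumP => i.
    by apply: contrapT => ni; apply: hn; exists i.
  have fi' : injective (dpj X0 i \o (g \o u \o f) : {linear S (jm b) -> X0 i}).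
    by apply: simple_inj (sS (jm b)) _; exists v; rewrite /= dpjE.
  have /topI /(congr1 val) /= im :=
    only (widen_ord mn i) _ _ _ (retract_refl _) (sS (jm b)) (pS (mjm b)) fi'.
  by have := ltn_ord i; rewrite -im ltnNge leq_addr.
have TT b b' : module_iso (T1 b) (T1 b') -> b = b'.
  move=> /isoP [u [u' [uK _]]]; have [_ [_ _ [f fi] _]] := hT1 b.
  have hi : injective (u \o f : {linear _ -> _}) by move=> x y /= /(can_inj uK) /fi.
  have /topI jj := only (jm b') _ _ _ (rT1 b') (sS (jm b)) (pS (mjm b)) hi.
  exact: rshift_inj (cast_ord_inj jj).
pose G (i : 'I_(t + (n - m))) := match fintype.split i with inl i => F i | inr j => T1 j end.
have [dF1 dF2 dF3] := dF.
have iG i : indecomposable (G i).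
  rewrite /G; case: fintype.split => a; first by case: (dF1 a).
  by have [Y [_ h _ _]] := hT1 a.
have nG i j : module_iso (G i) (G j) -> i = j.
  rewrite /G -{2}(splitK i) -{2}(splitK j).
  case: (fintype.split i) (fintype.split j) => a [b|b] /=.
  - by move=> /dF2 ->.
  - by move=> /iso_sym /FT.
  - by move=> /FT.
  - by move=> /TT ->.
have GF : in_add (dsum G) (dsum F).
  apply: add_dsum => a; apply: add_retract.
  have -> : F a = G (unsplit (inl a)) by rewrite /G unsplitK.
  by exists (din G _), (dpj G _) => x; apply: dpj_in.
have G1 b : retract (T1 b) (dsum G).
  have -> : T1 b = G (unsplit (inr b)) by rewrite /G unsplitK.
  by exists (din G _), (dpj G _) => x; apply: dpj_in.
have GT0 : in_add (dsum G) T0 := add_trans GF aF1.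
have XG : in_add (dsum X) (dsum G).
  have Xi i : in_add (dsum X) (X i).
    by apply: add_retract; exists (din X i), (dpj X i) => x; apply: dpj_in.
  apply: add_dsum => i; rewrite /G; case: fintype.split => a.
    by apply: (add_trans _ (add_retract (dF1 a).2)); apply: add_dsum => b; apply: Xi.
  by apply: (add_trans _ (add_retract (rT1 a))); apply: Xi.
have GX : in_add (dsum G) (dsum X).
  apply: add_dsum => i; have [im|mi] := ltnP i m.
    exact: add_trans GT0 (add_retract (X_T0 im)).
  have lt : (i - m < n - m)%N by rewrite ltn_sub2r // (leq_ltn_trans mi).
  have -> : i = jm (Ordinal lt) by apply: val_inj; rewrite /= subnKC.
  have [Y [e1 _ _ aY]] := hT1 (Ordinal lt).
  apply: (add_trans _ (add_retract (retract_iso e1))); apply: add_prod.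
    exact: add_retract.
  exact: add_trans GT0 aY.
have hG := strong_add hA approximations_strong XG GX.
(* [dsum G] is strong tilting with [t + (n - m)] pairwise non-isomorphic indecomposable summands, so
   this number equals [n]. *)
have et : t = m.
  have := summands_eq_simples hA hD hp hJ he hS iG nG hG.
  by move=> h; apply/eqP; rewrite -(eqn_add2r (n - m)) h subnKC.
subst t; exists F; split=> // j mj.
have [T [Y [e1 iT [f fi] aY]]] := split_ex j mj.
have rT : retract T (X j).
  by apply: retract_trans (retract_iso (iso_sym e1)); apply: retract_fst.
exists T, Y; split=> //.
  split; [exact: sS|exact: hpd| |].
    by exists f => // s; apply: socle_image.
  by move=> V sV dV [g gi _]; apply: only gi => //; apply: simple_Pf.
move=> M iM rM; have fM : finlen M.
  have rX : retract M (X j).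
    apply: retract_trans rM _.
    by apply: retract_trans (retract_iso (iso_sym e1)); apply: retract_snd.
  exact: (Pf_finlen fA (Pf_retract fA rX (pX j))).
have /(dF3 M iM) [i ei] : retract M T0.
  by apply: indec_add => //; apply: add_trans aY (add_retract rM).
apply: retract_trans (retract_iso ei) _.
by exists (din F i), (dpj F i) => x; apply: dpj_in.
Qed.

End Approximations.

Theorem theoremC
  (L : pzRingType) (hartin : artin_algebra L) (hbasic : basic_algebra L)
  (hcf : Pfin_contravariantly_finite L)
  (n : nat) (e : 'I_n -> L) (he : complete_primitive_idempotents e)
  (S : 'I_n -> lmodType L) (hS : forall i, is_top_of (e i) (S i))
  (E : 'I_n -> lmodType L)
  (hE : forall i, indecomposable_injective_with_socle (S i) (E i))
  (Ap : 'I_n -> lmodType L)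
  (hAp : forall i, minimal_Pfin_approximation (E i) (Ap i))
  (m : nat) (hmn : (m <= n)%N)
  (hpd : forall j : 'I_n, (m <= j)%N -> finite_pdim (S j))
  (hcorner : finite_pdim (corner_module (idempotent_partial_sum m he)
                                        (1 - partial_sum m e))) :
  (exists T : 'I_m -> lmodType L,
     distinct_indecomposable_summands T
       (dsum (fun i : 'I_m => Ap (widen_ord hmn i))) /\
     forall j : 'I_n, (m <= j)%N ->
       exists Tj Uj : lmodType L,
         [/\ module_iso (Ap j) (Tj * Uj)%type,
             indecomposable Tj,
             only_Pfin_simple_in_socle (S j) Tj
           & forall X : lmodType L, indecomposable X ->
               direct_summand X Uj -> direct_summand X (dsum T)]) /\
  (unlimited_strong_tilting L <->
   unlimited_strong_tilting (corner (idempotent_partial_sum m he))).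
Proof.
have [k [D [p [hD hp hJ]]]] := hbasic.
have fL := (artin_data hartin).1.
have cfL : cf L by apply/cfP.
split.
  have [T [dT hT]] := approximation_summands hartin hD hp hJ cfL he hS hE hAp hmn hpd.
  exists T; split; first exact/distinct_summandsP.
  move=> j mj; have [Tj [Uj [h1 h2 h3 h4]]] := hT j mj.
  by exists Tj, Uj; split=> // X iX /direct_summandP rX; apply/direct_summandP/h4.
apply: unlimited_corner => //; first exact: corner_module_Pf.
(* A simple module killed by the sum of the idempotents of index below [m] is the top of some [e i]
   with [m <= i], hence of finite projective dimension by [hpd]. *)
move=> V sV eV; have [v nv] := nonzero_ex sV.1.
have [i ni] : exists i, e i *: v <> 0.
  have [_ _ se] := he; apply: contrapT => hn; apply: nv.
  rewrite -[v]scale1r -se scaler_suml big1 // => i _.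
  by apply: contrapT => h; apply: hn; exists i.
have mi : (m <= i)%N.
  rewrite leqNgt; apply/negP => im; apply: ni.
  have -> : e i = e i * partial_sum m e.
    have [pe oe _] := he; rewrite /partial_sum mulr_sumr (bigD1 i) //= big1 ?addr0.
      by have [ie _ _] := pe i.
    by move=> j /andP[_ ji]; apply: oe; rewrite eq_sym.
  by rewrite -scalerA eV scaler0.
have e1 := simple_top fL hD hp hJ he hS sV ni.
apply: Pf_iso e1 _; apply: (simple_Pf hartin hD hp hJ he hS).
  exact: (top_simple fL hD hp hJ he hS).
exact: hpd.
Qed.
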